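(* There are absolute constants $C_1,\dots,C_5>0$ such that the following holds. Let $\beta\ge1$, $\delta\in(0,1/17]$, $n\in\mathbb N$, and $b=\beta n^{-\delta}$. Let $A$ be an $n\times n$ real random matrix with i.i.d. $\mathcal N(0,1/n)$ entries and $A_{\mathrm{sym}}=(A+A^{\mathsf T})/2$. For a diagonal matrix $D\ge0$ with $2\beta^2\mathrm{tr}_n(D^{-2})=1$ put $$g_{-D}(z)=\mathrm{tr}_n\left((z+D)^{-1}\right),\qquad \tilde z=ib+2\beta^2g_{-D}(ib),\qquad \tilde a=\mathrm{Re}\,\tilde z,\quad \tilde b=\mathrm{Im}\,\tilde z,$$ $$P=P(D)=\sqrt{\tilde b\left(\tilde b^2+(\tilde a-2\beta A_{\mathrm{sym}}+D)^2\right)^{-1}}.$$ Then: (1) $2\beta^2\mathrm{tr}_n(D^{-1})$ is the maximum of the spectrum of $\sqrt2\beta S-D$, where $S$ is a standard semicircular operator freely independent of $D$. Moreover $|2\beta^2\mathrm{tr}_n(D^{-1})-\tilde a|\le2\beta^4n^{-2\delta}\mathrm{tr}_n(D^{-3})$. (2) $\mathrm{tr}_n\left(P^2(\tilde a-2\beta A_{\mathrm{sym}}+D)^2\right)\le2\beta^5n^{-3\delta}\mathrm{tr}_n(D^{-4})\le2\beta^3n^{-3\delta}\|D^{-1}\|^2$. (3) With probability at least $1-C_1\exp(-C_2n)$ in $A$, we have $\|2A_{\mathrm{sym}}\|\le3$ and, for all nonnegative diagonal matrices $D$ with $2\beta^2\mathrm{tr}_n(D^{-2})=1$ simultaneously,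 $$\left\|E_{\mathcal D_n}[P(D)^2]-b(b^2+D^2)^{-1}\right\|_2\le C_3\beta n^{-2\delta}.$$ (4) $\mathrm{tr}_n\left[b(b^2+D^2)^{-1}\right]\ge\frac12\beta^{-1}n^{-\delta}-\beta\|D^{-1}\|^2n^{-3\delta}$, so in particular, on the event in (3), $$\mathrm{tr}_n[P^2]\ge C_4\beta^{-1}n^{-\delta}-C_3\beta n^{-2\delta}-\tfrac12\beta\|D^{-1}\|^2n^{-3\delta}.$$ (5) $\|P^2\|\le C_5\beta^{-1}n^{3\delta}$.
   Context: $\mathrm{tr}_n=\frac1n\mathrm{Tr}$ on $M_n(\mathbb C)$; $\|X\|_2=\mathrm{tr}_n(X^*X)^{1/2}$ is the normalized Hilbert–Schmidt norm and $\|X\|$ the operator norm. $E_{\mathcal D_n}$ is the map zeroing out off-diagonal entries. Scalars added to matrices denote multiples of the identity. In (1), $D$ and $S$ live in a tracial von Neumann algebra $(\mathcal M_n,\tau_n)$ which is the free product of $(M_n(\mathbb C),\mathrm{tr}_n)$ with the von Neumann algebra generated by $S$, where $S$ is self-adjoint with spectral distribution $\frac1{2\pi}\sqrt{4-t^2}\,\mathbf 1_{[-2,2]}(t)\,dt$. *)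

(* Defs.v *)
From HB Require Import structures.
From mathcomp Require Import all_boot all_order all_algebra.
From mathcomp Require Import complex.
From mathcomp Require Import all_classical all_reals all_analysis.

Set Implicit Arguments.
Unset Strict Implicit.
Unset Printing Implicit Defensive.

Import Order.TTheory GRing.Theory Num.Theory.
Import numFieldNormedType.Exports.

Local Open Scope classical_set_scope.
Local Open Scope ring_scope.
Local Open Scope complex_scope.

Definition ntr (F : fieldType) (n : nat) (X : 'M[F]_n) : F := n%:R^-1 * \tr X.

Definition mxC (R : realType) (n : nat) (X : 'M[R]_n) : 'M[R[i]]_n :=
  map_mx (real_complex R) X.

Definition hs_norm (R : realType) (n : nat) (X : 'M[R]_n) : R :=
  Num.sqrt (ntr (X^T *m X)).

Definition l2norm (R : realType) (n : nat) (v : 'cV[R]_n) : R :=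
  Num.sqrt (\sum_i v i 0 ^+ 2).

Definition opnorm (R : realType) (n : nat) (X : 'M[R]_n) : R :=
  sup [set l2norm (X *m v) | v in [set v : 'cV[R]_n | l2norm v <= 1]].

Definition diag_part (R : realType) (n : nat) (X : 'M[R]_n) : 'M[R]_n :=
  \matrix_(i, j) (if i == j then X i j else 0).

Definition sym_part (R : realType) (n : nat) (X : 'M[R]_n) : 'M[R]_n :=
  2^-1 *: (X + X^T).

Definition psdmx (R : realType) (n : nat) (X : 'M[R]_n) : Prop :=
  X^T = X /\ forall v : 'cV[R]_n, 0 <= (v^T *m X *m v) 0 0.

(* The square root of a positive semidefinite matrix; the default value 0 is
   only taken when no positive semidefinite square root exists. *)
Definition psd_sqrt (R : realType) (n : nat) (X : 'M[R]_n) : 'M[R]_n :=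
  xget 0 [set Y : 'M[R]_n | psdmx Y /\ Y *m Y = X].

(* [invmx] is a total function, so the invertibility of D that is implicit in
   tr_n(D^-2) = 1 / (2 beta^2) has to be spelled out. *)
Definition admissible (R : realType) (n : nat) (beta : R) (D : 'M[R]_n) : Prop :=
  [/\ is_diag_mx D, forall i, 0 <= D i i, D \in unitmx
    & 2 * beta ^+ 2 * ntr (invmx D ^+ 2) = 1].

Definition bpar (R : realType) (n : nat) (beta delta : R) : R :=
  beta * (n%:R `^ (- delta)).

Definition g_neg (R : realType) (n : nat) (D : 'M[R]_n) (z : R[i]) : R[i] :=
  ntr (invmx (z%:M + mxC D)).

Definition ztilde (R : realType) (n : nat) (beta b : R) (D : 'M[R]_n) : R[i] :=
  (0 +i* b) + (2 * beta ^+ 2)%:C * g_neg D (0 +i* b).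

Definition atilde (R : realType) (n : nat) (beta b : R) (D : 'M[R]_n) : R :=
  complex.Re (ztilde beta b D).

Definition btilde (R : realType) (n : nat) (beta b : R) (D : 'M[R]_n) : R :=
  complex.Im (ztilde beta b D).

Definition shifted (R : realType) (n : nat) (beta b : R) (A D : 'M[R]_n) :
    'M[R]_n :=
  (atilde beta b D)%:M - (2 * beta) *: sym_part A + D.

Definition Pmx (R : realType) (n : nat) (beta b : R) (A D : 'M[R]_n) : 'M[R]_n :=
  psd_sqrt (btilde beta b D *:
    invmx ((btilde beta b D ^+ 2)%:M + shifted beta b A D ^+ 2)).

Definition diag_resolvent (R : realType) (n : nat) (b : R) (D : 'M[R]_n) :
    'M[R]_n :=
  b *: invmx ((b ^+ 2)%:M + D ^+ 2).

Definition mutually_independent (R : realType) (d : measure_display)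
    (Omega : measurableType d) (P : probability Omega R) (I : finType)
    (X : I -> {RV P >-> R}) : Prop :=
  forall (J : {set I}) (B : I -> set R), (forall i, measurable (B i)) ->
    P [set w | forall i, i \in J -> B i (X i w)] =
    (\prod_(i in J) P (X i @^-1` B i))%E.

(* The second argument of [normal_prob] is the standard deviation. *)
Definition gaussian_iid (R : realType) (d : measure_display)
    (Omega : measurableType d) (P : probability Omega R) (n : nat)
    (A : 'I_n -> 'I_n -> {RV P >-> R}) : Prop :=
  mutually_independent (fun ij : 'I_n * 'I_n => A ij.1 ij.2) /\
  forall i j (B : set R), measurable B ->
    distribution P (A i j) B = normal_prob 0 (Num.sqrt n%:R^-1) B.

Definition rmx (R : realType) (d : measure_display) (Omega : measurableType d)
    (P : probability Omega R) (n : nat) (A : 'I_n -> 'I_n -> {RV P >-> R})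
    (w : Omega) : 'M[R]_n :=
  \matrix_(i, j) A i j w.

Definition good_event (R : realType) (d : measure_display)
    (Omega : measurableType d) (P : probability Omega R) (n : nat)
    (A : 'I_n -> 'I_n -> {RV P >-> R}) (beta delta C3 : R) : set Omega :=
  let b := bpar n beta delta in
  [set w | opnorm (2 *: sym_part (rmx A w)) <= 3 /\
    forall D : 'M[R]_n, admissible beta D ->
      hs_norm (diag_part (Pmx beta b (rmx A w) D ^+ 2) - diag_resolvent b D)
        <= C3 * beta * n%:R `^ (- (2 * delta))].

(* Operators on a complex Hilbert space H are plain functions H -> H, so that
   sums and scalar multiples are the pointwise ones, the product is [\o] and
   the unit is [idfun]; linearity and boundedness are imposed by [bounded_op]. *)

Definition hilbert_norm (R : realType) (H : completeNormedModType R[i])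
    (ip : {dot H for Num.conj}) : Prop :=
  forall x : H, `|x| ^+ 2 = ip x x.

Definition bounded_op (R : realType) (H : completeNormedModType R[i])
    (T : H -> H) : Prop :=
  linear T /\ exists c : R, forall x : H, `|T x| <= c%:C * `|x|.

Definition adjoint_of (R : realType) (H : completeNormedModType R[i])
    (ip : {dot H for Num.conj}) (T T' : H -> H) : Prop :=
  forall x y : H, ip (T x) y = ip x (T' y).

Definition commutant (R : realType) (H : completeNormedModType R[i])
    (X : set (H -> H)) : set (H -> H) :=
  [set T | bounded_op T /\ forall U, X U -> T \o U = U \o T].

(* A von Neumann algebra is a self-adjoint set of bounded operators equal to
   its double commutant; the double commutant of a self-adjoint set X is the
   von Neumann algebra generated by X. *)
Definition bicommutant (R : realType) (H : completeNormedModType R[i])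
    (X : set (H -> H)) : set (H -> H) :=
  commutant (commutant X).

Definition von_neumann_algebra (R : realType) (H : completeNormedModType R[i])
    (ip : {dot H for Num.conj}) (M : set (H -> H)) : Prop :=
  [/\ forall T, M T -> bounded_op T,
      forall T, M T -> exists2 T', M T' & adjoint_of ip T T'
    & bicommutant M = M].

(* In R[i] the relation x <= y means that y - x is a nonnegative real. *)
Definition op_le (R : realType) (H : completeNormedModType R[i])
    (ip : {dot H for Num.conj}) (T U : H -> H) : Prop :=
  forall x : H, ip (T x) x <= ip (U x) x.

(* tau preserves the suprema in M of upward directed sets of positive
   elements. *)
Definition normal_functional (R : realType) (H : completeNormedModType R[i])
    (ip : {dot H for Num.conj}) (M : set (H -> H)) (tau : (H -> H) -> R[i]) :
    Prop :=
  forall (F : set (H -> H)) (s : H -> H),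
    F `<=` M -> F !=set0 -> (forall T, F T -> op_le ip (fun=> 0) T) ->
    (forall T U, F T -> F U -> exists2 V, F V & op_le ip T V /\ op_le ip U V) ->
    M s -> (forall T, F T -> op_le ip T s) ->
    (forall U, M U -> (forall T, F T -> op_le ip T U) -> op_le ip s U) ->
    forall c : R[i], (forall T, F T -> tau T <= c) -> tau s <= c.

Definition faithful_normal_tracial_state (R : realType)
    (H : completeNormedModType R[i]) (ip : {dot H for Num.conj})
    (M : set (H -> H)) (tau : (H -> H) -> R[i]) : Prop :=
  (forall (a : R[i]) (T U : H -> H), M T -> M U ->
     tau (a *: T + U) = a * tau T + tau U) /\
  [/\ tau idfun = 1,
      forall T T', M T -> M T' -> adjoint_of ip T T' -> 0 <= tau (T' \o T),
      forall T U, M T -> M U -> tau (T \o U) = tau (U \o T),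
      forall T T', M T -> M T' -> adjoint_of ip T T' ->
        tau (T' \o T) = 0 -> T = (fun=> 0)
    & normal_functional ip M tau].

Definition op_spectrum (R : realType) (H : completeNormedModType R[i])
    (M : set (H -> H)) (T : H -> H) : set R[i] :=
  [set l | ~ exists2 U, M U &
     (T - l *: idfun) \o U = idfun /\ U \o (T - l *: idfun) = idfun].

Definition max_of_spectrum (R : realType) (H : completeNormedModType R[i])
    (M : set (H -> H)) (T : H -> H) (E : R) : Prop :=
  op_spectrum M T E%:C /\ forall l, op_spectrum M T l -> l <= E%:C.

(* Products of centred elements taken alternately from the two algebras have
   trace zero. *)
Definition free_pair (R : realType) (H : completeNormedModType R[i])
    (tau : (H -> H) -> R[i]) (A0 A1 : set (H -> H)) : Prop :=
  forall (k : nat) (e : nat -> bool) (x : nat -> (H -> H)),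
    (forall i, (i <= k)%N -> (if e i then A1 else A0) (x i) /\ tau (x i) = 0) ->
    (forall i, (i < k)%N -> e i != e i.+1) ->
    tau (\big[(fun T U : H -> H => T \o U)/idfun]_(0 <= i < k.+1) x i) = 0.

Definition trace_embedding (R : realType) (H : completeNormedModType R[i])
    (ip : {dot H for Num.conj}) (M : set (H -> H)) (tau : (H -> H) -> R[i])
    (n : nat) (iota : 'M[R[i]]_n -> (H -> H)) : Prop :=
  (forall X, M (iota X)) /\
  [/\ forall (a : R[i]) X Y, iota (a *: X + Y) = a *: iota X + iota Y,
      iota 1%:M = idfun,
      forall X Y, iota (X *m Y) = iota X \o iota Y,
      forall X, adjoint_of ip (iota X) (iota (map_mx Num.conj X)^T)
    & forall X, tau (iota X) = ntr X].

Definition semicircle_moment (R : realType) (k : nat) : R :=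
  (\int[@lebesgue_measure R]_(t in `[(-2 : R), 2])
     ((2 * pi)^-1 * Num.sqrt (4 - t ^+ 2) * t ^+ k))%R.

(* The spectral distribution of a bounded self-adjoint element is the compactly
   supported probability measure with the same moments. *)
Definition semicircular (R : realType) (H : completeNormedModType R[i])
    (ip : {dot H for Num.conj}) (tau : (H -> H) -> R[i]) (S : H -> H) : Prop :=
  adjoint_of ip S S /\
  forall k : nat, tau (iter k (fun T => S \o T) idfun) = (semicircle_moment R k)%:C.

(* (M, tau) is the free product of (M_n(C), tr_n), embedded by iota, with the
   von Neumann algebra generated by the semicircular element S. *)
Definition semicircular_free_product (R : realType)
    (H : completeNormedModType R[i]) (ip : {dot H for Num.conj})
    (M : set (H -> H)) (tau : (H -> H) -> R[i])
    (n : nat) (iota : 'M[R[i]]_n -> (H -> H)) (S : H -> H) : Prop :=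
  [/\ hilbert_norm ip /\ von_neumann_algebra ip M,
      faithful_normal_tracial_state ip M tau,
      trace_embedding ip M tau iota,
      M S /\ semicircular ip tau S
    & free_pair tau (range iota) (bicommutant [set S]) /\
      M = bicommutant (range iota `|` [set S])].

(* Main.v *)
(* Parts (2), (4) and (5) reduce, by the spectral theorem for real symmetric
   matrices, to b^3 / (3 beta^2) <= Im z~ <= 2 beta^2 b^3 tr_n(D^-4), which
   follows from 2 beta^2 tr_n(D^-2) = 1 by convexity.

   For (3), P^2 = - Im G with G = (z~ + D - 2 beta A_sym)^-1. Gaussian
   integration by parts yields the Schwinger-Dyson equation for the diagonal of
   E G, Poincare's inequality controls its error, and the equation is stable at
   z~; so E[diag P^2] is within O(beta n^(-2 delta)) of b (b^2 + D^2)^-1. The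
   deviation is a Lipschitz function of A whose constant is so small that
   Gaussian concentration survives a union bound over a net of exp(O(n log n))
   matrices D^-1. If |2 A_sym| exceeded 2.9 with high probability, its outlying
   eigenvalue would contribute to the trace of the resolvent at height
   n^(-1/2) an amount that the Schwinger-Dyson equation forbids.

   For (1), put sigma^2 = 2 beta^2, y = W + sigma S with W = c - D >= 0, and
   r = c + sigma^2 tr_n(D^-1). By freeness, Wick-ordered words
   a_0 S a_1 ... S a_m with m > 0 have trace zero, which turns the moments of y
   into a recursion solved by sum_k z^(-k-1) tau(y^k) = tr_n((w + D)^-1) for
   z = c + w + sigma^2 tr_n((w + D)^-1). At w = 0 this bounds tau(y^k) by C r^k,
   and faithfulness of tau upgrades it to |y| <= r. If r - y were invertible,
   tau((z - y)^-1) would be Lipschitz in z down to r, whereas dz/dw vanishes at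
   w = 0 by the normalisation of D. *)
Require Import Defs.
From HB Require Import structures.
From mathcomp Require Import all_boot all_order all_algebra.
From mathcomp Require Import complex.
From mathcomp Require Import all_classical all_reals all_analysis.
From mathcomp Require Import measurable_realfun.
From mathcomp Require Import ring lra.

Set Implicit Arguments.
Unset Strict Implicit.
Unset Printing Implicit Defensive.

Import Order.TTheory GRing.Theory Num.Theory.
Import numFieldNormedType.Exports.

Local Open Scope classical_set_scope.
Local Open Scope ring_scope.
Local Open Scope complex_scope.

(** * Gaussian vectors *)

(** The bound delta <= 1/17 balances powers of q = n^delta: Im z~ is of order beta q^-3, so the
    Schwinger-Dyson equation holds up to order q^6/n, its stability costs a factor q^9, and the
    result may be at most of order q^-2. The union bound fits the same range: with p = n^(1/17), a
    single D fails with probability of order exp(-60 n p) at most, and there are at most exp(52 n p)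
    cells. The net lives on D^-1 because D is unbounded; products of D with the resolvent are
    bounded only where the norm of 2 A_sym is, so the norm needs a separate argument, which starts
    from concentration alone, with no a priori bound on its mean. The estimates start at n = 12^17;
    below it C1 makes the probability bound void.

    In (1), M is given only as a bicommutant with an abstract trace, so norms, positivity and square
    roots are obtained from norm-convergent iterations. The shift c - D >= 0 makes every moment
    nonnegative; the solution of the recursion at w = 0 then dominates the moments term by term. *)

Section bounded_expectation.
Context d (T : measurableType d) (R : realType) (P : probability T R).

(** Bounded measurable functions form an algebra on which integrability is automatic. Resolvent
    entries at positive height belong to it; on the Gaussian space the only unbounded integrands are
    coordinates and their products with such functions. *)
Definition bmf (f : T -> R) := measurable_fun setT f /\ exists M : R, forall x, `|f x| <= M.

Definition Ex (f : T -> R) : R := \int[P]_x f x.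

Lemma bmf_int f : bmf f -> P.-integrable setT (EFin \o f).
Proof.
case=> mf [M hM]; apply: measurable_bounded_integrable => //.
  by rewrite (le_lt_trans (probability_le1 P measurableT)) ?ltry.
by exists M; split; [exact: num_real|move=> N MN x _; exact: le_trans (hM x) (ltW MN)].
Qed.

Lemma bmf_cst c : bmf (fun=> c).
Proof. by split; [exact: measurable_cst|exists `|c|]. Qed.

Lemma bmfD f g : bmf f -> bmf g -> bmf (fun x => f x + g x).
Proof.
move=> [mf [M hM]] [mg [N hN]]; split; first exact: measurable_funD.
by exists (M + N) => x; rewrite (le_trans (ler_normD _ _)) ?lerD.
Qed.

Lemma bmfM f g : bmf f -> bmf g -> bmf (fun x => f x * g x).
Proof.
move=> [mf [M hM]] [mg [N hN]]; split; first exact: measurable_funM.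
by exists (M * N) => x; rewrite normrM ler_pM.
Qed.

Lemma bmfZ c f : bmf f -> bmf (fun x => c * f x).
Proof. by move=> hf; apply: (bmfM (bmf_cst c)). Qed.

Lemma bmfN f : bmf f -> bmf (fun x => - f x).
Proof.
move=> hf; have := bmfZ (-1) hf; congr bmf; apply/funext => x.
by rewrite mulN1r.
Qed.

Lemma bmfB f g : bmf f -> bmf g -> bmf (fun x => f x - g x).
Proof. by move=> hf hg; apply: (bmfD hf (bmfN hg)). Qed.

Lemma bmfX n f : bmf f -> bmf (fun x => f x ^+ n).
Proof.
move=> hf; elim: n => [|n IH].
  by under eq_fun do rewrite expr0; exact: bmf_cst.
by under eq_fun do rewrite exprS; exact: bmfM.
Qed.

Lemma bmf_sum (I : Type) (r : seq I) (Q : pred I) (f : I -> T -> R) :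
  (forall i, Q i -> bmf (f i)) -> bmf (fun x => \sum_(i <- r | Q i) f i x).
Proof.
move=> hf; elim: r => [|i r IH].
  by under eq_fun do rewrite big_nil; exact: bmf_cst.
under eq_fun do rewrite big_cons.
by case: (boolP (Q i)) => [/hf fi|_] //; exact: bmfD.
Qed.

Lemma bmf_norm f : bmf f -> bmf (fun x => `|f x|).
Proof.
move=> [mf [M hM]]; split; first exact: measurableT_comp.
by exists M => x; rewrite normr_id.
Qed.

Lemma bmf_expR f : bmf f -> bmf (fun x => expR (f x)).
Proof.
move=> [mf [M hM]]; split; first exact: measurableT_comp.
exists (expR M) => x; rewrite ger0_norm ?expR_ge0// ler_expR.
exact: le_trans (ler_norm _) (hM x).
Qed.

Lemma Ex_cst c : Ex (fun=> c) = c.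
Proof.
rewrite /Ex Rintegral_cst//= [X in fine X]probability_setT.
by rewrite mulr1.
Qed.

Lemma ExD f g : bmf f -> bmf g -> Ex (fun x => f x + g x) = Ex f + Ex g.
Proof. by move=> hf hg; rewrite /Ex RintegralD//; exact: bmf_int. Qed.

Lemma ExZ c f : bmf f -> Ex (fun x => c * f x) = c * Ex f.
Proof. by move=> hf; rewrite /Ex RintegralZl//; exact: bmf_int. Qed.

Lemma ExN f : bmf f -> Ex (fun x => - f x) = - Ex f.
Proof.
by move=> hf; under [in LHS]eq_fun do rewrite -mulN1r; rewrite ExZ// mulN1r.
Qed.

Lemma ExB f g : bmf f -> bmf g -> Ex (fun x => f x - g x) = Ex f - Ex g.
Proof. by move=> hf hg; rewrite (ExD hf (bmfN hg)) ExN. Qed.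

Lemma Ex_sum (I : Type) (r : seq I) (f : I -> T -> R) :
  (forall i, bmf (f i)) ->
  Ex (fun x => \sum_(i <- r) f i x) = \sum_(i <- r) Ex (f i).
Proof.
move=> hf; elim: r => [|i r IH].
  by under eq_fun do rewrite big_nil; rewrite big_nil Ex_cst.
under eq_fun do rewrite big_cons.
by rewrite ExD ?IH ?big_cons//; apply: bmf_sum.
Qed.

Lemma Ex_le f g : bmf f -> bmf g -> (forall x, f x <= g x) -> Ex f <= Ex g.
Proof. by move=> hf hg fg; apply: le_Rintegral => //; exact: bmf_int. Qed.

Lemma Ex_ge0 f : bmf f -> (forall x, 0 <= f x) -> 0 <= Ex f.
Proof. by move=> hf f0; rewrite -(Ex_cst 0) Ex_le//; exact: bmf_cst. Qed.

Lemma Ex_norm f : bmf f -> `|Ex f| <= Ex (fun x => `|f x|).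
Proof.
move=> hf; rewrite ler_norml -ExN; last exact: bmf_norm.
have h := bmf_norm hf; apply/andP; split; apply: Ex_le => //.
- exact: bmfN.
- by move=> x; rewrite lerNl -normrN ler_norm.
- by move=> x; rewrite ler_norm.
Qed.

Lemma Ex_CS f g : bmf f -> bmf g ->
  Ex (fun x => f x * g x) ^+ 2 <= Ex (fun x => f x ^+ 2) * Ex (fun x => g x ^+ 2).
Proof.
move=> hf hg.
set a := Ex (fun x => f x ^+ 2); set c := Ex (fun x => g x ^+ 2).
set b := Ex _.
have quad t : 0 <= a + 2 * t * b + t ^+ 2 * c.
  have -> : a + 2 * t * b + t ^+ 2 * c = Ex (fun x => (f x + t * g x) ^+ 2).
    rewrite -[t ^+ 2 * _]ExZ; last exact: bmfX.
    rewrite -[2 * t * _]ExZ; last exact: bmfM.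
    have h1 : bmf (fun x => f x ^+ 2) by exact: bmfX.
    have h2 : bmf (fun x => 2 * t * (f x * g x)) by apply/bmfZ/bmfM.
    have h3 : bmf (fun x => t ^+ 2 * g x ^+ 2) by apply/bmfZ/bmfX.
    rewrite /a -(ExD h1 h2) -(ExD (bmfD h1 h2) h3).
    by congr Ex; apply/funext => x; ring.
  apply: Ex_ge0 => [|x]; last exact: sqr_ge0.
  by apply/bmfX/bmfD => //; exact: bmfZ.
have c0 : 0 <= c by apply: Ex_ge0 => [|x]; [exact: bmfX|exact: sqr_ge0].
have [c00|cn0] := eqVneq c 0.
  rewrite c00 mulr0; have a0 : 0 <= a.
    by apply: Ex_ge0 => [|x]; [exact: bmfX|exact: sqr_ge0].
  have [->|bn0] := eqVneq b 0; first by rewrite expr0n.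
  have := quad (- (a + 1) / (2 * b)); rewrite c00 mulr0 addr0.
  have -> : 2 * (- (a + 1) / (2 * b)) * b = - (a + 1) by field.
  by move=> h; exfalso; lra.
have cp : 0 < c by rewrite lt_def cn0.
have := quad (- b / c).
have -> : a + 2 * (- b / c) * b + (- b / c) ^+ 2 * c = (a * c - b ^+ 2) / c by field.
by rewrite pmulr_lge0 ?invr_gt0// subr_ge0.
Qed.

Lemma measurable_set_le (f : T -> R) c : measurable_fun setT f ->
  measurable [set x | f x <= c].
Proof.
move=> mf; rewrite [X in measurable X](_ : _ = f @^-1` `]-oo, c]); last first.
  by apply/seteqP; split => x /=; rewrite in_itv.
by rewrite -[_ @^-1` _]setTI; exact: mf.
Qed.

Lemma bmf_indic (A : set T) : measurable A -> bmf (\1_A).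
Proof.
move=> mA; split; first exact: measurable_indic.
by exists 1 => x; rewrite indicE; case: (_ \in _); rewrite ?normr1 ?normr0.
Qed.

Lemma Ex_indic (A : set T) : measurable A -> Ex (\1_A) = fine (P A).
Proof.
by move=> mA; rewrite /Ex /Rintegral integral_indic// setIT.
Qed.

Lemma Ex_markov f c : bmf f -> (forall x, 0 <= f x) -> 0 < c ->
  fine (P [set x | c < f x]) <= Ex f / c.
Proof.
move=> hf f0 c0.
have mA : measurable [set x | c < f x].
  rewrite [X in measurable X](_ : _ = f @^-1` `]c, +oo[); last first.
    by apply/seteqP; split => x /=; rewrite in_itv/= andbT.
  by rewrite -[_ @^-1` _]setTI; case: hf => + _; apply.
rewrite -Ex_indic// ler_pdivlMr// mulrC -ExZ; last exact: bmf_indic.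
apply: Ex_le => // [|x]; first exact/bmfZ/bmf_indic.
by rewrite indicE; case: (boolP (x \in _)) => [/set_mem/= /ltW|_];
  rewrite ?mulr1 ?mulr0.
Qed.

End bounded_expectation.

(** * The Prekopa-Leindler inequality for the Gaussian density on the line *)

Section gaussian_line.
Context (R : realType).
Notation lam := (@lebesgue_measure R).
Variables (s : R) (s0 : 0 < s).

Definition gpdf (x : R) : R := normal_pdf 0 s x.

Lemma gpdfE x : gpdf x = normal_peak s * expR (- x ^+ 2 / (s ^+ 2 *+ 2)).
Proof. by rewrite /gpdf normal_pdfE ?gt_eqF// /normal_fun subr0. Qed.

Lemma gpdf_gt0 x : 0 < gpdf x.
Proof. by rewrite gpdfE mulr_gt0 ?expR_gt0// normal_peak_gt0// gt_eqF. Qed.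

Lemma measurable_gpdf : measurable_fun setT gpdf.
Proof. exact: measurable_normal_pdf. Qed.

Lemma integral_normal_prob (f : R -> \bar R) :
  (normal_prob 0 s).-integrable setT f ->
  (\int[normal_prob 0 s]_x f x = \int[lam]_x (f x * (gpdf x)%:E))%E.
Proof.
move=> intf; have mf := measurable_int _ intf.
rewrite -(Radon_Nikodym_change_of_variables (normal_prob_dominates 0 s))//=.
apply: ae_eq_integral => //.
- apply: emeasurable_funM => //; apply: (measurable_int lam).
  by apply: Radon_Nikodym_integrable; exact: normal_prob_dominates.
- apply: emeasurable_funM => //=; apply/measurable_EFinP; exact: measurable_gpdf.
- apply: ae_eqe_mul2l => /=.
  rewrite Radon_NikodymE//=; first exact: normal_prob_dominates.
  move=> abmu; case: cid => /= h [h1 h2 h3].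
  apply: integral_ae_eq => //=.
  + by apply/measurable_EFinP; exact: measurable_gpdf.
  + by move=> E E01 mE; rewrite -h3.
Qed.

(** The parallelogram identity in the exponent. It fixes the cost (x - y)^2 / (4 s^2) of property
    (tau): with this cost the hypothesis of Prekopa-Leindler holds for [u * gpdf], [v * gpdf] and
    [gpdf]. *)
Lemma gpdf_mid x y :
  gpdf x * gpdf y * expR ((x - y) ^+ 2 / (4 * s ^+ 2)) = gpdf ((x + y) / 2) ^+ 2.
Proof.
rewrite !gpdfE expr2.
have -> a b c : normal_peak s * a * (normal_peak s * b) * c =
  normal_peak s * normal_peak s * (a * b * c) by move=> *; ring.
rewrite [RHS]mulrACA -!expRD; congr (_ * expR _).
by field; rewrite gt_eqF.
Qed.

End gaussian_line.
Section line_measure.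
Context (R : realType).
Notation lam := (@lebesgue_measure R).

(** Tonelli's theorem for the indicator of the region below the graph of [a]. *)
Lemma layer_cake (a : R -> R) : measurable_fun setT a -> (forall x, 0 <= a x) ->
  (\int[lam]_x (a x)%:E = \int[lam]_(t in `[0%R, +oo[) lam [set x | (t < a x)%R])%E.
Proof.
move=> ma a0.
pose S := [set z : R * R | 0 <= z.2 < a z.1].
have mS : measurable S.
  rewrite (_ : S = ((fun z : R * R => z.2) @^-1` `[0, +oo[) `&`
                   ((fun z : R * R => a z.1 - z.2) @^-1` `]0, +oo[)).
    apply: measurableI; rewrite -[_ @^-1` _]setTI.
      exact: measurable_snd.
    apply: measurable_funB => //; first exact: measurableT_comp.
  apply/seteqP; split => -[x t] /=; rewrite !in_itv/= !andbT subr_gt0.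
    by move/andP.
  by move=> [t1 t2]; apply/andP.
have mI : measurable_fun setT (fun z : R * R => (\1_S z)%:E : \bar R).
  exact/measurable_EFinP/measurable_indic.
have := @fubini_tonelli _ _ _ _ R lam lam _ mI (fun z => _).
move=> /(_ (fun z => _)) H.
transitivity (\int[lam]_x \int[lam]_y (\1_S (x, y))%:E)%E.
  apply: eq_integral => x _.
  transitivity (\int[lam]_y (\1_(`[0, a x[%classic : set R) y)%:E)%E; last first.
    apply: eq_integral => t _; rewrite !indicE.
    suff -> : (t \in (`[0, a x[%classic : set R)) = ((x, t) \in S) by [].
    by apply/idP/idP => /set_mem/=; rewrite ?in_itv/= => h; apply/mem_set; rewrite /= ?in_itv.
  rewrite integral_indic//.
  transitivity (lam (`[0, a x[%classic : set R)); last by rewrite setIT.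
  rewrite lebesgue_measure_itv/= lte_fin.
  by have := a0 x; rewrite le_eqVlt => /predU1P[<-|->]; rewrite ?ltxx// oppr0 adde0.
rewrite H; last by move=> z; rewrite lee_fin.
rewrite [RHS]integral_mkcond; apply: eq_integral => t _.
rewrite patchE; case: ifPn => ht.
  transitivity (\int[lam]_x (\1_([set x | (t < a x)%R] : set R) x)%:E)%E.
    apply: eq_integral => x _; rewrite !indicE.
    move: ht; rewrite inE/= in_itv/= andbT => t0.
    suff -> : ((x, t) \in S) = (x \in ([set x | (t < a x)%R] : set R)) by [].
    by apply/idP/idP => /set_mem/= h; apply/mem_set; rewrite /S/= ?t0//; case/andP: h.
  rewrite integral_indic ?setIT//.
  rewrite (_ : mkset _ = a @^-1` `]t, +oo[); first by rewrite -[_ @^-1` _]setTI; exact: ma.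
  by apply/seteqP; split => x /=; rewrite in_itv/= andbT.
rewrite -[RHS](integral0 lam setT); apply: eq_integral => x _.
rewrite indicE memNset// /S/= => /andP[t0 _].
by move: ht; rewrite notin_setE/= in_itv/= t0.
Qed.

(* One-dimensional Brunn-Minkowski inequality for sets whose midpoints lie in a
   symmetric interval. *)
Lemma midpoint_sets (A B C : set R) : measurable A -> measurable B -> measurable C ->
  A !=set0 -> B !=set0 -> (forall x y, A x -> B y -> C ((x + y) / 2)) ->
  (forall z w, C z -> `|w| <= `|z| -> C w) ->
  (lam A + lam B <= lam C + lam C)%E.
Proof.
move=> mA mB mC [x0 Ax0] [y0 By0] ABC symC.
have [[r rC]|unb] := pselect (exists r, forall z, C z -> `|z| <= r); last first.
  have -> : C = setT.
    apply/seteqP; split => // w _.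
    have [z Cz wz] : exists2 z, C z & `|w| <= `|z|.
      apply: contrapT => h; apply: unb; exists `|w| => z Cz.
      by case: (leP `|z| `|w|) => // /ltW wz; exfalso; apply: h; exists z.
    exact: symC Cz wz.
  rewrite -set_itvNyy lebesgue_measure_itv/= -/lam.
  by rewrite leey.
pose S := [set `|z| | z in C].
have S0 : S !=set0 by exists `|(x0 + y0) / 2|, ((x0 + y0) / 2) => //; exact: ABC.
have ubS : has_ubound S by exists r => _ [z Cz <-]; exact: rC.
have hS : has_sup S by [].
set rr := sup S.
have rC' z : C z -> `|z| <= rr by move=> Cz; apply: (sup_ubound ubS); exists z.
have rr0 : 0 <= rr by apply: le_trans (rC' _ (ABC _ _ Ax0 By0)).
have Cin : (`]- rr, rr[%classic : set R) `<=` C.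
  move=> w /=; rewrite in_itv/= -ltr_norml => wr.
  have [_ [z Cz <-] wz] := sup_gt S0 wr.
  exact: symC Cz (ltW wz).
have lC : ((rr *+ 2)%:E <= lam C)%E.
  apply: (@le_trans _ _ (lam `]- rr, rr[)%classic).
    rewrite lebesgue_measure_itv/= lte_fin; case: ifPn => h.
      by rewrite -EFinB lee_fin opprK mulr2n.
    by rewrite lee_fin mulr2n; move: h; rewrite -leNgt; lra.
  by apply: le_measure; rewrite ?inE.
(* Up to endpoints C is the interval from -rr to rr, so diameters suffice: sums of a point of A and
   a point of B stay within 2 rr of 0, which bounds the sum of the two diameters by 4 rr. *)
have bA x y : A x -> B y -> - (2 * rr) <= x + y <= 2 * rr.
  by move=> Ax By; have := rC' _ (ABC _ _ Ax By); rewrite ler_norml; lra.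
have uA : has_ubound A by exists (2 * rr - y0) => x Ax; have := bA _ _ Ax By0; lra.
have lA : has_lbound A by exists (- (2 * rr) - y0) => x Ax; have := bA _ _ Ax By0; lra.
have uB : has_ubound B by exists (2 * rr - x0) => x Ax; have := bA _ _ Ax0 Ax; lra.
have lB : has_lbound B by exists (- (2 * rr) - x0) => x Ax; have := bA _ _ Ax0 Ax; lra.
have meas (D : set R) : measurable D -> D !=set0 -> has_ubound D -> has_lbound D ->
  (lam D <= (sup D - inf D)%:E)%E.
  move=> mD [d Dd] uD lD.
  have sub : D `<=` `[inf D, sup D].
    by move=> z Dz /=; rewrite in_itv/= (inf_lbound lD)// (sup_ubound uD).
  apply: (@le_trans _ _ (lam `[inf D, sup D])%classic).
    by apply: le_measure; rewrite ?inE.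
  rewrite lebesgue_measure_itv/= lte_fin; case: ifPn => //.
  by move=> _; rewrite lee_fin subr_ge0; apply: (le_trans (inf_lbound lD Dd)); exact: sup_ubound.
have sAB : sup A + sup B <= 2 * rr.
  rewrite -lerBrDr; apply: ge_sup; first by exists x0.
  move=> x Ax; rewrite lerBrDr -lerBrDl; apply: ge_sup; first by exists y0.
  by move=> y By; have := bA _ _ Ax By; lra.
have iAB : - (2 * rr) <= inf A + inf B.
  rewrite -lerBlDr; apply: lb_le_inf; first by exists x0.
  move=> x Ax; rewrite lerBlDr -lerBlDl; apply: lb_le_inf; first by exists y0.
  by move=> y By; have := bA _ _ Ax By; lra.
have Ane : A !=set0 by exists x0.
have Bne : B !=set0 by exists y0.
apply: le_trans (leeD (meas A mA Ane uA lA) (meas B mB Bne uB lB)) _.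
apply: le_trans (leeD lC lC); rewrite -!EFinD lee_fin !mulr2n; lra.
Qed.

End line_measure.

Section tau_line.
Context (R : realType).
Notation lam := (@lebesgue_measure R).
Variables (s : R) (s0 : 0 < s).
Notation gamma := (normal_prob 0 s : probability (measurableTypeR R) R).

(** The superlevel sets of the density are intervals centred at 0, which is what [midpoint_sets]
    asks of its third set. *)
Lemma gpdf_even_decr z w : `|w| <= `|z| -> gpdf s z <= gpdf s w.
Proof.
move=> wz; rewrite !gpdfE// ler_pM2l ?normal_peak_gt0 ?gt_eqF// ler_expR.
rewrite !mulNr lerN2 ler_pM2r; last by rewrite invr_gt0 pmulrn_lgt0// exprn_gt0.
by rewrite -[w ^+ 2]real_normK ?num_real// -[z ^+ 2]real_normK ?num_real// lerXn2r// nnegrE.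
Qed.

Lemma Ex_gpdf (u : R -> R) : bmf u -> (forall x, 0 <= u x) ->
  ((Ex gamma u)%:E = \int[lam]_x (u x * gpdf s x)%:E)%E.
Proof.
move=> bu u0; rewrite /Ex /Rintegral fineK; last first.
  by apply: integrable_fin_num => //; exact: bmf_int.
rewrite integral_normal_prob//; last exact: (@bmf_int _ _ _ gamma).
Qed.

(** Prekopa-Leindler for [a = u * gpdf], [b = v * gpdf] and the density. After division by their
    suprema A and B, the superlevel sets of a and b are nonempty for the same heights t < 1, and
    midpoints between them lie in the superlevel set of [p / r], where r^2 = A B. Integration over t
    gives E u / A + E v / B <= 2 / r, and the arithmetic-geometric mean inequality concludes. *)
Lemma tau_line (u v : R -> R) : bmf u -> bmf v ->
  (forall x, 0 <= u x) -> (forall x, 0 <= v x) ->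
  (forall x y, u x * v y <= expR ((x - y) ^+ 2 / (4 * s ^+ 2))) ->
  Ex gamma u * Ex gamma v <= 1.
Proof.
move=> bu bv u0 v0 uv.
have [mu [Ku hu]] := bu; have [mv [Kv hv]] := bv.
pose p := gpdf s; have p0 x : 0 < p x by exact: gpdf_gt0.
have mp : measurable_fun setT p by exact: measurable_gpdf.
pose a x := u x * p x; pose b x := v x * p x.
have a0 x : 0 <= a x by rewrite mulr_ge0// ltW.
have b0 x : 0 <= b x by rewrite mulr_ge0// ltW.
have ma : measurable_fun setT a by apply: measurable_funM.
have mb : measurable_fun setT b by apply: measurable_funM.
have ab x y : a x * b y <= p ((x + y) / 2) ^+ 2.
  rewrite /a /b mulrACA -gpdf_mid// [leRHS]mulrC.
  by apply: ler_wpM2r => //; exact: mulr_ge0 (ltW (p0 _)) (ltW (p0 _)).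
have Eu : ((Ex gamma u)%:E = \int[lam]_x (a x)%:E)%E by rewrite Ex_gpdf.
have Ev : ((Ex gamma v)%:E = \int[lam]_x (b x)%:E)%E by rewrite Ex_gpdf.
have Eu0 : 0 <= Ex gamma u by exact: Ex_ge0.
have Ev0 : 0 <= Ex gamma v by exact: Ex_ge0.
have [[x0 ax0]|na] := pselect (exists x, 0 < a x); last first.
  suff -> : Ex gamma u = 0 by rewrite mul0r.
  apply: EFin_inj; rewrite Eu integral0_eq// => x _; congr EFin.
  apply/eqP; rewrite eq_le a0 andbT leNgt; apply/negP => ax; apply: na; by exists x.
have [[y0 by0]|nb] := pselect (exists x, 0 < b x); last first.
  suff -> : Ex gamma v = 0 by rewrite mulr0.
  apply: EFin_inj; rewrite Ev integral0_eq// => x _; congr EFin.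
  apply/eqP; rewrite eq_le b0 andbT leNgt; apply/negP => ax; apply: nb; by exists x.
have peak x : p x <= p 0 by apply: gpdf_even_decr; rewrite normr0.
have ubd (w : R -> R) K : (forall x, 0 <= w x) -> (forall x, `|w x| <= K) ->
    has_ubound (range (fun x => w x * p x)).
  move=> w0 hw; exists (K * p 0) => _ [x _ <-].
  apply: ler_pM => //; first exact: ltW.
  exact: le_trans (ler_norm _) (hw x).
have uba : has_ubound (range a) by apply: ubd hu.
have ubb : has_ubound (range b) by apply: ubd hv.
pose A := sup (range a); pose B := sup (range b).
have aA x : a x <= A by apply: (sup_ubound uba); exists x.
have bB x : b x <= B by apply: (sup_ubound ubb); exists x.
have A0 : 0 < A by exact: lt_le_trans ax0 (aA x0).
have B0 : 0 < B by exact: lt_le_trans by0 (bB y0).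
pose r := Num.sqrt (A * B); have r0 : 0 < r by rewrite sqrtr_gt0 mulr_gt0.
have r2 : r ^+ 2 = A * B by rewrite sqr_sqrtr// mulr_ge0// ltW.
have Lscale (w : R -> R) c : measurable_fun setT w -> (forall x, 0 <= w x) -> 0 < c ->
  (\int[lam]_x (w x)%:E = c%:E * \int[lam]_(t in `[0%R, +oo[) lam [set x | (t < w x / c)%R])%E.
  move=> mw w0 c0; rewrite -layer_cake; last by move=> x; rewrite divr_ge0// ltW.
    rewrite -ge0_integralZl//.
    - by apply: eq_integral => x _; rewrite -EFinM mulrC divfK// gt_eqF.
    - by apply/measurable_EFinP; apply: measurable_funM.
    - by move=> x _; rewrite lee_fin divr_ge0// ltW.
    - by rewrite lee_fin ltW.
  by apply: measurable_funM.
have mset (w : R -> R) c t : measurable_fun setT w -> measurable [set x | t < w x / c].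
  move=> mw; rewrite (_ : mkset _ = (fun x => w x / c) @^-1` `]t, +oo[).
    by rewrite -[_ @^-1` _]setTI; apply: measurable_funM.
  by apply/seteqP; split => x /=; rewrite in_itv/= andbT.
have mlev (w : R -> R) c : measurable_fun setT w -> (forall x, 0 <= w x) -> 0 < c ->
    measurable_fun (`[0%R, +oo[ : set R) (fun t => lam [set x | (t < w x / c)%R]).
  move=> mw w0 c0; apply: measurable_funTS.
  pose S := [set z : R * R | z.2 < w z.1 / c].
  have mS : measurable S.
    rewrite (_ : S = (fun z : R * R => w z.1 / c - z.2) @^-1` `]0, +oo[).
      rewrite -[_ @^-1` _]setTI; apply: measurable_funB => //.
      by apply: measurable_funM => //; exact: measurableT_comp.
    by apply/seteqP; split => -[x t] /=; rewrite in_itv/= andbT subr_gt0.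
  have := measurable_fun_ysection lam mS; congr (measurable_fun _ _).
  apply/funext => t /=; congr (lam _); apply/seteqP; split => x; rewrite /ysection/= inE //.
have key t : 0 <= t -> (lam [set x | (t < a x / A)%R] + lam [set x | (t < b x / B)%R] <=
    lam [set x | (t < p x / r)%R] + lam [set x | (t < p x / r)%R])%E.
  move=> t0; have [t1|t1] := ltP t 1; last first.
    rewrite (_ : [set x | t < a x / A] = set0); last first.
      apply/seteqP; split => // x /=; rewrite ltr_pdivlMr// => h.
      have := le_lt_trans _ h => /(_ A); rewrite ler_peMl//; last exact: ltW.
      by move=> /(_ isT); rewrite ltNge aA.
    rewrite (_ : [set x | t < b x / B] = set0); last first.
      apply/seteqP; split => // x /=; rewrite ltr_pdivlMr// => h.
      have := le_lt_trans _ h => /(_ B); rewrite ler_peMl//; last exact: ltW.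
      by move=> /(_ isT); rewrite ltNge bB.
    by rewrite !measure0 adde0 adde_ge0.
  apply: midpoint_sets.
  - exact: mset.
  - exact: mset.
  - exact: mset.
  - have [_ [x _ <-] hx] : exists2 z, range a z & t * A < z.
      by apply: sup_gt; [exists (a x0), x0|rewrite -/A gtr_pMl].
    by exists x; rewrite /= ltr_pdivlMr.
  - have [_ [x _ <-] hx] : exists2 z, range b z & t * B < z.
      by apply: sup_gt; [exists (b y0), y0|rewrite -/B gtr_pMl].
    by exists x; rewrite /= ltr_pdivlMr.
  - move=> x y /=; rewrite !ltr_pdivlMr// => hx hy.
    have tr : 0 <= t * r by apply: mulr_ge0 => //; exact: ltW.
    have tA : 0 <= t * A by apply: mulr_ge0 => //; exact: ltW.
    have tB : 0 <= t * B by apply: mulr_ge0 => //; exact: ltW.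
    rewrite -(@ltr_pXn2r _ 2)// ?nnegrE//; last exact: ltW.
    rewrite exprMn r2; apply: lt_le_trans (ab x y).
    by rewrite expr2 mulrACA; exact: ltr_pM.
  - move=> z w /= tz wz; apply: lt_le_trans tz _.
    by rewrite ler_pM2r ?invr_gt0//; exact: gpdf_even_decr.
have main : Ex gamma u / A + Ex gamma v / B <= 2 / r.
  rewrite -lee_fin EFinD !EFinM Eu Ev.
  have Lr (w : R -> R) c : measurable_fun setT w -> (forall x, 0 <= w x) -> 0 < c ->
    (\int[lam]_x (w x)%:E * (c^-1)%:E = \int[lam]_(t in `[0%R, +oo[) lam [set x | (t < w x / c)%R])%E.
    move=> mw w0 c0; rewrite (Lscale w c)// muleAC -EFinM divff ?gt_eqF//.
    by rewrite mul1e.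
  have Lp : ((r^-1)%:E = \int[lam]_(t in `[0%R, +oo[) lam [set x | (t < p x / r)%R])%E.
    rewrite -Lr//; last by move=> x; exact: ltW.
    by rewrite integral_normal_pdf mul1e.
  have -> : (2%:E * (r^-1)%:E = (r^-1)%:E + (r^-1)%:E)%E.
    by rewrite -EFinM -EFinD mulr_natl mulr2n.
  rewrite (Lr a A)// (Lr b B)// Lp.
  rewrite -!ge0_integralD//; try exact: mlev.
  - apply: ge0_le_integral => //=; try by move=> t _; rewrite adde_ge0.
    all: try by apply: emeasurable_funD; apply: mlev => // x; exact: ltW.
    by move=> t; rewrite in_itv/= andbT; exact: key.
  - by apply: mlev => // x; exact: ltW.
  - by apply: mlev => // x; exact: ltW.
have x1 : 0 <= Ex gamma u / A by rewrite divr_ge0// ltW.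
have y1 : 0 <= Ex gamma v / B by rewrite divr_ge0// ltW.
have -> : Ex gamma u * Ex gamma v = (Ex gamma u / A) * (Ex gamma v / B) * r ^+ 2.
  by rewrite r2; field; rewrite !gt_eqF.
set X := Ex gamma u / A in main x1 *; set Y := Ex gamma v / B in main y1 *.
have h : X * r + Y * r <= 2 by rewrite -mulrDl -ler_pdivlMr.
have -> : X * Y * r ^+ 2 = (X * r) * (Y * r) by ring.
have hX : 0 <= X * r by apply: mulr_ge0 => //; exact: ltW.
have hY : 0 <= Y * r by apply: mulr_ge0 => //; exact: ltW.
move: (X * r) (Y * r) h hX hY => m1 m2 h hX hY.
by have := sqr_ge0 (m1 - m2); nra.
Qed.

End tau_line.

(** * Gaussian product measures and property (tau) *)

Section expectation_prod.
Context d1 d2 (T1 : measurableType d1) (T2 : measurableType d2) (R : realType).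
Variables (P1 : probability T1 R) (P2 : probability T2 R).

Lemma bmf_slice1 (f : T1 * T2 -> R) x : bmf f -> bmf (fun y => f (x, y)).
Proof.
move=> [mf [M hM]]; split; last by exists M => y; exact: hM.
exact: measurableT_comp mf (measurable_pair1 x).
Qed.

Lemma bmf_slice2 (f : T1 * T2 -> R) y : bmf f -> bmf (fun x => f (x, y)).
Proof.
move=> [mf [M hM]]; split; last by exists M => x; exact: hM.
exact: measurableT_comp mf (measurable_pair2 y).
Qed.

Lemma Ex_bound d (T : measurableType d) (P : probability T R) (f : T -> R) M :
  bmf f -> (forall x, `|f x| <= M) -> `|Ex P f| <= M.
Proof.
move=> bf hM; apply: le_trans (Ex_norm P bf) _.
rewrite -[leRHS](Ex_cst P); apply: Ex_le => //; first exact: bmf_norm.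
exact: bmf_cst.
Qed.

Lemma Ex_fine d (T : measurableType d) (P : probability T R) (f : T -> R) :
  P.-integrable setT (EFin \o f) -> (\int[P]_x (f x)%:E = (Ex P f)%:E)%E.
Proof. by move=> hf; rewrite /Ex /Rintegral fineK// integrable_fin_num. Qed.

Lemma bmf_Ex2 (f : T1 * T2 -> R) : bmf f -> bmf (fun x => Ex P2 (fun y => f (x, y))).
Proof.
move=> bf; have [mf [M hM]] := bf; split; last first.
  by exists M => x; apply: Ex_bound => //; exact: bmf_slice1.
apply/measurable_EFinP.
have := measurable_fubini_F (bmf_int (P1 \x P2)%E bf).
congr (measurable_fun _ _); apply/funext => x /=.
by rewrite /fubini_F Ex_fine//; apply/bmf_int/bmf_slice1.
Qed.

Lemma bmf_Ex1 (f : T1 * T2 -> R) : bmf f -> bmf (fun y => Ex P1 (fun x => f (x, y))).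
Proof.
move=> bf; have [mf [M hM]] := bf; split; last first.
  by exists M => x; apply: Ex_bound => //; exact: bmf_slice2.
apply/measurable_EFinP.
have := measurable_fubini_G (bmf_int (P1 \x P2)%E bf).
congr (measurable_fun _ _); apply/funext => x /=.
by rewrite /fubini_G Ex_fine//; apply/bmf_int/bmf_slice2.
Qed.

Lemma Ex_prod12 (f : T1 * T2 -> R) :
  (P1 \x P2)%E.-integrable setT (EFin \o f) ->
  (forall x, P2.-integrable setT (fun y => (f (x, y))%:E)) ->
  Ex (P1 \x P2)%E f = Ex P1 (fun x => Ex P2 (fun y => f (x, y))).
Proof.
move=> bf sf; rewrite {1}/Ex /Rintegral -integral12_prod_meas1//.
by rewrite -[RHS]/(fine _); congr fine; apply: eq_integral => x _; exact: (Ex_fine (f := fun y => f (x, y)) (sf x)).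
Qed.

Lemma Ex_prod21 (f : T1 * T2 -> R) :
  (P1 \x P2)%E.-integrable setT (EFin \o f) ->
  (forall y, P1.-integrable setT (fun x => (f (x, y))%:E)) ->
  Ex (P1 \x P2)%E f = Ex P2 (fun y => Ex P1 (fun x => f (x, y))).
Proof.
move=> bf sf; rewrite {1}/Ex /Rintegral -integral21_prod_meas1//.
by rewrite -[RHS]/(fine _); congr fine; apply: eq_integral => x _; exact: (Ex_fine (f := fun y => f (y, x)) (sf x)).
Qed.

End expectation_prod.

Section gaussian_space.
Context (R : realType) (s : R).
Notation gamma := (normal_prob 0 s : probability (measurableTypeR R) R).

Definition tcons k (z : measurableTypeR R * k.-tuple (measurableTypeR R)) : k.+1.-tuple (measurableTypeR R) := [tuple of z.1 :: z.2].

Lemma measurable_tcons k : measurable_fun setT (@tcons k).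
Proof. exact: (measurable_cons (@measurable_fst _ _ (measurableTypeR R) (k.-tuple (measurableTypeR R))) measurable_snd). Qed.

HB.instance Definition _ k := isMeasurableFun.Build _ _ _ _ (@tcons k) (@measurable_tcons k).

(** The k-fold product measure, as an iterated image under [tcons], so that inductions on the
    dimension reduce to Fubini's theorem for two factors. *)
Fixpoint gaussm k : probability (k.-tuple (measurableTypeR R)) R :=
  if k is k'.+1 then distribution (gamma \x gaussm k')%E (@tcons k' : {mfun _ >-> _})
  else \d_[tuple].

Lemma bmf_tcons k (f : k.+1.-tuple (measurableTypeR R) -> R) : bmf f -> bmf (f \o @tcons k).
Proof.
move=> [mf [M hM]]; split; last by exists M => z; exact: hM.
exact: measurableT_comp mf (@measurable_tcons k).
Qed.

Lemma Ex_gaussmS k (f : k.+1.-tuple (measurableTypeR R) -> R) : measurable_fun setT f ->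
  (gamma \x gaussm k)%E.-integrable setT (EFin \o (f \o @tcons k)) ->
  Ex (gaussm k.+1) f = Ex (gamma \x gaussm k)%E (f \o @tcons k).
Proof.
move=> mf bf; rewrite /Ex /Rintegral /= integral_distribution//.
exact/measurable_EFinP.
Qed.

Definition tco k (x : k.-tuple (measurableTypeR R)) (i : 'I_k) : R := tnth x i.

Definition dist2 k (x y : k.-tuple (measurableTypeR R)) : R := \sum_(i < k) (tco x i - tco y i) ^+ 2.

Lemma dist2_tcons k (x y : measurableTypeR R * k.-tuple (measurableTypeR R)) :
  dist2 (tcons x) (tcons y) = ((x.1 : R) - (y.1 : R)) ^+ 2 + dist2 x.2 y.2.
Proof.
by rewrite /dist2 big_ord_recl; congr (_ + _); apply: eq_bigr => i _; rewrite /tco !tnthS.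
Qed.

End gaussian_space.

(* Maurey's property (tau); the Lipschitz and variance estimates below are all
   consequences of this single inequality, which tensorises by Tonelli. *)
Lemma property_tau (R : realType) (s : R) k (u v : k.-tuple (measurableTypeR R) -> R) : 0 < s ->
  bmf u -> bmf v -> (forall x, 0 <= u x) -> (forall x, 0 <= v x) ->
  (forall x y, u x * v y <= expR (dist2 x y / (4 * s ^+ 2))) ->
  Ex (gaussm s k) u * Ex (gaussm s k) v <= 1.
Proof.
move=> s0; elim: k u v => [|k IH] u v bu bv u0 v0 uv.
  have E (w : 0.-tuple (measurableTypeR R) -> R) : bmf w -> Ex (gaussm s 0) w = w [tuple].
    move=> bw; rewrite (_ : w = fun=> w [tuple]) ?Ex_cst//.
    by apply/funext => x; rewrite (tuple0 x).
  rewrite !E//; apply: le_trans (uv _ _) _.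
  by rewrite /dist2 big_ord0 mul0r expR0.
have bu' := bmf_tcons bu; have bv' := bmf_tcons bv.
rewrite !Ex_gaussmS; [|exact: bv.1|exact: bmf_int|exact: bu.1|exact: bmf_int].
rewrite !Ex_prod21; [|exact: bmf_int|by move=> y; apply/bmf_int/bmf_slice2|exact: bmf_int|by move=> y; apply/bmf_int/bmf_slice2].
apply: IH.
- exact: (bmf_Ex1 _ (gaussm s k) bu').
- exact: (bmf_Ex1 _ (gaussm s k) bv').
- by move=> x; apply: Ex_ge0 => [|z]; [exact: bmf_slice2|exact: u0].
- by move=> x; apply: Ex_ge0 => [|z]; [exact: bmf_slice2|exact: v0].
(* The partially integrated functions satisfy the hypothesis in dimension k: this is the inequality
   on the line for the fibres over x and y, the cost of the remaining coordinates being divided out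
   of u. *)
move=> x y; set c := expR _.
have c0 : 0 < c by exact: expR_gt0.
have bux := bmf_slice2 x bu'; have bvy := bmf_slice2 y bv'.
rewrite -[leRHS]mulr1 -ler_pdivrMl// mulrA.
rewrite -(ExZ _ c^-1 bux).
apply: (@tau_line R s s0 (fun a => c^-1 * u (tcons (a, x))) (fun b => v (tcons (b, y)))) => //.
- exact: bmfZ.
- by move=> z; rewrite mulr_ge0 ?invr_ge0 ?(ltW c0)//; exact: u0.
move=> a b; rewrite -mulrA ler_pdivrMl// -expRD -mulrDl addrC.
by have := uv (tcons (a, x)) (tcons (b, y)); rewrite dist2_tcons.
Qed.

(** * Concentration and Poincare inequalities *)

Section gaussian_lipschitz.
Context (R : realType) (k : nat).
Notation T := (k.-tuple (measurableTypeR R)).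

Lemma dist2_ge0 (x y : T) : 0 <= dist2 x y.
Proof. by apply: sumr_ge0 => i _; exact: sqr_ge0. Qed.

Lemma dist2C (x y : T) : dist2 x y = dist2 y x.
Proof. by apply: eq_bigr => i _; rewrite -sqrrN opprB. Qed.

Lemma measurable_tco i : measurable_fun setT (fun x : T => tco x i).
Proof. exact: measurable_tnth. Qed.

Lemma measurable_dist2 (y : T) : measurable_fun setT (fun x : T => dist2 x y).
Proof.
apply: measurable_sum => i; apply: measurable_funX; apply: measurable_funB => //.
exact: measurable_tco.
Qed.

(** Measurability refers to the product sigma-algebra, so a countable description is given: {f < c}
    is the union over rational points q of the sets where f q + L' dist (x, q) < c, and distances to
    a point are measurable. *)
Lemma lipschitz_measurable (f : T -> R) L : 
  (forall x y, `|f x - f y| <= L * Num.sqrt (dist2 x y)) -> measurable_fun setT f.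
Proof.
move=> fL; pose L' := `|L| + 1; have L0 : 0 < L' by rewrite ltr_wpDl.
have fL' x y : f x <= f y + L' * Num.sqrt (dist2 x y).
  rewrite -lerBlDl; apply: le_trans (ler_norm _) _; apply: le_trans (fL x y) _.
  by apply: ler_wpM2r; rewrite ?sqrtr_ge0// /L' (le_trans (ler_norm L))// lerDl.
pose q2t (q : k.-tuple rat) : T := [tuple (ratr (tnth q i) : measurableTypeR R) | i < k].
have dense (x : T) (e : R) : 0 < e -> exists q, dist2 x (q2t q) <= e ^+ 2.
  move=> e0; pose e' := e / (k%:R + 1).
  have k0 : 0 < k%:R + 1 :> R by rewrite ltr_wpDl.
  have e'0 : 0 < e' by rewrite divr_gt0.
  have /choice[g hg] : forall i, exists q : rat, `|tco x i - ratr q| <= e'.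
    move=> i; have [|q] := @rat_in_itvoo R (tco x i - e') (tco x i + e').
      by rewrite ltrD2l gtrN.
    by rewrite in_itv/= => /andP[h1 h2]; exists q; rewrite ler_norml; lra.
  exists [tuple g i | i < k]; rewrite /dist2.
  apply: (@le_trans _ _ (\sum_(i < k) e' ^+ 2)).
    apply: ler_sum => i _; rewrite /q2t {2}/tco !tnth_mktuple.
    by rewrite -real_normK ?num_real// lerXn2r ?nnegrE// ?ltW// hg.
  rewrite sumr_const card_ord -mulr_natl /e' expr_div_n mulrCA ler_piMr ?sqr_ge0//.
  rewrite ler_pdivrMr ?exprn_gt0// mul1r expr2 mulrDl mul1r.
  by have : 0 <= k%:R :> R by []; nra.
apply: (measurability _ (RGenInftyO.measurableE R)) => //.
move=> _ [_ [c ->] <-]; rewrite setTI.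
rewrite (_ : _ @^-1` _ =
  \bigcup_q [set x | f (q2t q) + L' * Num.sqrt (dist2 x (q2t q)) < c]).
  apply: countable_bigcupT_measurable => [|q]; first exact: countableP.
  rewrite (_ : mkset _ = (fun x => f (q2t q) + L' * Num.sqrt (dist2 x (q2t q))) @^-1` `]-oo, c[).
    rewrite -[_ @^-1` _]setTI; apply: measurable_funD => //.
    apply: measurable_funM => //.
    by apply: measurableT_comp; [apply: continuous_measurable_fun; exact: sqrt_continuous|exact: measurable_dist2].
  by apply/seteqP; split => x /=; rewrite in_itv.
apply/seteqP; split => x /=; rewrite in_itv/=.
  (* Moving to a rational point within e costs L' e twice, once in the value of f and once in the
     distance term; the denominator 3 leaves a strict inequality. *)
  move=> fc; pose e := (c - f x) / (3 * L').
  have e0 : 0 < e by rewrite divr_gt0 ?subr_gt0// mulr_gt0.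
  have [q hq] := dense x e e0; exists q => //=.
  have sq : Num.sqrt (dist2 x (q2t q)) <= e.
    by rewrite [leRHS](_ : e = Num.sqrt (e ^+ 2)) ?ler_wsqrtr// sqrtr_sqr ger0_norm// ltW.
  have := fL' (q2t q) x; rewrite dist2C => h.
  apply: (@le_lt_trans _ _ (f x + 2 * (L' * e))).
    have : L' * Num.sqrt (dist2 x (q2t q)) <= L' * e by rewrite ler_pM2l.
    by lra.
  have -> : L' * e = (c - f x) / 3 by rewrite /e; field; rewrite gt_eqF.
  by lra.
by move=> [q _ /=]; apply: le_lt_trans; exact: fL'.
Qed.

Lemma lipschitz_bmf (f : T -> R) L M :
  (forall x y, `|f x - f y| <= L * Num.sqrt (dist2 x y)) ->
  (forall x, `|f x| <= M) -> bmf f.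
Proof. by move=> fL fM; split; [exact: lipschitz_measurable fL|exists M]. Qed.

Variables (s : R) (s0 : 0 < s).
Notation G := (gaussm s k).

(** Property (tau) for the indicators of A and B, the first multiplied by exp (r^2 / (4 s^2)).
    Concentration is applied in this form: once A has probability bounded below, whatever is far
    from A is exponentially unlikely, with no reference to a mean or a median. *)
Lemma gaussm_sets (A B : set T) (r : R) : measurable A -> measurable B -> 0 <= r ->
  (forall x y, A x -> B y -> r ^+ 2 <= dist2 x y) ->
  fine (G A) * fine (G B) <= expR (- (r ^+ 2 / (4 * s ^+ 2))).
Proof.
move=> mA mB r0 AB; rewrite expRN -[leRHS]mulr1 -ler_pdivrMl ?invr_gt0 ?expR_gt0//.
rewrite invrK mulrA -!Ex_indic// -(ExZ G _ (bmf_indic R mA)).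
apply: property_tau => //.
- exact/bmfZ/bmf_indic.
- exact: bmf_indic.
move=> x y; rewrite !indicE; case: (boolP (x \in A)) => xA; last by rewrite mulr0 mul0r expR_ge0.
case: (boolP (y \in B)) => yB; last by rewrite mulr0 expR_ge0.
rewrite !mulr1 ler_expR ler_pM2r ?invr_gt0 ?mulr_gt0 ?exprn_gt0//.
by apply: AB; apply/set_mem.
Qed.

(* Poincare's inequality, for functions whose increments are controlled by a
   squared gradient [Gam] up to a uniform second order term. *)
Lemma gaussm_poincare (f Gam : T -> R) (M : R) : bmf f -> bmf Gam -> 0 <= M ->
  (forall x, 0 <= Gam x) ->
  (forall x y, f x - f y <= Num.sqrt (Gam x) * Num.sqrt (dist2 x y) + M * dist2 x y) ->
  Ex G (fun x => (f x - Ex G f) ^+ 2) <= 8 * s ^+ 2 * Ex G Gam.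
Proof.
move=> bf bG M0 Gam0 hf; set m := Ex G f.
have s2 : 0 < s ^+ 2 by rewrite exprn_gt0.
pose g x := f x - m.
have bg : bmf g by apply: bmfB => //; exact: bmf_cst.
have Eg : Ex G g = 0 by rewrite ExB ?Ex_cst ?subrr//; exact: bmf_cst.
have [_ [Bg hBg]] := bg; have [_ [BG hBG]] := bG.
(* Property (tau) for exp t and exp (- e g). Half of the cost absorbs the gradient term, by e q D <=
   D^2 / (8 s^2) + 2 s^2 e^2 q^2, and the other half the second-order term. Jensen's inequality
   removes the second factor, and E exp t <= 1 is expanded to second order in e. *)
have main e : 0 < e -> e * (8 * s ^+ 2 * M) <= 1 -> e * Bg <= 1 ->
    2 * s ^+ 2 * e ^+ 2 * BG <= 1 ->
    Ex G (fun x => g x ^+ 2) <= 8 * s ^+ 2 * Ex G Gam + e * (4 * s ^+ 2 * Ex G (fun x => g x * Gam x)).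
  move=> e0 eM eBg eBG; pose t x := e * g x - 2 * s ^+ 2 * e ^+ 2 * Gam x.
  have bt : bmf t by apply: bmfB; exact: bmfZ.
  have beg : bmf (fun x => - (e * g x)) by apply/bmfN/bmfZ.
  have tau : Ex G (fun x => expR (t x)) * Ex G (fun x => expR (- (e * g x))) <= 1.
    apply: property_tau => //.
    - exact: bmf_expR.
    - exact: bmf_expR.
    move=> x y; rewrite -expRD ler_expR /t ler_pdivlMr ?mulr_gt0//.
    have := hf x y; set q := Num.sqrt (Gam x); set D := Num.sqrt (dist2 x y).
    have -> : Gam x = q ^+ 2 by rewrite sqr_sqrtr.
    have -> : dist2 x y = D ^+ 2 by rewrite sqr_sqrtr// dist2_ge0.
    rewrite /g => h.
    have h1 : e * (f x - f y) <= e * (q * D) + e * (M * D ^+ 2).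
      by rewrite -mulrDr ler_pM2l.
    have h2 : e * (8 * s ^+ 2 * M) * D ^+ 2 <= D ^+ 2.
      by rewrite ler_piMl ?sqr_ge0.
    have h3 : 0 <= (4 * s ^+ 2 * e * q - D) ^+ 2 by exact: sqr_ge0.
    have h4 : (e * (f x - f y)) * (4 * s ^+ 2) <= (e * (q * D) + e * (M * D ^+ 2)) * (4 * s ^+ 2).
      by rewrite ler_pM2r// mulr_gt0.
    have -> : (e * (f x - m) - 2 * s ^+ 2 * e ^+ 2 * q ^+ 2 - e * (f y - m)) * (4 * s ^+ 2) =
      e * (f x - f y) * (4 * s ^+ 2) - 8 * (s ^+ 2 * e * q) ^+ 2 by ring.
    have h5 : (4 * s ^+ 2 * e * q - D) ^+ 2 =
       16 * (s ^+ 2 * e * q) ^+ 2 - 2 * (e * (q * D) * (4 * s ^+ 2)) + D ^+ 2 by ring.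
    rewrite h5 in h3.
    have h6 : e * (M * D ^+ 2) * (4 * s ^+ 2) = (e * (8 * s ^+ 2 * M) * D ^+ 2) / 2 by field.
    move: h4; rewrite [X in _ <= X]mulrDl h6 => h4; lra.
  have jensen : 1 <= Ex G (fun x => expR (- (e * g x))).
    apply: (@le_trans _ _ (Ex G (fun x => 1 + - (e * g x)))).
      rewrite ExD//; last exact: bmf_cst.
      by rewrite Ex_cst ExN ?ExZ// ?Eg ?mulr0 ?subr0//; exact: bmfZ.
    apply: Ex_le => //.
    - by apply: bmfD => //; exact: bmf_cst.
    - exact: bmf_expR.
    - by move=> x; exact: expR_ge1Dx.
  have Et : Ex G (fun x => expR (t x)) <= 1.
    apply: le_trans tau; by rewrite ler_peMr// Ex_ge0//; exact: bmf_expR.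
  (* Squaring 1 + y / 2 gives the coefficient 1/4; together with the loss 2 s^2 e^2 it produces the
     constant 8. *)
  have elow y : - 2 <= y -> 1 + y + y ^+ 2 / 4 <= expR y.
    move=> y2; have h := expR_ge1Dx (y / 2).
    have -> : expR y = expR (y / 2) ^+ 2 by rewrite -expRM_natr; congr expR; field.
    have : (1 + y / 2) ^+ 2 <= expR (y / 2) ^+ 2 by rewrite lerXn2r ?nnegrE ?expR_ge0//; lra.
    by move=> ?; lra.
  have tge x : - 2 <= t x.
    have h1 : - (e * g x) <= e * Bg.
      by rewrite -mulrN ler_pM2l// (le_trans _ (hBg x))// ler_normr lexx orbT.
    have h2 : 2 * s ^+ 2 * e ^+ 2 * Gam x <= 2 * s ^+ 2 * e ^+ 2 * BG.
      apply: ler_wpM2l; last exact: le_trans (ler_norm _) (hBG x).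
      by rewrite !mulr_ge0// ltW.
    by rewrite /t; lra.
  have b2 : bmf (fun x => (e ^+ 2 / 4) * g x ^+ 2) by apply/bmfZ/bmfX.
  have b3 : bmf (fun x => (- (s ^+ 2 * e ^+ 3)) * (g x * Gam x)) by apply/bmfZ/bmfM.
  have low : 1 - 2 * s ^+ 2 * e ^+ 2 * Ex G Gam + (e ^+ 2 / 4) * Ex G (fun x => g x ^+ 2)
      - s ^+ 2 * e ^+ 3 * Ex G (fun x => g x * Gam x) <= Ex G (fun x => expR (t x)).
    have b1 : bmf (fun x => 1 - 2 * s ^+ 2 * e ^+ 2 * Gam x).
      by apply: bmfB; [exact: bmf_cst|exact: bmfZ].
    have -> : 1 - 2 * s ^+ 2 * e ^+ 2 * Ex G Gam + e ^+ 2 / 4 * Ex G (fun x => g x ^+ 2)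
      - s ^+ 2 * e ^+ 3 * Ex G (fun x => g x * Gam x) = Ex G (fun x =>
       (1 - 2 * s ^+ 2 * e ^+ 2 * Gam x) + e ^+ 2 / 4 * g x ^+ 2 +
        - (s ^+ 2 * e ^+ 3) * (g x * Gam x)).
      rewrite (ExD G (bmfD b1 b2) b3) (ExD G b1 b2) ExB; [|exact: bmf_cst|exact: bmfZ].
      rewrite Ex_cst (ExZ G _ bG) (ExZ G _ (bmfX 2 bg)) (ExZ G _ (bmfM bg bG)).
      by rewrite mulNr.
    have -> : Ex G (fun x => expR (t x)) = Ex G (fun x => expR (t x) - e * g x) + e * Ex G g.
      by rewrite -(ExZ G _ bg) -ExD; [congr Ex; apply/funext => x; ring|apply: bmfB; [exact: bmf_expR|exact: bmfZ]|exact: bmfZ].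
    rewrite Eg mulr0 addr0; apply: Ex_le.
    - by apply: bmfD => //; exact: bmfD.
    - by apply: bmfB; [exact: bmf_expR|exact: bmfZ].
    move=> x; apply: le_trans (_ : 1 + t x + t x ^+ 2 / 4 - e * g x <= _); last first.
      by rewrite lerD2r elow.
    have h : 0 <= (2 * s ^+ 2 * e ^+ 2 * Gam x) ^+ 2 by exact: sqr_ge0.
    rewrite /t -subr_ge0.
    have -> : 1 + (e * g x - 2 * s ^+ 2 * e ^+ 2 * Gam x) +
      (e * g x - 2 * s ^+ 2 * e ^+ 2 * Gam x) ^+ 2 / 4 - e * g x -
      (1 - 2 * s ^+ 2 * e ^+ 2 * Gam x + e ^+ 2 / 4 * g x ^+ 2 +
       - (s ^+ 2 * e ^+ 3) * (g x * Gam x)) = (2 * s ^+ 2 * e ^+ 2 * Gam x) ^+ 2 / 4 by field.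
    by rewrite divr_ge0.
  have fin := le_trans low Et.
  have e2 : 0 < e ^+ 2 / 4 by rewrite divr_gt0 ?exprn_gt0.
  rewrite -(ler_pM2l e2).
  have -> : e ^+ 2 / 4 * (8 * s ^+ 2 * Ex G Gam + e * (4 * s ^+ 2 * Ex G (fun x => g x * Gam x))) =
    2 * s ^+ 2 * e ^+ 2 * Ex G Gam + s ^+ 2 * e ^+ 3 * Ex G (fun x => g x * Gam x) by field.
  by lra.
rewrite -/g; set X := Ex G _; set Y := 8 * s ^+ 2 * Ex G Gam.
have [//|XY] := leP X Y; exfalso.
pose Z := 4 * s ^+ 2 * Ex G (fun x => g x * Gam x).
(* The choice e = 1/K meets the three smallness conditions and makes the error term at most half of
   the supposed excess X - Y. *)
pose K := 1 + (8 * s ^+ 2 * M) + `|Bg| + 2 * s ^+ 2 * `|BG| + 2 * (`|Z| / (X - Y)).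
have sM : 0 <= 8 * s ^+ 2 * M by rewrite !mulr_ge0// ltW.
have sB : 0 <= 2 * s ^+ 2 * `|BG| by rewrite !mulr_ge0// ltW.
have sZ : 0 <= `|Z| / (X - Y) by rewrite divr_ge0// subr_ge0 ltW.
have nB : 0 <= `|Bg| by [].
have K1 : 1 <= K by rewrite /K; lra.
have K0 : 0 < K by lra.
have eK c : c <= K -> K^-1 * c <= 1 by move=> cK; rewrite mulrC ler_pdivrMr ?mul1r.
have Ki : K^-1 <= 1 by rewrite invf_le1.
have Kp : 0 < K^-1 by rewrite invr_gt0.
have := main K^-1 Kp _ _ _; rewrite -/X -/Y -/Z => H.
have : X <= Y + K^-1 * Z.
  apply: H.
  - by apply: eK; rewrite /K; lra.
  - apply: le_trans (_ : K^-1 * `|Bg| <= _); first by rewrite ler_pM2l// ler_norm.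
    by apply: eK; rewrite /K; lra.
  - apply: le_trans (_ : K^-1 * (2 * s ^+ 2 * `|BG|) <= _); last by apply: eK; rewrite /K; lra.
    have -> : 2 * s ^+ 2 * K^-1 ^+ 2 * BG = K^-1 * (K^-1 * (2 * s ^+ 2 * BG)) by ring.
    rewrite ler_pM2l//; apply: le_trans (_ : K^-1 * (2 * s ^+ 2 * `|BG|) <= _).
      by rewrite ler_pM2l// ler_pM2l ?mulr_gt0// ler_norm.
    by rewrite ler_piMl.
have h1 : K^-1 * Z <= K^-1 * `|Z| by rewrite ler_pM2l// ler_norm.
have h2 : K^-1 * (2 * (`|Z| / (X - Y))) <= 1 by apply: eK; rewrite /K; lra.
have d0 : 0 < X - Y by rewrite subr_gt0.
have h3 : K^-1 * `|Z| <= (X - Y) / 2.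
  have -> : K^-1 * `|Z| = K^-1 * (2 * (`|Z| / (X - Y))) * ((X - Y) / 2).
    by field; rewrite !gt_eqF.
  by rewrite ler_piMl// divr_ge0// ltW.
by lra.
Qed.

End gaussian_lipschitz.

(** * Gaussian integration by parts *)

Section ibp_line.
Context (R : realType).
Notation lam := (@lebesgue_measure R).
Variables (s : R) (s0 : 0 < s).
Notation gamma := (normal_prob 0 s : probability (measurableTypeR R) R).

(** Truncation at level n and monotone convergence extend the change of variables from bounded to
    nonnegative functions. *)
Lemma ge0_integral_normal_prob (f : R -> R) : measurable_fun setT f ->
  (forall x, 0 <= f x) ->
  (\int[gamma]_x (f x)%:E = \int[lam]_x (f x * gpdf s x)%:E)%E.
Proof.
move=> mf f0; pose g n x := Num.min (f x) n%:R.
have mg n : measurable_fun setT (g n) by apply: measurable_minr.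
have g0 n x : 0 <= g n x by rewrite /g le_min f0 ler0n.
have bg n : bmf (g n).
  by split => //; exists n%:R => x; rewrite ger0_norm// /g ge_min lexx orbT.
have gle n m x : (n <= m)%N -> g n x <= g m x.
  by move=> nm; rewrite /g le_min !ge_min lexx/= ler_nat nm orbT.
have cg x : (EFin (g n x) @[n --> \oo] --> (f x)%:E)%E.
  apply: cvg_EFin; first by near=> n.
  apply: cvg_near_cst; near=> n.
  rewrite /= /g min_l//; near: n; exists (`|Num.ceil (f x)|%N) => // n /= hn.
  apply: le_trans (ceil_ge (f x)) _.
  have c0 : 0 <= Num.ceil (f x) by rewrite ceil_ge0// (lt_le_trans _ (f0 x))// ltrN10.
  by rewrite -(gez0_abs c0) -pmulrn ler_nat.
have L : (\int[gamma]_x (g n x)%:E @[n --> \oo] --> \int[gamma]_x (f x)%:E)%E.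
  under [X in _ --> X]eq_integral do rewrite -(cvg_lim (@ereal_hausdorff R) (cg _)).
  apply: cvg_monotone_convergence => //.
  - by move=> n; apply/measurable_EFinP; exact: mg.
  - by move=> n x _; rewrite lee_fin.
  - by move=> x _ n m nm; rewrite lee_fin gle.
have Lp : (\int[lam]_x (g n x * gpdf s x)%:E @[n --> \oo] --> \int[lam]_x (f x * gpdf s x)%:E)%E.
  have cgp x : ((g n x * gpdf s x)%:E @[n --> \oo] --> (f x * gpdf s x)%:E)%E.
    under eq_fun do rewrite EFinM.
    by rewrite EFinM; apply: cvgeZr => //; exact: cg.
  under [X in _ --> X]eq_integral do rewrite -(cvg_lim (@ereal_hausdorff R) (cgp _)).
  apply: cvg_monotone_convergence => //.
  - move=> n; apply/measurable_EFinP; apply: measurable_funM; first exact: mg.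
    exact: measurable_gpdf.
  - by move=> n x _; rewrite lee_fin mulr_ge0// ltW// gpdf_gt0.
  - by move=> x _ n m nm; rewrite lee_fin ler_wpM2r ?gle// ltW// gpdf_gt0.
rewrite -(cvg_lim (@ereal_hausdorff R) L); apply/cvg_lim; first exact: ereal_hausdorff.
apply: cvg_trans Lp; apply: near_eq_cvg; near=> n.
by apply/esym; rewrite integral_normal_prob//; exact: (@bmf_int _ _ _ gamma _ (bg n)).
Unshelve. all: by end_near.
Qed.

(** Domination by the wider density of standard deviation 2 s: the exponents differ by 3/8 (x/s)^2,
    which outweighs |x|. This yields both the integrability of x and the decay of boundary terms. *)
Lemma gauss_first_moment x : `|x| * gpdf s x <=
  (s * normal_peak s / normal_peak (2 * s)) * gpdf (2 * s) x.
Proof.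
have p0 : 0 < normal_peak s by rewrite normal_peak_gt0 ?gt_eqF.
have s2 : 0 < 2 * s by rewrite mulr_gt0.
have p20 : 0 < normal_peak (2 * s) by rewrite normal_peak_gt0 ?gt_eqF.
rewrite !gpdfE//.
rewrite [leRHS](_ : _ = normal_peak s * (s * expR (- x ^+ 2 / ((2 * s) ^+ 2 *+ 2)))); last first.
  by field; rewrite gt_eqF.
rewrite mulrCA ler_pM2l//.
have -> : - x ^+ 2 / (s ^+ 2 *+ 2) = - x ^+ 2 / ((2 * s) ^+ 2 *+ 2) - 3 / 8 * (x / s) ^+ 2.
  by field; rewrite gt_eqF.
rewrite expRD mulrCA [leRHS]mulrC ler_pM2l ?expR_gt0//.
rewrite expRN ler_pdivrMr ?expR_gt0//.
have h := expR_ge1Dx (3 / 8 * (x / s) ^+ 2).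
rewrite -ler_pdivrMl// mulrC.
apply: le_trans h.
have -> : `|x| / s = `|x / s| by rewrite normrM normfV (gtr0_norm s0).
rewrite -(real_normK (num_real (x / s))).
have := sqr_ge0 (`|x / s| - 4 / 3); lra.
Qed.

Lemma integrable_gpdf_x : lam.-integrable setT (fun x => (x * gpdf s x)%:E).
Proof.
have mxp : measurable_fun setT (fun x : R => x * gpdf s x).
  by apply: measurable_funM => //; exact: measurable_gpdf.
set c := s * normal_peak s / normal_peak (2 * s).
apply: (@le_integrable _ _ _ lam setT measurableT _ (fun x => (c * gpdf (2 * s) x)%:E)).
- exact/measurable_EFinP.
- move=> x _ /=; rewrite lee_fin normrM (gtr0_norm (gpdf_gt0 s0 x)).
  by apply: le_trans (gauss_first_moment x) _; exact: ler_norm.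
under eq_fun do rewrite EFinM.
by apply: integrableZl => //; exact: integrable_normal_pdf.
Qed.

Lemma integrable_normal_x : gamma.-integrable setT (fun x : R => x%:E).
Proof.
apply/integrableP; split; first by apply/measurable_EFinP.
under eq_integral do rewrite abse_EFin.
rewrite ge0_integral_normal_prob//.
have /integrableP[_] := integrable_gpdf_x.
by under eq_integral do rewrite abse_EFin normrM (gtr0_norm (gpdf_gt0 s0 _)).
Qed.

(** Differentiability is encoded by a uniform second-order Taylor remainder, since this is what the
    resolvent identity provides; it also makes f' Lipschitz, hence continuous. *)
Lemma is_derive_quad (f f' : R -> R) (M x : R) :
  (forall x h, `|f (x + h) - f x - h * f' x| <= M * h ^+ 2) -> is_derive x (1 : R) f (f' x).
Proof.
move=> hf.
have M0 : 0 <= M by have := hf 0 1; rewrite expr1n mulr1; apply: le_trans.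
have C : h^-1 *: (f (h *: 1 + x) - f x) @[h --> (0 : R)^'] --> f' x.
  apply/cvgrPdist_le => e e0; near=> h.
  have h0 : h != 0 by near: h; exact: nbhs_dnbhs_neq.
  rewrite scaler1 /GRing.scale/= [h + x]addrC -normrN opprB.
  have -> : h^-1 * (f (x + h) - f x) - f' x = h^-1 * (f (x + h) - f x - h * f' x).
    by field.
  rewrite normrM normfV ler_pdivrMl ?normr_gt0//.
  apply: le_trans (hf _ _) _.
  rewrite -real_normK ?num_real// expr2 mulrCA ler_pM2l ?normr_gt0//.
  apply: (@le_trans _ _ ((M + 1) * `|h|)); first by rewrite ler_wpM2r// lerDl.
  rewrite -ler_pdivlMl ?ltr_wpDl//.
  near: h; apply: dnbhs0_le; rewrite mulr_gt0// invr_gt0 ltr_wpDl//.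
constructor; first by apply/cvg_ex; exists (f' x).
exact: cvg_lim.
Unshelve. all: by end_near.
Qed.

Lemma quad_lipschitz (f f' : R -> R) (M : R) :
  (forall x h, `|f (x + h) - f x - h * f' x| <= M * h ^+ 2) ->
  forall x y, `|f' x - f' y| <= 2 * M * `|x - y|.
Proof.
move=> hf x y; have h1 := hf x (y - x); have h2 := hf y (x - y).
rewrite (addrC x) subrK in h1; rewrite (addrC y) subrK in h2.
have [->|xy] := eqVneq x y; first by rewrite !subrr normr0 mulr0.
have d0 : 0 < `|y - x| by rewrite normr_gt0 subr_eq0 eq_sym.
have h3 : `|(y - x) * (f' x - f' y)| <= 2 * M * (y - x) ^+ 2.
  have -> : (y - x) * (f' x - f' y) = - ((f y - f x - (y - x) * f' x) + (f x - f y - (x - y) * f' y)).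
    by ring.
  rewrite normrN; apply: le_trans (ler_normD _ _) _.
  apply: le_trans (lerD h1 h2) _.
  by rewrite -(sqrrN (x - y)) opprB; lra.
by move: h3; rewrite normrM -real_normK ?num_real// expr2 mulrCA ler_pM2l// distrC (distrC x).
Qed.

Lemma is_derive_gpdf (x : R) : is_derive x (1 : R) (gpdf s) (- (x / s ^+ 2) * gpdf s x).
Proof.
have d1 := is_deriveM (is_derive_id x (1 : R)) (is_derive_id x (1 : R)).
have d2 := is_deriveZ (- (s ^+ 2 *+ 2)^-1) d1.
have d3 := is_derive1_comp (is_derive_expR _) d2.
have d4 := is_deriveZ (normal_peak s) d3.
rewrite (_ : gpdf s = normal_peak s \*: (expR \o (- (s ^+ 2 *+ 2)^-1 \*: (id * id)))); last first.
  apply/funext => y; rewrite gpdfE//= /GRing.scale/=; congr (_ * expR _).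
  by rewrite -[(id * id) y]/(y * y) expr2; field; rewrite gt_eqF.
apply: is_derive_eq d4 _; rewrite /GRing.scale/= -/(GRing.scale _ _).
rewrite -[(id * id) x]/(x * x) /GRing.scale/=; set e := expR _.
by field; rewrite gt_eqF.
Qed.

Lemma ibp_line (f f' : R -> R) (M : R) : bmf f -> bmf f' ->
  (forall x h, `|f (x + h) - f x - h * f' x| <= M * h ^+ 2) ->
  Ex gamma (fun x => x * f x) = s ^+ 2 * Ex gamma f'.
Proof.
move=> bf bf' hf.
have M0 : 0 <= M by have := hf 0 1; rewrite expr1n mulr1; apply: le_trans.
have [mf [B hB]] := bf; have [mf' [B' hB']] := bf'.
have B0 : 0 <= B by apply: le_trans (hB 0).
have s2 : s ^+ 2 != 0 by rewrite expf_neq0// gt_eqF.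
pose F x := f x * gpdf s x.
pose G x := f' x * gpdf s x - s ^- 2 * (x * f x * gpdf s x).
have dF (x : R) : is_derive x (1 : R) F (G x).
  have := is_deriveM (is_derive_quad x hf) (is_derive_gpdf x).
  by move=> h; apply: (is_derive_eq (f := F) h); rewrite /G /GRing.scale/=; field; rewrite gt_eqF.
have mxfp : measurable_fun setT (fun x : R => x * f x * gpdf s x).
  by apply: measurable_funM; [exact: measurable_funM|exact: measurable_gpdf].
have mG : measurable_fun setT G.
  apply: measurable_funB; first by apply: measurable_funM => //; exact: measurable_gpdf.
  by apply: measurable_funM => //; exact: measurable_cst.
have ixf : gamma.-integrable setT (fun x : R => (x * f x)%:E).
  apply: (@le_integrable _ _ _ gamma setT measurableT _ (fun x => (B * x)%:E)).
  - by apply/measurable_EFinP; apply: measurable_funM.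
  - move=> x _ /=; rewrite lee_fin !normrM mulrC (ger0_norm B0).
    by rewrite ler_wpM2r.
  under eq_fun do rewrite EFinM.
  by apply: integrableZl => //; exact: integrable_normal_x.
have i1 : lam.-integrable setT (fun x => (f' x * gpdf s x)%:E).
  apply: (@le_integrable _ _ _ lam setT measurableT _ (fun x => (B' * gpdf s x)%:E)).
  - by apply/measurable_EFinP; apply: measurable_funM => //; exact: measurable_gpdf.
  - move=> x _ /=; rewrite lee_fin !normrM ler_wpM2r//.
    exact: le_trans (hB' x) (ler_norm _).
  under eq_fun do rewrite EFinM.
  by apply: integrableZl => //; exact: integrable_normal_pdf.
have i2 : lam.-integrable setT (fun x => (x * f x * gpdf s x)%:E).
  apply: (@le_integrable _ _ _ lam setT measurableT _ (fun x => (B * (x * gpdf s x))%:E)).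
  - by apply/measurable_EFinP.
  - move=> x _ /=; rewrite lee_fin !normrM (ger0_norm B0) mulrAC mulrC.
    by rewrite ler_wpM2r ?mulr_ge0.
  under eq_fun do rewrite EFinM.
  by apply: integrableZl => //; exact: integrable_gpdf_x.
have iG : lam.-integrable setT (EFin \o G).
  rewrite /G (_ : _ \o _ = ((fun x => (f' x * gpdf s x)%:E) \-
     (fun x => (s ^- 2)%:E * (x * f x * gpdf s x)%:E))%E); last first.
    by apply/funext => x /=; rewrite EFinB EFinM.
  by apply: integrableB => //; exact: integrableZl.
have cG : continuous G.
  have cp : continuous (gpdf s).
    move=> x; apply: differentiable_continuous; apply/derivable1_diffP.
    by have [] := is_derive_gpdf x.
  have cf : continuous f.
    move=> x; apply: differentiable_continuous; apply/derivable1_diffP.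
    by have [] := is_derive_quad x hf.
  have cf' : continuous f'.
    move=> x; apply/cvgrPdist_le => e e0; near=> y.
    apply: le_trans (quad_lipschitz hf x y) _.
    apply: (@le_trans _ _ ((2 * M + 1) * `|x - y|)); first by rewrite ler_wpM2r// lerDl.
    rewrite -ler_pdivlMl ?ltr_wpDl ?mulr_ge0//.
    near: y; apply: cvgr_dist_le; first exact: cvg_id.
    by rewrite mulr_gt0// invr_gt0 ltr_wpDl ?mulr_ge0.
  move=> x; apply: cvgB; first by apply: cvgM; [exact: cf'|exact: cp].
  apply: cvgM; first exact: cvg_cst.
  by apply: cvgM; [apply: cvgM; [exact: cvg_id|exact: cf]|exact: cp].
have cF x : {for x, continuous F}.
  by apply: differentiable_continuous; apply/derivable1_diffP; have [] := dF x.
have FTC n : (\int[lam]_(x in `[(- n.+1%:R)%R, n.+1%:R]) (G x)%:E = (F n.+1%:R)%:E - (F (- n.+1%:R))%:E)%E.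
  apply: continuous_FTC2 => //.
  - by rewrite (lt_trans (_ : - n.+1%:R < 0))// oppr_lt0.
  - exact: continuous_subspaceT.
  - split.
    + by move=> x _; have [] := dF x.
    + by apply: cvg_at_right_filter; exact: cF.
    + by apply: cvg_at_left_filter; exact: cF.
  - by move=> x _; rewrite derive1E; have [_ ->] := dF x.
have L1 : ((\int[lam]_(x in `[(- n.+1%:R)%R, n.+1%:R]) (G x)%:E) @[n --> \oo] --> \int[lam]_x (G x)%:E)%E.
  under eq_fun do rewrite integral_mkcond.
  apply: (@dominated_cvg _ _ _ lam setT measurableT _ _ (fun x => `|(G x)%:E|%E)) => //.
  - move=> n; apply/(measurable_restrictT _ _).1 => //.
    by apply: measurable_funTS; exact/measurable_EFinP.
  - move=> x _; apply: cvg_near_cst; near=> n; rewrite patchE ifT// inE/= in_itv/=.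
    rewrite -ler_norml; near: n; exists (`|Num.ceil `|x| |%N) => // n /= hn.
    apply: le_trans (ceil_ge `|x|) _.
    have c0 : 0 <= Num.ceil `|x| by rewrite ceil_ge0// (lt_le_trans _ (normr_ge0 x))// ltrN10.
    by rewrite -(gez0_abs c0) -pmulrn ler_nat leqW.
  - exact: integrable_abse.
  - by move=> n x _; rewrite patchE; case: ifPn; rewrite ?abse0.
(* By [gauss_first_moment] the product of |x| and the density is bounded, so the boundary terms at
   distance n + 1 are of order 1/n. *)
pose K := B * (s * normal_peak s / normal_peak (2 * s) * normal_peak (2 * s)).
have Fle n x : `|x| = n.+1%:R -> `|F x| <= K * n.+1%:R^-1.
  move=> xn; rewrite -ler_pdivrMr ?invr_gt0// invrK /F normrM -mulrA.
  apply: ler_pM => //; rewrite (gtr0_norm (gpdf_gt0 s0 x)) mulrC -xn.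
  apply: le_trans (gauss_first_moment x) _; apply: ler_wpM2l.
    by rewrite divr_ge0 ?mulr_ge0 ?normal_peak_ge0// ltW.
  by apply: normal_pdf_ub; rewrite gt_eqF// mulr_gt0.
have L2 : (((F n.+1%:R)%:E - (F (- n.+1%:R))%:E)%E @[n --> \oo] --> (0 : \bar R))%E.
  under eq_fun do rewrite -EFinB.
  apply: cvg_EFin; first by near=> n.
  apply: (@norm_cvg0 R _); apply: (@squeeze_cvgr _ _ _ _ (fun=> 0) (fun n => 2 * K * harmonic n)).
  - near=> n; rewrite normr_ge0/=; apply: le_trans (ler_normB _ _) _.
    have := Fle n n.+1%:R; rewrite normr_nat => /(_ erefl) h1.
    have := Fle n (- n.+1%:R); rewrite normrN normr_nat => /(_ erefl) h2.
    apply: le_trans (lerD h1 h2) _; rewrite /harmonic/=.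
    by rewrite -[leRHS]mulrA mulr_natl mulr2n.
  - exact: cvg_cst.
  - by rewrite -[X in _ --> X](mulr0 (2 * K)); apply: cvgM; [exact: cvg_cst|exact: cvg_harmonic].
have G0 : (\int[lam]_x (G x)%:E = 0)%E.
  rewrite -(cvg_lim (@ereal_hausdorff R) L1); apply/cvg_lim; first exact: ereal_hausdorff.
  by under eq_fun do rewrite FTC.
have E1 : ((Ex gamma f')%:E = \int[lam]_x (f' x * gpdf s x)%:E)%E.
  rewrite -Ex_fine; last exact: bmf_int.
  by rewrite integral_normal_prob; [apply: eq_integral|exact: (@bmf_int _ _ _ gamma)].
have E2 : ((Ex gamma (fun x => x * f x))%:E = \int[lam]_x (x * f x * gpdf s x)%:E)%E.
  by rewrite -Ex_fine// integral_normal_prob//.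
have HG : (\int[lam]_x (G x)%:E = \int[lam]_x (f' x * gpdf s x)%:E -
    (s ^- 2)%:E * \int[lam]_x (x * f x * gpdf s x)%:E)%E.
  by rewrite -(integralZl measurableT i2) -integralB//; exact: integrableZl.
have : ((Ex gamma f')%:E - (s ^- 2)%:E * (Ex gamma (fun x => x * f x))%:E = 0)%E.
  by rewrite E1 E2 -HG.
move=> /eqP; rewrite -EFinM -EFinB eqe subr_eq0 => /eqP ->.
by rewrite mulrA divff// mul1r.
Unshelve. all: by end_near.
Qed.

End ibp_line.

Section gaussian_ibp.
Context (R : realType) (s : R) (s0 : 0 < s).
Notation gamma := (normal_prob 0 s : probability (measurableTypeR R) R).
Notation mT := (measurableTypeR R).

Definition tshift k (x : k.-tuple mT) (i : 'I_k) (h : R) : k.-tuple mT :=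
  [tuple (tco x j + (if j == i then h else 0) : mT) | j < k].

Lemma tco_tcons0 k (z : mT * k.-tuple mT) : tco (tcons z) ord0 = z.1.
Proof. by []. Qed.

Lemma tco_tconsS k (z : mT * k.-tuple mT) (j : 'I_k) : tco (tcons z) (lift ord0 j) = tco z.2 j.
Proof. by rewrite /tco tnthS. Qed.

Lemma tshift_tcons0 k (t : R) (x : k.-tuple mT) h :
  tshift (tcons (t, x)) ord0 h = tcons (t + h, x).
Proof.
apply: eq_from_tnth => i; rewrite tnth_mktuple.
by case: (unliftP ord0 i) => [j ->|->]; rewrite ?tco_tcons0 ?tco_tconsS ?addr0// /tcons tnthS.
Qed.

Lemma tshift_tconsS k (t : R) (x : k.-tuple mT) j h :
  tshift (tcons (t, x)) (lift ord0 j) h = tcons (t, tshift x j h).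
Proof.
apply: eq_from_tnth => i; rewrite tnth_mktuple.
case: (unliftP ord0 i) => [l ->|->]; last by rewrite tco_tcons0/= addr0.
by rewrite tco_tconsS /tcons tnthS tnth_mktuple (inj_eq lift_inj).
Qed.

Lemma integrable_prod1 d1 d2 (T1 : measurableType d1) (T2 : measurableType d2)
  (P1 : probability T1 R) (P2 : probability T2 R) (f : T1 -> R) :
  P1.-integrable setT (fun x => (f x)%:E) ->
  (P1 \x P2)%E.-integrable setT (fun z => (f z.1)%:E).
Proof.
move=> /integrableP[/measurable_EFinP mf fi].
apply/integrable12ltyP; first by apply/measurable_EFinP; exact: measurableT_comp.
rewrite (eq_integral (fun x => `|(f x)%:E|%E))// => x _ /=.
by rewrite integral_cst// [X in (_ * X)%E](_ : _ = 1%E) ?mule1//; exact: probability_setT.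
Qed.

Lemma integrable_prod2 d1 d2 (T1 : measurableType d1) (T2 : measurableType d2)
  (P1 : probability T1 R) (P2 : probability T2 R) (f : T2 -> R) :
  P2.-integrable setT (fun x => (f x)%:E) ->
  (P1 \x P2)%E.-integrable setT (fun z => (f z.2)%:E).
Proof.
move=> /integrableP[/measurable_EFinP mf fi].
apply/integrable12ltyP; first by apply/measurable_EFinP; exact: measurableT_comp.
rewrite (eq_integral (cst (\int[P2]_y `|(f y)%:E|)%E))//.
by rewrite integral_cst// [X in (_ * X)%E](_ : _ = 1%E) ?mule1//; exact: probability_setT.
Qed.

Lemma integrableM_bmf d (T : measurableType d) (P : probability T R) (f g : T -> R) :
  P.-integrable setT (fun x => (f x)%:E) -> bmf g ->
  P.-integrable setT (fun x => (f x * g x)%:E).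
Proof.
move=> intf [mg [M hM]]; have /integrableP[/measurable_EFinP mf _] := intf.
apply: (@le_integrable _ _ _ P setT measurableT _ (fun x => (M * f x)%:E)).
- by apply/measurable_EFinP; exact: measurable_funM.
- move=> x _ /=; rewrite lee_fin !normrM mulrC ler_wpM2r//.
  exact: le_trans (hM x) (ler_norm _).
under eq_fun do rewrite EFinM.
exact: integrableZl.
Qed.

Lemma integrable_tco k (i : 'I_k) : (gaussm s k).-integrable setT (fun x => (tco x i)%:E).
Proof.
elim: k i => [[]//|k IH] i.
apply: (integrable_pushforward (@measurable_tcons R k)) => //.
  by apply/measurable_EFinP; exact: measurable_tco.
rewrite preimage_setT; case: (unliftP ord0 i) => [j ->|->].
  rewrite (_ : _ \o _ = fun z => (tco z.2 j)%:E); last first.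
    by apply/funext => z /=; rewrite tco_tconsS.
  exact: integrable_prod2 (IH j).
rewrite (_ : _ \o _ = fun z : mT * k.-tuple mT => (z.1 : R)%:E); last first.
  by apply/funext => z /=; rewrite tco_tcons0.
by apply: (@integrable_prod1 _ _ _ _ gamma (gaussm s k) (fun x : R => x)); exact: integrable_normal_x.
Qed.

(** Fubini's theorem with the differentiated coordinate innermost: the order of integration depends
    on whether it is the head of the tuple, where [ibp_line] applies, or lies in the tail, where the
    induction hypothesis does. *)
Lemma gaussm_ibp k (i : 'I_k) (f f' : k.-tuple mT -> R) (M : R) :
  bmf f -> bmf f' ->
  (forall x h, `|f (tshift x i h) - f x - h * f' x| <= M * h ^+ 2) ->
  Ex (gaussm s k) (fun x => tco x i * f x) = s ^+ 2 * Ex (gaussm s k) f'.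
Proof.
elim: k i f f' => [[]//|k IH] i f f' bf bf' hf.
have bF := bmf_tcons bf; have bF' := bmf_tcons bf'.
have mxf : measurable_fun setT (fun x => tco x i * f x).
  by apply: measurable_funM; [exact: measurable_tco|exact: bf.1].
have iF' : (gamma \x gaussm s k)%E.-integrable setT (EFin \o (f' \o @tcons R k)) by exact: bmf_int.
rewrite (Ex_gaussmS bf'.1 iF').
case: (unliftP ord0 i) => [j ij|i0].
  have E : (fun x => tco x i * f x) \o @tcons R k =
      (fun z : mT * k.-tuple mT => tco z.2 j * (f \o @tcons R k) z).
    by apply/funext => z /=; rewrite ij tco_tconsS.
  have iE : (gamma \x gaussm s k)%E.-integrable setT
      (fun z : mT * k.-tuple mT => (tco z.2 j * (f \o @tcons R k) z)%:E).
    apply: integrableM_bmf => //.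
    exact: (@integrable_prod2 _ _ _ _ gamma (gaussm s k) (fun x => tco x j) (integrable_tco j)).
  rewrite Ex_gaussmS//; last by rewrite E.
  rewrite E Ex_prod12//; last first.
    move=> t; apply: (integrableM_bmf (integrable_tco j)); exact: (bmf_slice1 t bF).
  rewrite Ex_prod12//; last by move=> t; apply: bmf_int; exact: (bmf_slice1 t bF').
  rewrite -(ExZ gamma (s ^+ 2) (bmf_Ex2 gamma (gaussm s k) bF')).
  congr Ex; apply/funext => t; apply: IH.
  - exact: (bmf_slice1 t bF).
  - exact: (bmf_slice1 t bF').
  by move=> x h; have := hf (tcons (t, x)) h; rewrite ij tshift_tconsS.
have E : (fun x => tco x i * f x) \o @tcons R k =
    (fun z : mT * k.-tuple mT => (z.1 : R) * (f \o @tcons R k) z).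
  by apply/funext => z /=; rewrite i0 tco_tcons0.
have iE : (gamma \x gaussm s k)%E.-integrable setT
    (fun z : mT * k.-tuple mT => ((z.1 : R) * (f \o @tcons R k) z)%:E).
  apply: integrableM_bmf => //.
  exact: (@integrable_prod1 _ _ _ _ gamma (gaussm s k) (fun x : R => x) (integrable_normal_x s0)).
rewrite Ex_gaussmS//; last by rewrite E.
rewrite E Ex_prod21//; last first.
  move=> t; apply: (@integrableM_bmf _ _ gamma (fun x : R => x)).
    exact: integrable_normal_x.
  exact: (bmf_slice2 t bF).
rewrite Ex_prod21//; last by move=> t; apply: bmf_int; exact: (bmf_slice2 t bF').
rewrite -(ExZ _ (s ^+ 2) (bmf_Ex1 gamma (gaussm s k) bF')).
congr Ex; apply/funext => x; apply: (@ibp_line R s s0 (fun t => f (tcons (t, x))) (fun t => f' (tcons (t, x))) M).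
- exact: (bmf_slice2 x bF).
- exact: (bmf_slice2 x bF').
by move=> t h; have := hf (tcons (t, x)) h; rewrite i0 tshift_tcons0.
Qed.

End gaussian_ibp.

(** * Reduction to the canonical Gaussian space *)

Section gaussian_law.
Context (R : realType) (s : R).
Notation mT := (measurableTypeR R).

Definition rect k (B : 'I_k -> set R) : set (k.-tuple mT) :=
  [set x | forall i, B i (tco x i)].

Lemma gaussm_rect k (B : 'I_k -> set R) : (forall i, measurable (B i)) ->
  gaussm s k (rect B) = (\prod_(i < k) normal_prob 0 s (B i))%E.
Proof.
elim: k B => [|k IH] B mB.
  rewrite big_ord0 /= /dirac /= indicE mem_set//.
  by case.
have -> : gaussm s k.+1 (rect B) =
   (normal_prob 0 s \x gaussm s k)%E (B ord0 `*` rect (fun i => B (lift ord0 i))).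
  rewrite /= /distribution /pushforward; congr (_ _).
  apply/seteqP; split => [[t x] /= h|[t x] /= [h0 h] i].
    split; first by have := h ord0.
    by move=> i; have := h (lift ord0 i); rewrite tco_tconsS.
  case: (unliftP ord0 i) => [j ->|->]; last exact: h0.
  by rewrite tco_tconsS; exact: h.
transitivity (normal_prob 0 s (B ord0) * gaussm s k (rect (fun i => B (lift ord0 i))))%E; last first.
  by rewrite IH// big_ord_recl.
apply: product_measure1E; first exact: mB.
rewrite (_ : rect _ = \bigcap_(i in [set: 'I_k]) ((fun x => tco x i) @^-1` B (lift ord0 i))).
  apply: fin_bigcap_measurable => // i _; rewrite -[_ @^-1` _]setTI.
  exact: measurable_tco.
by apply/seteqP; split => x /= h i; [move=> _; exact: h|exact: h].
Qed.

(** Rectangles generate the product sigma-algebra and are stable under intersection, so they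
    determine a law. *)
Lemma tuple_law k d (Omega : measurableType d) (P : probability Omega R)
  (X : Omega -> k.-tuple mT) : measurable_fun setT X ->
  (forall B : 'I_k -> set R, (forall i, measurable (B i)) ->
    P (X @^-1` rect B) = (\prod_(i < k) normal_prob 0 s (B i))%E) ->
  forall C, measurable C -> P (X @^-1` C) = gaussm s k C.
Proof.
move=> mX XB C mC.
pose X' := HB.pack_for {mfun Omega >-> k.-tuple mT} X (isMeasurableFun.Build _ _ _ _ _ mX).
pose G : set (set (k.-tuple mT)) := [set rect B | B in [set B : 'I_k -> set R | forall i, measurable (B i)]].
have mrect B : (forall i, measurable (B i)) -> measurable (@rect k B).
  move=> mB; rewrite (_ : rect _ = \bigcap_(i in [set: 'I_k]) ((fun x => tco x i) @^-1` B i)).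
    apply: fin_bigcap_measurable => // i _; rewrite -[_ @^-1` _]setTI.
    exact: measurable_tco.
  by apply/seteqP; split => x /= h i; [move=> _; exact: h|exact: h].
have setTG : G setT.
  exists (fun=> setT) => //; by apply/seteqP; split.
suff : distribution P X' C = gaussm s k C by [].
apply: (@measure_unique _ _ _ G (fun=> setT)) => //.
- apply/seteqP; split.
    apply: smallest_sub; first exact: smallest_sigma_algebra.
    apply: (big_ind (fun S => S `<=` <<s G >>)).
    - exact: sub0set.
    - by move=> S S' hS hS'; rewrite subUset.
    move=> i _ _ [B mB <-].
    apply: sub_sigma_algebra; exists (fun j => if j == i then B else setT).
      by move=> j /=; case: ifP.
    rewrite setTI; apply/seteqP; split => x /=.
      by move=> /(_ i); rewrite eqxx.
    by move=> Bx j; case: eqP => // ->.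
  apply: smallest_sub; first exact: sigma_algebra_measurable.
  by move=> _ [B mB <-]; exact: mrect.
- move=> _ _ [B mB <-] [B' mB' <-]; exists (fun i => B i `&` B' i).
    by move=> i; exact: measurableI.
  by apply/seteqP; split => x /=; [move=> h; split => i; have [] := h i|move=> [h h'] i; split].
- by rewrite bigcup_const.
- by move=> _ [B mB <-]; apply: (etrans (XB B mB)); apply/esym; exact: gaussm_rect.
- by move=> _; rewrite (le_lt_trans (probability_le1 _ measurableT)) ?ltry.
Qed.

End gaussian_law.

Section matrix_law.
Context (R : realType) (n : nat).
Notation mT := (measurableTypeR R).

Definition tmx (x : (n * n).-tuple mT) : 'M[R]_n := \matrix_(i, j) tco x (mxvec_index i j).

(** Transfers events about A from an arbitrary probability space to the Gaussian measure on the n^2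
    coordinates listed by [mxvec], where property (tau) and integration by parts are available. *)
Lemma gaussian_iid_law d (Omega : measurableType d) (P : probability Omega R)
    (A : 'I_n -> 'I_n -> {RV P >-> R}) : gaussian_iid A ->
  exists X : Omega -> (n * n).-tuple mT, [/\ measurable_fun setT X,
    forall w, tmx (X w) = rmx A w &
    forall C, measurable C -> P (X @^-1` C) = gaussm (Num.sqrt n%:R^-1) (n * n) C].
Proof.
move=> [ind law].
pose X w : (n * n).-tuple mT := [tuple (mxvec (rmx A w) 0 k : mT) | k < n * n].
have XE w i j : tco (X w) (mxvec_index i j) = A i j w.
  by rewrite /tco tnth_mktuple mxvecE mxE.
have mX : measurable_fun setT X.
  apply/measurable_fun_tnthP => k; case/mxvec_indexP: k => i j.
  rewrite (_ : _ \o X = A i j); first exact: (measurable_funP (A i j)).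
  by apply/funext => w; rewrite -XE.
exists X; split => //.
  by move=> w; apply/matrixP => i j; rewrite !mxE XE.
apply: tuple_law => // B mB.
have := ind [set: 'I_n * 'I_n]%SET (fun ij => B (mxvec_index ij.1 ij.2)) (fun ij => mB _).
rewrite (_ : [set w | _] = X @^-1` rect B) => [->|]; last first.
  apply/seteqP; split => w /= h.
    by move=> k; case/mxvec_indexP: k => i j; have := h (i, j); rewrite inE XE; apply.
  by move=> [i j] _; have := h (mxvec_index i j); rewrite XE.
rewrite [RHS](reindex _ (curry_mxvec_bij n n)) /=.
rewrite (eq_bigl xpredT); last by move=> i; rewrite inE.
by apply: eq_bigr => -[i j] _ /=; exact: (law i j _ (mB _)).
Qed.

End matrix_law.

(** * Complex matrices and resolvents *)

Section finite_l2.
Context (R : realType) (I : finType).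
Implicit Types f g : I -> R.

Definition l2 f : R := Num.sqrt (\sum_i f i ^+ 2).

Lemma sumsq_ge0 f : 0 <= \sum_i f i ^+ 2.
Proof. by apply: sumr_ge0 => i _; exact: sqr_ge0. Qed.

Lemma l2_ge0 f : 0 <= l2 f. Proof. exact: sqrtr_ge0. Qed.

Lemma l2_sq f : l2 f ^+ 2 = \sum_i f i ^+ 2.
Proof. by rewrite sqr_sqrtr// sumsq_ge0. Qed.

Lemma cauchy_schwarz f g : \sum_i f i * g i <= l2 f * l2 g.
Proof.
have [f0|fn0] := eqVneq (l2 f) 0.
  have : \sum_i f i ^+ 2 = 0 by rewrite -l2_sq f0 expr0n.
  move=> /eqP; rewrite psumr_eq0 => [/allP h|i _]; last exact: sqr_ge0.
  rewrite f0 mul0r big1// => i _; have := h i (mem_index_enum _).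
  by rewrite sqrf_eq0 => /eqP ->; rewrite mul0r.
have [g0|gn0] := eqVneq (l2 g) 0.
  have : \sum_i g i ^+ 2 = 0 by rewrite -l2_sq g0 expr0n.
  move=> /eqP; rewrite psumr_eq0 => [/allP h|i _]; last exact: sqr_ge0.
  rewrite g0 mulr0 big1// => i _; have := h i (mem_index_enum _).
  by rewrite sqrf_eq0 => /eqP ->; rewrite mulr0.
have fp : 0 < l2 f by rewrite lt_def fn0 l2_ge0.
have gp : 0 < l2 g by rewrite lt_def gn0 l2_ge0.
have : 0 <= \sum_i (l2 g * f i - l2 f * g i) ^+ 2 by exact: sumsq_ge0.
have -> : \sum_i (l2 g * f i - l2 f * g i) ^+ 2 =
    2 * (l2 f * l2 g) * (l2 f * l2 g - \sum_i f i * g i).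
  transitivity (l2 g ^+ 2 * (\sum_i f i ^+ 2) + l2 f ^+ 2 * (\sum_i g i ^+ 2)
     - 2 * (l2 f * l2 g) * \sum_i f i * g i).
    rewrite !mulr_sumr -big_split -sumrB; apply: eq_bigr => i _ /=; ring.
  by rewrite -!l2_sq; ring.
by rewrite pmulr_rge0 ?mulr_gt0// subr_ge0.
Qed.

Lemma l2D f g : l2 (fun i => f i + g i) <= l2 f + l2 g.
Proof.
rewrite -(@ler_pXn2r _ 2)// ?nnegrE ?addr_ge0 ?l2_ge0//.
rewrite l2_sq sqrrD !l2_sq.
have -> : \sum_i (f i + g i) ^+ 2 = \sum_i f i ^+ 2 + (\sum_i f i * g i) *+ 2 + \sum_i g i ^+ 2.
  by rewrite -sumrMnl -!big_split; apply: eq_bigr => i _ /=; ring.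
by rewrite lerD2r lerD2l lerMn2r/= cauchy_schwarz.
Qed.

Lemma l2Z c f : l2 (fun i => c * f i) = `|c| * l2 f.
Proof.
rewrite -sqrtr_sqr -sqrtrM ?sqr_ge0//; congr Num.sqrt.
by rewrite mulr_sumr; apply: eq_bigr => i _; rewrite exprMn.
Qed.

Lemma l2B f g : l2 (fun i => f i - g i) <= l2 f + l2 g.
Proof.
have -> : l2 g = l2 (fun i => -1 * g i) by rewrite l2Z normrN1 mul1r.
apply: le_trans (l2D _ _); rewrite le_eqVlt; apply/orP; left; apply/eqP.
by congr l2; apply/funext => i; rewrite mulN1r.
Qed.

Lemma l2_le f g : (forall i, `|f i| <= `|g i|) -> l2 f <= l2 g.
Proof.
move=> fg; apply: ler_wsqrtr; apply: ler_sum => i _.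
by rewrite -real_normK ?num_real// -[leRHS]real_normK ?num_real// lerXn2r ?nnegrE.
Qed.

Lemma l2_dist f g : `|l2 f - l2 g| <= l2 (fun i => f i - g i).
Proof.
rewrite ler_norml; apply/andP; split.
  rewrite lerNl opprB lerBlDr.
  have -> : l2 (fun i => f i - g i) = l2 (fun i => -1 * (f i - g i)) by rewrite l2Z normrN1 mul1r.
  apply: le_trans (l2D _ _); rewrite le_eqVlt; apply/orP; left; apply/eqP.
  by congr l2; apply/funext => i; ring.
rewrite lerBlDr; apply: le_trans (l2D _ _); rewrite le_eqVlt; apply/orP; left; apply/eqP.
by congr l2; apply/funext => i; ring.
Qed.

End finite_l2.

Section complex_scalars.
Context (R : realType).
Implicit Types z w : R[i].

(** The modulus with values in [R], whereas the norm of [R[i]] takes values in [R[i]]. *)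
Definition nc z : R := Num.sqrt (complex.Re z ^+ 2 + complex.Im z ^+ 2).

Lemma ncE z : nc z = Normc.normc z.
Proof. by case: z. Qed.

Lemma nc_ge0 z : 0 <= nc z. Proof. exact: sqrtr_ge0. Qed.

Lemma nc_sq z : nc z ^+ 2 = complex.Re z ^+ 2 + complex.Im z ^+ 2.
Proof. by rewrite sqr_sqrtr// addr_ge0 ?sqr_ge0. Qed.

Lemma ncM z w : nc (z * w) = nc z * nc w.
Proof. by rewrite !ncE Normc.normcM. Qed.

Lemma ncD z w : nc (z + w) <= nc z + nc w.
Proof. by rewrite !ncE; exact: (@le_normcD R z w). Qed.

Lemma ncN z : nc (- z) = nc z.
Proof. by rewrite !ncE; exact: (@normcN R z). Qed.

Lemma nc0 : nc 0 = 0.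
Proof. by rewrite ncE Normc.normc0. Qed.

Lemma nc1 : nc 1 = 1.
Proof. by rewrite ncE Normc.normc1. Qed.

Lemma ncV z : nc z^-1 = (nc z)^-1.
Proof. by rewrite !ncE Normc.normcV. Qed.

Lemma nc_eq0 z : (nc z == 0) = (z == 0).
Proof.
apply/eqP/eqP => [|->]; last exact: nc0.
by rewrite ncE => /Normc.eq0_normc.
Qed.

Lemma Re_le_nc z : `|complex.Re z| <= nc z.
Proof. by rewrite -sqrtr_sqr ler_wsqrtr// lerDl sqr_ge0. Qed.

Lemma Im_le_nc z : `|complex.Im z| <= nc z.
Proof. by rewrite -sqrtr_sqr ler_wsqrtr// lerDr sqr_ge0. Qed.

Lemma nc_real (a : R) : nc a%:C = `|a|.
Proof. by rewrite /nc /= expr0n/= addr0 sqrtr_sqr. Qed.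

Lemma cReD z w : complex.Re (z + w) = complex.Re z + complex.Re w.
Proof. by case: z; case: w. Qed.
Lemma cImD z w : complex.Im (z + w) = complex.Im z + complex.Im w.
Proof. by case: z; case: w. Qed.
Lemma cReN z : complex.Re (- z) = - complex.Re z.
Proof. by case: z. Qed.
Lemma cImN z : complex.Im (- z) = - complex.Im z.
Proof. by case: z. Qed.
Lemma cReM z w : complex.Re (z * w) = complex.Re z * complex.Re w - complex.Im z * complex.Im w.
Proof. by case: z => a b; case: w. Qed.
Lemma cImM z w : complex.Im (z * w) = complex.Re z * complex.Im w + complex.Im z * complex.Re w.
Proof. by case: z => a b; case: w. Qed.
Lemma eq_complexP z w : complex.Re z = complex.Re w -> complex.Im z = complex.Im w -> z = w.
Proof. by case: z => a b; case: w => c d /= -> ->. Qed.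
Lemma Re_sum (I : Type) (r : seq I) (Q : pred I) (F : I -> R[i]) :
  complex.Re (\sum_(i <- r | Q i) F i) = \sum_(i <- r | Q i) complex.Re (F i).
Proof. by apply: (big_morph _ cReD). Qed.
Lemma Im_sum (I : Type) (r : seq I) (Q : pred I) (F : I -> R[i]) :
  complex.Im (\sum_(i <- r | Q i) F i) = \sum_(i <- r | Q i) complex.Im (F i).
Proof. by apply: (big_morph _ cImD). Qed.

Lemma nc_sum (I : Type) (r : seq I) (Q : pred I) (F : I -> R[i]) :
  nc (\sum_(i <- r | Q i) F i) <= \sum_(i <- r | Q i) nc (F i).
Proof.
elim/big_rec2: _ => [|i y x _ h]; first by rewrite nc0.
by apply: le_trans (ncD _ _) _; rewrite lerD2l.
Qed.

Lemma nc_sum_CS (I : finType) (F G : I -> R[i]) :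
  nc (\sum_i F i * G i) <= l2 (fun i => nc (F i)) * l2 (fun i => nc (G i)).
Proof.
apply: le_trans (nc_sum _ _ _) _; under eq_bigr do rewrite ncM.
exact: cauchy_schwarz.
Qed.

End complex_scalars.

Section frobenius.
Context (R : realType).

(** Unnormalised Frobenius norm. Operator norm bounds on complex matrices are stated as
    [fro (G *m Y) <= c * fro Y] for rectangular Y, which covers single columns as well as
    matrices. *)
Definition fro m n (Y : 'M[R[i]]_(m, n)) : R := l2 (fun ij : 'I_m * 'I_n => nc (Y ij.1 ij.2)).

Lemma fro_ge0 m n (Y : 'M[R[i]]_(m, n)) : 0 <= fro Y. Proof. exact: l2_ge0. Qed.

Lemma froE2 m n (Y : 'M[R[i]]_(m, n)) : fro Y ^+ 2 = \sum_i \sum_j nc (Y i j) ^+ 2.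
Proof. by rewrite l2_sq pair_big. Qed.

Lemma froT m n (Y : 'M[R[i]]_(m, n)) : fro Y^T = fro Y.
Proof.
apply: (pexpIrn (n := 2)); rewrite ?nnegrE ?fro_ge0// !froE2 exchange_big.
by apply: eq_bigr => i _; apply: eq_bigr => j _; rewrite mxE.
Qed.

Lemma froD m n (Y Z : 'M[R[i]]_(m, n)) : fro (Y + Z) <= fro Y + fro Z.
Proof.
apply: le_trans (l2D _ _); apply: l2_le => i; rewrite mxE.
by rewrite !ger0_norm ?nc_ge0 ?addr_ge0 ?nc_ge0// ncD.
Qed.

Lemma froZ m n c (Y : 'M[R[i]]_(m, n)) : fro (c *: Y) = nc c * fro Y.
Proof.
rewrite /fro -[nc c]ger0_norm ?nc_ge0// -l2Z; congr l2; apply/funext => i.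
by rewrite mxE ncM.
Qed.

Lemma froN m n (Y : 'M[R[i]]_(m, n)) : fro (- Y) = fro Y.
Proof. by rewrite -scaleN1r froZ ncN nc1 mul1r. Qed.

Lemma froB m n (Y Z : 'M[R[i]]_(m, n)) : fro (Y - Z) <= fro Y + fro Z.
Proof. by rewrite -(froN Z) froD. Qed.

Lemma nc_le_fro m n (Y : 'M[R[i]]_(m, n)) i j : nc (Y i j) <= fro Y.
Proof.
rewrite -(ler_pXn2r (n := 2)) ?nnegrE ?nc_ge0 ?fro_ge0// froE2.
rewrite (bigD1 i)//= (bigD1 j)//= -addrA lerDl addr_ge0//.
  by apply: sumr_ge0 => *; exact: sqr_ge0.
by apply: sumr_ge0 => *; apply: sumr_ge0 => *; exact: sqr_ge0.
Qed.

Lemma nc_tr_mul m n (Y : 'M[R[i]]_(m, n)) (Z : 'M[R[i]]_(n, m)) :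
  nc (\tr (Y *m Z)) <= fro Y * fro Z.
Proof.
rewrite -(froT Z) mxtrace_mulC.
have -> : \tr (Z *m Y) = \sum_(ij : 'I_m * 'I_n) Y ij.1 ij.2 * Z^T ij.1 ij.2.
  rewrite -(pair_big xpredT xpredT (fun i j => Y i j * Z^T i j))/= exchange_big.
  by apply: eq_bigr => i _; rewrite mxE; apply: eq_bigr => j _; rewrite mxE mulrC.
exact: nc_sum_CS.
Qed.

Definition fr m n (X : 'M[R]_(m, n)) : R := l2 (fun ij : 'I_m * 'I_n => X ij.1 ij.2).

Lemma fr_sq m n (X : 'M[R]_(m, n)) : fr X ^+ 2 = \tr (X^T *m X).
Proof.
rewrite l2_sq -(pair_big xpredT xpredT (fun i j => X i j ^+ 2))/= exchange_big.
by apply: eq_bigr => i _; rewrite mxE; apply: eq_bigr => j _; rewrite mxE.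
Qed.

Lemma fr_ge0 m n (X : 'M[R]_(m, n)) : 0 <= fr X. Proof. exact: l2_ge0. Qed.

Definition reM m n (Y : 'M[R[i]]_(m, n)) : 'M[R]_(m, n) := map_mx (@complex.Re R) Y.
Definition imM m n (Y : 'M[R[i]]_(m, n)) : 'M[R]_(m, n) := map_mx (@complex.Im R) Y.
Definition cM m n (X : 'M[R]_(m, n)) : 'M[R[i]]_(m, n) := map_mx (real_complex R) X.

Lemma reim_eq m n (Y Z : 'M[R[i]]_(m, n)) : reM Y = reM Z -> imM Y = imM Z -> Y = Z.
Proof.
move=> /matrixP h1 /matrixP h2; apply/matrixP => i j.
by have := h1 i j; have := h2 i j; rewrite !mxE => a b; exact: eq_complexP.
Qed.

Lemma reM_mul m n p (Y : 'M[R[i]]_(m, n)) (Z : 'M[R[i]]_(n, p)) :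
  reM (Y *m Z) = reM Y *m reM Z - imM Y *m imM Z.
Proof.
apply/matrixP => i j; rewrite !mxE Re_sum -sumrB; apply: eq_bigr => k _.
by rewrite !mxE cReM.
Qed.

Lemma imM_mul m n p (Y : 'M[R[i]]_(m, n)) (Z : 'M[R[i]]_(n, p)) :
  imM (Y *m Z) = reM Y *m imM Z + imM Y *m reM Z.
Proof.
apply/matrixP => i j; rewrite !mxE Im_sum -big_split; apply: eq_bigr => k _.
by rewrite !mxE cImM.
Qed.

Lemma fro_reim m n (Y : 'M[R[i]]_(m, n)) : fro Y ^+ 2 = fr (reM Y) ^+ 2 + fr (imM Y) ^+ 2.
Proof.
rewrite !l2_sq -big_split; apply: eq_bigr => i _ /=.
by rewrite nc_sq !mxE.
Qed.

Lemma fro_cM m n (X : 'M[R]_(m, n)) : fro (cM X) = fr X.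
Proof.
rewrite /fro /fr; congr Num.sqrt; apply: eq_bigr => i _; rewrite mxE nc_real.
by rewrite real_normK ?num_real.
Qed.

Lemma fr_eq0 m n (X : 'M[R]_(m, n)) : fr X = 0 -> X = 0.
Proof.
move=> h; have : \sum_(ij : 'I_m * 'I_n) X ij.1 ij.2 ^+ 2 = 0 by rewrite -l2_sq -/(fr X) h expr0n.
move=> /eqP; rewrite psumr_eq0 => [/allP h2|i _]; last exact: sqr_ge0.
apply/matrixP => i j; have := h2 (i, j) (mem_index_enum _).
by rewrite /= sqrf_eq0 mxE => /eqP.
Qed.

End frobenius.

(** * Resolvents of real symmetric matrices *)

Section resolvent.
Context (R : realType) (n : nat).
Implicit Types (X : 'M[R]_n) (eta : R).

Lemma fr_shift m X (P : 'M[R]_(n, m)) eta : X^T = X ->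
  fr (X *m P) ^+ 2 + eta ^+ 2 * fr P ^+ 2 = \tr (P^T *m ((eta ^+ 2)%:M + X *m X) *m P).
Proof.
move=> XT; rewrite !fr_sq trmx_mul XT mulmxDr mulmxDl mxtraceD addrC; congr (_ + _).
  by rewrite mul_mx_scalar -scalemxAl mxtraceZ.
by rewrite !mulmxA.
Qed.

Lemma shift_unit X eta : X^T = X -> 0 < eta -> (eta ^+ 2)%:M + X *m X \in unitmx.
Proof.
move=> XT eta0; set M := _ + _.
have MT : M^T = M by rewrite linearD/= trmx_mul XT tr_scalar_mx.
rewrite -row_free_unit -kermx_eq0; apply/eqP; apply: trmx_inj; rewrite trmx0.
set P := (kermx M)^T.
have MP : M *m P = 0.
  by apply: trmx_inj; rewrite trmx_mul trmxK MT mulmx_ker trmx0.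
have := fr_shift P eta XT; rewrite -/M -mulmxA MP mulmx0 mxtrace0.
move=> /eqP; rewrite paddr_eq0 ?sqr_ge0//; last by apply: mulr_ge0; exact: sqr_ge0.
move=> /andP[_]; rewrite mulf_eq0 sqrf_eq0 (gt_eqF eta0)/= sqrf_eq0 => /eqP.
exact: fr_eq0.
Qed.

Definition kmx eta X : 'M[R]_n := invmx ((eta ^+ 2)%:M + X *m X).

(** This is (X + i eta)^-1, assembled from the real matrix (eta^2 + X^2)^-1, so that its imaginary
    part is visibly - eta (eta^2 + X^2)^-1, that is - P^2 when X is [shifted] and eta is
    [btilde]. *)
Definition res eta X : 'M[R[i]]_n := cM (X *m kmx eta X) - 'i *: cM (eta *: kmx eta X).

Variables (eta : R) (eta0 : 0 < eta).

Lemma kmxV X : X^T = X -> ((eta ^+ 2)%:M + X *m X) *m kmx eta X = 1%:M.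
Proof. by move=> XT; rewrite mulmxV// shift_unit. Qed.

Lemma kmxVl X : X^T = X -> kmx eta X *m ((eta ^+ 2)%:M + X *m X) = 1%:M.
Proof. by move=> XT; rewrite mulVmx// shift_unit. Qed.

Lemma kmxC X : X^T = X -> X *m kmx eta X = kmx eta X *m X.
Proof.
move=> XT; rewrite -[LHS]mul1mx -(kmxVl XT) -mulmxA; congr (_ *m _).
have -> : ((eta ^+ 2)%:M + X *m X) *m (X *m kmx eta X) = X *m (((eta ^+ 2)%:M + X *m X) *m kmx eta X).
  by rewrite !mulmxA; congr (_ *m _); rewrite mulmxDl mulmxDr scalar_mxC mulmxA.
by rewrite kmxV// mulmx1.
Qed.

Lemma kmxT X : X^T = X -> (kmx eta X)^T = kmx eta X.
Proof. by move=> XT; rewrite /kmx trmx_inv linearD/= trmx_mul XT tr_scalar_mx. Qed.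

Lemma reM_res X : reM (res eta X) = X *m kmx eta X.
Proof.
apply/matrixP => i j; rewrite !mxE cReD cReN cReM /= ?mxE; ring.
Qed.

Lemma imM_res X : imM (res eta X) = - (eta *: kmx eta X).
Proof.
apply/matrixP => i j; rewrite !mxE cImD cImN cImM /= ?mxE; ring.
Qed.

Definition hmx X : 'M[R[i]]_n := cM X + ('i * eta%:C)%:M.

Lemma reM_hmx X : reM (hmx X) = X.
Proof.
apply/matrixP => i j; rewrite !mxE cReD /=.
by case: (i == j); rewrite ?mulr1n ?mulr0n /= ?mul0r ?mulr0 ?subr0 ?addr0.
Qed.

Lemma imM_hmx X : imM (hmx X) = eta%:M.
Proof.
apply/matrixP => i j; rewrite !mxE cImD /=.
by case: (i == j); rewrite ?mulr1n ?mulr0n /= ?mul0r ?mul1r ?add0r.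
Qed.

Lemma hmx_res X : X^T = X -> hmx X *m res eta X = 1%:M.
Proof.
move=> XT; apply: reim_eq.
  rewrite reM_mul reM_hmx imM_hmx reM_res imM_res mul_scalar_mx scalerN opprK scalerA -expr2.
  rewrite mulmxA -mul_scalar_mx -mulmxDl addrC kmxV//.
  by apply/matrixP => i j; rewrite !mxE; case: (i == j).
rewrite imM_mul reM_hmx imM_hmx reM_res imM_res mul_scalar_mx mulmxN -scalemxAr addNr.
by apply/matrixP => i j; rewrite !mxE; case: (i == j).
Qed.

Lemma res_hmx X : X^T = X -> res eta X *m hmx X = 1%:M.
Proof. by move=> XT; apply: mulmx1C; exact: hmx_res. Qed.

Lemma res_sym X : X^T = X -> (res eta X)^T = res eta X.
Proof.
move=> XT; apply/matrixP => i j; rewrite !mxE.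
have /matrixP/(_ i j) h1 := kmxT XT; rewrite mxE in h1; rewrite h1.
have : (X *m kmx eta X)^T = X *m kmx eta X by rewrite trmx_mul kmxT// XT -kmxC.
by move=> /matrixP/(_ i j); rewrite !mxE => ->.
Qed.

(** For Y = P + i Q the square of the right side is |X P - eta Q|^2 + |X Q + eta P|^2; the symmetry
    of X cancels the cross terms and leaves eta^2 |Y|^2 plus squares. *)
Lemma fro_hmx m X (Y : 'M[R[i]]_(n, m)) : X^T = X ->
  eta * fro Y <= fro (hmx X *m Y).
Proof.
move=> XT; rewrite -(ler_pXn2r (n := 2)) ?nnegrE ?mulr_ge0 ?fro_ge0 ?(ltW eta0)//.
rewrite exprMn !fro_reim reM_mul imM_mul reM_hmx imM_hmx !mul_scalar_mx.
set P := reM Y; set Q := imM Y.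
have sqB m' (U W : 'M[R]_(n, m')) : fr (U - W) ^+ 2 = fr U ^+ 2 + fr W ^+ 2 - 2 * \tr (U^T *m W).
  have UW : (U - W)^T = U^T - W^T by rewrite linearB.
  have trN (Z : 'M[R]_m') : \tr (- Z) = - \tr Z by rewrite raddfN.
  rewrite !fr_sq UW mulmxBl !mulmxBr !(mxtraceD, trN).
  have -> : \tr (W^T *m U) = \tr (U^T *m W) by rewrite -mxtrace_tr trmx_mul trmxK.
  ring.
have sqD m' (U W : 'M[R]_(n, m')) : fr (U + W) ^+ 2 = fr U ^+ 2 + fr W ^+ 2 + 2 * \tr (U^T *m W).
  have UW : (U + W)^T = U^T + W^T by rewrite linearD.
  rewrite !fr_sq UW mulmxDl !mulmxDr !mxtraceD.
  have -> : \tr (W^T *m U) = \tr (U^T *m W) by rewrite -mxtrace_tr trmx_mul trmxK.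
  ring.
have sqZ m' c (U : 'M[R]_(n, m')) : fr (c *: U) ^+ 2 = c ^+ 2 * fr U ^+ 2.
  have cU : (c *: U)^T = c *: U^T by rewrite linearZ.
  by rewrite !fr_sq cU -scalemxAl -scalemxAr !mxtraceZ mulrA.
rewrite sqB sqD !sqZ.
have -> : \tr ((X *m Q)^T *m (eta *: P)) = \tr ((X *m P)^T *m (eta *: Q)).
  rewrite -!scalemxAr !mxtraceZ !trmx_mul XT; congr (_ * _).
  by rewrite -mxtrace_tr !trmx_mul trmxK XT mulmxA.
have := sqr_ge0 (fr (X *m P)); have := sqr_ge0 (fr (X *m Q)).
set t := \tr _; move: (fr (X *m P)) (fr (X *m Q)) (fr P) (fr Q) t => a b c d t h1 h2.
by rewrite mulrDr; lra.
Qed.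

Lemma fro_resl m X (Y : 'M[R[i]]_(n, m)) : X^T = X -> fro (res eta X *m Y) <= eta^-1 * fro Y.
Proof.
move=> XT; rewrite ler_pdivlMl//; apply: le_trans (fro_hmx _ XT) _.
by rewrite mulmxA hmx_res// mul1mx.
Qed.

Lemma fro_resr m X (Y : 'M[R[i]]_(m, n)) : X^T = X -> fro (Y *m res eta X) <= eta^-1 * fro Y.
Proof. by move=> XT; rewrite -froT trmx_mul res_sym// -(froT Y) fro_resl. Qed.

Lemma resB X X' : X^T = X -> X'^T = X' ->
  res eta X' - res eta X = - (res eta X *m cM (X' - X) *m res eta X').
Proof.
move=> XT XT'.
have -> : cM (X' - X) = hmx X' - hmx X.
  by rewrite /hmx opprD addrACA subrr addr0 /cM map_mxB.
have -> : res eta X *m (hmx X' - hmx X) *m res eta X' =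
    res eta X *m (hmx X' *m res eta X') - res eta X *m hmx X *m res eta X'.
  by rewrite mulmxA -mulmxBl -mulmxBr.
rewrite (hmx_res XT') mulmx1.
rewrite (res_hmx XT) mul1mx.
by rewrite [RHS]opprB.
Qed.

(** Ward identity: the sum of all |G_ij|^2 equals - Im tr G / eta. *)
Lemma fro_res X : X^T = X -> fro (res eta X) ^+ 2 = \tr (kmx eta X).
Proof.
move=> XT; rewrite fro_reim reM_res imM_res.
have -> : fr (- (eta *: kmx eta X)) ^+ 2 = eta ^+ 2 * fr (kmx eta X) ^+ 2.
  have -> : (- (eta *: kmx eta X)) = (- eta) *: kmx eta X by rewrite scaleNr.
  have cU c (U : 'M[R]_n) : (c *: U)^T = c *: U^T by rewrite linearZ.
  by rewrite !fr_sq cU -scalemxAl -scalemxAr !mxtraceZ mulrA mulrNN -expr2.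
by rewrite fr_shift// kmxT// kmxVl// mul1mx.
Qed.

End resolvent.

(** * Schwinger-Dyson equation and variance bounds *)

Section complex_expectation.
Context d (T : measurableType d) (R : realType) (P : probability T R).
Implicit Types f g : T -> R[i].

Definition bmc f := bmf (fun x => complex.Re (f x)) /\ bmf (fun x => complex.Im (f x)).

Definition igc f := P.-integrable setT (fun x => (complex.Re (f x))%:E) /\
  P.-integrable setT (fun x => (complex.Im (f x))%:E).

Definition ExC f : R[i] := Ex P (fun x => complex.Re (f x)) +i* Ex P (fun x => complex.Im (f x)).

Lemma bmc_igc f : bmc f -> igc f.
Proof. by move=> [h1 h2]; split; exact: bmf_int. Qed.

Lemma bmc_cst c : bmc (fun=> c).
Proof. by split; exact: bmf_cst. Qed.

Lemma bmcD f g : bmc f -> bmc g -> bmc (fun x => f x + g x).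
Proof.
move=> [h1 h2] [h3 h4]; split.
  by under eq_fun do rewrite cReD; exact: bmfD.
by under eq_fun do rewrite cImD; exact: bmfD.
Qed.

Lemma bmcM f g : bmc f -> bmc g -> bmc (fun x => f x * g x).
Proof.
move=> [h1 h2] [h3 h4]; split.
  by under eq_fun do rewrite cReM; apply: bmfB; exact: bmfM.
by under eq_fun do rewrite cImM; apply: bmfD; exact: bmfM.
Qed.

Lemma bmcN f : bmc f -> bmc (fun x => - f x).
Proof.
by move=> hf; under eq_fun do rewrite -mulN1r; apply: bmcM => //; exact: bmc_cst.
Qed.

Lemma bmcB f g : bmc f -> bmc g -> bmc (fun x => f x - g x).
Proof. by move=> hf hg; apply: bmcD => //; exact: bmcN. Qed.

Lemma bmc_sum (I : Type) (r : seq I) (F : I -> T -> R[i]) :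
  (forall i, bmc (F i)) -> bmc (fun x => \sum_(i <- r) F i x).
Proof.
move=> hF; elim: r => [|i r IH].
  by under eq_fun do rewrite big_nil; exact: bmc_cst.
by under eq_fun do rewrite big_cons; exact: bmcD.
Qed.

Lemma bmf_nc2 f : bmc f -> bmf (fun x => nc (f x) ^+ 2).
Proof.
move=> [h1 h2]; under eq_fun do rewrite nc_sq.
by apply: bmfD; exact: bmfX.
Qed.

Lemma bmf_nc f : bmc f -> bmf (fun x => nc (f x)).
Proof.
move=> [[m1 [M1 h1]] [m2 [M2 h2]]]; split.
  apply: (measurableT_comp (f := @Num.sqrt R)).
    by apply: continuous_measurable_fun; exact: sqrt_continuous.
  by apply: measurable_funD; exact: measurable_funX.
exists (Num.sqrt (M1 ^+ 2 + M2 ^+ 2)) => x.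
rewrite ger0_norm ?nc_ge0// ler_wsqrtr// lerD//.
  by rewrite -real_normK ?num_real// lerXn2r ?nnegrE// (le_trans (normr_ge0 _) (h1 x)).
by rewrite -real_normK ?num_real// lerXn2r ?nnegrE// (le_trans (normr_ge0 _) (h2 x)).
Qed.

Lemma igcD f g : igc f -> igc g -> igc (fun x => f x + g x).
Proof.
move=> [h1 h2] [h3 h4]; split.
  by under eq_fun do rewrite cReD EFinD; exact: integrableD.
by under eq_fun do rewrite cImD EFinD; exact: integrableD.
Qed.

Lemma igc_sum (I : Type) (r : seq I) (F : I -> T -> R[i]) :
  (forall i, igc (F i)) -> igc (fun x => \sum_(i <- r) F i x).
Proof.
move=> hF; elim: r => [|i r IH].
  by under eq_fun do rewrite big_nil; exact/bmc_igc/bmc_cst.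
by under eq_fun do rewrite big_cons; exact: igcD.
Qed.

Lemma ExCD f g : igc f -> igc g -> ExC (fun x => f x + g x) = ExC f + ExC g.
Proof.
move=> [h1 h2] [h3 h4]; rewrite /ExC; apply: eq_complexP; rewrite ?cReD ?cImD /=.
  by under eq_fun do rewrite cReD; rewrite /Ex RintegralD.
by under eq_fun do rewrite cImD; rewrite /Ex RintegralD.
Qed.

Lemma ExC_cst c : ExC (fun=> c) = c.
Proof. by apply: eq_complexP; rewrite /= Ex_cst. Qed.

Lemma ExC_sum (I : Type) (r : seq I) (F : I -> T -> R[i]) :
  (forall i, igc (F i)) -> ExC (fun x => \sum_(i <- r) F i x) = \sum_(i <- r) ExC (F i).
Proof.
move=> hF; elim: r => [|i r IH].
  by under eq_fun do rewrite big_nil; rewrite big_nil ExC_cst.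
under eq_fun do rewrite big_cons.
by rewrite ExCD//; [rewrite big_cons IH|exact: igc_sum].
Qed.

Lemma igcZ c f : igc f -> igc (fun x => c * f x).
Proof.
move=> [h1 h2]; split.
  under eq_fun do rewrite cReM EFinB !EFinM.
  by apply: integrableB => //; exact: integrableZl.
under eq_fun do rewrite cImM EFinD !EFinM.
by apply: integrableD => //; exact: integrableZl.
Qed.

Lemma ExCZ c f : igc f -> ExC (fun x => c * f x) = c * ExC f.
Proof.
move=> [h1 h2].
have hZ (a : R) (g : T -> R) : P.-integrable setT (fun x => (g x)%:E) ->
    P.-integrable setT (EFin \o (fun x => a * g x)).
  move=> hg; rewrite (_ : _ \o _ = fun x => (a%:E * (g x)%:E)%E).
    exact: integrableZl.
  by apply/funext => x /=; rewrite EFinM.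
apply: eq_complexP; rewrite ?cReM ?cImM /ExC /=.
  under eq_fun do rewrite cReM.
  rewrite /Ex RintegralB//; [|exact: hZ|exact: hZ].
  by rewrite !RintegralZl.
under eq_fun do rewrite cImM.
rewrite /Ex RintegralD//; [|exact: hZ|exact: hZ].
by rewrite !RintegralZl.
Qed.

Lemma ExCB f g : igc f -> igc g -> ExC (fun x => f x - g x) = ExC f - ExC g.
Proof.
move=> hf hg; have hg' := igcZ (-1) hg.
rewrite -[- ExC g]mulN1r -ExCZ// -ExCD//; congr ExC; apply/funext => x.
by rewrite mulN1r.
Qed.

(** Multiplication by the conjugate of E f makes the expectation real, which reduces the claim to
    monotonicity. *)
Lemma nc_ExC f : bmc f -> nc (ExC f) <= Ex P (fun x => nc (f x)).
Proof.
move=> bf; have [bR bI] := bf; have bn := bmf_nc bf.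
have E0 : 0 <= Ex P (fun x => nc (f x)) by apply: Ex_ge0 => // x; exact: nc_ge0.
set w := ExC f.
have [->|wn0] := eqVneq (nc w) 0; first by [].
have w0 : 0 < nc w by rewrite lt_def wn0 nc_ge0.
rewrite -(ler_pM2l w0) -expr2 nc_sq -[X in _ <= X](ExZ P _ bn).
have -> : complex.Re w ^+ 2 + complex.Im w ^+ 2 =
   Ex P (fun x => complex.Re w * complex.Re (f x) + complex.Im w * complex.Im (f x)).
  by rewrite ExD ?ExZ//; exact: bmfZ.
apply: Ex_le; [by apply: bmfD; exact: bmfZ|exact: bmfZ|move=> x].
pose w' : R[i] := complex.Re w +i* (- complex.Im w).
have -> : nc w = nc w' by rewrite /nc /= sqrrN.
rewrite -ncM; apply: le_trans (Re_le_nc _); apply: le_trans (ler_norm _).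
by rewrite cReM /= mulNr opprK.
Qed.

Definition VarC f : R := Ex P (fun x => nc (f x - ExC f) ^+ 2).

Lemma VarCE f : bmc f -> VarC f =
  Ex P (fun x => (complex.Re (f x) - Ex P (fun x => complex.Re (f x))) ^+ 2) +
  Ex P (fun x => (complex.Im (f x) - Ex P (fun x => complex.Im (f x))) ^+ 2).
Proof.
move=> [h1 h2]; rewrite /VarC -ExD.
- by congr Ex; apply/funext => x; rewrite nc_sq cReD cImD cReN cImN.
- by apply/bmfX/bmfB => //; exact: bmf_cst.
- by apply/bmfX/bmfB => //; exact: bmf_cst.
Qed.

Lemma VarC_ge0 f : bmc f -> 0 <= VarC f.
Proof.
move=> bf; apply: Ex_ge0 => [|x]; last exact: sqr_ge0.
by apply/bmf_nc2/bmcB => //; exact: bmc_cst.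
Qed.

Lemma covC f g : bmc f -> bmc g ->
  nc (ExC (fun x => f x * g x) - ExC f * ExC g) <= Num.sqrt (VarC f) * Num.sqrt (VarC g).
Proof.
move=> bf bg.
have bf' : bmc (fun x => f x - ExC f) by apply: bmcB => //; exact: bmc_cst.
have bg' : bmc (fun x => g x - ExC g) by apply: bmcB => //; exact: bmc_cst.
have -> : ExC (fun x => f x * g x) - ExC f * ExC g =
    ExC (fun x => (f x - ExC f) * (g x - ExC g)).
  have h1 : igc (fun x => f x * g x) by apply/bmc_igc/bmcM.
  have h2 : igc (fun x => ExC g * f x) by exact/igcZ/bmc_igc.
  have h3 : igc (fun x => ExC f * g x) by exact/igcZ/bmc_igc.
  have h4 : igc (fun=> ExC f * ExC g) by exact/bmc_igc/bmc_cst.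
  have -> : ExC (fun x => (f x - ExC f) * (g x - ExC g)) =
    ExC (fun x => f x * g x + ExC f * ExC g + - 1 * (ExC g * f x + ExC f * g x)).
    by congr ExC; apply/funext => x; ring.
  rewrite (ExCD (igcD h1 h4) (igcZ (-1) (igcD h2 h3))) (ExCD h1 h4).
  rewrite (ExCZ _ (igcD h2 h3)) (ExCD h2 h3) (ExCZ _ (bmc_igc bf)) (ExCZ _ (bmc_igc bg)).
  by rewrite ExC_cst; ring.
apply: le_trans (nc_ExC (bmcM bf' bg')) _.
have n1 := bmf_nc bf'; have n2 := bmf_nc bg'.
rewrite -sqrtrM ?VarC_ge0// -[leLHS]ger0_norm; last first.
  by apply: Ex_ge0 => [|x]; [exact/bmf_nc/bmcM|exact: nc_ge0].
rewrite -sqrtr_sqr ler_wsqrtr//.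
have := Ex_CS P n1 n2.
by under [in X in X <= _]eq_fun do rewrite -ncM.
Qed.

End complex_expectation.

Lemma froM (R : realType) m n p (Y : 'M[R[i]]_(m, n)) (Z : 'M[R[i]]_(n, p)) :
  fro (Y *m Z) <= fro Y * fro Z.
Proof.
rewrite -(ler_pXn2r (n := 2)) ?nnegrE ?mulr_ge0 ?fro_ge0// exprMn !froE2 mulr_suml.
apply: ler_sum => i _.
rewrite [X in _ * X]exchange_big mulr_sumr; apply: ler_sum => j _.
rewrite -!(l2_sq (fun k => nc _)) -exprMn lerXn2r ?nnegrE ?nc_ge0 ?mulr_ge0 ?l2_ge0//.
by rewrite mxE nc_sum_CS.
Qed.

Lemma mxB_entry (R : realType) m p (Y Z : 'M[R[i]]_(m, p)) i j : Y i j - Z i j = (Y - Z) i j.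
Proof. by rewrite !mxE. Qed.

Lemma mxZ_entry (R : realType) m p c (Y : 'M[R[i]]_(m, p)) i j : c * Y i j = (c *: Y) i j.
Proof. by rewrite mxE. Qed.

Lemma mulmx_delta (K : pzRingType) m p q (Y : 'M[K]_(m, p)) (i : 'I_m) j (k : 'I_q) :
  (Y *m delta_mx j k) i k = Y i j.
Proof.
rewrite mxE (bigD1 j)//= big1 ?addr0; last first.
  by move=> l lj; rewrite mxE (negbTE lj) mulr0.
by rewrite mxE !eqxx mulr1.
Qed.

Lemma fro_delta (R : realType) m p (i : 'I_m) (j : 'I_p) :
  fro (delta_mx i j : 'M[R[i]]_(m, p)) = 1.
Proof.
apply: (pexpIrn (n := 2)); rewrite ?nnegrE ?fro_ge0 ?ler01// froE2 expr1n.
rewrite (bigD1 i)//= [X in _ + X]big1 ?addr0; last first.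
  by move=> k ki; rewrite big1// => l _; rewrite mxE (negbTE ki) nc0 expr0n.
rewrite (bigD1 j)//= [X in _ + X]big1 ?addr0; last first.
  by move=> l lj; rewrite mxE (negbTE lj) andbF nc0 expr0n.
by rewrite mxE !eqxx nc1 expr1n.
Qed.

(** * The resolvent as a function of the Gaussian matrix *)

Section schwinger_dyson.
Context (R : realType) (n : nat) (n0 : (0 < n)%N).
Variables (beta a eta : R) (D : 'M[R]_n).
Hypotheses (beta0 : 0 <= beta) (eta0 : 0 < eta) (DT : D^T = D).
Notation T := ((n * n).-tuple (measurableTypeR R)).
Notation s := (Num.sqrt (n%:R^-1 : R)).
Notation P := (gaussm s (n * n)).

Definition xmx (A : 'M[R]_n) : 'M[R]_n := a%:M - (2 * beta) *: sym_part A + D.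

Definition gres (x : T) : 'M[R[i]]_n := res eta (xmx (tmx x)).

Lemma s_gt0 : 0 < s.
Proof. by rewrite sqrtr_gt0 invr_gt0 ltr0n. Qed.

Lemma s_sq : s ^+ 2 = n%:R^-1.
Proof. by rewrite sqr_sqrtr// invr_ge0. Qed.

Lemma xmx_sym A : (xmx A)^T = xmx A.
Proof.
apply/matrixP => i j; have /matrixP/(_ i j) := DT; rewrite !mxE => ->.
by rewrite eq_sym [A i j + _]addrC.
Qed.

Lemma xmxB A A' : xmx A' - xmx A = - beta *: ((A' - A) + (A' - A)^T).
Proof. by apply/matrixP => i j; rewrite !mxE; field. Qed.

Lemma frT m p (X : 'M[R]_(m, p)) : fr X^T = fr X.
Proof. by rewrite -!fro_cM -[RHS]froT; congr fro; apply/matrixP => i j; rewrite !mxE. Qed.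

Lemma fr_xmxB A A' : fr (xmx A' - xmx A) <= 2 * beta * fr (A' - A).
Proof.
rewrite xmxB -fro_cM /cM map_mxZ map_mxD -!/(cM _) froZ /= nc_real normrN (ger0_norm beta0).
have -> : 2 * beta * fr (A' - A) = beta * (fr (A' - A) + fr (A' - A)^T) by rewrite frT; ring.
by rewrite ler_wpM2l//; apply: le_trans (froD _ _) _; rewrite !fro_cM.
Qed.

Lemma fr_tmx (x y : T) : fr (tmx x - tmx y) = Num.sqrt (dist2 x y).
Proof.
rewrite /fr /l2 /dist2; congr Num.sqrt.
rewrite [RHS](reindex _ (curry_mxvec_bij n n)) /=.
by apply: eq_bigr => -[i j] _; rewrite !mxE.
Qed.

Lemma gresB x y : gres y - gres x =
  - (gres x *m cM (xmx (tmx y) - xmx (tmx x)) *m gres y).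
Proof. by apply: resB => //; exact: xmx_sym. Qed.

Lemma gres_sym x i j : gres x i j = gres x j i.
Proof. by have /matrixP/(_ j i) := res_sym eta0 (xmx_sym (tmx x)); rewrite mxE. Qed.

Lemma fro_gl m (Y : 'M[R[i]]_(n, m)) x : fro (gres x *m Y) <= eta^-1 * fro Y.
Proof. by apply: fro_resl => //; exact: xmx_sym. Qed.

Lemma fro_gr m (Y : 'M[R[i]]_(m, n)) x : fro (Y *m gres x) <= eta^-1 * fro Y.
Proof. by apply: fro_resr => //; exact: xmx_sym. Qed.

Lemma fro_gresB x y : fro (gres x - gres y) <= eta^-1 ^+ 2 * (2 * beta) * Num.sqrt (dist2 x y).
Proof.
rewrite gresB froN; apply: le_trans (fro_gr _ _) _.
rewrite expr2 -2!mulrA; apply: ler_wpM2l; first by rewrite invr_ge0 ltW.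
apply: le_trans (fro_gl _ _) _; apply: ler_wpM2l; first by rewrite invr_ge0 ltW.
by rewrite fro_cM -fr_tmx; exact: fr_xmxB.
Qed.

Lemma nc_gres x i j : nc (gres x i j) <= eta^-1.
Proof.
rewrite -(mulmx_delta (gres x) i j (ord0 : 'I_1)).
apply: le_trans (nc_le_fro _ _ _) _; apply: le_trans (fro_gl _ _) _.
by rewrite fro_delta mulr1.
Qed.

Lemma bmc_gres i j : bmc (fun x => gres x i j).
Proof.
have L x y : nc (gres x i j - gres y i j) <= eta^-1 ^+ 2 * (2 * beta) * Num.sqrt (dist2 x y).
  rewrite mxB_entry; exact: le_trans (nc_le_fro _ _ _) (fro_gresB x y).
split.
  apply: (lipschitz_bmf (L := eta^-1 ^+ 2 * (2 * beta)) (M := eta^-1)) => [x y|x].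
    by apply: le_trans (L x y); rewrite -cReN -cReD; exact: Re_le_nc.
  exact: le_trans (Re_le_nc _) (nc_gres _ _ _).
apply: (lipschitz_bmf (L := eta^-1 ^+ 2 * (2 * beta)) (M := eta^-1)) => [x y|x].
  by apply: le_trans (L x y); rewrite -cImN -cImD; exact: Im_le_nc.
exact: le_trans (Im_le_nc _) (nc_gres _ _ _).
Qed.

Lemma tmx_shift (x : T) (i j : 'I_n) (h : R) :
  tmx (tshift x (mxvec_index i j) h) = tmx x + h *: delta_mx i j.
Proof.
apply/matrixP => k l; rewrite !mxE /tco tnth_mktuple; congr (_ + _).
have -> : (mxvec_index k l == mxvec_index i j) = ((k == i) && (l == j)).
  have [m Hm1 Hm2] := curry_mxvec_bij n n.
  apply/eqP/andP => [E|[/eqP -> /eqP ->]//].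
  have := Hm1 (k, l) isT; have := Hm1 (i, j) isT; rewrite /= E => -> [-> ->].
  by rewrite !eqxx.
by case: ifP => _; rewrite ?mulr1 ?mulr0.
Qed.

Definition dsym (i j : 'I_n) : 'M[R[i]]_n := cM (delta_mx i j + (delta_mx i j)^T).

Lemma gres_shift x i j h : gres (tshift x (mxvec_index i j) h) - gres x =
  (h * beta)%:C *: (gres x *m dsym i j *m gres (tshift x (mxvec_index i j) h)).
Proof.
rewrite gresB xmxB tmx_shift [tmx x + _]addrC addrK.
have -> : h *: delta_mx i j + (h *: delta_mx i j)^T = h *: (delta_mx i j + (delta_mx i j)^T) :> 'M[R]_n.
  by rewrite linearZ/= scalerDr.
rewrite scalerA {1}/cM map_mxZ -/(cM _) -/(dsym i j) -scalemxAr -scalemxAl -scaleNr.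
by congr (_ *: _); rewrite -rmorphN; congr (_%:C); ring.
Qed.

Lemma dsym_entry x i j k l :
  (gres x *m dsym i j *m gres x) k l = gres x k i * gres x j l + gres x k j * gres x i l.
Proof.
have -> : dsym i j = delta_mx i j + delta_mx j i.
  by rewrite /dsym trmx_delta /cM map_mxD !map_delta_mx.
rewrite mulmxDr mulmxDl mxE.
have H p q : (gres x *m delta_mx p q *m gres x) k l = gres x k p * gres x q l.
  rewrite -mulmxA mxE (bigD1 p)//= big1 ?addr0.
    congr (_ * _); rewrite mxE (bigD1 q)//= big1 ?addr0; first by rewrite mxE !eqxx mul1r.
    by move=> r rq; rewrite mxE (negbTE rq) andbF mul0r.
  move=> r rp; rewrite [X in _ * X]mxE big1 ?mulr0// => q' _.
  by rewrite mxE (negbTE rp) mul0r.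
by rewrite !H.
Qed.

Lemma fro_dsym i j : fro (dsym i j) <= 2.
Proof.
have -> : dsym i j = delta_mx i j + delta_mx j i.
  by rewrite /dsym trmx_delta /cM map_mxD !map_delta_mx.
by apply: le_trans (froD _ _) _; rewrite !fro_delta.
Qed.

Lemma gres_taylor x i j h :
  fro (gres (tshift x (mxvec_index i j) h) - gres x -
       (h * beta)%:C *: (gres x *m dsym i j *m gres x)) <=
  4 * beta ^+ 2 * eta^-1 ^+ 3 * h ^+ 2.
Proof.
set y := tshift _ _ _.
have e0 : 0 <= eta^-1 by rewrite invr_ge0 ltW.
rewrite gres_shift -/y -scalerBr -mulmxBr gres_shift -/y -scalemxAr scalerA froZ.
rewrite -rmorphM nc_real.
have -> : `|h * beta * (h * beta)| = beta ^+ 2 * h ^+ 2.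
  rewrite -expr2 exprMn mulrC ger0_norm// mulr_ge0//; exact: sqr_ge0.
have -> : 4 * beta ^+ 2 * eta^-1 ^+ 3 * h ^+ 2 = (beta ^+ 2 * h ^+ 2) * (4 * eta^-1 ^+ 3) by ring.
apply: ler_wpM2l; first by rewrite mulr_ge0 ?sqr_ge0.
apply: le_trans (_ : eta^-1 * (2 * (eta^-1 * (eta^-1 * 2))) <= _); last first.
  by rewrite le_eqVlt; apply/orP; left; apply/eqP; ring.
have dmul p (Y : 'M[R[i]]_(n, p)) : fro (dsym i j *m Y) <= 2 * fro Y.
  by apply: le_trans (froM _ _) _; apply: ler_wpM2r; [exact: fro_ge0|exact: fro_dsym].
have le1 : fro (dsym i j *m gres y) <= eta^-1 * 2.
  by apply: le_trans (fro_gr _ _) _; apply: (ler_wpM2l e0); exact: fro_dsym.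
have le2 : fro (gres x *m (dsym i j *m gres y)) <= eta^-1 * (eta^-1 * 2).
  by apply: le_trans (fro_gl _ _) _; exact: (ler_wpM2l e0).
rewrite -!mulmxA; apply: le_trans (fro_gl _ _) _; apply: (ler_wpM2l e0).
by apply: le_trans (dmul _ _) _; apply: ler_wpM2l.
Qed.

(** Integration by parts in the single entry A_ij. Since A enters [xmx] through - beta (A + A^T),
    the derivative of G is beta G (E_ij + E_ji) G, which accounts for the sign and for the two
    products. *)
Lemma ibp_gres i j k l :
  ExC P (fun x => (tco x (mxvec_index i j))%:C * gres x k l) =
  (n%:R^-1 * beta)%:C * ExC P (fun x => gres x k i * gres x j l + gres x k j * gres x i l).
Proof.
pose f' x := beta%:C * (gres x k i * gres x j l + gres x k j * gres x i l).
have bs : bmc (fun x => gres x k i * gres x j l + gres x k j * gres x i l).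
  by apply: bmcD; apply: bmcM; exact: bmc_gres.
have bf' : bmc f' by apply: bmcM => //; exact: bmc_cst.
have tay x h : nc (gres (tshift x (mxvec_index i j) h) k l - gres x k l - h%:C * f' x) <=
    4 * beta ^+ 2 * eta^-1 ^+ 3 * h ^+ 2.
  apply: le_trans (gres_taylor x i j h).
  apply: le_trans (nc_le_fro _ k l); rewrite le_eqVlt; apply/orP; left; apply/eqP; congr nc.
  by rewrite /f' -dsym_entry mulrA -rmorphM mxZ_entry !mxB_entry.
have E : ExC P (fun x => (tco x (mxvec_index i j))%:C * gres x k l) = (n%:R^-1)%:C * ExC P f'.
  have ibp g g' : bmf g -> bmf g' ->
      (forall x h, `|g (tshift x (mxvec_index i j) h) - g x - h * g' x| <=
        4 * beta ^+ 2 * eta^-1 ^+ 3 * h ^+ 2) ->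
      Ex P (fun x => tco x (mxvec_index i j) * g x) = n%:R^-1 * Ex P g'.
    by move=> bg bg' hg; rewrite (gaussm_ibp s_gt0 bg bg' hg) s_sq.
  have [bR bI] := bmc_gres k l; have [bR' bI'] := bf'.
  rewrite /ExC; apply: eq_complexP => /=.
    rewrite mul0r subr0 -(ibp _ _ bR bR').
      by congr Ex; apply/funext => x; rewrite cReM /= mul0r subr0.
    move=> x h; apply: le_trans (tay x h); apply: le_trans (Re_le_nc _).
    by rewrite !(cReD, cReN) [complex.Re (h%:C * _)]cReM /= mul0r subr0.
  rewrite mul0r addr0 -(ibp _ _ bI bI').
    by congr Ex; apply/funext => x; rewrite cImM /= mul0r addr0.
  move=> x h; apply: le_trans (tay x h); apply: le_trans (Im_le_nc _).
  by rewrite !(cImD, cImN) [complex.Im (h%:C * _)]cImM /= mul0r addr0.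
rewrite E ExCZ; last exact: bmc_igc.
by rewrite mulrA -rmorphM.
Qed.

#[local] Opaque gres.

Definition gtr x : R[i] := (n%:R^-1)%:C * \sum_i gres x i i.

Definition gtr2 x i : R[i] := \sum_k gres x i k * gres x k i.

Let e0 : 0 <= eta^-1. Proof. by rewrite invr_ge0 ltW. Qed.

Lemma bmc_gtr : bmc gtr.
Proof. by apply: bmcM; [exact: bmc_cst|apply: bmc_sum => i; exact: bmc_gres]. Qed.

Lemma bmc_gtr2 i : bmc (fun x => gtr2 x i).
Proof. by apply: bmc_sum => k; apply: bmcM; exact: bmc_gres. Qed.

Lemma gres_eq x i : is_diag_mx D ->
  (a +i* eta + (D i i)%:C) * gres x i i -
    beta%:C * \sum_k ((tco x (mxvec_index i k))%:C * gres x k i +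
                      (tco x (mxvec_index k i))%:C * gres x k i) = 1.
Proof.
move=> /is_diag_mxP Dd.
have E1 : (hmx eta (xmx (tmx x)) *m gres x) i i = 1.
  by rewrite (hmx_res eta0 (xmx_sym (tmx x))) mxE eqxx.
rewrite -[RHS]E1 [RHS]mxE.
have E k : hmx eta (xmx (tmx x)) i k =
    (k == i)%:R * (a +i* eta + (D i i)%:C) -
    beta%:C * ((tco x (mxvec_index i k))%:C + (tco x (mxvec_index k i))%:C).
  have DE : D i k = (k == i)%:R * D i i.
    by case: eqVneq => [->|ki]; rewrite ?mul1r// mul0r Dd// eq_sym.
  by rewrite !mxE DE [i == k]eq_sym; case: (k == i); apply: eq_complexP; rewrite /= ?mulr0n ?mulr1n; field.
under [RHS]eq_bigr do rewrite E mulrBl.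
rewrite [RHS]big_split sumrN; congr (_ - _).
  rewrite (bigD1 i)//= big1 ?addr0; first by rewrite eqxx mul1r.
  by move=> k ki; rewrite (negbTE ki) !mul0r.
by rewrite mulr_sumr; apply: eq_bigr => k _; rewrite -mulrA mulrDl.
Qed.

Lemma gres_tcoM_igc i j k l : igc P (fun x => (tco x (mxvec_index i j))%:C * gres x k l).
Proof.
have [bR bI] := bmc_gres k l; have ti := integrable_tco s_gt0 (mxvec_index i j); split.
  rewrite (_ : (fun _ => _) = fun x => (tco x (mxvec_index i j) * complex.Re (gres x k l))%:E); last first.
    by apply/funext => x; rewrite cReM /= mul0r subr0.
  exact: integrableM_bmf.
rewrite (_ : (fun _ => _) = fun x => (tco x (mxvec_index i j) * complex.Im (gres x k l))%:E); last first.
  by apply/funext => x; rewrite cImM /= mul0r addr0.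
exact: integrableM_bmf.
Qed.

(** Expectation of the diagonal entry of (X + i eta) G = 1, with the Gaussian entries removed by
    integration by parts. The products G_kk G_ii sum to the trace; the products G_ki^2, due to the
    symmetrisation of A, sum to [gtr2], the diagonal of G^2, and carry an additional 1/n. *)
Lemma schwinger_dyson i : is_diag_mx D ->
  (a +i* eta + (D i i)%:C) * ExC P (fun x => gres x i i) =
  1 + (2 * beta ^+ 2)%:C * ExC P (fun x => gtr x * gres x i i) +
  (2 * beta ^+ 2 * n%:R^-1)%:C * ExC P (fun x => gtr2 x i).
Proof.
move=> Dd.
pose F k x := (tco x (mxvec_index i k))%:C * gres x k i + (tco x (mxvec_index k i))%:C * gres x k i.
have iF k : igc P (F k) by apply: igcD; exact: gres_tcoM_igc.
have iS : igc P (fun x => \sum_k F k x) by exact: igc_sum.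
have ig : igc P (fun x => gres x i i) by apply: bmc_igc; exact: bmc_gres.
pose H k := ExC P (fun x => gres x k k * gres x i i + gres x k i * gres x k i).
have b1 k : bmc (fun x => gres x k k * gres x i i) by apply: bmcM; exact: bmc_gres.
have b2 k : bmc (fun x => gres x k i * gres x k i) by apply: bmcM; exact: bmc_gres.
have EF k : ExC P (F k) = (n%:R^-1 * (2 * beta))%:C * H k.
  rewrite ExCD; [|exact: gres_tcoM_igc|exact: gres_tcoM_igc].
  rewrite !ibp_gres -mulrDr.
  have -> : (fun x => gres x k i * gres x k i + gres x k k * gres x i i) =
            (fun x => gres x k k * gres x i i + gres x k i * gres x k i).
    by apply/funext => x; rewrite addrC.
  rewrite -/(H k) (_ : H k + H k = 2%:C * H k); last first.
    by rewrite rmorph_nat mulr_natl mulr2n.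
  by rewrite mulrA -rmorphM; congr (_%:C * _); ring.
have : ExC P (fun x => (a +i* eta + (D i i)%:C) * gres x i i - beta%:C * \sum_k F k x) = 1.
  by rewrite -[RHS](ExC_cst P); congr ExC; apply/funext => x; exact: gres_eq.
rewrite ExCB; [|exact: igcZ|exact: igcZ].
rewrite ExCZ// ExCZ// => /eqP; rewrite subr_eq => /eqP ->.
rewrite -addrA; congr (1 + _).
rewrite ExC_sum//; under eq_bigr do rewrite EF.
rewrite -mulr_sumr.
have -> : \sum_k H k = n%:R%:C * ExC P (fun x => gtr x * gres x i i) + ExC P (fun x => gtr2 x i).
  rewrite -ExC_sum; last by move=> k; exact/bmc_igc/bmcD.
  rewrite -ExCZ; last by apply/bmc_igc/bmcM; [exact: bmc_gtr|exact: bmc_gres].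
  rewrite -ExCD; [|apply/igcZ/bmc_igc/bmcM; [exact: bmc_gtr|exact: bmc_gres]
                  |exact/bmc_igc/bmc_gtr2].
  congr ExC; apply/funext => x; rewrite big_split /= /gtr /gtr2 !mulrA -rmorphM.
  rewrite mulfV ?pnatr_eq0 -?lt0n// mul1r mulr_suml; congr (_ + _).
  by apply: eq_bigr => k _; rewrite (gres_sym x i k).
rewrite mulrDr mulrDr !mulrA -!rmorphM.
have nn : n%:R != 0 :> R by rewrite pnatr_eq0 -lt0n.
by congr (_%:C * _ + _%:C * _); field.
Qed.

Lemma gaussm_poincareC (f : T -> R[i]) (Gam : T -> R) (M : R) : bmc f -> bmf Gam -> 0 <= M ->
  (forall x, 0 <= Gam x) ->
  (forall x y, nc (f x - f y) <= Num.sqrt (Gam x) * Num.sqrt (dist2 x y) + M * dist2 x y) ->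
  VarC P f <= 16 * n%:R^-1 * Ex P Gam.
Proof.
move=> bf bG M0 G0 hf; have [bR bI] := bf; rewrite VarCE//.
have -> : 16 * n%:R^-1 * Ex P Gam = 8 * s ^+ 2 * Ex P Gam + 8 * s ^+ 2 * Ex P Gam.
  by rewrite s_sq; ring.
apply: lerD; apply: (gaussm_poincare s_gt0 _ bG M0 G0) => // x y; apply: le_trans (hf x y);
  apply: le_trans (ler_norm _) _.
  by rewrite -cReN -cReD; exact: Re_le_nc.
by rewrite -cImN -cImD; exact: Im_le_nc.
Qed.

Lemma var_gres i j : VarC P (fun x => gres x i j) <= 64 * beta ^+ 2 * n%:R^-1 * eta^-1 ^+ 4.
Proof.
pose L := eta^-1 ^+ 2 * (2 * beta).
have L0 : 0 <= L by apply: mulr_ge0; [exact: exprn_ge0|exact: mulr_ge0].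
have H : VarC P (fun x => gres x i j) <= 16 * n%:R^-1 * Ex P (fun=> L ^+ 2).
  apply: (@gaussm_poincareC _ (fun=> L ^+ 2) 0 (bmc_gres i j)) => //.
  - exact: bmf_cst.
  - by move=> _; exact: sqr_ge0.
  move=> x y; rewrite mul0r addr0 sqrtr_sqr ger0_norm// mxB_entry.
  exact: le_trans (nc_le_fro _ _ _) (fro_gresB x y).
apply: le_trans H _; rewrite Ex_cst /L le_eqVlt; apply/orP; left; apply/eqP; ring.
Qed.

Definition vtr x : R := - complex.Im (gtr x).

Lemma fro_gres x : fro (gres x) ^+ 2 = n%:R * vtr x * eta^-1.
Proof.
have nn : n%:R != 0 :> R by rewrite pnatr_eq0 -lt0n.
rewrite fro_res; [|by []|exact: xmx_sym].
rewrite /vtr /gtr cImM /= mul0r addr0 Im_sum.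
have -> : \sum_i complex.Im (gres x i i) = \tr (imM (gres x)).
  by apply: eq_bigr => i _; rewrite [RHS]mxE.
have -> : \tr (imM (gres x)) = - (eta * \tr (kmx eta (xmx (tmx x)))).
  by rewrite [imM _]imM_res raddfN /= mxtraceZ.
by field; rewrite nn gt_eqF.
Qed.

Lemma vtr_ge0 x : 0 <= vtr x.
Proof.
have n0' : 0 < n%:R :> R by rewrite ltr0n.
have := sqr_ge0 (fro (gres x)); rewrite fro_gres pmulr_lge0 ?invr_gt0//.
by rewrite pmulr_rge0.
Qed.

Lemma nc_gtr x : nc (gtr x) <= eta^-1.
Proof.
rewrite /gtr ncM nc_real ger0_norm ?invr_ge0// ler_pdivrMl ?ltr0n//.
apply: le_trans (nc_sum _ _ _) _; apply: le_trans (ler_sum _ (fun i _ => nc_gres x i i)) _.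
by rewrite sumr_const card_ord mulr_natl.
Qed.

(** The gradient of the normalised trace is governed by G^2 / n, whose Frobenius norm the Ward
    identity bounds through v = - Im tr_n G. Hence the variance is of order n^-2 and proportional to
    E v; the second gain matters outside the spectrum, where v is as small as eta. *)
Lemma var_gtr : VarC P gtr <= 64 * beta ^+ 2 * n%:R^-1 ^+ 2 * eta^-1 ^+ 3 * Ex P vtr.
Proof.
have nn : n%:R != 0 :> R by rewrite pnatr_eq0 -lt0n.
have ni : 0 <= n%:R^-1 :> R by rewrite invr_ge0.
have bv : bmf vtr by apply: bmfN; have [] := bmc_gtr.
pose c := 4 * beta ^+ 2 * n%:R^-1 * eta^-1 ^+ 3.
have c0 : 0 <= c by rewrite /c; do !apply: mulr_ge0 => //; rewrite ?sqr_ge0// exprn_ge0.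
apply: le_trans (gaussm_poincareC bmc_gtr (bmfZ c bv)
  (M := n%:R^-1 * (4 * beta ^+ 2 * eta^-1 ^+ 3)) _ _ _) _.
- by do !apply: mulr_ge0 => //; rewrite ?sqr_ge0// exprn_ge0.
- by move=> x; apply: mulr_ge0 => //; exact: vtr_ge0.
- move=> x y.
  set Y := cM (xmx (tmx x) - xmx (tmx y)).
  have fY : fro Y <= 2 * beta * Num.sqrt (dist2 x y).
    by rewrite fro_cM -fr_tmx; exact: fr_xmxB.
  have fY0 := fro_ge0 Y.
  (* The increment is written with the resolvent at x alone plus a correction quadratic in the
     distance, so that the gradient [c * vtr x] is evaluated at x. *)
  have -> : gtr x - gtr y = - (n%:R^-1)%:C *
      (\tr (Y *m (gres x *m gres x)) + \tr (Y *m (gres x *m (gres y - gres x)))).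
    rewrite /gtr -mulrBr mulNr -mulrN; congr (_ * _).
    have -> : \sum_i gres x i i - \sum_i gres y i i = \tr (gres x - gres y).
      by rewrite linearB.
    have EB : gres x - gres y = - (gres y *m Y *m gres x) by exact: gresB.
    rewrite [in LHS]EB raddfN /=; congr (- _).
    rewrite -mulmxA mxtrace_mulC -mulmxA -mxtraceD -!mulmxDr.
    by rewrite [gres x + _]addrC subrK.
  rewrite ncM ncN nc_real ger0_norm//.
  have -> : Num.sqrt (c * vtr x) = n%:R^-1 * (2 * beta * (eta^-1 * fro (gres x))).
    rewrite -[RHS]ger0_norm; last first.
      by do !apply: mulr_ge0 => //; exact: fro_ge0.
    rewrite -sqrtr_sqr; congr Num.sqrt; rewrite !exprMn fro_gres /c; field.
    by rewrite nn gt_eqF.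
  have -> d : n%:R^-1 * (2 * beta * (eta^-1 * fro (gres x))) * Num.sqrt d =
     n%:R^-1 * (2 * beta * Num.sqrt d * (eta^-1 * fro (gres x))) by ring.
  have -> : n%:R^-1 * (4 * beta ^+ 2 * eta^-1 ^+ 3) * dist2 x y =
     n%:R^-1 * ((2 * beta * Num.sqrt (dist2 x y)) * (eta^-1 * (eta^-1 ^+ 2 * (2 * beta) * Num.sqrt (dist2 y x)))).
    rewrite (dist2C y x) -{1}[dist2 x y](sqr_sqrtr (dist2_ge0 x y)); ring.
  rewrite -mulrDr; apply: ler_wpM2l => //; apply: le_trans (ncD _ _) _; apply: lerD.
    apply: le_trans (nc_tr_mul _ _) _; apply: ler_pM => //; first exact: fro_ge0.
    exact: fro_gl.
  apply: le_trans (nc_tr_mul _ _) _; apply: ler_pM => //; first exact: fro_ge0.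
  by apply: le_trans (fro_gl _ _) _; apply: ler_wpM2l => //; exact: fro_gresB.
by rewrite ExZ// /c le_eqVlt; apply/orP; left; apply/eqP; ring.
Qed.

Lemma nc_gtr2 x i : nc (gtr2 x i) <= eta^-1 ^+ 2.
Proof.
have -> : gtr2 x i = (gres x *m (gres x *m delta_mx i (ord0 : 'I_1))) i ord0.
  by rewrite mulmxA mulmx_delta mxE.
apply: le_trans (nc_le_fro _ _ _) _; apply: le_trans (fro_gl _ _) _; rewrite expr2.
by apply: ler_wpM2l => //; apply: le_trans (fro_gl _ _) _; rewrite fro_delta mulr1.
Qed.

Lemma sum_gtr2 x : nc (\sum_i gtr2 x i) <= n%:R * vtr x * eta^-1.
Proof.
rewrite -fro_gres froE2; apply: le_trans (nc_sum _ _ _) _; apply: ler_sum => i _.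
apply: le_trans (nc_sum _ _ _) _; apply: ler_sum => k _.
by rewrite (gres_sym x k i) ncM expr2.
Qed.

End schwinger_dyson.

(** * The diagonal matrix D and z~ *)

Ltac nonneg := solve [repeat first [assumption | exact: sqr_ge0 | exact: ler0n | exact: ler01
  | apply: ltW; assumption | exact: nc_ge0 | exact: fro_ge0 | exact: normr_ge0 | exact: sqrtr_ge0
  | apply: exprn_ge0 | apply: mulr_ge0 | apply: addr_ge0 | rewrite invr_ge0]].

Ltac posit := solve [repeat first [assumption | exact: ltr01 | by rewrite ltr0n
  | apply: exprn_gt0 | apply: mulr_gt0 | apply: addr_gt0 | rewrite invr_gt0]].

Section diagonal_matrices.
Context (F : fieldType) (n : nat).
Implicit Types X : 'M[F]_n.

Lemma diag_mxE X : is_diag_mx X -> X = diag_mx (\row_i X i i).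
Proof.
move=> /is_diag_mxP Xd; apply/matrixP => i j; rewrite !mxE; case: eqVneq => [->|ij].
  by rewrite mulr1n.
by rewrite mulr0n Xd.
Qed.

Lemma diag_unit_neq0 X i : is_diag_mx X -> X \in unitmx -> X i i != 0.
Proof.
move=> Xd Xu; have /is_diag_mxP Xd' := Xd; have /matrixP/(_ i i) := mulmxV Xu.
rewrite !mxE eqxx (bigD1 i)//= big1 ?addr0; last first.
  by move=> k ki; rewrite Xd' ?mul0r// eq_sym.
by apply: contra_eqN => /eqP ->; rewrite mul0r eq_sym oner_eq0.
Qed.

Lemma diag_inv X : is_diag_mx X -> (forall i, X i i != 0) ->
  X \in unitmx /\ invmx X = diag_mx (\row_i (X i i)^-1).
Proof.
move=> Xd X0; set Y := diag_mx _.
have XY : X *m Y = 1%:M.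
  rewrite (diag_mxE Xd) mulmx_diag; apply/matrixP => i j; rewrite !mxE.
  by rewrite mulfV.
have [Xu _] := mulmx1_unit XY; split=> //.
by rewrite -[LHS]mulmx1 -XY mulmxA mulVmx// mul1mx.
Qed.

Lemma diag_exp (v : 'rV[F]_n) k : diag_mx v ^+ k = diag_mx (\row_i v 0 i ^+ k).
Proof.
elim: k => [|k IH].
  by apply/matrixP => i j; rewrite !mxE expr0.
rewrite exprS IH [LHS]mulmx_diag; congr diag_mx; apply/rowP => i.
by rewrite !mxE exprS.
Qed.

Lemma ntr_diag (v : 'rV[F]_n) : ntr (diag_mx v) = n%:R^-1 * \sum_i v 0 i.
Proof. by rewrite /ntr mxtrace_diag. Qed.

End diagonal_matrices.

Section averages.
Context (R : realType) (n : nat) (n0 : (0 < n)%N).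
Implicit Types f g : 'I_n -> R.

Definition mean f : R := n%:R^-1 * \sum_i f i.

Lemma meanD f g : mean (fun i => f i + g i) = mean f + mean g.
Proof. by rewrite /mean big_split mulrDr. Qed.

Lemma meanZ c f : mean (fun i => c * f i) = c * mean f.
Proof. by rewrite /mean -mulr_sumr mulrCA. Qed.

Lemma meanN f : mean (fun i => - f i) = - mean f.
Proof. by rewrite /mean sumrN mulrN. Qed.

Lemma meanB f g : mean (fun i => f i - g i) = mean f - mean g.
Proof. by rewrite meanD meanN. Qed.

Lemma mean_cst c : mean (fun=> c) = c.
Proof.
by rewrite /mean sumr_const card_ord -[c *+ n]mulr_natl mulKf// pnatr_eq0 -lt0n.
Qed.

Lemma mean_le f g : (forall i, f i <= g i) -> mean f <= mean g.
Proof. by move=> fg; rewrite ler_wpM2l ?invr_ge0// ler_sum. Qed.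

Lemma mean_ge0 f : (forall i, 0 <= f i) -> 0 <= mean f.
Proof. by move=> f0; rewrite mulr_ge0 ?invr_ge0// sumr_ge0. Qed.

Lemma mean_CS f g : mean (fun i => f i * g i) ^+ 2 <=
  mean (fun i => f i ^+ 2) * mean (fun i => g i ^+ 2).
Proof.
have h : `|\sum_i f i * g i| <= l2 f * l2 g.
  rewrite ler_norml lerNl; apply/andP; split; last exact: cauchy_schwarz.
  have := cauchy_schwarz (fun i => -1 * f i) g.
  rewrite l2Z normrN1 mul1r; apply: le_trans; rewrite le_eqVlt; apply/orP; left; apply/eqP.
  by rewrite -sumrN; apply: eq_bigr => i _; ring.
rewrite /mean mulrACA exprMn expr2; apply: ler_wpM2l; first by rewrite mulr_ge0 ?invr_ge0.
rewrite -!l2_sq -exprMn -real_normK ?num_real// lerXn2r ?nnegrE// mulr_ge0//; exact: l2_ge0.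
Qed.

End averages.

Section deterministic.
Context (R : realType) (n : nat) (n0 : (0 < n)%N).
Variables (beta b : R) (D : 'M[R]_n).
Hypotheses (beta1 : 1 <= beta) (b0 : 0 < b) (bb : b <= beta) (aD : admissible beta D).

Let d i := D i i.

Let Dd : is_diag_mx D. Proof. by have [] := aD. Qed.

Let beta0 : 0 < beta. Proof. exact: lt_le_trans ltr01 beta1. Qed.

Lemma adm_gt0 i : 0 < D i i.
Proof. by have [_ h u _] := aD; rewrite lt_def diag_unit_neq0// h. Qed.

Let d0 i : 0 < d i. Proof. exact: adm_gt0. Qed.

Lemma ntr_inv k : ntr (invmx D ^+ k) = mean (fun i => (d i)^-1 ^+ k).
Proof.
have [_ ->] := diag_inv Dd (fun i => lt0r_neq0 (d0 i)).
rewrite diag_exp ntr_diag; congr (_ * _); apply: eq_bigr => i _.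
by rewrite !mxE.
Qed.

Lemma mean_inv2 : 2 * beta ^+ 2 * mean (fun i => (d i)^-1 ^+ 2) = 1.
Proof. by have [_ _ _] := aD; rewrite ntr_inv. Qed.

Lemma mean_inv2E : mean (fun i => (d i)^-1 ^+ 2) = (2 * beta ^+ 2)^-1.
Proof.
have h : 2 * beta ^+ 2 != 0 by rewrite mulf_neq0 ?expf_neq0 ?pnatr_eq0 ?gt_eqF.
by apply: (mulfI h); rewrite mean_inv2 mulfV.
Qed.

Lemma ntr_diag_resolvent : ntr (diag_resolvent b D) = mean (fun i => b / (b ^+ 2 + d i ^+ 2)).
Proof.
rewrite /ntr; congr (_ * _); apply: eq_bigr => i _.
have E : (b ^+ 2)%:M + D ^+ 2 = diag_mx (\row_i (b ^+ 2 + d i ^+ 2)).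
  rewrite (diag_mxE Dd) diag_exp; apply/matrixP => k l; rewrite !mxE.
  by rewrite -mulrnDl.
have p k : b ^+ 2 + d k ^+ 2 != 0 by rewrite gt_eqF// ltr_wpDr ?sqr_ge0// exprn_gt0.
rewrite /diag_resolvent E; set X := diag_mx _.
have Xd : is_diag_mx X by exact: diag_mx_is_diag.
have Xn k : X k k != 0 by rewrite !mxE eqxx mulr1n p.
by have [_ ->] := diag_inv Xd Xn; rewrite !mxE eqxx !mulr1n.
Qed.

Lemma diag_resolvent_entry i j :
  diag_resolvent b D i j = (i == j)%:R * (b / (b ^+ 2 + d i ^+ 2)).
Proof.
have E : (b ^+ 2)%:M + D ^+ 2 = diag_mx (\row_i (b ^+ 2 + d i ^+ 2)).
  rewrite (diag_mxE Dd) diag_exp; apply/matrixP => k l; rewrite !mxE.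
  by rewrite -mulrnDl.
have p k : b ^+ 2 + d k ^+ 2 != 0 by rewrite gt_eqF// ltr_wpDr ?sqr_ge0// exprn_gt0.
rewrite /diag_resolvent E; set X := diag_mx _.
have Xd : is_diag_mx X by exact: diag_mx_is_diag.
have Xn k : X k k != 0 by rewrite !mxE eqxx mulr1n p.
have [_ ->] := diag_inv Xd Xn; rewrite !mxE eqxx; case: eqVneq => [_|_].
  by rewrite !mulr1n mul1r.
by rewrite !mulr0n mul0r mulr0.
Qed.

Lemma g_negE (z : R[i]) : (forall i, z + (d i)%:C != 0) ->
  g_neg D z = (n%:R^-1)%:C * \sum_i (z + (d i)%:C)^-1.
Proof.
move=> z0; rewrite /g_neg /ntr.
have E : z%:M + mxC D = diag_mx (\row_i (z + (d i)%:C)).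
  rewrite {1}(diag_mxE Dd); apply/matrixP => k l; rewrite !mxE; case: eqVneq => [->|kl].
    by rewrite !mulr1n.
  by rewrite !mulr0n rmorph0 addr0.
rewrite E; set X := diag_mx _.
have Xd : is_diag_mx X by exact: diag_mx_is_diag.
have Xn k : X k k != 0 by rewrite !mxE eqxx mulr1n z0.
have [_ ->] := diag_inv Xd Xn.
rewrite rmorphV ?unitfE ?pnatr_eq0 -?lt0n// rmorph_nat; congr (_ * _).
by apply: eq_bigr => i _; rewrite !mxE eqxx !mulr1n.
Qed.

Lemma invC_ib (t : R) : (0 +i* b + t%:C)^-1 = (t / (b ^+ 2 + t ^+ 2)) +i* (- (b / (b ^+ 2 + t ^+ 2))).
Proof.
have p : b ^+ 2 + t ^+ 2 != 0 by rewrite gt_eqF// ltr_wpDr ?sqr_ge0// exprn_gt0.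
have z0 : 0 +i* b + t%:C != 0.
  by rewrite eq_complex /= negb_and add0r addr0 (gt_eqF b0) orbT.
apply: (mulfI z0); rewrite mulfV//; apply: eq_complexP; rewrite /= ?(add0r, addr0); field.
all: by rewrite ?p.
Qed.

Lemma ztilde_ReIm :
  atilde beta b D = 2 * beta ^+ 2 * mean (fun i => d i / (b ^+ 2 + d i ^+ 2)) /\
  btilde beta b D = b - 2 * beta ^+ 2 * mean (fun i => b / (b ^+ 2 + d i ^+ 2)).
Proof.
have z0 i : 0 +i* b + (d i)%:C != 0.
  by rewrite eq_complex /= negb_and add0r addr0 (gt_eqF b0) orbT.
rewrite /atilde /btilde /ztilde g_negE//.
under eq_bigr do rewrite invC_ib.
split.
  rewrite cReD cReM /= cReM cImM /= Re_sum /= /mean; ring.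
rewrite cImD cImM /= cReM cImM /= Im_sum /= sumrN /mean; ring.
Qed.

Lemma atildeE : atilde beta b D = 2 * beta ^+ 2 * mean (fun i => d i / (b ^+ 2 + d i ^+ 2)).
Proof. by have [] := ztilde_ReIm. Qed.

Lemma btildeE1 : btilde beta b D = b - 2 * beta ^+ 2 * mean (fun i => b / (b ^+ 2 + d i ^+ 2)).
Proof. by have [] := ztilde_ReIm. Qed.

Let p i : 0 < b ^+ 2 + d i ^+ 2.
Proof. by rewrite ltr_wpDr ?sqr_ge0// exprn_gt0. Qed.

(** The normalisation of D cancels the term linear in b: b itself equals 2 beta^2 b tr_n(D^-2). What
    remains is positive and of order b^3. *)
Lemma btildeE : btilde beta b D =
  2 * beta ^+ 2 * b ^+ 3 * mean (fun i => (d i)^-1 ^+ 2 * (b ^+ 2 + d i ^+ 2)^-1).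
Proof.
have E i : (d i)^-1 ^+ 2 * (b ^+ 2 + d i ^+ 2)^-1 = b^-1 ^+ 2 * (d i)^-1 ^+ 2 -
    b^-1 ^+ 3 * (b / (b ^+ 2 + d i ^+ 2)).
  by field; rewrite !gt_eqF.
under eq_fun do rewrite E.
rewrite meanB (meanZ (b^-1 ^+ 2)) (meanZ (b^-1 ^+ 3)) btildeE1 mulrBr.
have -> : 2 * beta ^+ 2 * b ^+ 3 * (b^-1 ^+ 2 * mean (fun i => (d i)^-1 ^+ 2)) = b.
  by rewrite mean_inv2E; field; rewrite !gt_eqF.
by congr (_ - _); field; exact: lt0r_neq0.
Qed.

(** Jensen's inequality for x -> 1/x with the probability weights 2 beta^2 d_i^-2 / n, for which b^2
    + d_i^2 has mean m = b^2 + 2 beta^2; concretely, the tangent line at m. Then b <= beta gives m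
    <= 3 beta^2. *)
Lemma btilde_ge : b ^+ 3 / (3 * beta ^+ 2) <= btilde beta b D.
Proof.
rewrite btildeE; pose m := b ^+ 2 + 2 * beta ^+ 2.
have m0 : 0 < m by rewrite ltr_wpDr ?exprn_gt0// mulr_ge0 ?sqr_ge0.
have jensen i : (2 / m - b ^+ 2 / m ^+ 2) * (d i)^-1 ^+ 2 - m^-1 ^+ 2 <= (d i)^-1 ^+ 2 * (b ^+ 2 + d i ^+ 2)^-1.
  have -> : m^-1 ^+ 2 = (d i)^-1 ^+ 2 * (d i ^+ 2 / m ^+ 2) by field; rewrite !gt_eqF.
  rewrite mulrC -mulrBr; apply: ler_wpM2l; first exact: sqr_ge0.
  have pi0 := p i; rewrite -subr_ge0.
  have -> : (b ^+ 2 + d i ^+ 2)^-1 - (2 / m - b ^+ 2 / m ^+ 2 - d i ^+ 2 / m ^+ 2) =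
     (m - (b ^+ 2 + d i ^+ 2)) ^+ 2 / (m ^+ 2 * (b ^+ 2 + d i ^+ 2)).
    by field; rewrite !gt_eqF.
  by rewrite divr_ge0 ?sqr_ge0// mulr_ge0 ?sqr_ge0// ltW.
have := mean_le jensen; rewrite meanB meanZ mean_cst// => J.
have b3 : 0 < 2 * beta ^+ 2 * b ^+ 3 by rewrite !mulr_gt0// exprn_gt0.
apply: le_trans (ler_wpM2l (ltW b3) J); rewrite mulrBr.
have -> : 2 * beta ^+ 2 * b ^+ 3 * ((2 / m - b ^+ 2 / m ^+ 2) * mean (fun i => (d i)^-1 ^+ 2)) =
   b ^+ 3 * (2 / m - b ^+ 2 / m ^+ 2).
  by rewrite mean_inv2E; field; rewrite !gt_eqF.
have -> : b ^+ 3 * (2 / m - b ^+ 2 / m ^+ 2) - 2 * beta ^+ 2 * b ^+ 3 * m^-1 ^+ 2 = b ^+ 3 / m.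
  by rewrite /m; field; rewrite gt_eqF.
apply: ler_wpM2l; first by rewrite exprn_ge0 ?ltW.
rewrite lef_pV2 ?posrE// ?mulr_gt0 ?exprn_gt0// /m.
have : b ^+ 2 <= beta ^+ 2 by rewrite lerXn2r ?nnegrE//; nonneg.
by move=> ?; lra.
Qed.

Lemma btilde_gt0 : 0 < btilde beta b D.
Proof. by apply: lt_le_trans btilde_ge; rewrite divr_gt0 ?exprn_gt0 ?mulr_gt0 ?exprn_gt0. Qed.

Lemma btilde_le : btilde beta b D <= 2 * beta ^+ 2 * b ^+ 3 * ntr (invmx D ^+ 4).
Proof.
rewrite btildeE ntr_inv; apply: ler_wpM2l.
  by rewrite ltW// !mulr_gt0// exprn_gt0.
apply: mean_le => i.
have -> : (d i)^-1 ^+ 4 = (d i)^-1 ^+ 2 * (d i)^-1 ^+ 2 by rewrite -exprD.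
apply: ler_wpM2l; first exact: sqr_ge0.
by rewrite exprVn lef_pV2 ?posrE ?exprn_gt0// lerDr sqr_ge0.
Qed.

Lemma atilde_dist :
  `|2 * beta ^+ 2 * ntr (invmx D) - atilde beta b D| <= 2 * beta ^+ 2 * b ^+ 2 * ntr (invmx D ^+ 3).
Proof.
have -> : ntr (invmx D) = mean (fun i => (d i)^-1).
  by rewrite -[invmx D]expr1 ntr_inv; under eq_fun do rewrite expr1.
rewrite atildeE -mulrBr -meanB ntr_inv.
have E i : (d i)^-1 - d i / (b ^+ 2 + d i ^+ 2) = b ^+ 2 * ((d i)^-1 / (b ^+ 2 + d i ^+ 2)).
  by field; rewrite !gt_eqF.
under eq_fun do rewrite E.
have q i : 0 <= (d i)^-1 / (b ^+ 2 + d i ^+ 2) by rewrite divr_ge0 ?invr_ge0 ?ltW.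
rewrite meanZ ger0_norm; last first.
  apply: mulr_ge0; first by rewrite mulr_ge0 ?sqr_ge0.
  by apply: mulr_ge0; [exact: sqr_ge0|exact: mean_ge0].
rewrite mulrA; apply: ler_wpM2l; first by nonneg.
apply: mean_le => i; have -> : (d i)^-1 ^+ 3 = (d i)^-1 * (d i)^-1 ^+ 2 by rewrite exprS.
apply: ler_wpM2l; first by rewrite invr_ge0 ltW.
by rewrite exprVn lef_pV2 ?posrE ?exprn_gt0// lerDr sqr_ge0.
Qed.

Lemma ntr_inv4_le c : (forall i, (d i)^-1 <= c) ->
  2 * beta ^+ 2 * ntr (invmx D ^+ 4) <= c ^+ 2.
Proof.
move=> dc; rewrite ntr_inv.
have : mean (fun i => (d i)^-1 ^+ 4) <= c ^+ 2 * mean (fun i => (d i)^-1 ^+ 2).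
  rewrite -meanZ; apply: mean_le => i.
  have -> : (d i)^-1 ^+ 4 = (d i)^-1 ^+ 2 * (d i)^-1 ^+ 2 by rewrite -exprD.
  have i0 : 0 <= (d i)^-1 by rewrite invr_ge0 ltW.
  apply: ler_wpM2r; first exact: sqr_ge0.
  by rewrite lerXn2r ?nnegrE// (le_trans i0).
have bb0 : 0 <= 2 * beta ^+ 2 by rewrite mulr_ge0 ?sqr_ge0.
by move=> /(ler_wpM2l bb0); rewrite [X in _ <= X -> _]mulrCA mean_inv2 mulr1.
Qed.

(** Two terms of the alternating expansion of b / (b^2 + d^2) in powers of b/d, whose remainder is
    nonnegative. *)
Lemma ntr_diag_resolvent_ge c : (forall i, (d i)^-1 <= c) ->
  b / (2 * beta ^+ 2) - b ^+ 3 / (2 * beta ^+ 2) * c ^+ 2 <= ntr (diag_resolvent b D).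
Proof.
move=> dc; rewrite ntr_diag_resolvent.
have h i : b * (d i)^-1 ^+ 2 - b ^+ 3 * (d i)^-1 ^+ 4 <= b / (b ^+ 2 + d i ^+ 2).
  have -> : b / (b ^+ 2 + d i ^+ 2) = b * (d i)^-1 ^+ 2 - b ^+ 3 * (d i)^-1 ^+ 4 +
     b ^+ 5 * (d i)^-1 ^+ 4 / (b ^+ 2 + d i ^+ 2) by field; rewrite !gt_eqF.
  by rewrite lerDl divr_ge0 ?mulr_ge0 ?exprn_ge0 ?invr_ge0// ltW.
apply: le_trans (mean_le h); rewrite meanB !meanZ -(ntr_inv 4).
have bb0 : 0 < 2 * beta ^+ 2 by rewrite mulr_gt0 ?exprn_gt0.
apply: lerB.
  by rewrite mean_inv2E.
rewrite -mulrA; apply: ler_wpM2l; first by rewrite exprn_ge0 ?ltW.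
by rewrite mulrC ler_pdivlMr// mulrC; exact: ntr_inv4_le.
Qed.

End deterministic.

(** * Operator norm and square roots *)

Section operator_norm.
Context (R : realType) (n : nat).
Implicit Types (X Y : 'M[R]_n) (v : 'cV[R]_n).

Lemma l2norm_fr v : l2norm v = fr v.
Proof.
rewrite /l2norm /fr /l2 -(pair_big xpredT xpredT (fun i j => v i j ^+ 2))/=.
by congr Num.sqrt; apply: eq_bigr => i _; rewrite big_ord1.
Qed.

Lemma l2norm_ge0 v : 0 <= l2norm v. Proof. exact: sqrtr_ge0. Qed.

Lemma frM m p q (Y : 'M[R]_(m, p)) (Z : 'M[R]_(p, q)) : fr (Y *m Z) <= fr Y * fr Z.
Proof. by rewrite -!fro_cM /cM map_mxM froM. Qed.

Lemma frZ m p c (Y : 'M[R]_(m, p)) : fr (c *: Y) = `|c| * fr Y.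
Proof. by rewrite -!fro_cM /cM map_mxZ froZ nc_real. Qed.

Lemma frD m p (Y Z : 'M[R]_(m, p)) : fr (Y + Z) <= fr Y + fr Z.
Proof. by rewrite -!fro_cM /cM map_mxD froD. Qed.

Let S X := [set l2norm (X *m v) | v in [set v : 'cV[R]_n | l2norm v <= 1]].

Let S0 X : S X !=set0.
Proof. by exists (l2norm (X *m 0)), 0 => //=; rewrite /l2norm big1 ?sqrtr0// => i _; rewrite mxE expr0n. Qed.

Let Sub X (c : R) : 0 <= c -> (forall v, l2norm (X *m v) <= c * l2norm v) -> ubound (S X) c.
Proof.
move=> c0 h _ [v /= v1 <-]; apply: le_trans (h v) _.
by rewrite -[leRHS]mulr1 ler_wpM2l.
Qed.

Let Sfr X v : l2norm (X *m v) <= fr X * l2norm v.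
Proof. by rewrite !l2norm_fr frM. Qed.

Let Ssup X : has_sup (S X).
Proof. by split=> //; exists (fr X); apply: Sub => //; exact: fr_ge0. Qed.

Lemma opnorm_le X (c : R) : 0 <= c -> (forall v, l2norm (X *m v) <= c * l2norm v) -> opnorm X <= c.
Proof. by move=> c0 h; apply: (ge_sup (S0 X)); exact: Sub. Qed.

Lemma opnorm_ge0 X : 0 <= opnorm X.
Proof.
have [y Sy] := S0 X; have y0 : 0 <= y by have [v _ <-] := Sy; exact: l2norm_ge0.
by apply: le_trans y0 _; apply: ub_le_sup => //; exact: (Ssup X).2.
Qed.

Lemma l2normZ c v : l2norm (c *: v) = `|c| * l2norm v.
Proof. by rewrite !l2norm_fr frZ. Qed.

Lemma opnormP X v : l2norm (X *m v) <= opnorm X * l2norm v.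
Proof.
have [v0|v0] := eqVneq (l2norm v) 0.
  by apply: le_trans (Sfr X v) _; rewrite v0 !mulr0.
have vp : 0 < l2norm v by rewrite lt_def v0 l2norm_ge0.
rewrite -ler_pdivrMr// mulrC -[(l2norm v)^-1]ger0_norm ?invr_ge0 ?l2norm_ge0//.
rewrite -l2normZ scalemxAr; apply: ub_le_sup; first exact: (Ssup X).2.
by exists ((l2norm v)^-1 *: v) => //=; rewrite l2normZ ger0_norm ?invr_ge0 ?l2norm_ge0// mulVf.
Qed.

Lemma opnorm_lipschitz X Y : opnorm X <= opnorm Y + fr (X - Y).
Proof.
apply: opnorm_le => [|v]; first by rewrite addr_ge0 ?opnorm_ge0 ?fr_ge0.
have -> : X *m v = Y *m v + (X - Y) *m v by rewrite mulmxBl addrC subrK.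
rewrite mulrDl !l2norm_fr; apply: le_trans (frD _ _) _.
by apply: lerD; rewrite -!l2norm_fr ?opnormP.
Qed.

Lemma entry_le_opnorm X i : X i i <= opnorm X.
Proof.
pose e : 'cV[R]_n := delta_mx i 0.
have e1 : l2norm e = 1 by rewrite l2norm_fr -fro_cM /cM map_delta_mx fro_delta.
apply: le_trans (_ : l2norm (X *m e) <= _); last by have := opnormP X e; rewrite e1 mulr1.
rewrite l2norm_fr -fro_cM; apply: le_trans (nc_le_fro _ i 0).
by rewrite mxE nc_real mulmx_delta ler_norm.
Qed.

Lemma opnorm_kmx eta X : 0 < eta -> X^T = X -> opnorm (eta *: kmx eta X) <= eta^-1.
Proof.
move=> eta0 XT; apply: opnorm_le => [|v]; first by rewrite invr_ge0 ltW.
have eta2 : 0 < eta ^+ 2 by rewrite exprn_gt0.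
rewrite -scalemxAl l2normZ gtr0_norm// -ler_pdivlMl// mulrA -invfM -expr2 ler_pdivlMl//.
rewrite !l2norm_fr; set w := kmx eta X *m v.
have vE : v = ((eta ^+ 2)%:M + X *m X) *m w by rewrite /w mulmxA kmxV// mul1mx.
have h : eta ^+ 2 * fr w ^+ 2 <= fr w * fr v.
  apply: le_trans (_ : \tr (w^T *m ((eta ^+ 2)%:M + X *m X) *m w) <= _).
    by rewrite -(fr_shift w eta XT) lerDr sqr_ge0.
  rewrite -mulmxA -vE -(frT w) -!fro_cM; apply: le_trans (nc_tr_mul _ _).
  rewrite /cM -map_mxM -[X in nc X](_ : (\tr (w^T *m v))%:C = _); first by rewrite nc_real ler_norm.
  by rewrite /mxtrace rmorph_sum; apply: eq_bigr => i _; rewrite [RHS]mxE.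
have [w0|w0] := eqVneq (fr w) 0; first by rewrite w0 mulr0 fr_ge0.
have wp : 0 < fr w by rewrite lt_def w0 fr_ge0.
by rewrite -(ler_pM2l wp); apply: le_trans h; rewrite mulrCA -expr2.
Qed.

End operator_norm.

(** * Functional calculus for real symmetric matrices *)

Section real_spectral.
Context (R : realType) (n : nat).
Implicit Types X : 'M[R]_n.

Definition ctr m p (Y : 'M[R[i]]_(m, p)) : 'M[R[i]]_(p, m) := map_mx Num.conj Y^T.

Lemma real_spectral X : X^T = X -> exists (U : 'M[R[i]]_n) (lam : 'I_n -> R),
  [/\ ctr U *m U = 1%:M, U *m ctr U = 1%:M &
      cM X = ctr U *m diag_mx (\row_i (lam i)%:C) *m U].
Proof.
move=> XT; pose A := cM X.
have AE : A = map_mx Num.conj A^T.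
  apply/matrixP => i j; rewrite !mxE; have /matrixP/(_ i j) := XT; rewrite mxE => <-.
  by rewrite conj_Creal// complex_real.
have Ah : A \is hermsymmx by apply/is_hermitianmxP; rewrite expr0 scale1r.
have /orthomx_spectralP AS := hermitian_normalmx Ah.
have Uu := spectral_unitarymx A; have Ar := hermitian_spectral_diag_real Ah.
have UE := invmx_unitary Uu.
exists (spectralmx A), (fun i => complex.Re (spectral_diag A 0 i)); split.
- by rewrite /ctr -UE mulVmx// spectral_unit.
- by rewrite /ctr -UE mulmxV// spectral_unit.
rewrite -/A [LHS]AS UE; congr (_ *m diag_mx _ *m _); apply/rowP => i.
rewrite !mxE; apply/esym; have /mxOverP/(_ 0 i) := Ar.
by move=> /complex_realP [x ->].
Qed.

Section calculus.
Variables (U : 'M[R[i]]_n) (lam : 'I_n -> R).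
Hypotheses (UU : ctr U *m U = 1%:M) (UU' : U *m ctr U = 1%:M).
Implicit Types f g : 'I_n -> R.

Definition fcal f : 'M[R[i]]_n := ctr U *m diag_mx (\row_i (f i)%:C) *m U.

Lemma fcal_cst (c : R) : fcal (fun=> c) = cM c%:M.
Proof.
rewrite /fcal (_ : diag_mx _ = c%:C%:M); last by apply/matrixP => i j; rewrite !mxE.
by rewrite mul_mx_scalar -scalemxAl UU /cM map_scalar_mx scalemx1.
Qed.

Lemma fcalD f g : fcal (fun i => f i + g i) = fcal f + fcal g.
Proof.
rewrite /fcal -mulmxDl -mulmxDr -linearD; congr (_ *m diag_mx _ *m _).
by apply/rowP => i; rewrite !mxE rmorphD.
Qed.

Lemma fcalM f g : fcal (fun i => f i * g i) = fcal f *m fcal g.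
Proof.
rewrite /fcal !mulmxA -[ctr U *m _ *m U *m ctr U]mulmxA UU' mulmx1.
rewrite -[ctr U *m _ *m diag_mx _]mulmxA mulmx_diag.
congr (_ *m diag_mx _ *m _); by apply/rowP => i; rewrite !mxE rmorphM.
Qed.

Lemma tr_fcal f : \tr (fcal f) = (\sum_i f i)%:C.
Proof.
rewrite /fcal mxtrace_mulC mulmxA UU' mul1mx mxtrace_diag rmorph_sum.
by apply: eq_bigr => i _; rewrite mxE.
Qed.

Lemma conj_mul_nc (z : R[i]) : Num.conj z * z = (nc z ^+ 2)%:C.
Proof. by rewrite mulrC -normCK nc_sq; case: z => x y; rewrite normc_def -rmorphXn/= sqr_sqrtr// addr_ge0 ?sqr_ge0. Qed.

Lemma ctr_mul m p q (Y : 'M[R[i]]_(m, p)) (Z : 'M[R[i]]_(p, q)) : ctr (Y *m Z) = ctr Z *m ctr Y.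
Proof. by rewrite /ctr trmx_mul map_mxM. Qed.

Lemma ctrK m p (Y : 'M[R[i]]_(m, p)) : ctr (ctr Y) = Y.
Proof. by apply/matrixP => i j; rewrite !mxE conjCK. Qed.

Lemma ctr_cM m p (Y : 'M[R]_(m, p)) : ctr (cM Y) = cM Y^T.
Proof. by apply/matrixP => i j; rewrite !mxE conj_Creal// complex_real. Qed.

Lemma ctr_fcal f : ctr (fcal f) = fcal f.
Proof.
rewrite /fcal !ctr_mul ctrK mulmxA; congr (_ *m _ *m _).
apply/matrixP => i j; rewrite !mxE [j == i]eq_sym; case: eqVneq => [->|_].
  by rewrite !mulr1n conj_Creal// complex_real.
by rewrite !mulr0n conjC0.
Qed.

Lemma cM_inj m p : injective (@cM R m p).
Proof.
move=> Y Z /matrixP E; apply/matrixP => i j; have := E i j; rewrite !mxE.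
by case.
Qed.

Lemma fcal_sym (Y : 'M[R]_n) f : cM Y = fcal f -> Y^T = Y.
Proof. by move=> E; apply: cM_inj; rewrite -ctr_cM E ctr_fcal. Qed.

Lemma quad_fcal (Y : 'M[R]_n) f (v : 'cV[R]_n) : cM Y = fcal f ->
  (v^T *m Y *m v) 0 0 = \sum_i f i * nc ((U *m cM v) i 0) ^+ 2.
Proof.
move=> E; apply: (@complexI R).
have -> : ((v^T *m Y *m v) 0 0)%:C = (cM (v^T *m Y *m v)) 0 0 by rewrite [RHS]mxE.
have -> : cM (v^T *m Y *m v) = ctr (cM v) *m fcal f *m cM v.
  by rewrite ctr_cM -E /cM !map_mxM.
rewrite /fcal !mulmxA -ctr_mul -mulmxA.
move: (U *m cM v) => w; rewrite mxE rmorph_sum; apply: eq_bigr => i _.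
rewrite mul_mx_diag !mxE rmorphM mulrAC mulrC; congr (_ * _).
exact: conj_mul_nc.
Qed.

Lemma fcal_psd (Y : 'M[R]_n) f : cM Y = fcal f -> (forall i, 0 <= f i) -> psdmx Y.
Proof.
move=> E f0; split=> [|v]; first exact: fcal_sym E.
by rewrite (quad_fcal _ E) sumr_ge0// => i _; rewrite mulr_ge0 ?sqr_ge0.
Qed.

Lemma fcal_inv (Y : 'M[R]_n) f : cM Y = fcal f -> (forall i, f i != 0) ->
  cM (invmx Y) = fcal (fun i => (f i)^-1).
Proof.
move=> E f0; have YF : cM Y *m fcal (fun i => (f i)^-1) = 1%:M.
  rewrite E -fcalM (_ : (fun i => _) = fun=> 1); last by apply/funext => i; rewrite mulfV.
  by rewrite fcal_cst /cM map_scalar_mx.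
have [Yu _] := mulmx1_unit YF.
by rewrite /cM map_invmx -/(cM Y) -[LHS]mulmx1 -YF mulmxA mulVmx// mul1mx.
Qed.

(** The eigenbasis U is complex, so [fcal f] is not visibly a real matrix. For a polynomial f it is
    one, and interpolation on the finitely many eigenvalues reduces other functions to
    polynomials. *)
Lemma fcal_poly X (q : {poly R}) : cM X = fcal lam ->
  exists Y : 'M[R]_n, cM Y = fcal (fun i => q.[lam i]).
Proof.
move=> XE; elim/poly_ind: q => [|q c [Y YE]].
  by exists 0; under eq_fun do rewrite horner0; rewrite fcal_cst raddf0.
exists (Y *m X + c%:M); under eq_fun do rewrite hornerMXaddC.
by rewrite fcalD fcalM fcal_cst -YE -XE /cM map_mxD map_mxM.
Qed.

End calculus.

Lemma interpolation (s : seq R) (f : R -> R) :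
  exists q : {poly R}, forall x, x \in s -> q.[x] = f x.
Proof.
elim: s => [|a s [q hq]]; first by exists 0.
have [ain|ain] := boolP (a \in s).
  by exists q => x; rewrite inE => /orP [/eqP ->|]; apply: hq.
pose m : {poly R} := \prod_(y <- s) ('X - y%:P).
have ma : m.[a] != 0 by rewrite -/(root m a) root_prod_XsubC.
exists (q + ((f a - q.[a]) / m.[a])%:P * m) => x; rewrite inE !hornerE => /orP [/eqP ->|xs].
  by rewrite divfK// addrC subrK.
have /eqP -> : m.[x] == 0 by rewrite -/(root m x) root_prod_XsubC.
by rewrite mulr0 addr0 hq.
Qed.

Lemma fcal_sub U lam X t : ctr U *m U = 1%:M -> cM X = fcal U lam ->
  cM (X - t%:M) = fcal U (fun i => lam i - t).
Proof.
move=> UU XE; rewrite (fcalD U lam (fun=> - t)) fcal_cst// -XE.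
by rewrite [(- t)%:M]raddfN /cM map_mxD.
Qed.

Lemma cM_kmx U lam X eta t : ctr U *m U = 1%:M -> U *m ctr U = 1%:M ->
  cM X = fcal U lam -> 0 < eta ->
  cM (kmx eta (X - t%:M)) = fcal U (fun i => (eta ^+ 2 + (lam i - t) ^+ 2)^-1).
Proof.
move=> UU UU' XE eta0.
have E := fcal_sub t UU XE.
apply: fcal_inv => //; last first.
  by move=> i; rewrite gt_eqF// ltr_wpDr ?sqr_ge0// exprn_gt0.
rewrite fcalD fcal_cst// /cM map_mxD; congr (_ + _).
by under eq_fun do rewrite expr2; rewrite fcalM// map_mxM -/(cM _) E.
Qed.

(** Interpolating the scalar square root on the spectrum produces a real positive semidefinite root,
    so [psd_sqrt] does not take its default value here. *)
Lemma psd_sqrt_kmx eta X : 0 < eta -> X^T = X ->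
  psd_sqrt (eta *: kmx eta X) *m psd_sqrt (eta *: kmx eta X) = eta *: kmx eta X.
Proof.
move=> eta0 /real_spectral [U [lam [UU UU' XE]]].
have KE := cM_kmx 0 UU UU' XE eta0; rewrite raddf0 subr0 in KE.
pose phi (x : R) := Num.sqrt (eta * (eta ^+ 2 + (x - 0) ^+ 2)^-1).
have phi2 x : phi x * phi x = eta * (eta ^+ 2 + (x - 0) ^+ 2)^-1.
  rewrite -expr2 sqr_sqrtr// mulr_ge0 ?ltW// invr_gt0 ltr_wpDr ?sqr_ge0//.
  by rewrite exprn_gt0.
have [q hq] := interpolation [seq lam i | i : 'I_n] phi.
have [Y YE] := fcal_poly UU UU' q XE.
have hq' i : q.[lam i] = phi (lam i) by apply: hq; apply/mapP; exists i; rewrite ?mem_enum.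
have Yok : [set Y : 'M[R]_n | psdmx Y /\ Y *m Y = eta *: kmx eta X] Y.
  split.
    by apply: (fcal_psd YE) => i; rewrite hq' sqrtr_ge0.
  apply: cM_inj; rewrite {1}/cM map_mxM -/(cM Y) YE -fcalM//.
  have -> : (fun i => q.[lam i] * q.[lam i]) = fun i => eta * (eta ^+ 2 + (lam i - 0) ^+ 2)^-1.
    by apply/funext => i; rewrite hq' phi2.
  rewrite fcalM// fcal_cst// -KE /cM -map_mxM; congr map_mx.
  by rewrite mul_scalar_mx.
by have [] := xgetPex 0 (ex_intro _ Y Yok).
Qed.

(* The eigenvalue of largest modulus is +-opnorm X, and its contribution alone
   bounds these traces from below. *)
Lemma trace_outlier X : (0 < n)%N -> X^T = X -> exists2 l : R, `|l| = opnorm X &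
  forall eta eta' t, 0 < eta -> eta <= eta' ->
    (eta ^+ 2 + (l - t) ^+ 2)^-1 - (eta' ^+ 2 + (l - t) ^+ 2)^-1 <=
    \tr (kmx eta (X - t%:M)) - \tr (kmx eta' (X - t%:M)).
Proof.
move=> n0 /real_spectral [U [lam [UU UU' XE]]].
pose i0 : 'I_n := [arg max_(i > Ordinal n0) `|lam i|]%O.
have maxi i : `|lam i| <= `|lam i0|.
  by rewrite /i0; case: arg_maxP => //= j _; apply.
exists (lam i0).
  apply/eqP; rewrite eq_le; apply/andP; split.
    have E := fcal_sub (lam i0) UU XE.
    have /det0P [v v0 vX] : \det (X - (lam i0)%:M) == 0.
      rewrite -(inj_eq (@complexI R)) -det_map_mx -/(cM _) E /fcal !det_mulmx det_diag.
      by rewrite (bigD1 i0)//= mxE subrr rmorph0 mul0r mulr0 mul0r.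
    have XT : X^T = X by exact: fcal_sym XE.
    have vE : X *m v^T = lam i0 *: v^T.
      apply: trmx_inj; rewrite trmx_mul linearZ /= trmxK XT.
      by apply/eqP; rewrite -subr_eq0 -mul_mx_scalar -mulmxBr vX.
    have := opnormP X v^T; rewrite vE l2normZ ler_pM2r//.
    rewrite lt_def l2norm_ge0 andbT l2norm_fr; apply: contra_neq v0 => /fr_eq0 h.
    by apply: trmx_inj; rewrite h trmx0.
  apply: opnorm_le => // v.
  rewrite -(@ler_pXn2r _ 2)// ?nnegrE ?mulr_ge0 ?l2norm_ge0// exprMn !l2norm_fr !fr_sq.
  have trE (M : 'M[R]_1) : \tr M = M 0 0 by rewrite /mxtrace big_ord1.
  have EX : cM (X *m X) = fcal U (fun i => lam i * lam i).
    by rewrite fcalM// /cM map_mxM -/(cM X) XE.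
  have E1 : cM (1%:M : 'M[R]_n) = fcal U (fun=> 1) by rewrite fcal_cst.
  have XT : X^T = X by exact: fcal_sym XE.
  rewrite !trE trmx_mul XT mulmxA -[v^T *m X *m X]mulmxA (quad_fcal _ EX).
  rewrite -[v^T in leRHS]mulmx1 (quad_fcal _ E1) mulr_sumr; apply: ler_sum => i _.
  rewrite mul1r; apply: ler_wpM2r; first exact: sqr_ge0.
  by rewrite -expr2 -real_normK ?num_real// lerXn2r ?nnegrE.
move=> eta eta' t eta0 ee'.
have trK r : 0 < r -> \tr (kmx r (X - t%:M)) = \sum_i (r ^+ 2 + (lam i - t) ^+ 2)^-1.
  move=> r0; apply: (@complexI R).
  have <- : \tr (cM (kmx r (X - t%:M))) = (\sum_i (r ^+ 2 + (lam i - t) ^+ 2)^-1)%:C.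
    by rewrite (cM_kmx t UU UU' XE r0) tr_fcal.
  by rewrite /mxtrace rmorph_sum; apply: eq_bigr => i _; rewrite mxE.
have eta0' : 0 < eta' := lt_le_trans eta0 ee'.
rewrite !trK// -sumrB (bigD1 i0)//= lerDl sumr_ge0// => i _.
have pos r : 0 < r -> 0 < r ^+ 2 + (lam i - t) ^+ 2.
  by move=> r0; rewrite ltr_wpDr ?sqr_ge0// exprn_gt0.
rewrite subr_ge0 lef_pV2 ?posrE ?pos// lerD2r lerXn2r ?nnegrE//; exact: ltW.
Qed.

End real_spectral.

(** * Bounds on P^2 for fixed A and D *)

Section deterministic_bounds.
Context (R : realType) (n : nat) (n0 : (0 < n)%N).
Variables (beta b : R) (A D : 'M[R]_n).
Hypotheses (beta1 : 1 <= beta) (b0 : 0 < b) (bb : b <= beta) (aD : admissible beta D).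

Notation eta := (btilde beta b D).
Notation X := (shifted beta b A D).

Let eta0 : 0 < eta. Proof. exact: btilde_gt0. Qed.

Lemma shifted_xmx : X = xmx beta (atilde beta b D) D A.
Proof. by []. Qed.

Lemma adm_sym : D^T = D.
Proof. by have [/diag_mxE -> _ _ _] := aD; rewrite tr_diag_mx. Qed.

Lemma shifted_sym : X^T = X.
Proof. by rewrite shifted_xmx; apply: xmx_sym; exact: adm_sym. Qed.

Lemma Pmx_sq : Pmx beta b A D ^+ 2 = eta *: kmx eta X.
Proof. by rewrite expr2 /Pmx; apply: psd_sqrt_kmx => //; exact: shifted_sym. Qed.

(** P^2 X^2 = eta (1 - eta^2 (eta^2 + X^2)^-1), and the subtracted term has nonnegative trace. *)
Lemma ntr_Pmx_shifted : ntr (Pmx beta b A D ^+ 2 *m X ^+ 2) <= eta.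
Proof.
have E : kmx eta X *m X ^+ 2 = 1%:M - eta ^+ 2 *: kmx eta X.
  have := kmxVl eta0 shifted_sym; rewrite mulmxDr mul_mx_scalar => <-.
  by rewrite addrAC subrr add0r.
rewrite Pmx_sq -scalemxAl E /ntr mxtraceZ raddfB /= mxtrace1 mxtraceZ.
have t0 : 0 <= \tr (kmx eta X) by rewrite -(fro_res eta0 shifted_sym) sqr_ge0.
have nn : 0 < n%:R :> R by rewrite ltr0n.
rewrite ler_pdivrMl// mulrC; apply: ler_wpM2r; first exact: ltW.
by rewrite gerBl mulr_ge0// sqr_ge0.
Qed.

Lemma opnorm_Pmx : opnorm (Pmx beta b A D ^+ 2) <= eta^-1.
Proof. by rewrite Pmx_sq; apply: opnorm_kmx => //; exact: shifted_sym. Qed.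

Lemma inv_le_opnorm i : (D i i)^-1 <= opnorm (invmx D).
Proof.
have [Dd _ _ _] := aD.
have [_ E] := diag_inv Dd (fun i => lt0r_neq0 (adm_gt0 aD i)).
by have := entry_le_opnorm (invmx D) i; rewrite {1}E !mxE eqxx.
Qed.

Lemma ntr_le_hs_norm (Y : 'M[R]_n) : `|ntr Y| <= hs_norm Y.
Proof.
have -> : ntr Y = mean (fun i => Y i i) by [].
have n1 := mean_CS (fun i => Y i i) (fun=> 1).
rewrite -sqrtr_sqr ler_wsqrtr//.
have -> : mean (fun i => Y i i) = mean (fun i => Y i i * 1) by congr mean; apply/funext => i; rewrite mulr1.
apply: le_trans n1 _; rewrite mean_cst// expr1n mulr1 /ntr ler_wpM2l ?invr_ge0// /mxtrace; apply: ler_sum => i _.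
rewrite mxE (bigD1 i)//= mxE -expr2 lerDl; apply: sumr_ge0 => k _.
by rewrite mxE -expr2 sqr_ge0.
Qed.

Lemma ntr_diag_part (Y : 'M[R]_n) : ntr (diag_part Y) = ntr Y.
Proof. by rewrite /ntr; congr (_ * _); apply: eq_bigr => i _; rewrite mxE eqxx. Qed.

End deterministic_bounds.

(** * Expectation of the diagonal of the resolvent *)

Section stability.
Context (R : realType) (n : nat) (n0 : (0 < n)%N).
Variables (beta b a eta eps : R) (d : 'I_n -> R) (y er : 'I_n -> R[i]).

Let u : R[i] := 0 +i* b.
Let z : R[i] := a +i* eta.
Let cmean (f : 'I_n -> R[i]) : R[i] := (n%:R^-1)%:C * \sum_i f i.
Let c : R := 2 * beta ^+ 2.

Hypotheses (beta0 : 0 < beta) (b0 : 0 < b) (eta0 : 0 < eta) (eps0 : 0 <= eps).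
Hypothesis zE : z = u + c%:C * cmean (fun i => (u + (d i)%:C)^-1).
Hypothesis etaE : eta = b - c * mean (fun i => b / (b ^+ 2 + d i ^+ 2)).
Hypothesis yE : forall i, (z + (d i)%:C - c%:C * cmean y) * y i = 1 + er i.
Hypothesis yIm : complex.Im (cmean y) <= 0.
Hypothesis erB : forall i, nc (er i) <= eps.
Hypothesis epsB : c * eps <= eta ^+ 2.

Let nc_cmean f (B : R) : (forall i, nc (f i) <= B) -> nc (cmean f) <= B.
Proof.
move=> h; rewrite ncM nc_real ger0_norm ?invr_ge0// ler_pdivrMl ?ltr0n//.
apply: le_trans (nc_sum _ _ _) _; apply: le_trans (ler_sum _ (fun i _ => h i)) _.
by rewrite sumr_const card_ord mulr_natl.
Qed.

Lemma Im_inv (w : R[i]) : complex.Im w^-1 = - complex.Im w * nc w^-1 ^+ 2.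
Proof.
have [->|w0] := eqVneq w 0; first by rewrite invr0 /= oppr0 mul0r.
rewrite ncV exprVn nc_sq; case: w w0 => x t /= w0.
have : x ^+ 2 + t ^+ 2 != 0.
  by move: w0; apply: contraNneq => h; rewrite -nc_eq0 /nc /= h sqrtr0.
by move=> h; rewrite mulNr.
Qed.

Lemma nc_inv_le (w : R[i]) (t : R) : 0 < t -> t <= complex.Im w -> nc w^-1 <= t^-1.
Proof.
move=> t0 tw; have ti : t <= nc w by apply: le_trans tw (le_trans (ler_norm _) (Im_le_nc w)).
by rewrite ncV lef_pV2// posrE (lt_le_trans t0).
Qed.

(** Put w = z - c mean y, W_i = (w + d_i)^-1 and U_i = (u + d_i)^-1. Then (u - w)(1 - c mean (W U))
    is c times the averaged error e', so the second factor must stay away from 0. Cauchy-Schwarz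
    bounds |c mean (W U)|^2 by mw mu. Here mu = 1 - eta/b exactly, and mw <= 1 is read off the
    imaginary part of the equation once c |e'| <= eta, which [epsB] ensures. The gap is thus eta /
    (2 b). *)
Lemma stability i : nc (y i - (u + (d i)%:C)^-1) <= eps / eta + 4 * beta ^+ 2 * eps / eta ^+ 3.
Proof.
have c0 : 0 < c by rewrite mulr_gt0 ?exprn_gt0.
pose w : R[i] := z - c%:C * cmean y.
pose W i := (w + (d i)%:C)^-1; pose U i := (u + (d i)%:C)^-1.
have Imw : complex.Im w = eta - c * complex.Im (cmean y).
  by rewrite cImD cImN [complex.Im (_%:C * _)]cImM /= mul0r addr0.
have weta : eta <= complex.Im w by rewrite Imw lerDl -mulrN mulr_ge0 ?oppr_ge0// ltW.
have Imwd k : complex.Im (w + (d k)%:C) = complex.Im w by rewrite cImD /= addr0.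
have w0 k : w + (d k)%:C != 0.
  by apply: contraTneq (lt_le_trans eta0 weta) => /(congr1 (@complex.Im R)); rewrite Imwd => ->; rewrite ltxx.
have u0 k : u + (d k)%:C != 0.
  by apply: contraTneq b0 => /(congr1 (@complex.Im R)); rewrite cImD /= addr0 => ->; rewrite ltxx.
have ncW k : nc (W k) <= eta^-1 by apply: nc_inv_le => //; rewrite Imwd.
have ncU k : nc (U k) <= b^-1 by apply: nc_inv_le => //; rewrite cImD /= addr0.
have yW k : y k = W k + er k * W k.
  apply: (mulfI (w0 k)); have -> : (w + (d k)%:C) * y k = 1 + er k by rewrite -yE /w; congr (_ * _); ring.
  by rewrite /W; field; exact: w0.
pose e' := cmean (fun k => er k * W k).
have ne' : nc e' <= eps / eta.
  by apply: nc_cmean => k; rewrite ncM; apply: ler_pM; rewrite ?nc_ge0.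
have yM : cmean y = cmean W + e'.
  by rewrite /e' /cmean -mulrDr -big_split; congr (_ * _); apply: eq_bigr => k _; exact: yW.
pose mw := c * mean (fun k => nc (W k) ^+ 2); pose mu := c * mean (fun k => nc (U k) ^+ 2).
have ce' : c * nc e' <= eta.
  apply: le_trans (ler_wpM2l (ltW c0) ne') _.
  by rewrite mulrA ler_pdivrMr// -expr2.
have ImW : complex.Im (cmean W) = - complex.Im w * mean (fun k => nc (W k) ^+ 2).
  rewrite cImM /= mul0r addr0 Im_sum /mean mulrCA; congr (_ * _).
  by rewrite mulr_sumr; apply: eq_bigr => k _; rewrite Im_inv Imwd.
have mw1 : mw <= 1.
  have E : complex.Im w * (1 - mw) = eta - c * complex.Im e'.
    by rewrite /mw mulrBr mulr1 {1}Imw yM cImD ImW; ring.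
  have : 0 <= complex.Im w * (1 - mw).
    rewrite E subr_ge0; apply: le_trans ce'; apply: ler_wpM2l; first exact: ltW.
    exact: le_trans (ler_norm _) (Im_le_nc _).
  by rewrite pmulr_rge0 ?subr_ge0// (lt_le_trans eta0).
have ncU2 k : nc (U k) ^+ 2 = (b ^+ 2 + d k ^+ 2)^-1.
  by rewrite ncV exprVn nc_sq /= add0r addr0 addrC.
have muE : mu = 1 - eta / b.
  rewrite etaE /mu; under eq_fun do rewrite ncU2.
  by rewrite [X in b - _ * X]meanZ; field; exact: lt0r_neq0.
have mu0 : 0 <= mu by apply: mulr_ge0; [exact: ltW|apply: mean_ge0 => k; exact: sqr_ge0].
pose h := cmean (fun k => W k * U k).
have etab : eta / b <= 1 by rewrite -subr_ge0 -muE.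
have nh : nc (c%:C * h) <= 1 - eta / (2 * b).
  have -> : eta / (2 * b) = eta / b / 2 by field; exact: lt0r_neq0.
  rewrite -(ler_pXn2r (n := 2)) ?nnegrE ?nc_ge0//; last by lra.
  apply: le_trans (_ : mw * mu <= _).
    have -> : mw * mu = c ^+ 2 * (mean (fun k => nc (W k) ^+ 2) * mean (fun k => nc (U k) ^+ 2)).
      by rewrite /mw /mu; ring.
    rewrite ncM nc_real exprMn real_normK ?num_real//; apply: ler_wpM2l; first exact: sqr_ge0.
    apply: le_trans (mean_CS (fun k => nc (W k)) (fun k => nc (U k))).
    rewrite lerXn2r ?nnegrE ?nc_ge0//; first by apply: mean_ge0 => k; rewrite mulr_ge0 ?nc_ge0.
    rewrite ncM nc_real ger0_norm ?invr_ge0//; apply: ler_wpM2l; first by rewrite invr_ge0.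
    by apply: le_trans (nc_sum _ _ _) _; apply: ler_sum => k _; rewrite ncM.
  apply: le_trans (_ : mu <= _); first by rewrite -[leRHS]mul1r; exact: ler_wpM2r.
  by rewrite muE; have := sqr_ge0 (eta / b); nra.
have WU k : W k - U k = (u - w) * (W k * U k).
  by rewrite /W /U; field; rewrite w0 u0.
have hE : cmean W - cmean U = (u - w) * h.
  rewrite /h /cmean -mulrBr -sumrB [RHS]mulrCA; congr (_ * _).
  by rewrite mulr_sumr; apply: eq_bigr => k _; exact: WU.
have key : (u - w) * (1 - c%:C * h) = c%:C * e'.
  rewrite mulrBr mulr1 mulrCA -hE.
  have -> : u - w = c%:C * (cmean y - cmean U) by rewrite /w zE -/(U _); ring.
  by rewrite yM; ring.
have hw : nc (u - w) * (eta / (2 * b)) <= c * (eps / eta).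
  apply: le_trans (_ : nc (u - w) * nc (1 - c%:C * h) <= _).
    apply: ler_wpM2l; first exact: nc_ge0.
    have := ncD (1 - c%:C * h) (c%:C * h); rewrite subrK nc1.
    by lra.
  rewrite -ncM key ncM nc_real ger0_norm ?(ltW c0)//; apply: ler_wpM2l => //; exact: ltW.
have -> : y i - (u + (d i)%:C)^-1 = er i * W i + (u - w) * (W i * U i).
  by rewrite yW -WU -/(U i); ring.
apply: le_trans (ncD _ _) _; apply: lerD.
  by rewrite ncM; apply: ler_pM; rewrite ?nc_ge0.
rewrite !ncM; apply: le_trans (_ : nc (u - w) * (eta^-1 * b^-1) <= _).
  by apply: ler_wpM2l; [exact: nc_ge0|apply: ler_pM; rewrite ?nc_ge0].
have -> : nc (u - w) * (eta^-1 * b^-1) = (nc (u - w) * (eta / (2 * b))) * (2 / eta ^+ 2).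
  by field; rewrite !gt_eqF.
have -> : 4 * beta ^+ 2 * eps / eta ^+ 3 = (c * (eps / eta)) * (2 / eta ^+ 2).
  by rewrite /c; field; rewrite gt_eqF.
by apply: ler_wpM2r => //; rewrite divr_ge0// sqr_ge0.
Qed.

End stability.

Section mean_estimate.
Context (R : realType) (n : nat) (n0 : (0 < n)%N).
Notation s := (Num.sqrt (n%:R^-1 : R)).
Notation P := (gaussm s (n * n)).

Section error.
Variables (beta a eta : R) (D : 'M[R]_n).
Hypotheses (beta0 : 0 <= beta) (eta0 : 0 < eta) (DT : D^T = D) (Dd : is_diag_mx D).
Notation G := (gres beta a eta D).
Let yy i := ExC P (fun x => G x i i).
Let ym := (n%:R^-1)%:C * \sum_i yy i.

Lemma ExC_gtr : ExC P (gtr beta a eta D) = ym.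
Proof.
have bg i : bmc (fun x => G x i i) by exact: bmc_gres.
rewrite /gtr ExCZ; last by apply: bmc_igc; exact: bmc_sum.
by rewrite ExC_sum// => i; exact: bmc_igc.
Qed.

Lemma Ex_vtr : Ex P (vtr beta a eta D) = - complex.Im ym.
Proof. by rewrite -ExC_gtr /vtr ExN//; have [] := bmc_gtr a beta0 eta0 DT. Qed.

(** Cauchy-Schwarz for the covariance of the trace with G_ii: the trace contributes a deviation of
    order 1/n, the entry one of order n^(-1/2), which is the factor [s]. *)
Lemma sd_error i : nc ((a +i* eta + (D i i)%:C - (2 * beta ^+ 2)%:C * ym) * yy i - 1) <=
  128 * beta ^+ 4 * n%:R^-1 * s * eta^-1 ^+ 4 + 2 * beta ^+ 2 * n%:R^-1 * eta^-1 ^+ 2.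
Proof.
have e0 : 0 <= eta^-1 by rewrite invr_ge0 ltW.
have ni : 0 <= n%:R^-1 :> R by rewrite invr_ge0.
have s0 : 0 <= s by exact: sqrtr_ge0.
rewrite mulrBl (schwinger_dyson n0 a beta0 eta0 DT i Dd) -ExC_gtr -/(yy i).
set E1 := ExC P (fun x => _ * _); set E2 := ExC P (fun x => gtr2 _ _ _ _ _ _).
have -> : 1 + (2 * beta ^+ 2)%:C * E1 + (2 * beta ^+ 2 / n%:R)%:C * E2 -
   (2 * beta ^+ 2)%:C * ExC P (gtr beta a eta D) * yy i - 1 =
   (2 * beta ^+ 2)%:C * (E1 - ExC P (gtr beta a eta D) * yy i) + (2 * beta ^+ 2 / n%:R)%:C * E2 by ring.
have bg := bmc_gtr a beta0 eta0 DT; have bG := bmc_gres a beta0 eta0 DT i i.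
apply: le_trans (ncD _ _) _; apply: lerD; rewrite ncM nc_real ger0_norm; last 1 first.
- by do ?apply: mulr_ge0 => //; exact: sqr_ge0.
- have -> : 128 * beta ^+ 4 / n%:R * s * eta^-1 ^+ 4 =
      2 * beta ^+ 2 * ((8 * beta * n%:R^-1 * eta^-1 ^+ 2) * (8 * beta * s * eta^-1 ^+ 2)) by ring.
  apply: ler_wpM2l; first by apply: mulr_ge0 => //; exact: sqr_ge0.
  have cv : nc (E1 - ExC P (gtr beta a eta D) * yy i) <=
    Num.sqrt (VarC P (gtr beta a eta D)) * Num.sqrt (VarC P (fun x => G x i i)) := covC P bg bG.
  apply: le_trans cv _; apply: ler_pM; rewrite ?sqrtr_ge0//.
    rewrite -[leRHS]ger0_norm -?sqrtr_sqr; last by nonneg.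
    apply: ler_wsqrtr; apply: le_trans (var_gtr n0 a beta0 eta0 DT) _.
    have bv : bmf (vtr beta a eta D) by apply: bmfN; exact: bg.2.
    apply: le_trans (_ : 64 * beta ^+ 2 * n%:R^-1 ^+ 2 * eta^-1 ^+ 3 * eta^-1 <= _).
      apply: ler_wpM2l; first by nonneg.
      rewrite -[leRHS](Ex_cst P); apply: Ex_le => //; first exact: bmf_cst.
      move=> x; apply: le_trans (nc_gtr n0 beta a eta0 DT x).
      by rewrite /vtr -cImN -ncN; exact: le_trans (ler_norm _) (Im_le_nc _).
    by rewrite le_eqVlt; apply/orP; left; apply/eqP; ring.
  rewrite -[leRHS]ger0_norm -?sqrtr_sqr; last by nonneg.
  apply: ler_wsqrtr; apply: le_trans (var_gres n0 a beta0 eta0 DT i i) _.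
  rewrite !exprMn (s_sq R n) le_eqVlt; apply/orP; left; apply/eqP; ring.
- by apply: mulr_ge0 => //; exact: sqr_ge0.
apply: ler_wpM2l; first by nonneg.
have b2 := bmc_gtr2 a beta0 eta0 DT i.
apply: le_trans (nc_ExC P b2) _; rewrite -[leRHS](Ex_cst P); apply: Ex_le.
- exact: bmf_nc.
- exact: bmf_cst.
by move=> x; exact: nc_gtr2.
Qed.

End error.

(** Exceeds 111 * 10400: the Schwinger-Dyson error is at most 10400 q^6 / n, with 10400 = 128 * 81 +
    32, and the stability factor at most (3 + 108) q^9. *)
Definition mean_const : R := 120 * 100 * 100.

(** Since 1/eta <= 3 q^3 / beta, the final error is of order q^15 / n, and [q ^+ 17 <= n] turns this
    into q^-2. The hypothesis with q^12 is the smallness condition of [stability], where 18 * 10400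
    = 187200 is rounded up to 190000. *)
Lemma mean_estimate (beta q : R) (D : 'M[R]_n) : 1 <= beta -> 1 <= q ->
  q ^+ 17 <= n%:R -> (19 * 100 * 100) * q ^+ 12 <= n%:R -> admissible beta D ->
  let b := beta / q in
  forall i, `|Ex P (fun x => - complex.Im (gres beta (atilde beta b D) (btilde beta b D) D x i i)) -
    b / (b ^+ 2 + D i i ^+ 2)| <= mean_const * q^-1 ^+ 2.
Proof.
move=> beta1 q1 q17 q12 aD b i.
have beta0 : 0 < beta := lt_le_trans ltr01 beta1.
have q0 : 0 < q := lt_le_trans ltr01 q1.
have b0 : 0 < b by rewrite divr_gt0.
have bb : b <= beta by rewrite ler_pdivrMr// ler_peMr// ltW.
have nn : 0 < n%:R :> R by rewrite ltr0n.
have DT := adm_sym aD; have [Dd _ _ _] := aD.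
set a := atilde beta b D; set eta := btilde beta b D.
have eta0 : 0 < eta := btilde_gt0 n0 beta1 b0 bb aD.
have etage : beta / (3 * q ^+ 3) <= eta.
  apply: le_trans (btilde_ge n0 beta1 b0 bb aD); rewrite le_eqVlt; apply/orP; left; apply/eqP.
  by rewrite /b; field; rewrite !gt_eqF.
have etai : eta^-1 <= 3 * q ^+ 3 / beta.
  rewrite -[leRHS]invrK lef_pV2 ?posrE ?invr_gt0//; last by posit.
  by rewrite invf_div.
have i0 : 0 <= eta^-1 by rewrite invr_ge0 ltW.
pose t := 3 * q ^+ 3 / beta.
have t0 : 0 <= t by rewrite /t; nonneg.
have s0 : 0 <= s by exact: sqrtr_ge0.
(* The factor n^(-1/2) is traded for q^-8, which more than pays for the q^6 by which eta^-4 exceeds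
   eta^-2. *)
have sq8 : s <= (q ^+ 8)^-1.
  rewrite -(ler_pXn2r (n := 2)) ?nnegrE//; last by nonneg.
  rewrite s_sq exprVn lef_pV2 ?posrE ?exprn_gt0// -exprM; apply: le_trans q17.
  by rewrite ler_weXn2l.
pose eps := 128 * beta ^+ 4 * n%:R^-1 * s * eta^-1 ^+ 4 + 2 * beta ^+ 2 * n%:R^-1 * eta^-1 ^+ 2.
pose eps1 := (104 * 100) * q ^+ 6 / n%:R.
have eps0 : 0 <= eps by rewrite /eps; nonneg.
have epsle : eps <= eps1.
  have pw k : eta^-1 ^+ k <= t ^+ k by rewrite lerXn2r ?nnegrE.
  have -> : eps1 = (128 * 81) * q ^+ 6 / n%:R + 32 * q ^+ 6 / n%:R by rewrite /eps1; field; rewrite gt_eqF.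
  apply: lerD.
    apply: le_trans (_ : 128 * beta ^+ 4 / n%:R * (q ^+ 8)^-1 * t ^+ 4 <= _).
      apply: ler_pM => //; [by nonneg|by nonneg|].
      by apply: ler_wpM2l => //; nonneg.
    have -> : 128 * beta ^+ 4 / n%:R * (q ^+ 8)^-1 * t ^+ 4 = (128 * 81) * q ^+ 4 / n%:R.
      by rewrite /t; field; rewrite !gt_eqF.
    apply: ler_wpM2r; first by nonneg.
    by apply: ler_wpM2l => //; rewrite ler_weXn2l.
  apply: le_trans (_ : 2 * beta ^+ 2 / n%:R * t ^+ 2 <= _).
    by apply: ler_wpM2l => //; nonneg.
  have -> : 2 * beta ^+ 2 / n%:R * t ^+ 2 = 18 * q ^+ 6 / n%:R.
    by rewrite /t; field; rewrite !gt_eqF.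
  apply: ler_wpM2r; first by nonneg.
  by apply: ler_wpM2r; [nonneg|lra].
have cond : 2 * beta ^+ 2 * eps <= eta ^+ 2.
  apply: le_trans (_ : (beta / (3 * q ^+ 3)) ^+ 2 <= _); last first.
    by rewrite lerXn2r ?nnegrE//; [rewrite divr_ge0//; nonneg|exact: ltW].
  apply: le_trans (_ : 2 * beta ^+ 2 * eps1 <= _); first by apply: ler_wpM2l => //; nonneg.
  have -> : 2 * beta ^+ 2 * eps1 = (beta / (3 * q ^+ 3)) ^+ 2 * ((18 * (104 * 100)) * q ^+ 12 / n%:R).
    by rewrite /eps1; field; rewrite !gt_eqF.
  rewrite -[leRHS]mulr1; apply: ler_wpM2l; first exact: sqr_ge0.
  rewrite ler_pdivrMr// mul1r; apply: le_trans q12; apply: ler_wpM2r; first by nonneg.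
  by lra.
have zE : a +i* eta = 0 +i* b + (2 * beta ^+ 2)%:C *
    ((n%:R^-1)%:C * \sum_i (0 +i* b + (D i i)%:C)^-1).
  have -> : a +i* eta = ztilde beta b D by rewrite /a /eta /atilde /btilde; case: (ztilde _ _ _).
  rewrite /ztilde (g_negE n0 aD)// => k.
  by rewrite eq_complex /= negb_and add0r addr0 (gt_eqF b0) orbT.
pose yy k := ExC P (fun x => gres beta a eta D x k k).
pose er k := (a +i* eta + (D k k)%:C - (2 * beta ^+ 2)%:C * ((n%:R^-1)%:C * \sum_i yy i)) * yy k - 1.
have := @stability R n n0 beta b a eta eps (fun k => D k k) yy er beta0 b0 eta0 zE
  (btildeE1 n0 b0 aD).
move=> H; apply: le_trans (_ : eps / eta + 4 * beta ^+ 2 * eps / eta ^+ 3 <= _).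
  have H1 : nc (yy i - (0 +i* b + (D i i)%:C)^-1) <= eps / eta + 4 * beta ^+ 2 * eps / eta ^+ 3.
    apply: H cond i.
    - by move=> k; rewrite /er [RHS]addrC subrK.
    - rewrite -oppr_ge0 -(Ex_vtr a (ltW beta0) eta0 DT); apply: Ex_ge0.
        by apply: bmfN; have [] := bmc_gtr a (ltW beta0) eta0 DT.
      by move=> x; apply: vtr_ge0.
    - by move=> k; apply: sd_error => //; exact: ltW.
  apply: le_trans H1.
  rewrite invC_ib//; apply: le_trans (Im_le_nc _).
    rewrite cImD cImN /= opprK ExN; last by have [] := bmc_gres a (ltW beta0) eta0 DT i i.
    by rewrite -normrN opprB opprK addrC.
have -> : eps / eta + 4 * beta ^+ 2 * eps / eta ^+ 3 = eps * (eta^-1 + 4 * beta ^+ 2 * eta^-1 ^+ 3).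
  by field; rewrite gt_eqF.
have tt : eta^-1 + 4 * beta ^+ 2 * eta^-1 ^+ 3 <= 111 * q ^+ 9.
  have : eta^-1 <= 3 * q ^+ 9.
    apply: le_trans etai _; rewrite -mulrA; apply: ler_wpM2l => //.
    apply: le_trans (_ : q ^+ 3 <= _); last by rewrite ler_weXn2l.
    by rewrite ler_pdivrMr// ler_peMr// exprn_ge0// ltW.
  have : 4 * beta ^+ 2 * eta^-1 ^+ 3 <= 108 * q ^+ 9.
    apply: le_trans (_ : 4 * beta ^+ 2 * t ^+ 3 <= _).
      by apply: ler_wpM2l; [nonneg|rewrite lerXn2r ?nnegrE].
    have -> : 4 * beta ^+ 2 * t ^+ 3 = 108 * q ^+ 9 / beta by rewrite /t; field; rewrite gt_eqF.
    by rewrite ler_pdivrMr// ler_peMr//; nonneg.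
  by lra.
apply: le_trans (ler_pM eps0 _ epsle tt) _; first by nonneg.
have -> : eps1 * (111 * q ^+ 9) = (111 * (104 * 100)) * q^-1 ^+ 2 * (q ^+ 17 / n%:R).
  by rewrite /eps1; field; rewrite !gt_eqF.
apply: le_trans (_ : (111 * (104 * 100)) * q^-1 ^+ 2 * 1 <= _).
  by apply: ler_wpM2l; [nonneg|rewrite ler_pdivrMr// mul1r].
by rewrite mulr1 /mean_const; apply: ler_wpM2r; [nonneg|lra].
Qed.

End mean_estimate.

(** * Operator norm of A_sym *)

(** Continuity from above. It supplies a level at which the operator norm can be truncated to a
    bounded function, in place of a moment estimate. *)
Lemma probability_tail d (T : measurableType d) (R : realType) (P : probability T R)
    (f : T -> R) (e : R) : measurable_fun setT f -> 0 < e ->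
  exists2 M : R, 0 <= M & fine (P [set x | M < f x]) <= e.
Proof.
move=> mf e0; pose F (k : nat) := [set x | k%:R < f x].
have mF k : measurable (F k).
  have -> : F k = ~` [set x | f x <= k%:R].
    by apply/seteqP; split => x /=; rewrite /F /= ltNge => /negP.
  by apply: measurableC; exact: measurable_set_le.
have F0 : \bigcap_k F k = set0.
  apply/seteqP; split => // x /= h.
  have := h (Num.truncn (f x)).+1 I; rewrite /F /= ltNge ltW//.
  by apply: truncnS_gt.
have cv : (P \o F) k @[k --> \oo] --> P (\bigcap_k F k).
  apply: nonincreasing_cvg_mu => //.
  - by apply: (le_lt_trans (probability_le1 P (mF 0%N))); rewrite ltry.
  - by rewrite F0.
  - by move=> i j ij; apply/subsetPset => x; apply: le_lt_trans; rewrite ler_nat.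
move: cv; rewrite F0 measure0 => /fine_cvgP [_ /cvgrPdist_le /(_ e e0) [N _ h]].
exists N%:R => //; have := h N (leqnn N); rewrite /= sub0r normrN.
exact: le_trans (ler_norm _).
Qed.

Section outlier.
Context (R : realType).

Lemma le_of_sq (a b : R) : 0 <= b -> a ^+ 2 <= b ^+ 2 -> a <= b.
Proof.
move=> b0 ab; apply: le_trans (ler_norm a) _.
by rewrite -(ler_pXn2r (n := 2)) ?nnegrE// real_normK ?num_real.
Qed.

Let b01 : (0 : R) <= 1. Proof. exact: ler01. Qed.

(* The self-consistent equation z y = 1 + 2 y^2 + e at z = a + i eta, y = u - i v, for real a
   outside the support [-sqrt 8, sqrt 8]: v/eta hardly depends on eta. *)
Lemma self_consistent_outside (a eta u v k e1 e2 : R) :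
  285 / 100 <= a -> 0 < eta -> eta <= 10^-1 ^+ 3 -> 0 <= v -> 0 <= k -> k <= eta / 100 ->
  `|e1| <= k * v -> `|e2| <= k * v ->
  a * u + eta * v = 1 + 2 * u ^+ 2 - 2 * v ^+ 2 + e1 ->
  v * (a - 4 * u) = eta * u - e2 ->
  `|v / eta - (a / Num.sqrt (a ^+ 2 - 8) - 1) / 4| <= 3 * eta.
Proof.
move=> a1 eta0 eta1 v0 k0 ke; rewrite ler_norml => /andP [e1l e1u].
rewrite ler_norml => /andP [e2l e2u] hR hI.
set r := Num.sqrt _.
have a0 : 0 < a by lra.
have r2 : r ^+ 2 = a ^+ 2 - 8 by rewrite sqr_sqrtr//; nra.
have r00 : 0 <= r by exact: sqrtr_ge0.
(* 2.85^2 - 8 = 0.35^2, whence the lower bound on r; 8.2 exceeds 2.85 / 0.35. *)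
have a2 : 285 / 100 * (285 / 100) <= a ^+ 2 by nra.
have rl : 35 / 100 <= r by apply: le_of_sq => //; rewrite r2; lra.
have r0 : 0 < r by lra.
have ar : a <= 82 / 10 * r.
  by apply: le_of_sq; [apply: mulr_ge0 => //; lra|rewrite exprMn r2; lra].
(* S = Re (z - 4 y), and z - 4 y is a square root of z^2 - 8 up to the error; it is compared with r,
   the positive root at eta = 0. *)
pose S := a - 4 * u.
have uE : u = (a - S) / 4 by rewrite /S; field.
have S2 : S ^+ 2 = r ^+ 2 + 8 * (eta * v + 2 * v ^+ 2 - e1).
  by rewrite r2 /S; move: hR => /(congr1 (fun t => 8 * t)); lra.
have kv : k * v <= eta * v by apply: ler_wpM2r => //; lra.
have S2r : r ^+ 2 <= S ^+ 2.
  by rewrite S2 lerDl; apply: mulr_ge0 => //; have := sqr_ge0 v; lra.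
have k1 : k <= 10^-1 ^+ 5 by apply: le_trans ke _; lra.
have S0 : 0 < S.
  (* The other branch: for S <= -r the imaginary part of the equation would force eta u <= 0,
     whereas u > 0. *)
  rewrite ltNge; apply/negP => Sn.
  have Sr : r <= - S by apply: le_of_sq; [lra|rewrite sqrrN].
  have u0 : 0 < eta * u by apply: mulr_gt0 => //; lra.
  have : eta * u <= v * (S + k) by move: hI; rewrite -/S => hI; lra.
  have : v * (S + k) <= 0 by apply: mulr_ge0_le0 => //; lra.
  by lra.
have rS : r <= S by apply: le_of_sq => //; exact: ltW.
have vle : v <= 41 / 10 * eta.
  have h1 : v * (S - k) <= eta * a / 4.
    have : eta * u <= eta * a / 4 by rewrite -mulrA; apply: ler_wpM2l; [exact: ltW|lra].
    by move: hI; rewrite -/S => hI; lra.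
  have h2 : v * (r / 2) <= v * (S - k) by apply: ler_wpM2l => //; lra.
  have h3 : eta * a <= eta * (82 / 10 * r) by apply: ler_wpM2l => //; exact: ltW.
  have : r * v <= r * (41 / 10 * eta) by lra.
  by rewrite ler_pM2l.
have eta2 : eta ^+ 2 <= 10^-1 ^+ 3 * eta by rewrite expr2; apply: ler_wpM2r => //; exact: ltW.
have Sr2 : S ^+ 2 - r ^+ 2 <= 304 * eta ^+ 2.
  have : v ^+ 2 <= (41 / 10 * eta) ^+ 2 by rewrite lerXn2r ?nnegrE//; lra.
  have : eta * v <= eta * (41 / 10 * eta) by apply: ler_wpM2l => //; exact: ltW.
  have : k * v <= eta / 100 * (41 / 10 * eta) by apply: ler_pM.
  by rewrite S2; lra.
have E : v / eta - (a / r - 1) / 4 = - (e2 / (eta * S)) - (a / r) * (S - r) / (4 * S).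
  have -> : v = (eta * u - e2) / S by rewrite -hI -/S mulfK// gt_eqF.
  by rewrite uE; field; rewrite !gt_eqF.
rewrite E; apply: le_trans (ler_normB _ _) _; rewrite normrN.
have b1 : `|e2 / (eta * S)| <= 4^-1 * eta.
  rewrite normrM [X in _ * X]ger0_norm; last by rewrite invr_ge0 mulr_ge0// ltW.
  rewrite ler_pdivrMr ?mulr_gt0//; apply: le_trans (_ : k * v <= _).
    by rewrite ler_norml e2l e2u.
  apply: le_trans (_ : eta / 100 * (41 / 10 * eta) <= _); first exact: ler_pM.
  have : eta ^+ 2 * (35 / 100) <= eta ^+ 2 * S by apply: ler_wpM2l; [exact: sqr_ge0|lra].
  by have := sqr_ge0 eta; lra.
have b2 : `|(a / r) * (S - r) / (4 * S)| <= 11 / 4 * eta.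
  have Sr0 : 0 <= S - r by rewrite subr_ge0.
  rewrite ger0_norm; last by nonneg.
  have h1 : S - r <= 304 / (2 * (35 / 100)) * eta ^+ 2.
    have : (S - r) * (2 * (35 / 100)) <= (S - r) * (S + r) by apply: ler_wpM2l; lra.
    have -> : (S - r) * (S + r) = S ^+ 2 - r ^+ 2 by ring.
    by lra.
  have h2 : a / r <= 82 / 10 by rewrite ler_pdivrMr.
  rewrite ler_pdivrMr ?mulr_gt0//.
  apply: le_trans (_ : 82 / 10 * (304 / (2 * (35 / 100)) * eta ^+ 2) <= _).
    by apply: ler_pM; [rewrite divr_ge0// ltW|exact: Sr0|exact: h2|exact: h1].
  have : eta * (35 / 100) <= eta * S by apply: ler_wpM2l; lra.
  by lra.
by lra.
Qed.

Lemma two_gaps (x1 x2 x3 x4 c e f : R) : `|x1 - c| <= 3 * e -> `|x2 - c| <= 3 * f ->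
  `|x3 - c| <= 3 * e -> `|x4 - c| <= 3 * f -> x1 - x2 + (x3 - x4) <= 6 * e + 6 * f.
Proof.
by rewrite !ler_norml => /andP [? ?] /andP [? ?] /andP [? ?] /andP [? ?]; lra.
Qed.

Variables (n : nat) (n0 : (0 < n)%N).
Notation T := ((n * n).-tuple (measurableTypeR R)).
Notation s := (Num.sqrt (n%:R^-1 : R)).
Notation P := (gaussm s (n * n)).

Definition hermx (x : T) : 'M[R]_n := 2 *: sym_part (tmx x).

Lemma opnorm_hermx_lipschitz x y : `|opnorm (hermx x) - opnorm (hermx y)| <= 2 * Num.sqrt (dist2 x y).
Proof.
have h z w : opnorm (hermx z) - opnorm (hermx w) <= 2 * Num.sqrt (dist2 z w).
  rewrite lerBlDl; apply: le_trans (opnorm_lipschitz _ (hermx w)) _; rewrite lerD2l.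
  have -> : hermx z - hermx w = xmx 1 0 0 (tmx w) - xmx 1 0 0 (tmx z).
    by apply/matrixP => i j; rewrite !mxE; ring.
  apply: le_trans (fr_xmxB _ _ _ _ _) _ => //.
  by rewrite mulr1 dist2C -fr_tmx.
by rewrite ler_norml lerNl opprB; apply/andP; split; [rewrite dist2C|]; exact: h.
Qed.

Lemma measurable_opnorm_hermx : measurable_fun setT (fun x => opnorm (hermx x)).
Proof. exact: lipschitz_measurable opnorm_hermx_lipschitz. Qed.

Let D0T : (0 : 'M[R]_n)^T = 0. Proof. exact: trmx0. Qed.

Let D0d : is_diag_mx (0 : 'M[R]_n). Proof. by apply/is_diag_mxP => i j _; rewrite mxE. Qed.

(** The equation is averaged over i before it is estimated: the covariance becomes the variance of
    the trace, and by the Ward identity both error terms are multiples of E v. An error proportional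
    to v is what [self_consistent_outside] can absorb. *)
Lemma sd_trace (a eta : R) (y := ExC P (gtr 1 a eta (0 : 'M[R]_n))) : 0 < eta ->
  nc ((a +i* eta) * y - 1 - 2%:C * y ^+ 2) <=
  (128 * n%:R^-1 ^+ 2 * eta^-1 ^+ 3 + 2 * n%:R^-1 * eta^-1) * Ex P (vtr 1 a eta (0 : 'M[R]_n)).
Proof.
move=> eta0; have ni : 0 <= n%:R^-1 :> R by rewrite invr_ge0.
have nn : n%:R != 0 :> R by rewrite pnatr_eq0 -lt0n.
have bg := bmc_gtr a b01 eta0 D0T.
have bG i : bmc (fun x => gres 1 a eta (0 : 'M[R]_n) x i i) by exact: bmc_gres.
have b2 i : bmc (fun x => gtr2 1 a eta (0 : 'M[R]_n) x i) by exact: bmc_gtr2.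
set V := Ex P _.
set E2 := ExC P (fun x => \sum_i gtr2 1 a eta (0 : 'M[R]_n) x i).
have main : (a +i* eta) * y = 1 + 2%:C * ExC P (fun x => gtr 1 a eta (0 : 'M[R]_n) x * gtr 1 a eta 0 x)
    + (2 * n%:R^-1 ^+ 2)%:C * E2.
  have Ey : y = (n%:R^-1)%:C * \sum_i ExC P (fun x => gres 1 a eta (0 : 'M[R]_n) x i i) by exact: ExC_gtr.
  have Egg : ExC P (fun x => gtr 1 a eta (0 : 'M[R]_n) x * gtr 1 a eta 0 x) =
      (n%:R^-1)%:C * \sum_i ExC P (fun x => gtr 1 a eta (0 : 'M[R]_n) x * gres 1 a eta (0 : 'M[R]_n) x i i).
    rewrite -ExC_sum => [|i]; last by apply/bmc_igc/bmcM.
    rewrite -ExCZ; last by apply/bmc_igc/bmc_sum => i; exact: bmcM.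
    by congr ExC; apply/funext => x; rewrite {2}/gtr mulrCA mulr_sumr.
  have sd i : (a +i* eta) * ExC P (fun x => gres 1 a eta (0 : 'M[R]_n) x i i) =
      1 + 2%:C * ExC P (fun x => gtr 1 a eta (0 : 'M[R]_n) x * gres 1 a eta (0 : 'M[R]_n) x i i) +
      (2 * n%:R^-1)%:C * ExC P (fun x => gtr2 1 a eta (0 : 'M[R]_n) x i).
    have := schwinger_dyson n0 a b01 eta0 D0T i D0d.
    by rewrite mxE rmorph0 addr0 expr1n mulr1.
  rewrite Ey mulrCA mulr_sumr; under eq_bigr do rewrite sd.
  rewrite !big_split /= sumr_const card_ord -!mulr_sumr.
  have -> : \sum_i ExC P (fun x => gtr2 1 a eta (0 : 'M[R]_n) x i) = E2.
    by rewrite /E2 ExC_sum// => i; exact: bmc_igc.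
  rewrite Egg !mulrDr; congr (_ + _ + _).
  - by rewrite -[1 *+ n]/(n%:R) -(rmorph_nat (real_complex R)) -rmorphM mulVf.
  - by rewrite mulrCA.
  - by rewrite mulrA -rmorphM; congr (_%:C * _); ring.
rewrite main.
have -> : forall X Y : R[i], 1 + 2%:C * X + Y - 1 - 2%:C * y ^+ 2 = 2%:C * (X - y * y) + Y by move=> X Y; ring.
rewrite [leRHS]mulrDl; apply: le_trans (ncD _ _) _; apply: lerD; rewrite ncM nc_real ger0_norm//.
- have cv := covC P bg bg; rewrite -[X in _ <= X]expr2 sqr_sqrtr in cv; last exact: VarC_ge0.
  have -> : 128 * n%:R^-1 ^+ 2 * eta^-1 ^+ 3 * V = 2 * (64 * 1 ^+ 2 * n%:R^-1 ^+ 2 * eta^-1 ^+ 3 * V) by ring.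
  apply: ler_wpM2l => //; apply: le_trans cv _.
  by apply: le_trans (var_gtr n0 a b01 eta0 D0T) _.
- have -> : 2 / n%:R / eta * V = 2 * n%:R^-1 ^+ 2 * (n%:R * V * eta^-1) by field; rewrite nn gt_eqF.
  apply: ler_wpM2l; first by nonneg.
  have bv : bmf (vtr 1 a eta (0 : 'M[R]_n)) by apply: bmfN; exact: bg.2.
  have bS : bmc (fun x => \sum_i gtr2 1 a eta (0 : 'M[R]_n) x i) by exact: bmc_sum.
  apply: le_trans (nc_ExC P bS) _.
  have -> : n%:R * V * eta^-1 = Ex P (fun x => n%:R * eta^-1 * vtr 1 a eta (0 : 'M[R]_n) x).
    by rewrite ExZ// mulrAC.
  apply: Ex_le => [||x]; [exact: bmf_nc|exact: bmfZ|].
  by apply: le_trans (sum_gtr2 n0 1 a eta0 D0T x) _; rewrite mulrAC.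
Qed.

Notation vt a eta := (vtr 1 a eta (0 : 'M[R]_n)).

(** At height eta = t n^(-1/2) the relative error k is (128 / t^3 + 2 / t) n^(-1/2), which is at
    most eta / 100 as soon as t >= 40. Both signs of a are treated since only the modulus of the
    outlying eigenvalue is known. *)
Lemma vtr_outside (a t eta : R) (sg : bool) : 285 / 100 <= a -> eta = t * s ->
  40 <= t -> t <= 80 -> s <= 10^-1 ^+ 7 ->
  `|Ex P (vt ((-1) ^+ sg * a) eta) / eta - (a / Num.sqrt (a ^+ 2 - 8) - 1) / 4| <= 3 * eta.
Proof.
move=> a1 etaE t40 t80 s7; have s0 := s_gt0 R n0; rewrite {eta}etaE; set eta := t * s.
have eta0 : 0 < eta by apply: mulr_gt0 => //; lra.
set a' := (-1) ^+ sg * a; have := sd_trace a' eta0; set y := ExC P _.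
pose k : R := 128 * n%:R^-1 ^+ 2 * eta^-1 ^+ 3 + 2 * n%:R^-1 * eta^-1.
rewrite -/k; set v := Ex P _ => H.
have vE : v = - complex.Im y.
  by rewrite /v /vtr ExN//; have [] := bmc_gtr a' b01 eta0 D0T.
have v0 : 0 <= v.
  apply: Ex_ge0 => [|x]; last exact: vtr_ge0.
  by apply: bmfN; have [] := bmc_gtr a' b01 eta0 D0T.
have k0 : 0 <= k by apply: addr_ge0; nonneg.
have ke : k <= eta / 100.
  have gen (r m : R) : r != 0 -> r ^+ 2 = m ->
      128 * m ^+ 2 * (t * r)^-1 ^+ 3 + 2 * m * (t * r)^-1 = (128 / t ^+ 3 + 2 / t) * r.
    by move=> r0 <-; field; rewrite r0 gt_eqF//; lra.
  have -> : k = (128 / t ^+ 3 + 2 / t) * s := gen _ _ (lt0r_neq0 s0) (s_sq R n).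
  rewrite /eta mulrAC; apply: ler_wpM2r; first exact: ltW.
  have t0 : 0 < t by lra.
  have -> : 128 / t ^+ 3 + 2 / t = (128 + 2 * t ^+ 2) / t ^+ 3 by field; rewrite gt_eqF.
  rewrite ler_pdivrMr ?exprn_gt0// mulrAC -exprS.
  have : 1600 <= t ^+ 2 by rewrite expr2; nra.
  have : (t ^+ 2) * (t ^+ 2) >= 1600 * t ^+ 2 by apply: ler_wpM2r; [exact: sqr_ge0|rewrite expr2; nra].
  by rewrite -exprD; lra.
have eta1 : eta <= 10^-1 ^+ 3.
  have : t * s <= 80 * 10^-1 ^+ 7 by apply: ler_pM; [lra|exact: ltW|lra|exact: s7].
  by rewrite /eta; lra.
pose e := (a' +i* eta) * y - 1 - 2%:C * y ^+ 2.
pose u := complex.Re y.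
have yE : y = u +i* (- v) by rewrite vE opprK /u; case: (y).
have hR : a' * u + eta * v = 1 + 2 * u ^+ 2 - 2 * v ^+ 2 + complex.Re e.
  by rewrite /e yE expr2 /=; ring.
have hI : eta * u - a' * v = - 4 * u * v + complex.Im e.
  by rewrite /e yE expr2 /=; ring.
have eR : `|complex.Re e| <= k * v by apply: le_trans (Re_le_nc _) H.
have eI : `|complex.Im e| <= k * v by apply: le_trans (Im_le_nc _) H.
move: hR hI; rewrite /a'; case: (sg); rewrite ?expr1 ?expr0 ?mul1r ?mulN1r => hR hI.
  apply: (self_consistent_outside (u := - u) a1 eta0 eta1 v0 k0 ke eR (e2 := - complex.Im e)).
  - by rewrite normrN.
  - by rewrite sqrrN -hR; ring.
  - by move: hI; lra.
apply: (self_consistent_outside (u := u) a1 eta0 eta1 v0 k0 ke eR eI hR).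
by move: hI; lra.
Qed.

Lemma vtr_kmx a eta x : 0 < eta -> vt a eta x / eta = n%:R^-1 * \tr (kmx eta (hermx x - a%:M)).
Proof.
move=> eta0; have nn : n%:R != 0 :> R by rewrite pnatr_eq0 -lt0n.
have -> : vt a eta x / eta = n%:R^-1 * (n%:R * vt a eta x * eta^-1) by field; rewrite nn gt_eqF.
rewrite -fro_gres// fro_res//; last by apply: xmx_sym.
congr (_ * \tr (invmx (_ + _))).
have -> : xmx 1 a 0 (tmx x) = - (hermx x - a%:M) by apply/matrixP => i j; rewrite !mxE; ring.
by rewrite mulNmx mulmxN opprK.
Qed.

Lemma hermx_sym x : (hermx x)^T = hermx x.
Proof. by apply/matrixP => i j; rewrite !mxE addrC. Qed.

#[local] Opaque vtr kmx hermx.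

Lemma vtr_gap a e f x : 0 < e -> 0 < f -> vt a e x / e - vt a f x / f =
  n%:R^-1 * (\tr (kmx e (hermx x - a%:M)) - \tr (kmx f (hermx x - a%:M))).
Proof. by move=> e0 f0; rewrite mulrBr; congr (_ - _); exact: vtr_kmx. Qed.

(* On the window |opnorm - a| <= 12/sqrt n one eigenvalue near a or -a separates the
   resolvents at heights 40/sqrt n and 80/sqrt n. *)
Lemma outlier_gap a e f x : e = 40 * s -> f = 80 * s -> `|opnorm (hermx x) - a| <= 12 * s ->
  4 * 10^-1 ^+ 4 <= (vt a e x / e - vt a f x / f) + (vt (- a) e x / e - vt (- a) f x / f).
Proof.
move=> eE fE xa; have s0 := s_gt0 R n0.
have [l lO tr] := trace_outlier n0 (hermx_sym x).
have e40 : 0 < e by rewrite eE mulr_gt0.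
have e80 : 0 < f by rewrite fE mulr_gt0.
have e48 : e <= f by rewrite eE fE; apply: ler_wpM2r; [exact: ltW|lra].
suff h : 4 * 10^-1 ^+ 4 <=
    n%:R^-1 * (\tr (kmx e (hermx x - a%:M)) - \tr (kmx f (hermx x - a%:M))) +
    n%:R^-1 * (\tr (kmx e (hermx x - (- a)%:M)) - \tr (kmx f (hermx x - (- a)%:M))).
  by apply: le_trans h _; apply: lerD; rewrite le_eqVlt; apply/orP; left; apply/eqP;
    apply/esym; exact: vtr_gap.
have fE' r : ((40 * s) ^+ 2 + r ^+ 2)^-1 - ((80 * s) ^+ 2 + r ^+ 2)^-1 =
   4800 * s ^+ 2 / (((40 * s) ^+ 2 + r ^+ 2) * ((80 * s) ^+ 2 + r ^+ 2)).
  have p c : 0 < c -> (c * s) ^+ 2 + r ^+ 2 != 0.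
    by move=> c0; rewrite gt_eqF// ltr_wpDr ?sqr_ge0// exprn_gt0// mulr_gt0.
  by field; rewrite !p.
have f0 r : 0 <= (e ^+ 2 + r ^+ 2)^-1 - (f ^+ 2 + r ^+ 2)^-1.
  by rewrite eE fE fE'; apply: mulr_ge0; [nonneg|rewrite invr_ge0; nonneg].
(* 4800 = 80^2 - 40^2, and 4800 / (1744 * 6544) exceeds 4 * 10^-4. *)
have fw r : `|r| <= 12 * s -> 4 * 10^-1 ^+ 4 <=
    s ^+ 2 * (((40 * s) ^+ 2 + r ^+ 2)^-1 - ((80 * s) ^+ 2 + r ^+ 2)^-1).
  move=> rs; rewrite fE'.
  have r2 : r ^+ 2 <= 144 * s ^+ 2.
    have -> : 144 * s ^+ 2 = (12 * s) ^+ 2 by ring.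
    by rewrite -real_normK ?num_real// lerXn2r ?nnegrE//; apply: mulr_ge0 => //; exact: ltW.
  have den : ((40 * s) ^+ 2 + r ^+ 2) * ((80 * s) ^+ 2 + r ^+ 2) <= (1744 * s ^+ 2) * ((2 * 3272) * s ^+ 2).
    by apply: ler_pM; [nonneg|nonneg| |]; rewrite exprMn; lra.
  have den0 : 0 < ((40 * s) ^+ 2 + r ^+ 2) * ((80 * s) ^+ 2 + r ^+ 2).
    by apply: mulr_gt0; apply: ltr_wpDr; rewrite ?sqr_ge0// exprn_gt0// mulr_gt0.
  rewrite mulrA ler_pdivlMr//.
  apply: le_trans (ler_wpM2l _ den) _; first by nonneg.
  have -> : 4 * 10^-1 ^+ 4 * (1744 * s ^+ 2 * (2 * 3272 * s ^+ 2)) =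
     (4 * 10^-1 ^+ 4 * (1744 * (2 * 3272))) * (s ^+ 2 * s ^+ 2) by ring.
  have -> : s ^+ 2 * (4800 * s ^+ 2) = 4800 * (s ^+ 2 * s ^+ 2) by ring.
  by apply: ler_wpM2r; [nonneg|lra].
have trp := tr _ _ a e40 e48; have trm := tr _ _ (- a) e40 e48.
have fw' r : `|r| <= 12 * s -> 4 * 10^-1 ^+ 4 <=
    n%:R^-1 * ((e ^+ 2 + r ^+ 2)^-1 - (f ^+ 2 + r ^+ 2)^-1).
  by move=> rs; have := fw r rs; rewrite eE fE s_sq.
have mon (A B : R) : A <= B -> n%:R^-1 * A <= n%:R^-1 * B by move=> ?; apply: ler_wpM2l; rewrite ?invr_ge0.
have := mon _ _ trp; have := mon _ _ trm.
have := mon _ _ (f0 (l - a)); have := mon _ _ (f0 (l - - a)); rewrite mulr0.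
have [l0|l0] := leP 0 l.
  have lO' : opnorm (hermx x) = l by rewrite -lO ger0_norm.
  by rewrite lO' in xa; have := fw' (l - a) xa; lra.
have lO' : opnorm (hermx x) = - l by rewrite -lO ltr0_norm.
have lE : l - - a = - (- l - a) by ring.
have xa' : `|l - - a| <= 12 * s by rewrite lE normrN -lO'.
by have := fw' (l - - a) xa'; lra.
Qed.

(** Poincare's inequality confines the norm, with probability at least 3/4, to a window of radius 12
    n^(-1/2) around an unknown a, the mean of the truncated norm. If a < 2.85, the window lies below
    2.9. Otherwise [outlier_gap] forces an expected gap of at least 3 * 10^-4 between the two
    heights, while [vtr_outside] allows at most 720 n^(-1/2). *)
Lemma opnorm_quarter : s <= 10^-1 ^+ 7 ->
  4^-1 <= fine (P [set x | opnorm (hermx x) <= 29 / 10]).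
Proof.
move=> s7; have s0 := s_gt0 R n0.
have mO := measurable_opnorm_hermx.
have e100 : 0 < 100^-1 :> R by rewrite invr_gt0.
have [M M0 tailM] := probability_tail P mO e100.
pose f x := Num.min (opnorm (hermx x)) M.
have fl x y : `|f x - f y| <= 2 * Num.sqrt (dist2 x y).
  apply: le_trans (opnorm_hermx_lipschitz x y); rewrite /f.
  have g (p q : R) : Num.min p M - Num.min q M <= `|p - q|.
    by have := ler_norm (p - q); have := normr_ge0 (p - q); case: (leP p M); case: (leP q M); lra.
  by rewrite ler_norml g andbT lerNl opprB distrC g.
have bf : bmf f.
  apply: (lipschitz_bmf fl (M := M)) => x.
  by rewrite ger0_norm ?le_min ?opnorm_ge0// ge_min lexx orbT.
set a := Ex P f; pose g x := (f x - a) ^+ 2.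
have bg : bmf g by apply: bmfX; apply: bmfB => //; exact: bmf_cst.
have Eg : Ex P g <= 32 * s ^+ 2.
  have H : Ex P g <= 8 * s ^+ 2 * Ex P (fun=> 2 ^+ 2).
    apply: (@gaussm_poincare R (n * n) s s0 f (fun=> 2 ^+ 2) 0 bf) => //.
    - exact: bmf_cst.
    - move=> x y; rewrite mul0r addr0 sqrtr_sqr ger0_norm//.
      exact: le_trans (ler_norm _) (fl x y).
  by apply: le_trans H _; rewrite Ex_cst le_eqVlt; apply/orP; left; apply/eqP; ring.
pose B1 := [set x | 144 * s ^+ 2 < g x]; pose B2 := [set x | M < opnorm (hermx x)].
have mB (h : T -> R) c : measurable_fun setT h -> measurable [set x | c < h x].
  move=> mh; have -> : [set x | c < h x] = ~` [set x | h x <= c].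
    by apply/seteqP; split => x /=; rewrite ltNge => /negP.
  by apply: measurableC; exact: measurable_set_le.
have mB1 : measurable B1 by apply: mB; exact: bg.1.
have mB2 : measurable B2 by exact: mB.
(* Chebyshev's inequality: the variance is at most 32 s^2, and 32 / 144 = 2 / 9. *)
have PB1 : fine (P B1) <= 2 / 9.
  apply: le_trans (Ex_markov _ bg _ _) _ => [x||].
  - exact: sqr_ge0.
  - by rewrite mulr_gt0// exprn_gt0.
  by rewrite ler_pdivrMr; [lra|rewrite mulr_gt0// exprn_gt0].
have bI (A : set T) : measurable A -> bmf (\1_A : T -> R) by exact: bmf_indic.
have PB12 : 3 / 4 <= Ex P (fun x => 1 - \1_B1 x - \1_B2 x).
  rewrite ExB ?ExB ?Ex_cst ?Ex_indic//; try exact: bI.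
  - by have := tailM; rewrite -/B2; lra.
  - exact: bmf_cst.
  - by apply: bmfB; [exact: bmf_cst|exact: bI].
have b12 : bmf (fun x => 1 - \1_B1 x - \1_B2 x : R).
  by apply: bmfB; [apply: bmfB; [exact: bmf_cst|exact: bI]|exact: bI].
have win x : ~ B1 x -> ~ B2 x -> `|opnorm (hermx x) - a| <= 12 * s.
  move=> /negP; rewrite -leNgt => h1 /negP; rewrite -leNgt => h2.
  have fx : f x = opnorm (hermx x) by rewrite /f; case: leP h2.
  rewrite -fx; apply: le_of_sq; first by nonneg.
  by rewrite real_normK ?num_real//; apply: le_trans h1 _; rewrite exprMn; lra.
have lei x : x \in B1 \/ x \in B2 -> 1 - \1_B1 x - \1_B2 x <= 0 :> R.
  by rewrite !indicE; case: (x \in B1); case: (x \in B2) => -[]//= _; lra.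
have [a285|a285] := leP (285 / 100) a; last first.
  rewrite -(Ex_indic P); last exact: measurable_set_le.
  apply: le_trans (_ : 3 / 4 <= _); first by lra.
  apply: le_trans PB12 _; apply: Ex_le => //; first by apply: bI; exact: measurable_set_le.
  move=> x; have [xB1|xB1] := boolP (x \in B1); first by apply: le_trans (lei x (or_introl xB1)) _; rewrite indicE.
  have [xB2|xB2] := boolP (x \in B2); first by apply: le_trans (lei x (or_intror xB2)) _; rewrite indicE.
  have := win x; rewrite !notin_setE in xB1 xB2 => /(_ xB1 xB2) w.
  rewrite [\1__ x in leRHS]indicE mem_set.
    by rewrite !indicE !memNset// !subr0.
  by rewrite /=; move: w; rewrite ler_norml; lra.
exfalso.
have [e eE] : exists e, e = 40 * s by exists (40 * s).
have [f' fE] : exists f', f' = 80 * s by exists (80 * s).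
have e0 : 0 < e by rewrite eE mulr_gt0.
have f0 : 0 < f' by rewrite fE mulr_gt0.
pose del x := (vt a e x / e - vt a f' x / f') + (vt (- a) e x / e - vt (- a) f' x / f').
have bv b eta : 0 < eta -> bmf (vt b eta) by move=> h; apply: bmfN; have [] := bmc_gtr b b01 h D0T.
have bq b t : 0 < t -> bmf (fun x => vt b t x / t).
  by move=> t0; under eq_fun do rewrite mulrC; apply: bmfZ; exact: bv.
have Eq b t : 0 < t -> Ex P (fun x => vt b t x / t) = Ex P (vt b t) / t.
  move=> t0; have -> : (fun x => vt b t x / t) = (fun x => t^-1 * vt b t x).
    by apply/funext => x; exact: mulrC.
  by rewrite (ExZ P t^-1 (bv b t t0)); exact: mulrC.
have bqB b : bmf (fun x => vt b e x / e - vt b f' x / f') by apply: bmfB; exact: bq.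
have bdel : bmf del by exact: bmfD.
have delpos x : 4 * 10^-1 ^+ 4 * (1 - \1_B1 x - \1_B2 x) <= del x.
  have mon b : 0 <= vt b e x / e - vt b f' x / f'.
    rewrite (vtr_gap b x e0 f0) mulr_ge0 ?invr_ge0//.
    have [l _ tr] := trace_outlier n0 (hermx_sym x).
    have ef : e <= f' by rewrite eE fE; apply: ler_wpM2r; [exact: ltW|lra].
    apply: le_trans (tr _ _ b e0 ef); rewrite subr_ge0 lef_pV2 ?posrE.
    - by rewrite lerD2r lerXn2r ?nnegrE// ltW.
    - by rewrite ltr_wpDr ?sqr_ge0// exprn_gt0.
    - by rewrite ltr_wpDr ?sqr_ge0// exprn_gt0.
  have d0 : 0 <= del x by apply: addr_ge0.
  have neg : 1 - \1_B1 x - \1_B2 x <= 0 :> R -> 4 * 10^-1 ^+ 4 * (1 - \1_B1 x - \1_B2 x) <= del x.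
    by move=> h; apply: le_trans d0; apply: mulr_ge0_le0 => //; lra.
  have [xB1|xB1] := boolP (x \in B1); first by apply: neg; exact: lei (or_introl xB1).
  have [xB2|xB2] := boolP (x \in B2); first by apply: neg; exact: lei (or_intror xB2).
  rewrite !notin_setE in xB1 xB2; rewrite !indicE !memNset// !subr0 mulr1.
  by apply: outlier_gap => //; exact: win.
have Edel : 3 * 10^-1 ^+ 4 <= Ex P del.
  apply: le_trans (Ex_le P (bmfZ (4 * 10^-1 ^+ 4) b12) bdel delpos).
  by rewrite ExZ//; move: PB12; lra.
have Edel2 : Ex P del <= 720 * s.
  have EqB b : Ex P (fun x => vt b e x / e - vt b f' x / f') =
      Ex P (vt b e) / e - Ex P (vt b f') / f'.
    apply: etrans (ExB P (bq b e e0) (bq b f' f0)) _.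
    by congr (_ - _); exact: Eq.
  have -> : Ex P del = (Ex P (vt a e) / e - Ex P (vt a f') / f') +
      (Ex P (vt (- a) e) / e - Ex P (vt (- a) f') / f').
    apply: etrans (ExD P (bqB a) (bqB (- a))) _.
    by congr (_ + _); exact: EqB.
  have l48 : 40 <= 80 :> R by rewrite ler_nat.
  have h1 := vtr_outside false a285 eE (lexx 40) l48 s7.
  have h2 := vtr_outside false a285 fE l48 (lexx 80) s7.
  have h3 := vtr_outside true a285 eE (lexx 40) l48 s7.
  have h4 := vtr_outside true a285 fE l48 (lexx 80) s7.
  rewrite expr0 mul1r in h1 h2; rewrite expr1 mulN1r in h3 h4.
  apply: le_trans (two_gaps h1 h2 h3 h4) _.
  by rewrite eE fE le_eqVlt; apply/orP; left; apply/eqP; ring.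
by move: (le_trans Edel Edel2); lra.
Qed.

(** The norm is 2-Lipschitz, so the sets where it is at most 2.9 and above 3 are at distance at
    least 1/20. This gives the exponent n / 1600, the origin of the constant C2. *)
Lemma opnorm_tail : s <= 10^-1 ^+ 7 ->
  fine (P [set x | 3 < opnorm (hermx x)]) <= 4 * expR (- (n%:R / 1600)).
Proof.
move=> s7; have s0 := s_gt0 R n0; have mO := measurable_opnorm_hermx.
have mB : measurable [set x | 3 < opnorm (hermx x)].
  have -> : [set x | 3 < opnorm (hermx x)] = ~` [set x | opnorm (hermx x) <= 3].
    by apply/seteqP; split => x /=; rewrite ltNge => /negP.
  by apply: measurableC; exact: measurable_set_le.
have mA := measurable_set_le (29 / 10) mO.
have sep : forall x y, [set x | opnorm (hermx x) <= 29 / 10] x ->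
    [set x | 3 < opnorm (hermx x)] y -> (20^-1) ^+ 2 <= dist2 x y.
  move=> x y /= hx hy; have := opnorm_hermx_lipschitz y x.
  rewrite dist2C => h; rewrite -[leRHS]sqr_sqrtr ?dist2_ge0// lerXn2r ?nnegrE ?sqrtr_ge0//.
  by have := le_trans (ler_norm _) h; lra.
have := gaussm_sets s0 mA mB (_ : 0 <= 20^-1) sep; rewrite invr_ge0 => /(_ (ler0n _ _)).
rewrite s_sq.
have -> : 20^-1 ^+ 2 / (4 * n%:R^-1) = n%:R / 1600 :> R.
  by field; rewrite pnatr_eq0 -lt0n n0.
have q := opnorm_quarter s7; have p0 : 0 <= fine (P [set x | 3 < opnorm (hermx x)]).
  by rewrite fine_ge0.
have : 4^-1 * fine (P [set x | 3 < opnorm (hermx x)]) <=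
  fine (P [set x | opnorm (hermx x) <= 29 / 10]) * fine (P [set x | 3 < opnorm (hermx x)]).
  by apply: ler_wpM2r.
by lra.
Qed.

End outlier.

(** * Uniformity in D *)

Section net.
Context (R : realType) (n : nat) (n0 : (0 < n)%N).
Notation T := ((n * n).-tuple (measurableTypeR R)).
Notation s := (Num.sqrt (n%:R^-1 : R)).
Notation P := (gaussm s (n * n)).

Lemma fr_opnorm (X : 'M[R]_n) m (Y : 'M[R]_(n, m)) : fr (X *m Y) <= opnorm X * fr Y.
Proof.
apply: le_of_sq; first by rewrite mulr_ge0 ?opnorm_ge0 ?fr_ge0.
have sqE p (Z : 'M[R]_(n, p)) : fr Z ^+ 2 = \sum_j l2norm (col j Z) ^+ 2.
  rewrite l2_sq -(pair_big xpredT xpredT (fun i j => Z i j ^+ 2))/= exchange_big.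
  apply: eq_bigr => j _; rewrite sqr_sqrtr ?sumsq_ge0//.
  by apply: eq_bigr => i _; rewrite mxE.
rewrite exprMn !sqE mulr_sumr; apply: ler_sum => j _.
rewrite -exprMn lerXn2r ?nnegrE ?mulr_ge0 ?opnorm_ge0 ?l2norm_ge0//.
by rewrite !colE -mulmxA opnormP.
Qed.

Lemma fro_opnorm (X : 'M[R]_n) m (Y : 'M[R[i]]_(n, m)) : fro (cM X *m Y) <= opnorm X * fro Y.
Proof.
apply: le_of_sq; first by rewrite mulr_ge0 ?opnorm_ge0 ?fro_ge0.
have reX : reM (cM X) = X by apply/matrixP => i j; rewrite !mxE.
have imX : imM (cM X) = 0 by apply/matrixP => i j; rewrite !mxE.
rewrite exprMn !fro_reim reM_mul imM_mul reX imX !mul0mx subr0 addr0 mulrDr -!exprMn.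
by apply: lerD; rewrite lerXn2r ?nnegrE ?mulr_ge0 ?opnorm_ge0 ?fr_ge0 ?fr_opnorm.
Qed.

Lemma l2_Im_diag (Y : 'M[R[i]]_n) : l2 (fun i => complex.Im (Y i i)) <= fro Y.
Proof.
apply: le_of_sq; first exact: fro_ge0.
rewrite l2_sq froE2; apply: ler_sum => i _; rewrite (bigD1 i)//=.
rewrite ler_wpDr ?sumr_ge0// => [k _|]; first exact: sqr_ge0.
by rewrite nc_sq lerDr sqr_ge0.
Qed.

Variables (beta q : R).
Hypotheses (beta1 : 1 <= beta) (q1 : 1 <= q).
Let b := beta / q.
Let beta0 : 0 < beta. Proof. exact: lt_le_trans ltr01 beta1. Qed.
Let q0 : 0 < q. Proof. exact: lt_le_trans ltr01 q1. Qed.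
Let b0 : 0 < b. Proof. exact: divr_gt0. Qed.
Let bb : b <= beta. Proof. by rewrite ler_pdivrMr// ler_peMr// ltW. Qed.

Notation adm := (@admissible R n beta).
Notation at_ := (atilde beta b).
Notation et_ := (btilde beta b).
Notation G D x := (gres beta (at_ D) (et_ D) D x).

Definition rdiag (D : 'M[R]_n) i : R := b / (b ^+ 2 + D i i ^+ 2).

(** The quantity of part (3), with the diagonal of P^2 expressed by the resolvent and [s] as the
    normalisation n^(-1/2); [hs_norm_fdev] is the link. *)
Definition fdev D x : R := s * l2 (fun i => - complex.Im (G D x i i) - rdiag D i).

Lemma eta_inv D : adm D -> 0 < et_ D /\ (et_ D)^-1 <= 3 * q ^+ 3 / beta.
Proof.
move=> aD; have e0 : 0 < et_ D := btilde_gt0 n0 beta1 b0 bb aD; split=> //.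
rewrite -[leRHS]invrK lef_pV2 ?posrE ?invr_gt0//; last by posit.
rewrite invf_div; apply: le_trans (btilde_ge n0 beta1 b0 bb aD); rewrite le_eqVlt; apply/orP; left; apply/eqP.
by rewrite /b; field; rewrite !gt_eqF.
Qed.

Lemma hs_norm_fdev D x : adm D ->
  hs_norm (diag_part (Pmx beta b (tmx x) D ^+ 2) - diag_resolvent b D) = fdev D x.
Proof.
move=> aD; have [e0 _] := eta_inv aD.
rewrite (Pmx_sq n0 (tmx x) beta1 b0 bb aD); set Y := _ - _.
have YE i j : Y i j = (i == j)%:R * (- complex.Im (G D x i i) - rdiag D i).
  have -> : Y i j = diag_part (et_ D *: kmx (et_ D) (shifted beta b (tmx x) D)) i j -
      diag_resolvent b D i j by rewrite [LHS]mxE [X in _ + X]mxE.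
  rewrite (diag_resolvent_entry b0 aD) [diag_part _ _ _]mxE; case: eqVneq => [<-|_]; last by rewrite !mul0r subr0.
  rewrite !mul1r; congr (_ - _).
  have -> : complex.Im (G D x i i) = imM (res (et_ D) (shifted beta b (tmx x) D)) i i by rewrite [RHS]mxE.
  by rewrite imM_res [in RHS]mxE opprK.
rewrite /hs_norm /ntr /fdev /l2 -sqrtrM ?invr_ge0//; congr (Num.sqrt (_ * _)).
rewrite -fr_sq l2_sq -(pair_big xpredT xpredT (fun i j => Y i j ^+ 2))/=.
apply: eq_bigr => i _; rewrite (bigD1 i)//= big1 ?addr0 => [|j ji]; rewrite YE ?eqxx ?mul1r//.
by rewrite eq_sym (negbTE ji) mul0r expr0n.
Qed.

#[local] Opaque gres.

(** The resolvent contributes 2 beta / eta^2 and the normalised norm a further n^(-1/2). As the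
    coordinates have variance 1/n, concentration has an exponent of order n^2 beta^2 / q^12 times
    the squared deviation. *)
Lemma fdev_lipschitz D x y : adm D ->
  `|fdev D x - fdev D y| <= s * (18 * q ^+ 6 / beta) * Num.sqrt (dist2 x y).
Proof.
move=> aD; have [e0 ei] := eta_inv aD; have DT := adm_sym aD.
have s0 : 0 <= s by exact: sqrtr_ge0.
rewrite /fdev -mulrBr normrM ger0_norm// -mulrA; apply: ler_wpM2l => //.
apply: le_trans (l2_dist _ _) _.
apply: le_trans (_ : fro (G D y - G D x) <= _).
  apply: le_trans (l2_Im_diag _); rewrite le_eqVlt; apply/orP; left; apply/eqP.
  have gen (Y Z : 'M[R[i]]_n) (r : R) i : - complex.Im (Y i i) - r - (- complex.Im (Z i i) - r) =
      complex.Im ((Z - Y) i i).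
    by rewrite -mxB_entry cImD cImN; ring.
  by congr l2; apply/funext => i; exact: gen.
apply: le_trans (fro_gresB (at_ D) (ltW beta0) e0 DT y x) _; rewrite dist2C.
apply: ler_wpM2r; first exact: sqrtr_ge0.
have -> : 18 * q ^+ 6 / beta = (3 * q ^+ 3 / beta) ^+ 2 * (2 * beta) by field; rewrite gt_eqF.
apply: ler_wpM2r; first by nonneg.
by rewrite lerXn2r ?nnegrE ?invr_ge0 ?(ltW e0)//; nonneg.
Qed.

Hypotheses (q17 : q ^+ 17 <= n%:R) (q12 : 19 * 100 * 100 * q ^+ 12 <= n%:R).

Notation mc := (mean_const R).

Let n0R : 0 < n%:R :> R. Proof. by rewrite ltr0n. Qed.

Lemma bmf_fdev2 D : adm D -> bmf (fun x => fdev D x ^+ 2).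
Proof.
move=> aD; have [e0 _] := eta_inv aD; have DT := adm_sym aD.
have -> : (fun x => fdev D x ^+ 2) =
    (fun x => n%:R^-1 * \sum_i (- complex.Im (G D x i i) - rdiag D i) ^+ 2).
  by apply/funext => x; rewrite /fdev exprMn s_sq l2_sq.
apply: bmfZ; apply: bmf_sum => i _; apply: bmfX; apply: bmfB; last exact: bmf_cst.
by apply: bmfN; have [] := bmc_gres (at_ D) (ltW beta0) e0 DT i i.
Qed.

(** Squared bias plus variance, entry by entry; the variance is of order q^12 / n, hence of order
    q^-4 because q^16 <= n. *)
Lemma fdev_mean D : adm D -> Ex P (fun x => fdev D x ^+ 2) <= (2 * mc * q^-1 ^+ 2) ^+ 2.
Proof.
move=> aD; have [e0 ei] := eta_inv aD; have DT := adm_sym aD.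
have bG i : bmf (fun x => - complex.Im (G D x i i)).
  by apply: bmfN; have [] := bmc_gres (at_ D) (ltW beta0) e0 DT i i.
have -> : (fun x => fdev D x ^+ 2) =
    (fun x => n%:R^-1 * \sum_i (- complex.Im (G D x i i) - rdiag D i) ^+ 2).
  by apply/funext => x; rewrite /fdev exprMn s_sq l2_sq.
have b2 i : bmf (fun x => (- complex.Im (G D x i i) - rdiag D i) ^+ 2).
  by apply: bmfX; apply: bmfB => //; exact: bmf_cst.
rewrite ExZ ?Ex_sum//; last by apply: bmf_sum => i _; exact: b2.
set c := 2 * mc * q^-1 ^+ 2.
rewrite ler_pdivrMl//.
have -> : n%:R * c ^+ 2 = \sum_(i < n) c ^+ 2 by rewrite sumr_const card_ord mulr_natl.
apply: ler_sum => i _.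
set m := Ex P (fun x => - complex.Im (G D x i i)).
have bm : bmf (fun x => (- complex.Im (G D x i i) - m) ^+ 2).
  by apply: bmfX; apply: bmfB => //; exact: bmf_cst.
apply: le_trans (_ : 2 * Ex P (fun x => (- complex.Im (G D x i i) - m) ^+ 2) + 2 * (m - rdiag D i) ^+ 2 <= _).
  rewrite -(ExZ P 2 bm) -[2 * (m - _) ^+ 2](Ex_cst P) -ExD; [|exact: bmfZ|exact: bmf_cst].
  apply: Ex_le => [||x]; [exact: b2|apply: bmfD; [exact: bmfZ|exact: bmf_cst]|].
  move: (- complex.Im _) (rdiag D i) => v r.
  by rewrite -subr_ge0 (_ : _ - _ = (v - m - (m - r)) ^+ 2) ?sqr_ge0//; ring.
have v1 : Ex P (fun x => (- complex.Im (G D x i i) - m) ^+ 2) <= 64 * 81 * q^-1 ^+ 4.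
  apply: le_trans (_ : VarC P (fun x => G D x i i) <= _).
    have bGc := bmc_gres (at_ D) (ltW beta0) e0 DT i i; rewrite (VarCE P bGc).
    have -> : (fun x => (- complex.Im (G D x i i) - m) ^+ 2) =
        (fun x => (complex.Im (G D x i i) - Ex P (fun x => complex.Im (G D x i i))) ^+ 2).
      apply/funext => x; rewrite /m ExN; last by have [] := bmc_gres (at_ D) (ltW beta0) e0 DT i i.
      by rewrite -sqrrN; congr (_ ^+ 2); ring.
    rewrite lerDr; apply: Ex_ge0 => [|x]; last exact: sqr_ge0.
    apply: bmfX; apply: bmfB; last exact: bmf_cst.
    by have [] := bmc_gres (at_ D) (ltW beta0) e0 DT i i.
  apply: le_trans (var_gres n0 (at_ D) (ltW beta0) e0 DT i i) _.
  apply: le_trans (_ : 64 * beta ^+ 2 / n%:R * (3 * q ^+ 3 / beta) ^+ 4 <= _).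
    apply: ler_wpM2l; first by nonneg.
    by rewrite lerXn2r ?nnegrE ?invr_ge0 ?(ltW e0)//; nonneg.
  have -> : 64 * beta ^+ 2 / n%:R * (3 * q ^+ 3 / beta) ^+ 4 =
      (64 * 81 * q^-1 ^+ 4) * (q ^+ 16 / n%:R) * (beta^-1 ^+ 2).
    by field; rewrite !gt_eqF.
  have q16 : q ^+ 16 / n%:R <= 1.
    rewrite ler_pdivrMr// mul1r; apply: le_trans q17.
    by rewrite ler_weXn2l.
  have bi : beta^-1 ^+ 2 <= 1 by rewrite exprn_ile1 ?invr_ge0 ?invf_le1// ltW.
  rewrite -mulrA -[leRHS]mulr1; apply: ler_wpM2l; first by nonneg.
  by rewrite mulr_ile1//; nonneg.
have v2 : (m - rdiag D i) ^+ 2 <= (mc * q^-1 ^+ 2) ^+ 2.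
  rewrite -real_normK ?num_real// lerXn2r ?nnegrE//; first by rewrite /mean_const; nonneg.
  exact: mean_estimate.
have -> : c ^+ 2 = 4 * mc ^+ 2 * q^-1 ^+ 4 by rewrite /c; ring.
rewrite (_ : (mc * q^-1 ^+ 2) ^+ 2 = mc ^+ 2 * q^-1 ^+ 4) in v2; last by ring.
have : 64 * 81 * q^-1 ^+ 4 <= mc ^+ 2 * q^-1 ^+ 4.
  by apply: ler_wpM2r; [nonneg|rewrite /mean_const; lra].
by lra.
Qed.

Lemma mean_const_gt0 : 0 < mc.
Proof. by rewrite /mean_const; posit. Qed.

Lemma prob_compl (A : set T) : measurable A -> fine (P (~` A)) = 1 - fine (P A).
Proof.
move=> mA; have mC := measurableC mA.
have := ExB P (@bmf_cst _ T R 1) (bmf_indic R mA); rewrite Ex_cst (Ex_indic P mA) => <-.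
rewrite -(Ex_indic P mC); congr Ex; apply/funext => x.
by rewrite !indicE in_setC; case: (x \in A); rewrite ?subrr ?subr0.
Qed.

(** The part 4 [mc] is twice the root mean square bound of [fdev_mean], so that by Markov's
    inequality [fdev] stays below it with probability 3/4. The additional 280 is the distance over
    which concentration acts, chosen so that 280^2 / (4 * 18^2) > 60. *)
Definition bad D := [set x | (4 * mc + 280) * beta * q^-1 ^+ 2 < fdev D x].

Lemma measurable_fdev D : adm D -> measurable_fun setT (fdev D).
Proof. by move=> aD; apply: lipschitz_measurable => x y; exact: fdev_lipschitz. Qed.

Lemma measurable_bad D : adm D -> measurable (bad D).
Proof.
move=> aD; have -> : bad D = ~` [set x | fdev D x <= (4 * mc + 280) * beta * q^-1 ^+ 2].
  by apply/seteqP; split => x /=; rewrite /bad /= ltNge => /negP.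
by apply: measurableC; apply: measurable_set_le; exact: measurable_fdev.
Qed.

#[local] Opaque fdev mean_const.

Lemma prob_bad D : adm D -> fine (P (bad D)) <= 4 / 3 * expR (- (60 * n%:R ^+ 2 / q ^+ 16)).
Proof.
move=> aD; have s0 := s_gt0 R n0.
pose c := 4 * mc * q^-1 ^+ 2.
have mc0 := mean_const_gt0.
have c0 : 0 < c by rewrite /c; posit.
pose A := [set x | fdev D x ^+ 2 <= c ^+ 2].
have b2 := bmf_fdev2 aD.
have mA : measurable A by apply: measurable_set_le; exact: b2.1.
have PA : 3 / 4 <= fine (P A).
  have mAc : measurable [set x | c ^+ 2 < fdev D x ^+ 2].
    have -> : [set x | c ^+ 2 < fdev D x ^+ 2] = ~` A.
      by apply/seteqP; split => x /=; rewrite ltNge => /negP.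
    exact: measurableC.
  have -> : A = ~` [set x | c ^+ 2 < fdev D x ^+ 2].
    by apply/seteqP; split => x /=; rewrite /A /= leNgt => /negP.
  rewrite prob_compl//.
  have := Ex_markov P b2 (fun x => sqr_ge0 _) (exprn_gt0 2 c0).
  have : Ex P (fun x => fdev D x ^+ 2) / c ^+ 2 <= 4^-1.
    rewrite ler_pdivrMr ?exprn_gt0//; apply: le_trans (fdev_mean aD) _.
    by rewrite /c le_eqVlt; apply/orP; left; apply/eqP; field; rewrite gt_eqF.
  by lra.
pose r := 280 * beta ^+ 2 / (18 * q ^+ 8 * s).
have r0 : 0 <= r by rewrite /r; apply: ltW; posit.
have sep : forall x y, A x -> bad D y -> r ^+ 2 <= dist2 x y.
  move=> x y; rewrite /A /bad /= => hx hy.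
  have fx : fdev D x <= c by apply: le_of_sq => //; exact: ltW.
  have := fdev_lipschitz y x aD; rewrite dist2C.
  have h1 : c <= 4 * mc * beta * q^-1 ^+ 2.
    rewrite /c; apply: ler_wpM2r; first by nonneg.
    by rewrite ler_peMr//; nonneg.
  have h2 : 280 * beta * q^-1 ^+ 2 <= fdev D y - fdev D x.
    have -> : 280 * beta * q^-1 ^+ 2 = (4 * mc + 280) * beta * q^-1 ^+ 2 - 4 * mc * beta * q^-1 ^+ 2 by ring.
    by apply: lerB; [exact: ltW|exact: le_trans fx h1].
  move=> h3; have h4 := le_trans h2 (le_trans (ler_norm _) h3).
  rewrite -[leRHS]sqr_sqrtr ?dist2_ge0// lerXn2r ?nnegrE ?sqrtr_ge0//.
  have k0 : 0 < s * (18 * q ^+ 6 / beta) by posit.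
  rewrite -(ler_pM2l k0); apply: le_trans h4; rewrite le_eqVlt; apply/orP; left; apply/eqP.
  by rewrite /r; field; rewrite !gt_eqF.
have := gaussm_sets s0 mA (measurable_bad aD) r0 sep.
have -> : r ^+ 2 / (4 * s ^+ 2) = (280 ^+ 2 / (4 * 18 ^+ 2)) * beta ^+ 4 * (n%:R ^+ 2 / q ^+ 16).
  have -> : r ^+ 2 / (4 * s ^+ 2) = (280 ^+ 2 / (4 * 18 ^+ 2)) * beta ^+ 4 * ((s ^+ 2)^-1 ^+ 2 / q ^+ 16).
    by rewrite /r; field; rewrite !gt_eqF.
  by rewrite s_sq invrK.
have e1 : expR (- (280 ^+ 2 / (4 * 18 ^+ 2) * beta ^+ 4 * (n%:R ^+ 2 / q ^+ 16))) <=
    expR (- (60 * n%:R ^+ 2 / q ^+ 16)).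
  rewrite ler_expR lerN2 -[60 * _ / _]mulrA; apply: ler_wpM2r; first by nonneg.
  have : 1 <= beta ^+ 4 by rewrite exprn_ege1.
  by lra.
have p0 : 0 <= fine (P (bad D)) by rewrite fine_ge0.
have h : 3 / 4 * fine (P (bad D)) <= fine (P A) * fine (P (bad D)) by apply: ler_wpM2r.
by move=> h2; have := le_trans h (le_trans h2 e1); lra.
Qed.

End net.

(** * Dependence of the resolvent on D *)

Section resolvent_identities.
Context (R : realType) (n m : nat).
Implicit Types (z : R[i]) (B D G H : 'M[R[i]]_n) (Y : 'M[R[i]]_(n, m)).

Let zcancel (V : zmodType) (a c x : V) : x = (a - c + x) - a + c.
Proof. by rewrite -[RHS]addrA (addrC (- a) c) -(opprB a c) (addrC (a - c) x) addrK. Qed.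

(** Solves (z - B + D) G = 1 for D G: a product with the unbounded D is traded for the bounded z and
    B. *)
Lemma inverse_mull z B D G Y : (z%:M - B + D) *m G = 1%:M ->
  D *m G *m Y = Y - z *: (G *m Y) + B *m (G *m Y).
Proof.
move=> E; have E' : Y = z *: (G *m Y) - B *m (G *m Y) + D *m (G *m Y).
  by rewrite -[LHS]mul1mx -E -mulmxA !mulmxDl mulNmx mul_scalar_mx.
by rewrite {2}E' -mulmxA; exact: zcancel.
Qed.

Lemma inverse_mulr z B D G Y : G *m (z%:M - B + D) = 1%:M ->
  G *m D *m Y = Y - z *: (G *m Y) + G *m (B *m Y).
Proof.
move=> E; have E' : Y = z *: (G *m Y) - G *m (B *m Y) + G *m D *m Y.
  rewrite -[LHS]mul1mx -E !mulmxDr mulmxN !mulmxDl mulNmx mul_mx_scalar -scalemxAl.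
  by rewrite -(mulmxA G B).
by rewrite {2}E'; exact: zcancel.
Qed.

Lemma inverse_diff G G' H H' : G *m H = 1%:M -> H' *m G' = 1%:M -> G - G' = G *m (H' - H) *m G'.
Proof. by move=> E E'; rewrite mulmxBr mulmxBl E mul1mx -mulmxA E' mulmx1. Qed.

Lemma mulmx_scalarD z (W G G' : 'M[R[i]]_n) :
  G *m (z%:M + W) *m G' = z *: (G *m G') + G *m W *m G'.
Proof. by rewrite mulmxDr mulmxDl mul_mx_scalar -scalemxAl. Qed.

End resolvent_identities.

Section comparison.
Context (R : realType) (n : nat) (n0 : (0 < n)%N).
Variables (beta q : R).
Hypotheses (beta1 : 1 <= beta) (q1 : 1 <= q).
Let b := beta / q.
Let beta0 : 0 < beta. Proof. exact: lt_le_trans ltr01 beta1. Qed.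
Let q0 : 0 < q. Proof. exact: lt_le_trans ltr01 q1. Qed.
Let b0 : 0 < b. Proof. exact: divr_gt0. Qed.
Let bb : b <= beta. Proof. by rewrite ler_pdivrMr// ler_peMr// ltW. Qed.

Notation adm := (@admissible R n beta).
Notation at_ := (atilde beta b).
Notation et_ := (btilde beta b).

Let einv D : adm D -> 0 < et_ D /\ (et_ D)^-1 <= 3 * q ^+ 3 / beta.
Proof. exact: eta_inv. Qed.

Lemma nc_le_abs (z : R[i]) : nc z <= `|complex.Re z| + `|complex.Im z|.
Proof.
apply: le_of_sq; first by rewrite addr_ge0.
rewrite nc_sq -[complex.Re z ^+ 2]real_normK ?num_real// -[complex.Im z ^+ 2]real_normK ?num_real//.
rewrite -subr_ge0 (_ : _ - _ = 2 * (`|complex.Re z| * `|complex.Im z|)); last by ring.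
by rewrite mulr_ge0 ?mulr_ge0.
Qed.

(** The inequality 1/d <= beta / (2 d^2) + 1 / (2 beta) reduces the mean of D^-1 to the prescribed
    mean of D^-2. *)
Lemma nc_ztilde D : adm D -> nc (at_ D +i* et_ D) <= 3 * beta.
Proof.
move=> aD; have [e0 _] := einv aD; have d0 := adm_gt0 aD.
apply: le_trans (nc_le_abs _) _ => /=.
have pd i : 0 < b ^+ 2 + D i i ^+ 2 by rewrite ltr_wpDr ?sqr_ge0// exprn_gt0.
have e1 : et_ D <= beta.
  apply: le_trans bb; rewrite (btildeE1 n0 b0 aD) gerBl mulr_ge0//; first by nonneg.
  by apply: mean_ge0 => i; rewrite divr_ge0 ?ltW.
have a0 : 0 <= at_ D.
  rewrite (atildeE n0 b0 aD); apply: mulr_ge0; first by nonneg.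
  by apply: mean_ge0 => i; rewrite divr_ge0 ?ltW.
have a1 : at_ D <= 3 / 2 * beta.
  rewrite (atildeE n0 b0 aD).
  apply: le_trans (_ : 2 * beta ^+ 2 * mean (fun i => 2^-1 * beta * (D i i)^-1 ^+ 2 + (2 * beta)^-1) <= _).
    apply: ler_wpM2l; first by nonneg.
    apply: mean_le => i; apply: le_trans (_ : (D i i)^-1 <= _).
      rewrite ler_pdivrMr// -subr_ge0.
      have -> : (D i i)^-1 * (b ^+ 2 + D i i ^+ 2) - D i i = (D i i)^-1 * b ^+ 2 by field; rewrite gt_eqF.
      by rewrite mulr_ge0 ?sqr_ge0// invr_ge0 ltW.
    rewrite -subr_ge0 (_ : _ - _ = (2 * beta)^-1 * (beta * (D i i)^-1 - 1) ^+ 2).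
      by rewrite mulr_ge0 ?sqr_ge0// invr_ge0; nonneg.
    by field; rewrite !gt_eqF.
  rewrite meanD meanZ mean_cst// (mean_inv2E beta1 aD) le_eqVlt; apply/orP; left; apply/eqP.
  by field; rewrite gt_eqF.
by rewrite !ger0_norm// ?(ltW e0)//; lra.
Qed.

Variables (A : 'M[R]_n).
Hypothesis hA : opnorm (2 *: sym_part A) <= 3.
Notation H := (2 *: sym_part A).
Notation GA D := (res (et_ D) (xmx beta (at_ D) D A)).

Lemma hmx_split D : hmx (et_ D) (xmx beta (at_ D) D A) =
  (at_ D +i* et_ D)%:M - beta%:C *: cM H + cM D.
Proof.
apply/matrixP => i j; rewrite !mxE.
by case: (i == j); apply: eq_complexP; rewrite /= ?mulr1n ?mulr0n; ring.
Qed.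

Lemma fro_H m (Y : 'M[R[i]]_(n, m)) : fro (beta%:C *: cM H *m Y) <= 3 * beta * fro Y.
Proof.
rewrite -scalemxAl froZ nc_real gtr0_norm//.
have -> : 3 * beta * fro Y = beta * (3 * fro Y) by ring.
apply: ler_wpM2l; first exact: ltW.
by apply: le_trans (fro_opnorm _ _) _; apply: ler_wpM2r => //; exact: fro_ge0.
Qed.

Let bound (D : 'M[R]_n) (f : R) : adm D -> 0 <= f ->
  f + 3 * beta * ((et_ D)^-1 * f) + 3 * beta * ((et_ D)^-1 * f) <= 19 * q ^+ 3 * f.
Proof.
move=> aD f0; have [e0 ei] := einv aD.
have h : 3 * beta * ((et_ D)^-1 * f) <= 9 * q ^+ 3 * f.
  rewrite mulrA; apply: ler_wpM2r => //.
  have -> : 9 * q ^+ 3 = 3 * beta * (3 * q ^+ 3 / beta) by field; rewrite gt_eqF.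
  by apply: ler_wpM2l => //; nonneg.
have : f <= q ^+ 3 * f by rewrite ler_peMl// exprn_ege1.
by lra.
Qed.

#[local] Opaque res.

(** D may be arbitrarily large, but D G = 1 - z~ G + beta H G with |z~| <= 3 beta and H of norm at
    most 3; hence the constant 1 + 9 + 9. Here the event on the norm enters the comparison. *)
Lemma fro_DG D m (Y : 'M[R[i]]_(n, m)) : adm D -> fro (cM D *m GA D *m Y) <= 19 * q ^+ 3 * fro Y.
Proof.
move=> aD; have [e0 ei] := einv aD; have DT := adm_sym aD.
have XT := xmx_sym beta (at_ D) DT A.
have fG : fro (GA D *m Y) <= (et_ D)^-1 * fro Y by exact: fro_resl.
have E : cM D *m GA D *m Y =
    Y - (at_ D +i* et_ D) *: (GA D *m Y) + beta%:C *: cM H *m (GA D *m Y).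
  by apply: inverse_mull; rewrite -hmx_split hmx_res.
rewrite E; apply: le_trans (froD _ _) _.
apply: le_trans (bound aD (fro_ge0 Y)); apply: lerD; last first.
  by apply: le_trans (fro_H _) _; apply: ler_wpM2l => //; nonneg.
apply: le_trans (froB _ _) _; apply: lerD => //; rewrite froZ; apply: ler_pM => //.
- exact: nc_ge0.
- exact: fro_ge0.
- exact: nc_ztilde.
Qed.

Lemma fro_GD D m (Y : 'M[R[i]]_(n, m)) : adm D -> fro (GA D *m cM D *m Y) <= 19 * q ^+ 3 * fro Y.
Proof.
move=> aD; have [e0 ei] := einv aD; have DT := adm_sym aD.
have XT := xmx_sym beta (at_ D) DT A.
have E : GA D *m cM D *m Y =
    Y - (at_ D +i* et_ D) *: (GA D *m Y) + GA D *m (beta%:C *: cM H *m Y).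
  by apply: inverse_mulr; rewrite -hmx_split res_hmx.
rewrite E; apply: le_trans (froD _ _) _.
have fG m' (Z : 'M[R[i]]_(n, m')) : fro (GA D *m Z) <= (et_ D)^-1 * fro Z by exact: fro_resl.
apply: le_trans (bound aD (fro_ge0 Y)); apply: lerD; last first.
  apply: le_trans (fG _ _) _; rewrite mulrCA; apply: ler_wpM2l; last exact: fro_H.
  by rewrite invr_ge0 ltW.
apply: le_trans (froB _ _) _; apply: lerD => //; rewrite froZ; apply: ler_pM => //.
- exact: nc_ge0.
- exact: fro_ge0.
- exact: nc_ztilde.
Qed.

Variables (D D' : 'M[R]_n) (h : R).
Hypotheses (aD : adm D) (aD' : adm D') (h0 : 0 <= h).
Hypothesis close : forall i, `|(D i i)^-1 - (D' i i)^-1| <= h.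

(** |i b + d| >= d, so adding i b only shrinks the difference of the inverses. *)
Lemma nc_inv_ib_diff i : nc ((0 +i* b + (D i i)%:C)^-1 - (0 +i* b + (D' i i)%:C)^-1) <= h.
Proof.
have d0 := adm_gt0 aD i; have d0' := adm_gt0 aD' i.
have nz (t : R) : 0 < t -> t <= nc (0 +i* b + t%:C) /\ 0 +i* b + t%:C != 0.
  move=> t0; split; last first.
    by rewrite eq_complex /= negb_and add0r addr0 (gt_eqF b0) orbT.
  by apply: le_trans (Re_le_nc _); rewrite cReD /= add0r ler_norm.
have [n1 z1] := nz _ d0; have [n2 z2] := nz _ d0'.
have -> : (0 +i* b + (D i i)%:C)^-1 - (0 +i* b + (D' i i)%:C)^-1 =
    (D' i i - D i i)%:C * ((0 +i* b + (D i i)%:C)^-1 * (0 +i* b + (D' i i)%:C)^-1).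
  by rewrite rmorphB; field; rewrite z1 z2.
apply: le_trans (close i); rewrite !ncM nc_real.
have -> : (D i i)^-1 - (D' i i)^-1 = (D' i i - D i i) * ((D i i)^-1 * (D' i i)^-1).
  by field; rewrite !gt_eqF.
rewrite [leRHS]normrM; apply: ler_wpM2l => //.
rewrite ger0_norm; last by rewrite mulr_ge0 ?invr_ge0 ?ltW.
by rewrite !ncV; apply: ler_pM; rewrite ?invr_ge0 ?nc_ge0// lef_pV2// posrE; apply: lt_le_trans n1 || apply: lt_le_trans n2.
Qed.

Lemma nc_ztilde_diff : nc ((at_ D +i* et_ D) - (at_ D' +i* et_ D')) <= 2 * beta ^+ 2 * h.
Proof.
have zE E : adm E -> at_ E +i* et_ E = 0 +i* b + (2 * beta ^+ 2)%:C *
    ((n%:R^-1)%:C * \sum_i (0 +i* b + (E i i)%:C)^-1).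
  move=> aE; have -> : at_ E +i* et_ E = ztilde beta b E by rewrite /atilde /btilde; case: (ztilde _ _ _).
  rewrite /ztilde (g_negE n0 aE)// => k.
  by rewrite eq_complex /= negb_and add0r addr0 (gt_eqF b0) orbT.
rewrite !zE// opprD addrACA subrr add0r -!mulrBr -sumrB !ncM !nc_real.
rewrite ger0_norm; last by nonneg.
apply: ler_wpM2l; first by nonneg.
rewrite ger0_norm ?invr_ge0// ler_pdivrMl ?ltr0n//.
apply: le_trans (nc_sum _ _ _) _; apply: le_trans (ler_sum _ (fun i _ => nc_inv_ib_diff i)) _.
by rewrite sumr_const card_ord mulr_natl.
Qed.

Let sn := Num.sqrt (n%:R : R).

Lemma fro_id : fro (1%:M : 'M[R[i]]_n) = sn.
Proof.
rewrite /sn; apply: (pexpIrn (n := 2)); rewrite ?nnegrE ?fro_ge0 ?sqrtr_ge0// froE2 sqr_sqrtr ?ler0n//.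
rewrite -[RHS]mulr1 mulr_natl -[in RHS](card_ord n) -sumr_const; apply: eq_bigr => i _.
rewrite (bigD1 i)//= mxE eqxx nc1 expr1n big1 ?addr0// => j ji.
by rewrite mxE eq_sym (negbTE ji) nc0 expr0n.
Qed.

(** G - G' = dz G G' + (G D)(D^-1 - D'^-1)(D' G'): as a function of D^-1 the resolvent is Lipschitz
    uniformly over all admissible D. The constant is 18 + 19^2. *)
Lemma fro_resolvent_diff : fro (GA D - GA D') <= 379 * q ^+ 6 * (sn * h).
Proof.
have [e0 ei] := einv aD; have DT := adm_sym aD.
have [e0' ei'] := einv aD'; have DT' := adm_sym aD'.
have XT := xmx_sym beta (at_ D) DT A; have XT' := xmx_sym beta (at_ D') DT' A.
have [Dd _ Du _] := aD; have [Dd' _ Du' _] := aD'.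
pose W := invmx D - invmx D'.
have DWD : D *m W *m D' = D' - D.
  by rewrite /W mulmxBr mulmxBl mulmxV// mul1mx -mulmxA mulVmx// mulmx1.
pose dz : R[i] := (at_ D' +i* et_ D') - (at_ D +i* et_ D).
have E : GA D - GA D' = dz *: (GA D *m GA D') + GA D *m cM D *m (cM W *m (cM D' *m GA D' *m 1%:M)).
  have -> : GA D *m cM D *m (cM W *m (cM D' *m GA D' *m 1%:M)) = GA D *m cM (D' - D) *m GA D'.
    by rewrite -DWD /cM !map_mxM mulmx1 !mulmxA.
  have -> : GA D - GA D' = GA D *m (hmx (et_ D') (xmx beta (at_ D') D' A) -
      hmx (et_ D) (xmx beta (at_ D) D A)) *m GA D'.
    by apply: inverse_diff; [exact: res_hmx|exact: hmx_res].
  have -> : hmx (et_ D') (xmx beta (at_ D') D' A) - hmx (et_ D) (xmx beta (at_ D) D A) =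
      dz%:M + cM (D' - D).
    rewrite !hmx_split /dz raddfB /= /cM map_mxB.
    by apply/matrixP => i j; rewrite !mxE; ring.
  exact: mulmx_scalarD.
have WE i j : W i j = (i == j)%:R * ((D i i)^-1 - (D' i i)^-1).
  rewrite /W; have [_ ->] := diag_inv Dd (fun i => lt0r_neq0 (adm_gt0 aD i)).
  have [_ ->] := diag_inv Dd' (fun i => lt0r_neq0 (adm_gt0 aD' i)).
  by rewrite !mxE; case: eqVneq => [_|_]; rewrite ?mulr1n ?mulr0n ?mul1r ?mul0r ?subrr.
have fW m (Y : 'M[R[i]]_(n, m)) : fro (cM W *m Y) <= h * fro Y.
  have -> : cM W *m Y = \matrix_(i, j) (((D i i)^-1 - (D' i i)^-1)%:C * Y i j).
    apply/matrixP => i j; rewrite !mxE (bigD1 i)//= big1 ?addr0 => [|k ki].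
      by rewrite mxE WE eqxx mul1r.
    by rewrite mxE WE eq_sym (negbTE ki) mul0r mul0r.
  apply: le_of_sq; first by rewrite mulr_ge0 ?fro_ge0.
  rewrite exprMn !froE2 mulr_sumr; apply: ler_sum => i _; rewrite mulr_sumr; apply: ler_sum => j _.
  rewrite mxE ncM exprMn nc_real; apply: ler_wpM2r; first exact: sqr_ge0.
  by rewrite lerXn2r ?nnegrE.
have q3 : 0 <= 19 * q ^+ 3 by nonneg.
rewrite E; apply: le_trans (froD _ _) _.
have -> : 379 * q ^+ 6 * (sn * h) = 18 * q ^+ 6 * (sn * h) + 19 * q ^+ 3 * (h * (19 * q ^+ 3 * sn)) by ring.
apply: lerD.
  rewrite froZ; have fGG : fro (GA D *m GA D') <= (3 * q ^+ 3 / beta) * ((3 * q ^+ 3 / beta) * sn).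
    have t0 : 0 <= 3 * q ^+ 3 / beta by nonneg.
    apply: le_trans (fro_resl e0 (GA D') XT) _; apply: ler_pM => //; rewrite ?invr_ge0 ?fro_ge0 ?(ltW e0)//.
    rewrite -[GA D']mulmx1; apply: le_trans (fro_resl e0' _ XT') _; rewrite fro_id.
    by apply: ler_wpM2r => //; exact: sqrtr_ge0.
  apply: le_trans (_ : 2 * beta ^+ 2 * h * (3 * q ^+ 3 / beta * (3 * q ^+ 3 / beta * sn)) <= _).
    apply: ler_pM => //; [exact: nc_ge0|exact: fro_ge0|].
    by rewrite /dz -ncN opprB nc_ztilde_diff.
  by rewrite le_eqVlt; apply/orP; left; apply/eqP; field; rewrite gt_eqF.
apply: le_trans (fro_GD _ aD) _; apply: ler_wpM2l => //.
apply: le_trans (fW _ _) _; apply: ler_wpM2l => //.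
by rewrite -fro_id; exact: fro_DG.
Qed.

End comparison.

(** * Union bound over a net of inverses *)

Section net_event.
Context (R : realType) (n : nat) (n0 : (0 < n)%N).
Notation T := ((n * n).-tuple (measurableTypeR R)).
Notation s := (Num.sqrt (n%:R^-1 : R)).
Notation P := (gaussm s (n * n)).
Variables (beta q p : R).
Hypotheses (beta1 : 1 <= beta) (q1 : 1 <= q) (qp : q <= p) (p12 : 12 <= p) (p17 : p ^+ 17 = n%:R).
Let b := beta / q.
Let beta0 : 0 < beta. Proof. exact: lt_le_trans ltr01 beta1. Qed.
Let q0 : 0 < q. Proof. exact: lt_le_trans ltr01 q1. Qed.
Let b0 : 0 < b. Proof. exact: divr_gt0. Qed.
Let p0 : 0 < p. Proof. exact: lt_le_trans q0 qp. Qed.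
Let nR0 : 0 < n%:R :> R. Proof. by rewrite ltr0n. Qed.

Notation adm := (@admissible R n beta).
Notation mc := (mean_const R).

Let q17 : q ^+ 17 <= n%:R.
Proof. by rewrite -p17 lerXn2r ?nnegrE// ltW. Qed.

(** This decides the threshold 12 for p: 12^5 = 248832 exceeds 190000, and the remaining p^12
    dominates q^12. *)
Let q12 : 19 * 100 * 100 * q ^+ 12 <= n%:R.
Proof.
apply: le_trans (_ : p ^+ 5 * p ^+ 12 <= _); last by rewrite -exprD p17.
apply: ler_pM; [by nonneg|by nonneg| |by rewrite lerXn2r ?nnegrE// ltW].
apply: le_trans (_ : 12 ^+ 5 <= _); last by rewrite lerXn2r ?nnegrE// ltW.
have -> : (12 : R) ^+ 5 = 12 * 12 * (12 * 144) by ring.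
by lra.
Qed.

Let s7 : s <= 10^-1 ^+ 7.
Proof.
apply: le_of_sq => //; rewrite s_sq -p17 -exprM -[_ ^+ (7 * 2)]invrK lef_pV2 ?posrE ?invr_gt0 ?exprn_gt0//.
rewrite -exprVn invrK; apply: le_trans (_ : p ^+ 14 <= _).
  by rewrite lerXn2r ?nnegrE// ?(ltW p0)// (le_trans _ p12)// ler_nat.
by rewrite ler_weXn2l// (le_trans _ p12)// ler1n.
Qed.

(** 380 = 379 + 1: the resolvents move by [fro_resolvent_diff], the deterministic diagonal by
    [nc_inv_ib_diff]. The mesh 1 / (beta n^2) is far below beta q^-8, at which the sum is of order
    beta q^-2. *)
Lemma fdev_close (x : T) (D D' : 'M[R]_n) : opnorm (hermx x) <= 3 -> adm D -> adm D' ->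
  (forall i, `|(D i i)^-1 - (D' i i)^-1| <= (beta * n%:R ^+ 2)^-1) ->
  fdev beta q D x <= fdev beta q D' x + 380 * beta * q^-1 ^+ 2.
Proof.
move=> hx aD aD' close; set h := (beta * n%:R ^+ 2)^-1.
have h0 : 0 <= h by rewrite invr_ge0; nonneg.
rewrite -lerBlDl; apply: le_trans (ler_norm _) _.
have s0 := s_gt0 R n0; pose sn := Num.sqrt (n%:R : R).
have ssn : s * sn = 1 by rewrite -sqrtrM ?invr_ge0// mulVf ?gt_eqF// sqrtr1.
rewrite /fdev -mulrBr normrM gtr0_norm//.
apply: le_trans (_ : s * (379 * q ^+ 6 * (sn * h) + sn * h) <= _); last first.
  have -> : s * (379 * q ^+ 6 * (sn * h) + sn * h) = (s * sn) * ((379 * q ^+ 6 + 1) * h) by ring.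
  rewrite ssn mul1r; apply: le_trans (_ : 380 * q ^+ 6 * h <= _).
    apply: ler_wpM2r => //; have : 1 <= q ^+ 6 by rewrite exprn_ege1.
    by lra.
  have -> : 380 * q ^+ 6 * h = 380 * (q^-1 ^+ 2 * (q ^+ 8 / n%:R ^+ 2) / beta).
    by rewrite /h; field; rewrite !gt_eqF.
  have -> : 380 * beta * q^-1 ^+ 2 = 380 * (q^-1 ^+ 2 * 1 * beta) by ring.
  apply: ler_wpM2l => //; apply: ler_pM; [by nonneg|by nonneg| |].
    apply: ler_wpM2l; first by nonneg.
    rewrite ler_pdivrMr ?exprn_gt0// mul1r.
    apply: le_trans (_ : q ^+ 17 * q ^+ 17 <= _); last by rewrite expr2; apply: ler_pM => //; nonneg.
    by rewrite -exprD ler_weXn2l.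
  by apply: le_trans beta1; rewrite invf_le1.
apply: ler_wpM2l; first exact: ltW.
apply: le_trans (l2_dist _ _) _.
have gen (u v r r' : 'I_n -> R) : l2 (fun i => (u i - r i) - (v i - r' i)) <=
    l2 (fun i => u i - v i) + l2 (fun i => r i - r' i).
  apply: le_trans (l2B _ _); rewrite le_eqVlt; apply/orP; left; apply/eqP.
  by congr l2; apply/funext => i; ring.
apply: le_trans (gen _ _ _ _) _; apply: lerD.
  apply: le_trans (_ : fro (gres beta (atilde beta b D') (btilde beta b D') D' x -
                            gres beta (atilde beta b D) (btilde beta b D) D x) <= _).
    apply: le_trans (l2_Im_diag _); rewrite le_eqVlt; apply/orP; left; apply/eqP.
    have gen2 (Y Z : 'M[R[i]]_n) i : - complex.Im (Y i i) - (- complex.Im (Z i i)) =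
        complex.Im ((Z - Y) i i).
      by rewrite -mxB_entry cImD cImN; ring.
    by congr l2; apply/funext => i; exact: gen2.
  by apply: fro_resolvent_diff => // i; rewrite distrC.
have rE E i : adm E -> rdiag beta q E i = - complex.Im (0 +i* b + (E i i)%:C)^-1.
  by move=> aE; rewrite (invC_ib b0) /= opprK.
apply: le_of_sq; first by rewrite mulr_ge0 ?sqrtr_ge0.
rewrite exprMn l2_sq sqr_sqrtr ?ler0n//.
have -> : n%:R * h ^+ 2 = \sum_(i < n) h ^+ 2 by rewrite sumr_const card_ord mulr_natl.
apply: ler_sum => i _; rewrite -real_normK ?num_real// lerXn2r ?nnegrE//.
apply: le_trans (nc_inv_ib_diff beta1 q1 aD aD' close i).
rewrite !rE//; apply: le_trans (Im_le_nc _).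
rewrite -/b cImD cImN -[leRHS]normrN le_eqVlt; apply/orP; left; apply/eqP.
by congr (`|_|); ring.
Qed.

(** A grid of mesh 1 / (beta n^2) on the diagonal of D^-1. For admissible D the normalisation gives
    beta / d_i <= n, so the indices do not exceed n^3 and [inord] does not alter them. *)
Definition cell (D : 'M[R]_n) : {ffun 'I_n -> 'I_(n ^ 3).+1} :=
  [ffun i => inord (Num.truncn ((D i i)^-1 * (beta * n%:R ^+ 2)))].

Lemma cell_close D D' : adm D -> adm D' -> cell D = cell D' ->
  forall i, `|(D i i)^-1 - (D' i i)^-1| <= (beta * n%:R ^+ 2)^-1.
Proof.
move=> aD aD' /ffunP cc i; have := cc i; rewrite !ffunE => /(congr1 val).
have N0 : 0 < beta * n%:R ^+ 2 by posit.
have small E : adm E -> (Num.truncn ((E i i)^-1 * (beta * n%:R ^+ 2)) < (n ^ 3).+1)%N.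
  move=> aE; have d0 := adm_gt0 aE i; rewrite ltnS truncn_le_nat.
  apply: le_lt_trans (_ : (n ^ 3)%:R < _); last by rewrite ltr_nat.
  have kb : (E i i)^-1 * beta <= n%:R.
    apply: le_of_sq => //; rewrite exprMn.
    have : (E i i)^-1 ^+ 2 <= n%:R * mean (fun k => (E k k)^-1 ^+ 2).
      rewrite /mean mulrA mulfV ?gt_eqF// mul1r (bigD1 i)//= lerDl.
      by apply: sumr_ge0 => k _; exact: sqr_ge0.
    rewrite (mean_inv2E beta1 aE) => h.
    apply: le_trans (ler_wpM2r (sqr_ge0 beta) h) _.
    have -> : n%:R * (2 * beta ^+ 2)^-1 * beta ^+ 2 = n%:R / 2 :> R by field; rewrite gt_eqF.
    have n1 : 1 <= n%:R :> R by rewrite ler1n.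
    have : n%:R * 1 <= n%:R * n%:R :> R by apply: ler_wpM2l.
    by rewrite expr2; lra.
  have -> : (n ^ 3)%:R = n%:R * n%:R ^+ 2 :> R by rewrite natrX exprS.
  by rewrite mulrA; apply: ler_wpM2r => //; exact: sqr_ge0.
rewrite /= !inordK ?small// => eqt.
have t1 : 0 <= (D i i)^-1 * (beta * n%:R ^+ 2) by rewrite mulr_ge0 ?invr_ge0 ?ltW ?(adm_gt0 aD).
have t2 : 0 <= (D' i i)^-1 * (beta * n%:R ^+ 2) by rewrite mulr_ge0 ?invr_ge0 ?ltW ?(adm_gt0 aD').
have := trunc_itv t1; have := trunc_itv t2; rewrite eqt => /andP [l1 u1] /andP [l2 u2].
rewrite -[leRHS]mul1r ler_pdivlMr// -[X in _ * X]gtr0_norm// -normrM mulrBl.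
rewrite -natr1 in u1 u2; rewrite ler_norml; lra.
Qed.

(** n^3 + 1 <= 2 p^51 <= exp (52 p) because p^17 = n: the logarithm of n is crudely replaced by p.
    The count stays below concentration, whose exponent 60 n^2 / q^16 is at least 60 n p since q <=
    p. *)
Lemma net_count : ((n ^ 3).+1 ^ n)%:R * (4 / 3 * expR (- (60 * n%:R ^+ 2 / q ^+ 16))) <=
  4 / 3 * expR (- (n%:R / 1600)) :> R.
Proof.
have n1 : 1 <= n%:R :> R by rewrite ler1n.
have c1 : ((n ^ 3).+1 ^ n)%:R <= expR (n%:R * (52 * p)) :> R.
  rewrite expRM_natl natrX lerXn2r ?nnegrE ?expR_ge0 ?ler0n//.
  have pe : p <= expR p by apply: le_trans (expR_ge1Dx p); rewrite lerDr.
  have e2 : 2 <= expR p.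
    apply: le_trans (expR_ge1Dx p); rewrite [2](_ : _ = 1 + 1)// lerD2l.
    by rewrite (le_trans _ p12)// ler1n.
  have -> : 52 * p = p + 51%:R * p by ring.
  rewrite expRD expRM_natl; apply: le_trans (_ : 2 * p ^+ 51 <= _).
    have -> : p ^+ 51 = n%:R ^+ 3 by rewrite -p17 -exprM.
    rewrite -natr1 natrX; have : 1 <= n%:R ^+ 3 :> R by rewrite exprn_ege1.
    by lra.
  apply: ler_pM => //; first by nonneg.
  by rewrite lerXn2r ?nnegrE ?expR_ge0// ltW.
have c2 : expR (- (60 * n%:R ^+ 2 / q ^+ 16)) <= expR (- (n%:R * (60 * p))).
  rewrite ler_expR lerN2 ler_pdivlMr ?exprn_gt0//.
  have -> : 60 * n%:R ^+ 2 = (n%:R * 60) * n%:R :> R by ring.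
  have -> : n%:R * (60 * p) * q ^+ 16 = (n%:R * 60) * (p * q ^+ 16) by ring.
  apply: ler_wpM2l; first by nonneg.
  have -> : n%:R = p * p ^+ 16 by rewrite -p17 -exprS.
  apply: ler_wpM2l; first exact: ltW.
  by rewrite lerXn2r ?nnegrE// ltW.
apply: le_trans (_ : expR (n%:R * (52 * p)) * (4 / 3 * expR (- (n%:R * (60 * p)))) <= _).
  have c43 : 0 <= 4 / 3 :> R by rewrite divr_ge0.
  by apply: ler_pM; [exact: ler0n|rewrite mulr_ge0 ?expR_ge0|exact: c1|exact: ler_wpM2l].
rewrite mulrCA -expRD; apply: ler_wpM2l; first by lra.
rewrite ler_expR.
have h : n%:R * 12 <= n%:R * p :> R by apply: ler_wpM2l => //; exact: ltW.
by lra.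
Qed.

(** The event of (3) quantifies over uncountably many D; [E] is a measurable part of it described by
    finitely many representatives. The constants come from 4 mc + 280 + 380 <= 5 mc and 4 + 4/3 <=
    6. *)
Lemma net_event : exists E : set T, [/\ measurable E,
  forall x, E x -> opnorm (hermx x) <= 3 /\ forall D, adm D ->
    hs_norm (diag_part (Pmx beta b (tmx x) D ^+ 2) - diag_resolvent b D) <= 5 * mc * beta * q^-1 ^+ 2 &
  1 - 6 * expR (- (n%:R / 1600)) <= fine (P E)].
Proof.
have mO := @measurable_opnorm_hermx R n.
(* Representatives must be admissible, since concentration is known for those. In a cell without
   admissible matrices [rep] is the default 0, which is not invertible, and [Bc] is empty. *)
pose rep c := xget 0 [set D | adm D /\ cell D = c].
pose Bc c := if `[<adm (rep c)>] then bad beta q (rep c) else set0.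
have mB c : measurable (Bc c).
  by rewrite /Bc; case: asboolP => // h; exact: measurable_bad.
pose U := \big[setU/set0]_(c : {ffun 'I_n -> 'I_(n ^ 3).+1}) Bc c.
have mU : measurable U by apply: bigsetU_measurable.
pose O3 := [set x : T | opnorm (hermx x) <= 3].
have mO3 : measurable O3 := measurable_set_le 3 mO.
have UE x : U x <-> exists c, Bc c x.
  have UEr (r : seq {ffun 'I_n -> 'I_(n ^ 3).+1}) :
      (\big[setU/set0]_(c <- r) Bc c) x <-> exists2 c, c \in r & Bc c x.
    elim: r => [|c r IH]; first by rewrite big_nil; split => // -[].
    rewrite big_cons; split => [[cx|/IH [c' c'r c'x]]|[c']].
    - by exists c; rewrite ?mem_head.
    - by exists c' => //; rewrite inE c'r orbT.
    - by rewrite inE => /orP [/eqP ->|c'r] c'x; [left|right; apply/IH; exists c'].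
  rewrite /U UEr; split => [[c _ cx]|[c cx]]; first by exists c.
  by exists c => //; exact: mem_index_enum.
exists (O3 `&` ~` U); split.
- by apply: measurableI => //; exact: measurableC.
- move=> x [hx nU]; split => // D aD; rewrite (hs_norm_fdev n0 beta1 q1)//.
  have [aR cR] : adm (rep (cell D)) /\ cell (rep (cell D)) = cell D.
    by apply: (@xgetPex _ 0 [set D' | adm D' /\ cell D' = cell D]); exists D.
  have nb : ~ bad beta q (rep (cell D)) x.
    move=> hb; apply: nU; apply/UE; exists (cell D); rewrite /Bc.
    by case: asboolP.
  have : fdev beta q (rep (cell D)) x <= (4 * mc + 280) * beta * q^-1 ^+ 2.
    by rewrite leNgt; apply/negP.
  have := fdev_close hx aD aR (cell_close aD aR (esym cR)).
  move=> h1 h2; apply: le_trans h1 _; apply: le_trans (lerD h2 (lexx _)) _.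
  rewrite -!mulrDl; apply: ler_wpM2r; first by nonneg.
  by apply: ler_wpM2r; [exact: ltW|rewrite /mean_const; lra].
- pose f (x : T) : R := \1_O3 x - \sum_c \1_(Bc c) x.
  have bI (A : set T) : measurable A -> bmf (\1_A : T -> R) by exact: bmf_indic.
  have bS : bmf (fun x => \sum_c \1_(Bc c) x : R) by apply: bmf_sum => c _; exact: bI.
  have bf : bmf f by apply: bmfB => //; exact: bI.
  have mE : measurable (O3 `&` ~` U) by apply: measurableI => //; exact: measurableC.
  rewrite -(Ex_indic P mE); apply: le_trans (_ : Ex P f <= _); last first.
    apply: Ex_le => // [|x]; first exact: bI.
    rewrite /f indicI [X in _ <= X]/= [\1_O3 x]indicE.
    have S0 : 0 <= \sum_c \1_(Bc c) x :> R by apply: sumr_ge0 => c _; rewrite indicE.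
    case: (x \in O3) => /=; last by rewrite mul0r sub0r oppr_le0.
    rewrite mul1r indicE; case: (boolP (x \in ~` U)) => [_|xU]; first by rewrite gerBl.
    rewrite subr_le0; have /UE [c cx] : U x.
      by move: xU; rewrite in_setC negbK => /set_mem.
    rewrite (bigD1 c)//= indicE mem_set//= lerDl.
    by apply: sumr_ge0 => c' _; rewrite indicE.
  rewrite /f (ExB P (bI _ mO3) bS) (Ex_sum P) => [|c]; last exact: bI.
  have h1 : 1 - 4 * expR (- (n%:R / 1600)) <= Ex P (\1_O3 : T -> R).
    rewrite (Ex_indic P mO3).
    have := opnorm_tail n0 s7.
    have -> : [set x : T | 3 < opnorm (hermx x)] = ~` O3.
      by apply/seteqP; split => x /=; rewrite /O3 /= ltNge => /negP.
    by rewrite prob_compl//; lra.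
  have h2 : \sum_c Ex P (\1_(Bc c) : T -> R) <= 4 / 3 * expR (- (n%:R / 1600)).
    apply: le_trans net_count.
    have -> : ((n ^ 3).+1 ^ n)%N = #|{ffun 'I_n -> 'I_(n ^ 3).+1}| by rewrite card_ffun !card_ord.
    rewrite mulr_natl -sumr_const; apply: ler_sum => c _.
    rewrite (Ex_indic P (mB c)) /Bc; case: asboolP => h; first exact: prob_bad.
    by rewrite measure0 mulr_ge0 ?expR_ge0//; lra.
  by have := expR_ge0 (- (n%:R / 1600) : R); lra.
Qed.

End net_event.

(** * Powers of n and assembly of the matrix estimates *)

Section powers.
Context (R : realType) (n : nat) (n0 : (0 < n)%N) (beta delta : R).
Hypotheses (delta0 : 0 < delta) (delta17 : delta <= 17^-1).
Let q : R := n%:R `^ delta.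
Let p : R := n%:R `^ 17^-1.

Lemma powR_natmul (x : R) k : n%:R `^ (k%:R * x) = (n%:R `^ x) ^+ k.
Proof. by rewrite mulrC powRrM powR_mulrn// powR_ge0. Qed.

Lemma npow_ge1 : 1 <= q.
Proof.
rewrite -(powRr0 (n%:R : R)); apply: ler_powR; last exact: ltW.
by rewrite ler1n.
Qed.

Lemma npow_le : q <= p.
Proof. by apply: ler_powR => //; rewrite ler1n. Qed.

Lemma npow17 : p ^+ 17 = n%:R.
Proof. by rewrite -powR_natmul mulfV ?pnatr_eq0// powRr1. Qed.

Lemma bparE : bpar n beta delta = beta / q.
Proof. by rewrite /bpar powRN. Qed.

Lemma npowN k : n%:R `^ (- (k%:R * delta)) = q^-1 ^+ k.
Proof. by rewrite powRN powR_natmul exprVn. Qed.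

Lemma npowN1 : n%:R `^ (- delta) = q^-1.
Proof. by rewrite powRN. Qed.

End powers.

(** What holds for each fixed A and D. The trace bound of (4) is conditional on the deviation bound
    of (3), whose constant is left free as [C3]. *)
Lemma deterministic_parts (R : realType) (beta delta : R) (n : nat) (A D : 'M[R]_n) (C3 : R) :
  1 <= beta -> 0 < delta -> delta <= 17^-1 -> (0 < n)%N -> admissible beta D ->
  let b := bpar n beta delta in
  [/\ `|2 * beta ^+ 2 * ntr (invmx D) - atilde beta b D|
        <= 2 * beta ^+ 4 * n%:R `^ (- (2 * delta)) * ntr (invmx D ^+ 3),
      ntr (Pmx beta b A D ^+ 2 *m shifted beta b A D ^+ 2)
        <= 2 * beta ^+ 5 * n%:R `^ (- (3 * delta)) * ntr (invmx D ^+ 4) /\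
      2 * beta ^+ 5 * n%:R `^ (- (3 * delta)) * ntr (invmx D ^+ 4)
        <= 2 * beta ^+ 3 * n%:R `^ (- (3 * delta)) * opnorm (invmx D) ^+ 2,
      2^-1 * beta^-1 * n%:R `^ (- delta) - beta * opnorm (invmx D) ^+ 2 * n%:R `^ (- (3 * delta))
        <= ntr (diag_resolvent b D),
      hs_norm (diag_part (Pmx beta b A D ^+ 2) - diag_resolvent b D)
          <= C3 * beta * n%:R `^ (- (2 * delta)) ->
        2^-1 * beta^-1 * n%:R `^ (- delta) - C3 * beta * n%:R `^ (- (2 * delta))
          - 2^-1 * beta * opnorm (invmx D) ^+ 2 * n%:R `^ (- (3 * delta))
        <= ntr (Pmx beta b A D ^+ 2) &
      opnorm (Pmx beta b A D ^+ 2) <= 3 * beta^-1 * n%:R `^ (3 * delta)].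
Proof.
move=> beta1 delta0 delta17 n0 aD b.
have q1 := npow_ge1 n0 delta0; set q := n%:R `^ delta in q1.
have q0 : 0 < q := lt_le_trans ltr01 q1.
have beta0 : 0 < beta := lt_le_trans ltr01 beta1.
have bE : b = beta / q by exact: bparE.
have b0 : 0 < b by rewrite bE divr_gt0.
have bb : b <= beta by rewrite bE ler_pdivrMr// ler_peMr// ltW.
rewrite !npowN npowN1 powR_natmul -/q.
have dc := inv_le_opnorm aD; set c := opnorm (invmx D) in dc *.
have i4 := ntr_inv4_le aD dc.
have R1 : b / (2 * beta ^+ 2) = 2^-1 * beta^-1 * q^-1.
  by rewrite bE; field; rewrite !gt_eqF.
have R2 : b ^+ 3 / (2 * beta ^+ 2) * c ^+ 2 = 2^-1 * beta * c ^+ 2 * q^-1 ^+ 3.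
  by rewrite bE; field; rewrite !gt_eqF.
have low := ntr_diag_resolvent_ge beta1 b0 aD dc; rewrite R1 R2 in low.
split.
- have -> : 2 * beta ^+ 4 * q^-1 ^+ 2 * ntr (invmx D ^+ 3) = 2 * beta ^+ 2 * b ^+ 2 * ntr (invmx D ^+ 3).
    by rewrite bE; field; rewrite !gt_eqF.
  exact: atilde_dist.
- split.
    apply: le_trans (ntr_Pmx_shifted n0 A beta1 b0 bb aD) _.
    have -> : 2 * beta ^+ 5 * q^-1 ^+ 3 * ntr (invmx D ^+ 4) = 2 * beta ^+ 2 * b ^+ 3 * ntr (invmx D ^+ 4).
      by rewrite bE; field; rewrite !gt_eqF.
    exact: btilde_le.
  have -> : 2 * beta ^+ 5 * q^-1 ^+ 3 * ntr (invmx D ^+ 4) =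
      beta ^+ 3 * q^-1 ^+ 3 * (2 * beta ^+ 2 * ntr (invmx D ^+ 4)) by ring.
  have -> : 2 * beta ^+ 3 * q^-1 ^+ 3 * c ^+ 2 = beta ^+ 3 * q^-1 ^+ 3 * (2 * c ^+ 2) by ring.
  apply: ler_wpM2l; first by nonneg.
  by apply: le_trans i4 _; have := sqr_ge0 c; lra.
- apply: le_trans low; rewrite lerD2l lerN2.
  have : 0 <= beta * c ^+ 2 * q^-1 ^+ 3 by nonneg.
  by lra.
- move=> good.
  have h := le_trans (ntr_le_hs_norm n0 (diag_part (Pmx beta b A D ^+ 2) - diag_resolvent b D)) good.
  have E : ntr (diag_part (Pmx beta b A D ^+ 2) - diag_resolvent b D) =
      ntr (Pmx beta b A D ^+ 2) - ntr (diag_resolvent b D).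
    by rewrite -[in RHS]ntr_diag_part /ntr raddfB mulrBr.
  by move: h; rewrite E ler_norml => /andP [h _]; lra.
- apply: le_trans (opnorm_Pmx n0 A beta1 b0 bb aD) _.
  have eg := btilde_ge n0 beta1 b0 bb aD; have e0 := btilde_gt0 n0 beta1 b0 bb aD.
  have -> : 3 * beta^-1 * q ^+ 3 = (b ^+ 3 / (3 * beta ^+ 2))^-1.
    by rewrite bE; field; rewrite !gt_eqF.
  by rewrite lef_pV2 ?posrE//; posit.
Qed.

(** For p < 12 the empty event suffices: there [K] bounds n / 1600, so (6 + exp K) exp (- n / 1600)
    >= 1. *)
Lemma good_event_prob (R : realType) (beta delta K : R) (n : nat) :
  (forall p : R, 0 <= p -> p < 12 -> p ^+ 17 / 1600 <= K) ->
  1 <= beta -> 0 < delta -> delta <= 17^-1 -> (0 < n)%N ->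
  forall (d : measure_display) (Omega : measurableType d) (P : probability Omega R)
    (A : 'I_n -> 'I_n -> {RV P >-> R}), gaussian_iid A ->
  exists E : set Omega, [/\ measurable E, E `<=` good_event A beta delta (5 * mean_const R)
    & ((1 - (6 + expR K) * expR (- (1600^-1 * n%:R)))%:E <= P E)%E].
Proof.
move=> HK beta1 delta0 delta17 n0 d Omega P A iid.
pose p : R := n%:R `^ 17^-1.
have p17 : p ^+ 17 = n%:R := npow17 R n.
have [p12|p12] := leP 12 p; last first.
  exists set0; split => //; rewrite measure0 lee_fin subr_le0 mulrDl -expRD.
  apply: le_trans (_ : expR (K - 1600^-1 * n%:R) <= _); last first.
    by rewrite lerDr mulr_ge0 ?expR_ge0.
  apply: le_trans (expR_ge1Dx _); rewrite lerDl -p17 [1600^-1 * _]mulrC subr_ge0.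
  by apply: HK => //; exact: powR_ge0.
have q1 := npow_ge1 n0 delta0; have qp := npow_le n0 delta17.
have [E [mE Egood PE]] := net_event n0 beta1 q1 qp p12 p17.
have [X [mX XA law]] := gaussian_iid_law iid.
exists (X @^-1` E); split.
- by rewrite -[X @^-1` E]setTI; exact: mX.
- move=> w /Egood [h1 h2]; split; first by move: h1; rewrite /hermx XA.
  by move=> D aD; rewrite npowN -XA bparE; exact: h2.
rewrite law//.
have fin : gaussm (Num.sqrt n%:R^-1) (n * n) E \is a fin_num.
  by rewrite fin_numElt (lt_le_trans _ (measure_ge0 _ _))// (le_lt_trans (probability_le1 _ mE))// ltry.
rewrite -(fineK fin) lee_fin; apply: le_trans PE; rewrite lerD2l lerN2 [1600^-1 * _]mulrC.
by apply: ler_wpM2r; [exact: expR_ge0|rewrite lerDl expR_ge0].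
Qed.

(** * Operators in a von Neumann algebra *)

(** Serves both Cauchy-Schwarz inequalities below, for the inner product and for the trace; a
    vanishing c is included since a trace of squares may vanish. *)
Lemma discriminant_le (R : realFieldType) (a b c : R) :
  (forall t, 0 <= a + 2 * t * b + t ^+ 2 * c) -> b ^+ 2 <= a * c.
Proof.
move=> h.
have c0 : 0 <= c.
  rewrite leNgt; apply/negP => c0.
  have a0 : 0 <= a by have := h 0; rewrite mulr0 mul0r expr0n mul0r !addr0.
  have := h ((a + 2 * `|b| + 1) / - c + 1).
  set s := (a + 2 * `|b| + 1) / - c.
  have s0 : 0 <= s.
    rewrite /s; apply: divr_ge0; last by rewrite oppr_ge0 ltW.
    by apply: addr_ge0 => //; apply: addr_ge0 => //; apply: mulr_ge0.
  have es : s * c = - (a + 2 * `|b| + 1).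
    by rewrite /s invrN mulrN mulNr divfK// lt_eqF.
  have -> : a + 2 * (s + 1) * b + (s + 1) ^+ 2 * c
     = a + 2 * (s + 1) * b + (s + 1) * (s * c) + (s + 1) * c by ring.
  rewrite es leNgt => /negP; apply.
  have hb : b <= `|b| by exact: ler_norm.
  have h1 : (s + 1) * c < 0 by rewrite nmulr_llt0// ltr_wpDl.
  have h2 : 0 <= (s + 1) * (`|b| - b).
    by apply: mulr_ge0; [exact: addr_ge0|rewrite subr_ge0].
  have h3 : 0 <= s * a by rewrite mulr_ge0.
  nra.
have [c0'|cp] := eqVneq c 0.
  rewrite c0' mulr0; have [->|b0] := eqVneq b 0; first by rewrite expr0n.
  have := h (- (a + 1) / (2 * b)); rewrite c0' mulr0 addr0.
  have -> : a + 2 * (- (a + 1) / (2 * b)) * b = - 1 by field.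
  by rewrite oppr_ge0 ler10.
have cgt : 0 < c by rewrite lt_neqAle eq_sym cp.
have := h (- b / c).
have -> : a + 2 * (- b / c) * b + (- b / c) ^+ 2 * c = (a * c - b ^+ 2) / c.
  by field.
by rewrite pmulr_lge0 ?invr_gt0// subr_ge0.
Qed.

Section real_part.
Variables (R : realType) (H : completeNormedModType R[i]).
Variable ip : {dot H for Num.conj}.
Hypothesis hip : hilbert_norm ip.

Definition nr (x : H) : R := complex.Re `|x|.

Lemma nrE x : `|x| = (nr x)%:C.
Proof.
have : `|x| \is Num.real by exact: normr_real.
by rewrite /nr; case: (`|x|) => a b; rewrite complex_real => /eqP /= ->.
Qed.

Lemma nr_ge0 x : 0 <= nr x.
Proof. by have := normr_ge0 x; rewrite nrE lecR. Qed.

Lemma nr0 : nr 0 = 0. Proof. by rewrite /nr normr0. Qed.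

Lemma nr_eq0 x : nr x = 0 -> x = 0.
Proof. by move=> h; apply/eqP; rewrite -normr_eq0 nrE h. Qed.

Lemma nrN x : nr (- x) = nr x. Proof. by rewrite /nr normrN. Qed.

Lemma nrD x y : nr (x + y) <= nr x + nr y.
Proof. by have := ler_normD x y; rewrite !nrE -rmorphD lecR. Qed.

Lemma nrB x y : nr (x - y) <= nr x + nr y.
Proof. by rewrite -[nr y]nrN nrD. Qed.

Lemma nr_tri x y z : nr (x - z) <= nr (x - y) + nr (y - z).
Proof. by rewrite -[x - z](subrKA y) nrD. Qed.

Lemma nrZ (a : R) x : nr (a%:C *: x) = `|a| * nr x.
Proof.
have := normrZ a%:C x; rewrite !nrE normc_def /= expr0n addr0 sqrtr_sqr.
by rewrite -rmorphM => /complexI.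
Qed.

(** Self-adjointness and positivity are expressed through the underlying real inner product, so that
    all scalars in the estimates are real. *)
Definition re (x y : H) : R := complex.Re (ip x y).

Lemma reC x y : re x y = re y x.
Proof.
rewrite /re (hermC ip) expr0 mul1r; apply: (@complexI R).
by rewrite !complexRe Re_conj.
Qed.

Lemma reDl x y z : re (x + y) z = re x z + re y z.
Proof. by rewrite /re linearDl raddfD. Qed.

Lemma reDr x y z : re z (x + y) = re z x + re z y.
Proof. by rewrite reC reDl !(reC z). Qed.

Lemma reZl (a : R) x y : re (a%:C *: x) y = a * re x y.
Proof. by rewrite /re linearZl_LR /=; case: (ip x y) => u v /=; rewrite mul0r subr0. Qed.

Lemma reZr (a : R) x y : re x (a%:C *: y) = a * re x y.
Proof. by rewrite reC reZl reC. Qed.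

Lemma reNl x y : re (- x) y = - re x y.
Proof. by rewrite -scaleN1r -(rmorphN1 (real_complex R)) reZl mulN1r. Qed.

Lemma reNr x y : re x (- y) = - re x y.
Proof. by rewrite reC reNl reC. Qed.

Lemma nr_re x : nr x ^+ 2 = re x x.
Proof. by rewrite /re -hip nrE -rmorphXn. Qed.

Definition reE := (reDl, reDr, reNl, reNr, reZl, reZr).

Lemma re_CS x y : re x y <= nr x * nr y.
Proof.
have h : re x y ^+ 2 <= (nr x * nr y) ^+ 2.
  rewrite exprMn !nr_re; apply: discriminant_le => t.
  have := sqr_ge0 (nr (x + t%:C *: y)); rewrite nr_re !reE (reC y x).
  by move=> /le_trans; apply; rewrite le_eqVlt; apply/orP; left; apply/eqP; ring.
have xy0 : 0 <= nr x * nr y by rewrite mulr_ge0 ?nr_ge0.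
apply: le_trans (ler_norm _) _.
by rewrite -(@ler_pXn2r _ 2) ?nnegrE// real_normK ?num_real.
Qed.

Definition opb (c : R) (X : H -> H) := forall x, nr (X x) <= c * nr x.

Lemma bounded_opP (X : H -> H) :
  bounded_op X <-> linear X /\ exists2 c, 0 <= c & opb c X.
Proof.
split=> -[lX [c hc]].
  split=> //.
  exists `|c| => // x; rewrite -lecR -nrE; apply: le_trans (hc x) _.
  rewrite nrE -rmorphM lecR; apply: ler_wpM2r; first exact: nr_ge0.
  exact: ler_norm.
by move=> h; split => //; exists c => x; rewrite !nrE -rmorphM lecR.
Qed.

(** Convergence in operator norm. *)
Definition cvo (X : nat -> H -> H) (Y : H -> H) :=
  forall e, 0 < e -> exists N, forall n x, (N <= n)%N ->
    nr (X n x - Y x) <= e * nr x.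

Lemma nr_small (v : H) (K : R) : (forall e, 0 < e -> nr v <= e * K) -> v = 0.
Proof.
move=> h; apply: nr_eq0; apply/eqP; rewrite eq_le nr_ge0 andbT.
rewrite leNgt; apply/negP => v0.
have K0 : 0 < K.
  rewrite ltNge; apply/negP => K0; have := h 1 ltr01; rewrite mul1r => hv.
  by have := le_trans hv K0; rewrite leNgt v0.
have := h (nr v / K / 2); rewrite !divr_gt0// => /(_ isT).
rewrite mulrAC divfK ?gt_eqF//; lra.
Qed.

Lemma monotone_tail (s : nat -> R) (L : R) :
  (forall n, s n <= s n.+1) -> (forall n, s n <= L) ->
  forall e, 0 < e -> exists N, forall m n, (N <= m)%N -> (m <= n)%N ->
    s n - s m <= e.
Proof.
move=> s1 sL e e0.
have hi : {homo s : m n / (m <= n)%N >-> m <= n} by apply: homo_leq; [|exact: le_trans|].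
have sup1 : has_sup (range s).
  by split; [exists (s 0%N), 0%N | exists L => _ [n _ <-]].
have [x [N _ <-] hN] := sup_adherent e0 sup1.
exists N => m n Nm mn.
have h1 : s n <= sup (range s) by apply: ub_le_sup; [exact: sup1.2 | exists n].
have h2 := hi _ _ Nm.
lra.
Qed.

(** The increments are majorised by those of a bounded increasing scalar sequence, so the operators
    are uniformly Cauchy. The Neumann series and the square root iteration both come with such a
    majorant. *)
Lemma limit_op (X : nat -> H -> H) (s : nat -> R) (L : R) :
  (forall n x, nr (X n.+1 x - X n x) <= (s n.+1 - s n) * nr x) ->
  (forall n, s n <= s n.+1) -> (forall n, s n <= L) ->
  exists Y, cvo X Y.
Proof.
move=> h s1 sL.
have hmn x m k : nr (X (m + k)%N x - X m x) <= (s (m + k)%N - s m) * nr x.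
  elim: k => [|k IH]; first by rewrite addn0 !subrr nr0 mul0r.
  rewrite addnS; apply: le_trans (nr_tri _ (X (m + k)%N x) _) _.
  apply: le_trans (lerD (h _ _) IH) _; rewrite -mulrDl subrKA//.
have tl := monotone_tail s1 sL.
have hc e : 0 < e -> exists N, forall m n x, (N <= m)%N -> (N <= n)%N ->
    nr (X m x - X n x) <= e * nr x.
  move=> e0; have [N hN] := tl _ e0; exists N => m n x Nm Nn.
  wlog mn : m n Nm Nn / (n <= m)%N.
    move=> hw; have [mn|nm] := leqP n m; first exact: hw.
    by rewrite -nrN opprB; apply: hw => //; exact: ltnW.
  rewrite -(subnKC mn); apply: le_trans (hmn _ _ _) _.
  rewrite subnKC//; apply: ler_wpM2r; first exact: nr_ge0.
  exact: hN.
have cv x : exists l : H, (fun n => X n x) @ \oo --> l.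
  have : cvg ((fun n => X n x) @ \oo).
    apply: cauchy_cvg; apply: cauchy_exP => e e0.
    have ee : e = (complex.Re e)%:C by apply/esym/RRe_real; exact: gtr0_real.
    have e0' : 0 < complex.Re e by rewrite -ltcR -ee.
    have k0 : 0 < nr x + 1 by rewrite ltr_wpDl// nr_ge0.
    have [N hN] := hc (complex.Re e / (nr x + 1)) (divr_gt0 e0' k0).
    exists (X N x); exists N => // n /= Nn; rewrite -ball_normE /= nrE ee ltcR.
    apply: le_lt_trans (hN _ _ _ (leqnn N) Nn) _.
    rewrite mulrAC ltr_pdivrMr// ltr_pM2l// ltrDl//.
  by move=> /cvg_ex.
have [Y hY] := choice cv.
exists Y => e e0; have [N hN] := hc _ e0; exists N => n x Nn.
rewrite leNgt; apply/negP => hlt.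
have e1 : 0 < (nr (X n x - Y x) - e * nr x)%:C by rewrite ltcR subr_gt0.
have /cvgrPdist_lt /(_ _ e1) [N2 _ hN2] := hY x.
have := hN2 (maxn N N2); rewrite /= leq_maxr => /(_ isT).
rewrite nrE ltcR.
have := hN n (maxn N N2) x Nn (leq_maxl _ _).
have := nr_tri (X n x) (X (maxn N N2) x) (Y x).
rewrite -[nr (Y x - _)]nrN opprB.
lra.
Qed.

End real_part.

(** * The algebra as a ring closed under norm limits *)

Section von_neumann_closure.
Variables (R : realType) (H : completeNormedModType R[i]).
Variable ip : {dot H for Num.conj}.
Variable M : set (H -> H).
Hypothesis hM : von_neumann_algebra ip M.

Lemma vnP (T : H -> H) : M T <->
  bounded_op T /\ forall U, commutant M U -> T \o U = U \o T.
Proof. by case: hM => _ _ {1}<-; split=> -[bT h]; split. Qed.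

Lemma vn_linear (T : H -> H) : M T -> linear T.
Proof. by move=> /vnP[[]]. Qed.

Lemma commutant_linear (U : H -> H) : commutant M U -> linear U.
Proof. by move=> [[]]. Qed.

Lemma linear_op (T : H -> H) : linear T ->
  [/\ forall x y, T (x + y) = T x + T y, forall a x, T (a *: x) = a *: T x,
      T 0 = 0 & forall x, T (- x) = - T x].
Proof.
move=> lT.
have t0 : T 0 = 0.
  have := lT 1 0 0; rewrite !scale1r add0r => /eqP.
  by rewrite -[X in X == _]addr0 (inj_eq (addrI _)) => /eqP <-.
have tZ a x : T (a *: x) = a *: T x by rewrite -[a *: x]addr0 lT t0 addr0.
split => //; first by move=> x y; rewrite -[x]scale1r lT !scale1r.
by move=> x; rewrite -scaleN1r tZ scaleN1r.
Qed.

Lemma vn_id : M idfun.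
Proof.
apply/vnP; split=> //; apply/bounded_opP; split=> //.
by exists 1 => // x; rewrite mul1r.
Qed.

Lemma vn_comp T U : M T -> M U -> M (T \o U).
Proof.
move=> /vnP[/bounded_opP[lT [c c0 hc]] cT] /vnP[/bounded_opP[lU [e e0 he]] cU].
apply/vnP; split.
  apply/bounded_opP; split; first by move=> a x y /=; rewrite lU lT.
  exists (c * e); first exact: mulr_ge0.
  move=> x /=; apply: le_trans (hc _) _; rewrite -mulrA.
  by apply: ler_wpM2l => //; exact: he.
move=> V ZV; apply/funext => x /=.
have /= h1 := congr1 (@^~ x) (cU _ ZV); have /= h2 := congr1 (@^~ (U x)) (cT _ ZV).
by rewrite h1 h2.
Qed.

Lemma vn_lin (a : R[i]) T U : M T -> M U -> M (a *: T + U).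
Proof.
move=> /vnP[[lT [c hc]] cT] /vnP[[lU [e he]] cU]; apply/vnP; split.
  split.
    move=> k x y; rewrite !fctE lT lU !scalerDr !scalerA [a * k]mulrC.
    by rewrite addrACA.
  have ea : `|a| = (complex.Re `|a|)%:C by rewrite RRe_real// normr_real.
  exists (complex.Re `|a| * c + e) => x.
  rewrite rmorphD rmorphM mulrDl /= -ea !fctE; apply: le_trans (ler_normD _ _) _.
  apply: lerD (he x); rewrite normrZ -mulrA; apply: ler_wpM2l (hc x).
  exact: normr_ge0.
move=> V ZV; apply/funext => x /=.
have [vD vZ _ _] := linear_op (commutant_linear ZV).
have := congr1 (@^~ x) (cU _ ZV); have := congr1 (@^~ x) (cT _ ZV).
by rewrite /= !fctE vD vZ => -> ->.
Qed.

Lemma vn_zero : M 0.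
Proof.
have -> : 0 = (-1 : R[i]) *: idfun + idfun :> (H -> H).
  by rewrite scaleN1r addNr.
by apply: vn_lin vn_id vn_id.
Qed.

Lemma vn_add T U : M T -> M U -> M (T + U).
Proof. by move=> mT mU; rewrite -[T]scale1r; exact: vn_lin. Qed.

Lemma vn_scale (a : R[i]) T : M T -> M (a *: T).
Proof. by move=> mT; rewrite -[a *: T]addr0; apply: vn_lin mT vn_zero. Qed.

Lemma vn_opp T : M T -> M (- T).
Proof. by move=> mT; rewrite -scaleN1r; exact: vn_scale. Qed.

Lemma nrZc (a : R[i]) (x : H) : nr (a *: x) = complex.Re `|a| * nr x.
Proof.
have ea : `|a| = (complex.Re `|a|)%:C by rewrite RRe_real// normr_real.
by have := normrZ a x; rewrite !nrE {1}ea -rmorphM => /complexI.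
Qed.

Lemma subr_telescope (V : zmodType) (p q r q' r' : V) :
  p - (q + r) = - (q' + r' - p) + (q' - q) + (r' - r).
Proof. by rewrite opprB -addrA (addrACA q') -opprD subrKA. Qed.

(** Membership in a bicommutant passes to norm limits because linearity, boundedness and commutation
    with a bounded operator do. *)
Lemma vn_limit (X : nat -> H -> H) (Y : H -> H) :
  (forall n, M (X n)) -> cvo X Y -> M Y.
Proof.
move=> mX cXY; apply/vnP; split.
  apply/bounded_opP; split.
    move=> a x y; apply/eqP; rewrite -subr_eq0; apply/eqP.
    apply: (@nr_small _ _ _ (nr (a *: x + y) + complex.Re `|a| * nr x + nr y)).
    move=> e e0; have [N hN] := cXY e e0.
    have -> : Y (a *: x + y) - (a *: Y x + Y y) = - (X N (a *: x + y) - Y (a *: x + y))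
       + (a *: (X N x - Y x)) + (X N y - Y y).
      by rewrite (vn_linear (mX N)) scalerBr; exact: subr_telescope.
    have h1 := hN N (a *: x + y) (leqnn N).
    have h2 := hN N x (leqnn N); have h3 := hN N y (leqnn N).
    apply: le_trans (nrD _ _) _; rewrite mulrDr; apply: lerD (h3).
    apply: le_trans (nrD _ _) _; rewrite nrN mulrDr; apply: lerD (h1) _.
    rewrite nrZc mulrCA; apply: ler_wpM2l (h2).
    by rewrite -lecR RRe_real ?normr_ge0// normr_real.
  have [N hN] := cXY 1 ltr01.
  have /vnP[/bounded_opP[_ [c c0 hc]] _] := mX N.
  exists (c + 1); first exact: addr_ge0.
  move=> x; have -> : Y x = X N x - (X N x - Y x) by rewrite opprB addrC subrK.
  apply: le_trans (nrB _ _) _; rewrite mulrDl; apply: lerD (hc x) _.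
  exact: hN.
move=> U ZU; apply/funext => x /=; apply/eqP; rewrite -subr_eq0; apply/eqP.
have [uD uZ _ uN] := linear_op (commutant_linear ZU).
have [/bounded_opP[_ [c c0 hc]] _] := ZU.
apply: (@nr_small _ _ _ (2 * c * nr x)) => e e0.
have [N hN] := cXY e e0; have /vnP[_ /(_ U ZU) cN] := mX N.
have -> : Y (U x) - U (Y x) = U (X N x - Y x) - (X N (U x) - Y (U x)).
  have := congr1 (@^~ x) cN; rewrite /= uD uN => ->.
  by rewrite opprB [RHS]addrC subrKA.
have h1 := hN N x (leqnn N); have h2 := hN N (U x) (leqnn N).
apply: le_trans (nrB _ _) _.
have h3 := hc (X N x - Y x); have h4 := hc x.
have h5 : e * nr (U x) <= e * (c * nr x) by rewrite ler_pM2l.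
have h6 : c * nr (X N x - Y x) <= c * (e * nr x) by exact: ler_wpM2l.
lra.
Qed.

End von_neumann_closure.

(** Bundled as a type, M carries a ring structure and a real vector space structure. Scalars are
    real so that they preserve self-adjointness. *)
Definition vnop (R : realType) (H : completeNormedModType R[i])
  (ip : {dot H for Num.conj}) (M : set (H -> H))
  (hM : von_neumann_algebra ip M) : Type := {T : H -> H | M T}.

Section vnop_ring.
Variables (R : realType) (H : completeNormedModType R[i]).
Variable ip : {dot H for Num.conj}.
Variable M : set (H -> H).
Hypothesis hM : von_neumann_algebra ip M.
Local Notation A := (vnop hM).

Definition ev (X : A) : H -> H := sval X.

Lemma ev_inj : injective ev.
Proof. by move=> [X mX] [Y mY] /= h; apply: eq_exist. Qed.

Lemma ev_mem (X : A) : M (ev X). Proof. exact: svalP. Qed.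

Definition vn_mk (T : H -> H) (mT : M T) : A := exist _ T mT.

HB.instance Definition _ := gen_eqMixin A.
HB.instance Definition _ := gen_choiceMixin A.

Definition vnop_zero : A := vn_mk (vn_zero hM).
Definition vnop_opp (X : A) : A := vn_mk (vn_opp hM (ev_mem X)).
Definition vnop_add (X Y : A) : A := vn_mk (vn_add hM (ev_mem X) (ev_mem Y)).

Lemma vnop_addA : associative vnop_add.
Proof. by move=> X Y Z; apply: ev_inj; exact: addrA. Qed.
Lemma vnop_addC : commutative vnop_add.
Proof. by move=> X Y; apply: ev_inj; exact: addrC. Qed.
Lemma vnop_add0 : left_id vnop_zero vnop_add.
Proof. by move=> X; apply: ev_inj; exact: add0r. Qed.
Lemma vnop_addN : left_inverse vnop_zero vnop_opp vnop_add.
Proof. by move=> X; apply: ev_inj; exact: addNr. Qed.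

HB.instance Definition _ := GRing.isZmodule.Build A
  vnop_addA vnop_addC vnop_add0 vnop_addN.

Definition vnop_one : A := vn_mk (vn_id hM).
Definition vnop_mul (X Y : A) : A := vn_mk (vn_comp hM (ev_mem X) (ev_mem Y)).

Lemma vnop_mulA : associative vnop_mul.
Proof. by move=> X Y Z; apply: ev_inj. Qed.
Lemma vnop_mul1l : left_id vnop_one vnop_mul.
Proof. by move=> X; apply: ev_inj. Qed.
Lemma vnop_mul1r : right_id vnop_one vnop_mul.
Proof. by move=> X; apply: ev_inj. Qed.
Lemma vnop_mulDl : left_distributive vnop_mul +%R.
Proof. by move=> X Y Z; apply: ev_inj. Qed.
Lemma vnop_mulDr : right_distributive vnop_mul +%R.
Proof.
move=> X Y Z; apply: ev_inj; apply/funext => x /=.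
by have [h _ _ _] := linear_op (vn_linear hM (ev_mem X)); exact: h.
Qed.

HB.instance Definition _ := GRing.Zmodule_isPzRing.Build A
  vnop_mulA vnop_mul1l vnop_mul1r vnop_mulDl vnop_mulDr.

Definition vnop_scale (a : R) (X : A) : A := vn_mk (vn_scale hM a%:C (ev_mem X)).

Lemma vnop_scaleA a b X :
  vnop_scale a (vnop_scale b X) = vnop_scale (a * b) X.
Proof. by apply: ev_inj; rewrite /= rmorphM; exact: scalerA. Qed.
Lemma vnop_scale1 : left_id 1 vnop_scale.
Proof. by move=> X; apply: ev_inj; exact: scale1r. Qed.
Lemma vnop_scaleDr : right_distributive vnop_scale +%R.
Proof. by move=> a X Y; apply: ev_inj; exact: scalerDr. Qed.
Lemma vnop_scaleDl X : {morph vnop_scale^~ X : a b / a + b}.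
Proof. by move=> a b; apply: ev_inj; rewrite /= rmorphD; exact: scalerDl. Qed.

HB.instance Definition _ := GRing.Zmodule_isLmodule.Build R A
  vnop_scaleA vnop_scale1 vnop_scaleDr vnop_scaleDl.

Lemma evD (X Y : A) x : ev (X + Y) x = ev X x + ev Y x. Proof. by []. Qed.
Lemma evN (X : A) x : ev (- X) x = - ev X x. Proof. by []. Qed.
Lemma evB (X Y : A) x : ev (X - Y) x = ev X x - ev Y x. Proof. by []. Qed.
Lemma evM (X Y : A) x : ev (X * Y) x = ev X (ev Y x). Proof. by []. Qed.
Lemma evZ (a : R) (X : A) x : ev (a *: X) x = a%:C *: ev X x. Proof. by []. Qed.
Lemma ev1 x : ev (1 : A) x = x. Proof. by []. Qed.
Lemma ev0 x : ev (0 : A) x = 0. Proof. by []. Qed.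

Lemma ev_lin (X : A) : linear (ev X). Proof. exact: vn_linear hM _ (ev_mem X). Qed.
Lemma evDx (X : A) x y : ev X (x + y) = ev X x + ev X y.
Proof. by have [h _ _ _] := linear_op (ev_lin X). Qed.
Lemma evZx (X : A) (a : R[i]) x : ev X (a *: x) = a *: ev X x.
Proof. by have [_ h _ _] := linear_op (ev_lin X). Qed.
Lemma evNx (X : A) x : ev X (- x) = - ev X x.
Proof. by have [_ _ _ h] := linear_op (ev_lin X). Qed.
Lemma evBx (X : A) x y : ev X (x - y) = ev X x - ev X y.
Proof. by rewrite evDx evNx. Qed.

Lemma vnopZl (a : R) (X Y : A) : (a *: X) * Y = a *: (X * Y).
Proof. by apply: ev_inj. Qed.
Lemma vnopZr (a : R) (X Y : A) : X * (a *: Y) = a *: (X * Y).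
Proof. by apply: ev_inj; apply/funext => x; rewrite evM evZ evZx. Qed.

(** Operator norm at most c, as a predicate, since upper bounds are what the estimates
    manipulate. *)
Definition nb (c : R) (X : A) := opb c (ev X).

Lemma nb_ex (X : A) : exists2 c, 0 <= c & nb c X.
Proof. by have /(vnP hM)[/bounded_opP[_ h] _] := ev_mem X. Qed.

Lemma nb_le c d X : c <= d -> nb c X -> nb d X.
Proof. by move=> cd h x; apply: le_trans (h x) (ler_wpM2r (nr_ge0 _) cd). Qed.

Lemma nbD c d X Y : nb c X -> nb d Y -> nb (c + d) (X + Y).
Proof.
by move=> hX hY x; rewrite evD mulrDl; apply: le_trans (nrD _ _) (lerD _ _).
Qed.

Lemma nbN c X : nb c X -> nb c (- X).
Proof. by move=> h x; rewrite evN nrN. Qed.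

Lemma nbB c d X Y : nb c X -> nb d Y -> nb (c + d) (X - Y).
Proof. by move=> hX /nbN; exact: nbD. Qed.

Lemma nbM c d X Y : 0 <= c -> nb c X -> nb d Y -> nb (c * d) (X * Y).
Proof.
by move=> c0 hX hY x; rewrite evM -mulrA; apply: le_trans (hX _) (ler_wpM2l c0 _).
Qed.

Lemma nbZ (a c : R) X : nb c X -> nb (`|a| * c) (a *: X).
Proof. by move=> h x; rewrite evZ nrZ -mulrA ler_wpM2l. Qed.

Lemma nbZ_ge0 (a c : R) X : 0 <= a -> nb c X -> nb (a * c) (a *: X).
Proof. by move=> a0 /(nbZ a); rewrite ger0_norm. Qed.

Lemma nb1 : nb 1 1.
Proof. by move=> x; rewrite ev1 mul1r. Qed.

Lemma nb0 : nb 0 0.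
Proof. by move=> x; rewrite ev0 nr0 mul0r. Qed.

Lemma nbX c X n : 0 <= c -> nb c X -> nb (c ^+ n) (X ^+ n).
Proof.
move=> c0 hX; elim: n => [|n IH]; first exact: nb1.
by rewrite !exprS; exact: nbM.
Qed.

Lemma nb_small X : (forall e, 0 < e -> nb e X) -> X = 0.
Proof.
move=> h; apply: ev_inj; apply/funext => x; rewrite ev0.
by apply: (@nr_small _ _ _ (nr x)) => e e0; exact: h.
Qed.

Definition cvA (X : nat -> A) (Y : A) :=
  forall e, 0 < e -> exists N, forall n, (N <= n)%N -> nb e (X n - Y).

Lemma cvA_unique X Y Z : cvA X Y -> cvA X Z -> Y = Z.
Proof.
move=> hY hZ; apply/eqP; rewrite -subr_eq0; apply/eqP; apply: nb_small => e e0.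
have [N hN] := hY _ (divr_gt0 e0 (ltr0n _ 2)); have [N' hN'] := hZ _ (divr_gt0 e0 (ltr0n _ 2)).
have h1 := hN (maxn N N') (leq_maxl _ _); have h2 := hN' (maxn N N') (leq_maxr _ _).
rewrite (splitr e); have -> : Y - Z = (X (maxn N N') - Z) - (X (maxn N N') - Y).
  by rewrite opprB [RHS]addrC subrKA.
exact: nbB.
Qed.

Lemma cvA_cst Y : cvA (fun=> Y) Y.
Proof. by move=> e e0; exists 0%N => n _; rewrite subrr; apply: nb_le (ltW e0) nb0. Qed.

Lemma cvA_shift X Y : cvA X Y -> cvA (fun n => X n.+1) Y.
Proof. by move=> h e e0; have [N hN] := h e e0; exists N => n Nn; apply: hN; exact: leqW. Qed.

Lemma cvAD X Y Z T : cvA X Y -> cvA Z T -> cvA (fun n => X n + Z n) (Y + T).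
Proof.
move=> hY hZ e e0.
have [N hN] := hY _ (divr_gt0 e0 (ltr0n _ 2)); have [N' hN'] := hZ _ (divr_gt0 e0 (ltr0n _ 2)).
exists (maxn N N') => n; rewrite geq_max => /andP[n1 n2].
by rewrite (splitr e) opprD addrACA; apply: nbD; [exact: hN|exact: hN'].
Qed.

Lemma cvAN X Y : cvA X Y -> cvA (fun n => - X n) (- Y).
Proof.
by move=> h e e0; have [N hN] := h e e0; exists N => n Nn; rewrite -opprD; apply: nbN; exact: hN.
Qed.

Lemma cvAM X Y Z T : cvA X Y -> cvA Z T -> cvA (fun n => X n * Z n) (Y * T).
Proof.
move=> hY hZ e e0; have [c c0 hc] := nb_ex Y; have [d d0 hd] := nb_ex T.
pose k := c + d + 1; have k1 : 1 <= k by rewrite lerDr addr_ge0.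
have k0 : 0 < k by exact: lt_le_trans ltr01 k1.
pose f := Num.min (e / k / 2) 1.
have f0 : 0 < f by rewrite lt_min ltr01 !divr_gt0.
have fe : f * k <= e / 2.
  by rewrite -ler_pdivlMr// mulrAC ge_min lexx.
have f1 : f <= 1 by rewrite ge_min lexx orbT.
have [N hN] := hY _ f0; have [N' hN'] := hZ _ f0.
exists (maxn N N') => n; rewrite geq_max => /andP[n1 n2].
have -> : X n * Z n - Y * T = (X n - Y) * (Z n - T) + (X n - Y) * T + Y * (Z n - T).
  by rewrite -mulrDr subrK mulrBl mulrBr addrA subrK.
apply: (@nb_le (f * f + f * d + c * f)).
  have h1 : f * f <= f by rewrite ger_pMl.
  have : f * k = f + f * d + c * f by rewrite /k; ring.
  lra.
have h1 := hN _ n1; have h2 := hN' _ n2.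
by apply: nbD; [apply: nbD|]; apply: nbM => //; exact: ltW.
Qed.

Lemma cvAZ (a : R) X Y : cvA X Y -> cvA (fun n => a *: X n) (a *: Y).
Proof.
have e (Z : A) : a *: Z = (a *: (1 : A)) * Z by rewrite vnopZl mul1r.
move=> h; rewrite e; under eq_fun do rewrite e.
exact: cvAM (cvA_cst _) h.
Qed.

Lemma cvA_nb c X Y : (forall n, nb c (X n)) -> cvA X Y -> nb c Y.
Proof.
move=> hX hY x; apply/ler_addgt0Pr => e e0.
have k0 : 0 < nr x + 1 by rewrite ltr_wpDl// nr_ge0.
have [N hN] := hY _ (divr_gt0 e0 k0).
have -> : ev Y x = ev (X N) x - ev (X N - Y) x by rewrite evB opprB addrC subrK.
apply: le_trans (nrB _ _) _; apply: lerD (hX N x) _.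
apply: le_trans (hN _ (leqnn N) x) _; rewrite mulrAC ler_pdivrMr// ler_pM2l//.
by rewrite lerDl.
Qed.

Lemma cvA_exists (X : nat -> A) (s : nat -> R) (L : R) :
  (forall n, nb (s n.+1 - s n) (X n.+1 - X n)) ->
  (forall n, s n <= s n.+1) -> (forall n, s n <= L) ->
  exists Y, cvA X Y.
Proof.
move=> h s1 sL.
have [Y cY] := @limit_op R H (fun n => ev (X n)) s L h s1 sL.
have mY : M Y by apply: (vn_limit hM _ cY) => n; exact: ev_mem.
exists (vn_mk mY) => e e0; have [N hN] := cY e e0.
by exists N => n Nn x; exact: hN.
Qed.

Lemma neumann (theta : R) (X : A) : 0 <= theta -> theta < 1 -> nb theta X ->
  exists G : A, (1 - X) * G = 1 /\ G * (1 - X) = 1.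
Proof.
move=> t0 t1 hX.
pose S n : A := \sum_(k < n) X ^+ k.
have dS n : S n.+1 - S n = X ^+ n by rewrite /S big_ord_recr /= addrAC subrr add0r.
pose s n : R := \sum_(k < n) theta ^+ k.
have ds n : s n.+1 - s n = theta ^+ n by rewrite /s big_ord_recr /= addrAC subrr add0r.
have [G hG] : exists G, cvA S G.
  apply: (@cvA_exists S s (1 - theta)^-1).
  - by move=> n; rewrite dS ds; exact: nbX.
  - by move=> n; rewrite -subr_ge0 ds exprn_ge0.
  move=> n; rewrite -[leRHS]mul1r ler_pdivlMr ?subr_gt0// -opprB mulrN.
  rewrite mulrC -subrX1 opprB gerBl exprn_ge0//.
exists G.
have X0 : cvA (fun n => X ^+ n) 0.
  rewrite -(subrr G); under eq_fun do rewrite -dS.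
  by apply: cvAD (cvA_shift hG) (cvAN hG).
have c1 : cvA (fun n => 1 - X ^+ n) 1.
  by rewrite -[X in cvA _ X]subr0; apply: cvAD (cvA_cst _) (cvAN X0).
have e1 n : 1 - X ^+ n = (1 - X) * S n by rewrite -opprB subrX1 -mulNr opprB.
have e2 n : (1 - X) * S n = S n * (1 - X).
  have cX : GRing.comm X (S n).
    by apply: commr_sum => i _; apply: commrX.
  by rewrite mulrBl mulrBr mul1r mulr1 cX.
split; apply: cvA_unique c1.
  by under eq_fun do rewrite e1; apply: cvAM (cvA_cst _) hG.
by under eq_fun do rewrite e1 e2; apply: cvAM hG (cvA_cst _).
Qed.

Definition sa (X : A) := forall x y, re ip (ev X x) y = re ip x (ev X y).

(** Symmetry of the real part gives symmetry of the whole form, as Im <u, v> = - Re <i u, v> and X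
    commutes with i. *)
Lemma sa_adjoint X : sa X -> adjoint_of ip (ev X) (ev X).
Proof.
move=> h x y.
have im u v : complex.Im (ip u v) = - re ip ('i *: u) v.
  rewrite /re linearZl_LR /=; case: (ip u v) => a b /=.
  by rewrite mul0r mul1r sub0r opprK.
apply/eqP; rewrite eq_complex; apply/andP; split; apply/eqP; first exact: h.
by rewrite !im -evZx h.
Qed.

Lemma adjoint_sa X : adjoint_of ip (ev X) (ev X) -> sa X.
Proof. by move=> h x y; rewrite /re h. Qed.

Lemma sa1 : sa 1. Proof. by []. Qed.
Lemma saD X Y : sa X -> sa Y -> sa (X + Y).
Proof. by move=> hX hY x y; rewrite !evD reDl reDr hX hY. Qed.
Lemma saN X : sa X -> sa (- X).
Proof. by move=> hX x y; rewrite !evN reNl reNr hX. Qed.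
Lemma saB X Y : sa X -> sa Y -> sa (X - Y).
Proof. by move=> hX /saN; exact: saD. Qed.
Lemma saZ (a : R) X : sa X -> sa (a *: X).
Proof. by move=> hX x y; rewrite !evZ reZl reZr hX. Qed.
Lemma sa0 : sa 0. Proof. by rewrite -(subrr 1); exact: saB. Qed.
Lemma saM X Y : sa X -> sa Y -> GRing.comm X Y -> sa (X * Y).
Proof. by move=> hX hY c x y; rewrite evM hX hY c. Qed.
Lemma saX X n : sa X -> sa (X ^+ n).
Proof.
move=> hX; elim: n => [|n IH]; first exact: sa1.
by rewrite exprS; apply: saM => //; apply: commrX.
Qed.

Lemma re_opb c X x y : hilbert_norm ip -> nb c X -> re ip (ev X x) y <= c * nr x * nr y.
Proof.
move=> hip h; apply: le_trans (re_CS hip _ _) _.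
by apply: ler_wpM2r (h x); exact: nr_ge0.
Qed.
End vnop_ring.

Lemma bernoulli_le (R : realDomainType) (t : R) n : 0 <= t -> 1 + t * n%:R <= (1 + t) ^+ n.
Proof.
move=> t0; elim: n => [|n IH]; first by rewrite mulr0 addr0.
rewrite exprS -natr1 mulrDr mulr1 mulrDl mul1r addrA; apply: lerD => //.
rewrite -[leLHS]mulr1; apply: ler_wpM2l => //.
by rewrite exprn_ege1// lerDl.
Qed.

Lemma exp_growth_le (R : realType) (p q a K : R) : 0 <= q -> 0 < a ->
  (forall k, p ^+ k * a <= K * q ^+ k) -> p <= q.
Proof.
move=> q0 a0 h; rewrite leNgt; apply/negP => qp.
move: q0; rewrite le_eqVlt => /predU1P[q0|q0].
  have := h 1%N; rewrite !expr1 -q0 mulr0 leNgt => /negP; apply.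
  by rewrite mulr_gt0// q0.
pose t := p / q - 1; have t0 : 0 < t by rewrite subr_gt0 ltr_pdivlMr// mul1r.
have [N hN] : exists N, K / a / t < N%:R.
  by exists (Num.bound `|K / a / t|); apply: le_lt_trans (ler_norm _) (archi_boundP _).
have := h N; rewrite leNgt => /negP; apply.
have -> : p = (1 + t) * q by rewrite /t addrC subrK divfK// gt_eqF.
rewrite exprMn mulrAC ltr_pM2r ?exprn_gt0// -ltr_pdivrMr//.
apply: lt_le_trans (bernoulli_le N (ltW t0)).
rewrite ltr_pdivrMr// in hN; rewrite mulrC; lra.
Qed.

(** The ratios of consecutive terms do not decrease, so a first ratio above q would force growth
    faster than K q^k. *)
Lemma log_convex_le (R : realType) (a : nat -> R) (q K : R) : 0 <= q ->
  (forall k, 0 <= a k) -> (forall k, a k.+1 ^+ 2 <= a k * a k.+2) ->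
  (forall k, a k <= K * q ^+ k) -> a 1%N <= q * a 0%N.
Proof.
move=> q0 ap lc bd; rewrite leNgt; apply/negP => h.
have a0 : 0 < a 0%N.
  rewrite lt_neqAle ap andbT eq_sym; apply/eqP => a0.
  have := lc 0%N; rewrite a0 mul0r leNgt => /negP; apply.
  by rewrite exprn_gt0// -(mulr0 q) -a0.
pose p := a 1%N / a 0%N.
have pq : q < p by rewrite ltr_pdivlMr.
have p0 : 0 < p by exact: le_lt_trans pq.
have hk k : 0 < a k /\ p * a k <= a k.+1.
  elim: k => [|k [ak IH]]; first by rewrite divfK ?gt_eqF.
  have ak1 : 0 < a k.+1 by apply: lt_le_trans IH; rewrite mulr_gt0.
  split=> //; rewrite -(ler_pM2l ak); apply: le_trans (lc k).
  by rewrite mulrCA expr2 mulrA ler_pM2r.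
have hp k : p ^+ k * a 0%N <= a k.
  elim: k => [|k IH]; first by rewrite mul1r.
  rewrite exprS -mulrA; apply: le_trans (hk k).2.
  by rewrite ler_pM2l.
have : p <= q by apply: (@exp_growth_le _ _ _ (a 0%N) K) => // k; apply: le_trans (hp k) (bd k).
by rewrite leNgt pq.
Qed.

(** * Positivity and norm bounds from a faithful trace *)

Section trace.
Variables (R : realType) (H : completeNormedModType R[i]).
Variable ip : {dot H for Num.conj}.
Variable M : set (H -> H).
Hypothesis hM : von_neumann_algebra ip M.
Hypothesis hip : hilbert_norm ip.
Variable tau : (H -> H) -> R[i].
Hypothesis ht : faithful_normal_tracial_state ip M tau.
Local Notation A := (vnop hM).

(** Expansion of |(c^2 - X^2) x|^2 together with |X^2 x| <= c |X x|; the triangle inequality alone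
    would give 2 c^2. *)
Lemma square_defect_nb (c : R) (X : A) : sa X -> 0 <= c -> nb c X ->
  nb (c ^+ 2) (c ^+ 2 *: (1 : A) - X * X).
Proof.
move=> sX c0 hX x.
have h0 : 0 <= c ^+ 2 * nr x by rewrite mulr_ge0 ?nr_ge0// sqr_ge0.
rewrite -(@ler_pXn2r _ 2) ?nnegrE ?nr_ge0// (nr_re hip) evB evZ ev1 evM.
rewrite !(reDl, reDr, reNl, reNr, reZl, reZr).
rewrite [re ip (ev X (ev X x)) x]reC -[re ip x (ev X (ev X x))]sX -!(nr_re hip).
have h1 : nr (ev X (ev X x)) ^+ 2 <= (c * nr (ev X x)) ^+ 2.
  by rewrite ler_pXn2r ?nnegrE ?nr_ge0// mulr_ge0 ?nr_ge0.
have h2 : 0 <= c ^+ 2 * nr (ev X x) ^+ 2 by rewrite mulr_ge0 ?sqr_ge0.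
rewrite exprMn in h1.
rewrite exprMn -exprM; move: h1 h2; rewrite (exprM c 2 2) !(expr2 (c ^+ 2)).
set u := c ^+ 2; set v := nr _ ^+ 2; set w := nr _ ^+ 2; set z := nr _ ^+ 2.
nra.
Qed.

(** V is the limit of W_(k+1) = (X + W_k^2) / 2, the iteration behind the power series of 1 - sqrt
    (1 - x). The scalar iteration with 1 in place of X increases, stays below 1 and majorises the
    increments, so that norm exactly 1 is allowed. As a limit of polynomials in X, V commutes with
    whatever X does. *)
Lemma one_sub_sqrt (X : A) : sa X -> nb 1 X ->
  exists V : A, [/\ sa V, nb 1 V, (1 - V) * (1 - V) = 1 - X
    & forall B : A, GRing.comm X B -> GRing.comm V B].
Proof.
move=> sX nX.
pose W := fix W n : A := if n is n'.+1 then 2^-1 *: (X + W n' * W n') else 0.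
pose s := fix s n : R := if n is n'.+1 then 2^-1 * (1 + s n' * s n') else 0.
have s01 n : 0 <= s n <= 1.
  elim: n => [|n IH] /=; first by rewrite lexx ler01.
  by move: IH; set t := s n; move=> ?; apply/andP; split; nra.
have ss n : s n <= s n.+1.
  by rewrite /=; have := sqr_ge0 (s n - 1); rewrite expr2; nra.
have nW n : nb (s n) (W n).
  elim: n => [|n IH]; first exact: nb0.
  have /andP[s0 _] := s01 n.
  have -> : s n.+1 = `|2^-1| * (1 + s n * s n) by rewrite ger0_norm// invr_ge0.
  apply: nbZ.
  by apply: nbD => //; apply: nbM.
have dW n : nb (s n.+1 - s n) (W n.+1 - W n).
  elim: n => [|n IH]; first by rewrite !subr0; exact: nW.
  have -> : W n.+2 - W n.+1 = 2^-1 *: (W n.+1 * (W n.+1 - W n) + (W n.+1 - W n) * W n).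
    by rewrite mulrBr mulrBl subrKA [LHS]/= -scalerBr opprD addrACA subrr add0r.
  have -> : s n.+2 - s n.+1 = `|2^-1| * (s n.+1 * (s n.+1 - s n) + (s n.+1 - s n) * s n).
    rewrite ger0_norm ?invr_ge0//.
    have sE k : s k.+1 = 2^-1 * (1 + s k * s k) by [].
    by rewrite !sE; ring.
  have /andP[s0 _] := s01 n.+1.
  by apply: nbZ; apply: nbD; apply: nbM => //; rewrite subr_ge0.
have [V hV] := cvA_exists dW ss (fun n => proj2 (andP (s01 n))).
exists V.
have saW n : sa (W n).
  elim: n => [|n IH]; first exact: sa0.
  by apply: saZ; apply: saD => //; apply: saM.
split.
- move=> x y; apply/eqP; rewrite -subr_eq0; apply/eqP; apply/eqP.
  have : `|re ip (ev V x) y - re ip x (ev V y)| <= 0.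
    apply/ler_addgt0Pr => e e0; rewrite add0r.
    have k0 : 0 < 2 * nr x * nr y + 1 by rewrite ltr_wpDl// !mulr_ge0 ?nr_ge0.
    have [N hN] := hV _ (divr_gt0 e0 k0); have {hN} := hN N (leqnn N).
    set D := W N - V; set f := e / _ => hD.
    have eV z : ev V z = ev (W N) z - ev D z by rewrite /D evB opprB addrC subrK.
    rewrite !eV; clearbody D.
    rewrite !(reDl, reDr, reNl, reNr) saW.
    set u := re ip x (ev (W N) y); set p := re ip (ev D x) y.
    rewrite (_ : u + - p - (u + - re ip x (ev D y)) = re ip x (ev D y) - p); last by ring.
    rewrite {}/p.
    have fk : f * (2 * nr x * nr y + 1) = e by rewrite /f divfK// gt_eqF.
    have f0 : 0 < f by rewrite divr_gt0.
    have h1 := re_opb x y hip hD; have h2 := re_opb y x hip hD.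
    have h3 := re_opb x (- y) hip hD; have h4 := re_opb y (- x) hip hD.
    move: h3 h4; rewrite !reNr !nrN => h3 h4.
    rewrite [re ip x _]reC ler_norml; apply/andP; split; nra.
  by rewrite normr_le0.
- apply: cvA_nb hV => n; apply: nb_le (nW n).
  by have /andP[] := s01 n.
- have e : V = 2^-1 *: (X + V * V).
    apply: cvA_unique (cvA_shift hV) _; apply: cvAZ; apply: cvAD (cvA_cst _) _.
    exact: cvAM.
  have e2 : 2 *: V = X + V * V by rewrite {1}e scalerA divff ?pnatr_eq0// scale1r.
  rewrite mulrBr mulr1 mulrBl mul1r opprB addrA -addrA.
  have -> : X = 2 *: V - V * V by rewrite e2 addrK.
  by rewrite scaler_nat mulr2n !opprD opprK !addrA [LHS]addrAC.
move=> B cB; apply: cvA_unique (cvAM hV (cvA_cst B)) _.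
have cW n : W n * B = B * W n.
  elim: n => [|n IH]; first by rewrite mul0r mulr0.
  by rewrite /= vnopZl vnopZr mulrDl mulrDr cB -mulrA IH mulrA IH mulrA.
by under eq_fun do rewrite cW; apply: cvAM (cvA_cst _) hV.
Qed.

Definition rho (X : A) : R := complex.Re (tau (ev X)).

Lemma tau_lin a (X Y : A) : tau (ev (a *: X + Y)) = a%:C * tau (ev X) + tau (ev Y).
Proof. by case: ht => h _; apply: h; exact: ev_mem. Qed.

Lemma rho_is_linear : linear (rho : A -> R^o).
Proof.
move=> a X Y; rewrite /rho tau_lin.
by case: (tau _) => u v; case: (tau _) => u' v' /=; rewrite mul0r subr0.
Qed.

HB.instance Definition _ := GRing.isLinear.Build R A R^o _ rho rho_is_linear.

Lemma rhoD X Y : rho (X + Y) = rho X + rho Y.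
Proof. exact: raddfD. Qed.
Lemma rhoB X Y : rho (X - Y) = rho X - rho Y.
Proof. exact: raddfB. Qed.
Lemma rhoN X : rho (- X) = - rho X.
Proof. exact: raddfN. Qed.
Lemma rho0 : rho 0 = 0.
Proof. exact: raddf0. Qed.
Lemma rhoZ a X : rho (a *: X) = a * rho X.
Proof. exact: linearZ. Qed.

Lemma rho1 : rho 1 = 1.
Proof. by case: ht => _ [h _ _ _ _]; rewrite /rho h. Qed.

Lemma rhoC X Y : rho (X * Y) = rho (Y * X).
Proof.
case: ht => _ [_ _ h _ _]; rewrite /rho; congr complex.Re.
by apply: h; exact: ev_mem.
Qed.

Lemma tau_sq (X : A) : sa X -> tau (ev (X * X)) = (rho (X * X))%:C.
Proof.
move=> sX; case: ht => _ [_ h _ _ _].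
have := h _ _ (ev_mem X) (ev_mem X) (sa_adjoint sX).
rewrite /rho -[ev X \o ev X]/(ev (X * X)); case: (tau _) => u v /=.
by rewrite lecE /= => /andP[/eqP -> _].
Qed.

Lemma rho_sq_ge0 (X : A) : sa X -> 0 <= rho (X * X).
Proof.
move=> sX; case: ht => _ [_ h _ _ _].
have := h _ _ (ev_mem X) (ev_mem X) (sa_adjoint sX).
by rewrite -[ev X \o ev X]/(ev (X * X)) tau_sq// lecR.
Qed.

Lemma rho_sq_eq0 (X : A) : sa X -> rho (X * X) = 0 -> X = 0.
Proof.
move=> sX h0; case: ht => _ [_ _ _ h _]; apply: ev_inj.
apply: (h _ _ (ev_mem X) (ev_mem X) (sa_adjoint sX)).
by rewrite -[ev X \o ev X]/(ev (X * X)) tau_sq// h0.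
Qed.

Lemma rho_CS (X Y : A) : sa X -> sa Y -> rho (X * Y) ^+ 2 <= rho (X * X) * rho (Y * Y).
Proof.
move=> sX sY; apply: discriminant_le => t.
have := rho_sq_ge0 (saD sX (saZ t sY)).
rewrite mulrDl !mulrDr !vnopZl !vnopZr !rhoD !rhoZ (rhoC Y X).
by rewrite le_eqVlt => h; rewrite le_eqVlt; move: h; congr (_ || _); congr (_ _ _); ring.
Qed.

(** Positivity of the trace is known on squares; after scaling, c^2 - X^2 is exhibited as a square
    by [one_sub_sqrt]. *)
Lemma rho_sq_le (c : R) (X : A) : sa X -> 0 <= c -> nb c X -> rho (X * X) <= c ^+ 2.
Proof.
move=> sX; rewrite le_eqVlt => /predU1P[<-|c0] hX.
  have -> : X = 0 by apply: nb_small => e e0; apply: nb_le (ltW e0) hX.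
  by rewrite mul0r rho0 expr0n.
pose Y := c^-1 *: X.
have sY : sa Y by exact: saZ.
have nY : nb 1 Y.
  have -> : 1 = `|c^-1| * c by rewrite ger0_norm ?invr_ge0 ?(ltW c0)// mulVf// gt_eqF.
  exact: nbZ.
have sYY : sa (Y * Y) by exact: saM.
have nYY : nb 1 (Y * Y) by rewrite -(mulr1 1); exact: nbM.
have [V [sV _ hV _]] := one_sub_sqrt sYY nYY.
have := rho_sq_ge0 (saB (sa1 hM) sV); rewrite hV rhoB rho1 subr_ge0.
rewrite /Y vnopZl vnopZr !rhoZ mulrA -expr2 exprVn mulrC.
by rewrite ler_pdivrMr ?exprn_gt0// mul1r.
Qed.

Lemma rho_mul_le (c d : R) (X Y : A) : sa X -> sa Y -> 0 <= c -> 0 <= d ->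
  nb c X -> nb d Y -> `|rho (X * Y)| <= c * d.
Proof.
move=> sX sY c0 d0 nX nY.
rewrite -(@ler_pXn2r _ 2) ?nnegrE ?mulr_ge0// real_normK ?num_real//.
apply: le_trans (rho_CS sX sY) _; rewrite exprMn.
by apply: ler_pM; rewrite ?rho_sq_ge0 ?rho_sq_le.
Qed.

(* With P = |Q| and R^2 = P, the element m = P - Q satisfies
   m Q m = - m P m = - (R m)^2, so positivity of the trace forces R m = 0. *)
Lemma positive_of_trace (Q : A) : sa Q ->
  (forall m : A, sa m -> (forall B, GRing.comm Q B -> GRing.comm m B) ->
     0 <= rho (m * Q * m)) ->
  forall x, 0 <= re ip (ev Q x) x.
Proof.
move=> sQ; wlog nQ : Q sQ / nb 1 Q.
  move=> hw pos x; have [c c0 hc] := nb_ex Q.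
  pose d := (c + 1)^-1; have d0 : 0 < d by rewrite invr_gt0 ltr_wpDl.
  have h := hw (d *: Q) (saZ d sQ).
  rewrite -(pmulr_rge0 _ d0) -reZl -evZ; apply: h.
    apply: nb_le (nbZ d hc); rewrite gtr0_norm// /d mulrC ler_pdivrMr ?mul1r.
      by rewrite lerDl.
    by rewrite ltr_wpDl.
  move=> m sm cm; rewrite vnopZr vnopZl rhoZ; apply: mulr_ge0; first exact: ltW.
  by apply: pos => // B cB; apply: cm; rewrite /GRing.comm vnopZl vnopZr cB.
move=> pos.
have sA : sa (1 - Q * Q) by apply: saB; [exact: sa1 | exact: saM].
have nA : nb 1 (1 - Q * Q).
  have := square_defect_nb sQ ler01 nQ; rewrite expr1n scale1r; exact.
have [V [sV nV hV cV]] := one_sub_sqrt sA nA.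
have [W [sW nW hW cW]] := one_sub_sqrt sV nV.
rewrite (_ : 1 - (1 - Q * Q) = Q * Q) in hV; last by rewrite opprB addrC subrK.
set P := 1 - V in hV hW; set T := 1 - W in hW.
have cA B : GRing.comm Q B -> GRing.comm (1 - Q * Q) B.
  by move=> cB; rewrite /GRing.comm mulrBl mulrBr mul1r mulr1 -mulrA cB mulrA cB mulrA.
have cP B : GRing.comm Q B -> GRing.comm P B.
  by move=> /cA /cV cB; rewrite /GRing.comm mulrBl mulrBr mul1r mulr1 cB.
have cT B : GRing.comm V B -> GRing.comm T B.
  by move=> /cW cB; rewrite /GRing.comm mulrBl mulrBr mul1r mulr1 cB.
have QP : GRing.comm Q P by apply: commr_sym; exact: cP.
have sP : sa P by apply: saB => //; exact: sa1.
have sT : sa T by apply: saB => //; exact: sa1.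
pose m := P - Q; have sm : sa m by exact: saB.
have cm B : GRing.comm Q B -> GRing.comm m B.
  by move=> cB; rewrite /GRing.comm mulrBl mulrBr cP// cB.
have Qm : Q * m = - (P * m).
  by rewrite /m (mulrBr Q) (mulrBr P) -hV QP opprB.
have Tm : GRing.comm T m by apply: cT; apply: commr_sym; apply: cm; apply: commr_sym; apply: cV; apply: cA.
have mTT : (T * m) * (T * m) = m * P * m by rewrite {1}Tm -mulrA (mulrA T T) hW mulrA.
have sTm : sa (T * m) by exact: saM.
have T0 : T * m = 0.
  apply: rho_sq_eq0 => //; apply/eqP; rewrite eq_le rho_sq_ge0// andbT.
  have := pos m sm cm; rewrite -mulrA Qm mulrN rhoN oppr_ge0 mulrA.
  by rewrite -mTT.
have P0 : P * m = 0 by rewrite -hW -mulrA T0 mulr0.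
have m0 : m = 0.
  apply: rho_sq_eq0 => //; rewrite {1}/m mulrBl Qm P0 opprK addr0.
  exact: rho0.
move=> x; have -> : Q = P by apply/esym/eqP; rewrite -subr_eq0; apply/eqP.
by rewrite -hW evM sT -(nr_re hip) sqr_ge0.
Qed.

(** For m commuting with y the numbers a_k = rho ((m y^k)^2) are log-convex, and of order r^(2k) by
    Cauchy-Schwarz, which separates m^2 from y^(2k). Hence a_1 <= r^2 a_0, that is rho (m (r^2 -
    y^2) m) >= 0, and [positive_of_trace] turns this into an operator inequality. The factor C drops
    out because log-convexity only sees the rate of growth. *)
Lemma nb_of_moments (C r : R) (y : A) : sa y -> 0 <= r ->
  (forall k, rho (y ^+ k) <= C * r ^+ k) -> nb r y.
Proof.
move=> sy r0 hy.
have syy : sa (y * y) by exact: saM.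
have pos x : 0 <= re ip (ev (r ^+ 2 *: (1 : A) - y * y) x) x.
  apply: positive_of_trace x.
    by apply: saB => //; apply: saZ; exact: sa1.
  move=> m sm cm.
  have cym : GRing.comm m y.
    apply: cm; rewrite /GRing.comm mulrBl mulrBr vnopZl vnopZr mul1r mulr1.
    by rewrite mulrA.
  have cyk k : GRing.comm m (y ^+ k) by exact: commrX.
  pose a k := rho ((m * y ^+ k) * (m * y ^+ k)).
  have aE i j : rho ((m * y ^+ i) * (m * y ^+ j)) = rho ((m * m) * y ^+ (i + j)).
    by rewrite -!mulrA (mulrA (y ^+ i)) -cyk -mulrA exprD !mulrA.
  have sk k : sa (m * y ^+ k) by apply: saM => //; exact: saX.
  have -> : rho (m * (r ^+ 2 *: (1 : A) - y * y) * m) = r ^+ 2 * a 0%N - a 1%N.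
    rewrite /a !aE expr0 mulr1 mulrBr mulrBl rhoB vnopZr vnopZl rhoZ mulr1.
    congr (_ - rho _); rewrite -!mulrA -cym (mulrA y) -cym -!mulrA.
    by rewrite exprD expr1.
  rewrite subr_ge0.
  apply: (@log_convex_le _ a _ (`|rho ((m * m) * (m * m)) * C| + 1)); first exact: sqr_ge0.
  - by move=> k; exact: rho_sq_ge0.
  - move=> k; have -> : a k.+1 = rho ((m * y ^+ k) * (m * y ^+ k.+2)).
      by rewrite /a !aE; congr (rho (_ * _ ^+ _)); rewrite !addnS addSn.
    exact: rho_CS.
  move=> k; have rk : 0 <= (r ^+ 2) ^+ k by rewrite exprn_ge0// sqr_ge0.
  set K := _ + 1; have K1 : 1 <= K by rewrite lerDr.
  have K0 : 0 <= K by exact: le_trans K1.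
  apply: le_trans (ler_norm _) _.
  rewrite -(@ler_pXn2r _ 2) ?nnegrE ?mulr_ge0// real_normK ?num_real//.
  rewrite /a aE; apply: le_trans (rho_CS (saM sm sm (commr_refl m)) (saX _ sy)) _.
  rewrite -exprD.
  have h := hy (k + k + (k + k))%N.
  have g : 0 <= rho (m * m * (m * m)) by apply: rho_sq_ge0; exact: saM.
  apply: le_trans (ler_wpM2l g h) _; rewrite [leLHS]mulrA.
  have -> : r ^+ (k + k + (k + k)) = ((r ^+ 2) ^+ k) ^+ 2.
    by rewrite -!exprM; congr (_ ^+ _); rewrite mul2n muln2 !addnn.
  rewrite [leRHS]exprMn; apply: ler_wpM2r; first exact: sqr_ge0.
  apply: le_trans (ler_norm _) _; apply: (@le_trans _ _ K); first by rewrite lerDl.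
  by rewrite expr2 ler_peMl.
move=> x; rewrite -(@ler_pXn2r _ 2) ?nnegrE ?mulr_ge0 ?nr_ge0// exprMn.
have := pos x; rewrite evB evZ ev1 evM reDl reNl reZl sy -!(nr_re hip) subr_ge0.
exact.
Qed.

End trace.

(** * Semicircle moments *)

Section semicircle.
Variable R : realType.
Local Notation m := (semicircle_moment R).

Let w (k : nat) (t : R) : R := Num.sqrt (4 - t ^+ 2) * t ^+ k.

Let cont_quad : continuous (fun t : R => 4 - t ^+ 2).
Proof.
move=> t; apply: (@continuousB R R^o R (cst 4) (fun t => t ^+ 2)).
  exact: cvg_cst.
exact: exprn_continuous.
Qed.

Let cont_w k : continuous (w k).
Proof.
move=> t; apply: (@continuousM R R (fun t => Num.sqrt (4 - t ^+ 2)) (fun t => t ^+ k)).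
  apply: (@continuous_comp _ _ _ (fun t : R => 4 - t ^+ 2) Num.sqrt).
    exact: cont_quad.
  exact: sqrt_continuous.
exact: exprn_continuous.
Qed.

Let int_w (c : R) k : lebesgue_measure.-integrable `[(-2 : R), 2] (EFin \o (fun t => c * w k t)).
Proof.
apply: continuous_compact_integrable; first exact: segment_compact.
apply: continuous_subspaceT => t.
by apply: (@continuousM R R (cst c) (w k)); [exact: cvg_cst | exact: cont_w].
Qed.

Let int_w1 k : lebesgue_measure.-integrable `[(-2 : R), 2] (EFin \o w k).
Proof.
apply: continuous_compact_integrable; first exact: segment_compact.
exact/continuous_subspaceT/cont_w.
Qed.

Let momentE k : m k = (2 * pi)^-1 * \int[@lebesgue_measure R]_(t in `[(-2 : R), 2]) w k t.
Proof.
rewrite -RintegralZl//.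
by rewrite /semicircle_moment; apply: eq_Rintegral => t _; rewrite mulrA.
Qed.

Let prim (k : nat) (t : R) : R := (4 - t ^+ 2) * w k t.

Let cont_prim k : continuous (prim k).
Proof.
move=> t; apply: (@continuousM R R (fun t : R => 4 - t ^+ 2) (w k)).
  exact: cont_quad.
exact: cont_w.
Qed.

Let deriv_prim k (t : R) : -2 < t < 2 ->
  is_derive t (1 : R) (prim k)
    (4 * k%:R * w k.-1 t - k%:R * w k.-1.+2 t - 3 * w k.+1 t).
Proof.
move=> /andP[t1 t2].
have g0 : 0 < 4 - t ^+ 2 by nra.
have dX n : is_derive t (1 : R) (fun t : R => t ^+ n) (n%:R * t ^+ n.-1).
  have h := is_deriveX n (is_derive_id t (1 : R)); rewrite exprfctE in h.
  apply: is_derive_eq h _.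
  by rewrite /GRing.scale /= mulr1 mulr_natl.
have dg : is_derive t (1 : R) (fun t : R => 4 - t ^+ 2) (- (2 * t)).
  have h := is_deriveB (is_derive_cst (4 : R) t (1 : R)) (dX 2%N).
  apply: (is_derive_eq (f := fun t : R => 4 - t ^+ 2) h).
  by rewrite sub0r expr1.
have ds := @is_derive1_comp _ Num.sqrt (fun t : R => 4 - t ^+ 2) t _ _ (is_derive1_sqrt g0) dg.
have := is_deriveM dg (is_deriveM ds (dX k)).
move=> h; apply: (is_derive_eq (f := prim k) h).
rewrite /GRing.scale /= /w.
set s := Num.sqrt _.
rewrite [X in _ + X * _ = _](_ : _ = s * t ^+ k)//.
have s0 : s != 0 by rewrite gt_eqF// sqrtr_gt0.
have es : 4 - t ^+ 2 = s ^+ 2 by rewrite sqr_sqrtr// ltW.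
case: k h => [|k] h /=; first by rewrite es expr0; field.
have e4 : 4 = s ^+ 2 + t ^+ 2 by rewrite -es subrK.
rewrite es [in RHS]e4 !exprS; field.
by [].
Qed.

(** The primitive (4 - t^2)^(3/2) t^k vanishes at both ends of the support. For k = 0 the truncated
    index [k.-1] comes with coefficient zero. *)
Lemma semicircle_moment_ibp k :
  4 * k%:R * m k.-1 - k%:R * m k.-1.+2 - 3 * m k.+1 = 0.
Proof.
pose f t := 4 * k%:R * w k.-1 t - k%:R * w k.-1.+2 t - 3 * w k.+1 t.
have h22 : (-2 : R) < 2 by lra.
have h0 : \int[@lebesgue_measure R]_(t in `[(-2 : R), 2]) f t = 0.
  rewrite /Rintegral (@continuous_FTC2 _ f (prim k) _ _ h22).
  - have e : 4 - 2 ^+ 2 = 0 :> R by ring.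
    by rewrite /= /prim sqrrN e !mul0r subrr.
  - apply: continuous_subspaceT => t.
    apply: (@continuousB _ _ _ (fun t => 4 * k%:R * w k.-1 t - k%:R * w k.-1.+2 t) (fun t => 3 * w k.+1 t)).
      apply: (@continuousB _ _ _ (fun t => 4 * k%:R * w k.-1 t) (fun t => k%:R * w k.-1.+2 t)).
        by apply: (@continuousM R R (cst (4 * k%:R)) (w k.-1)); [exact: cvg_cst | exact: cont_w].
      by apply: (@continuousM R R (cst k%:R) (w k.-1.+2)); [exact: cvg_cst | exact: cont_w].
    by apply: (@continuousM R R (cst 3) (w k.+1)); [exact: cvg_cst | exact: cont_w].
  - split.
    + by move=> t; rewrite in_itv /= => ht; have [] := deriv_prim k ht.
    + by apply: cvg_at_right_filter; exact: cont_prim.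
    by apply: cvg_at_left_filter; exact: cont_prim.
  by move=> t; rewrite in_itv /= => ht; rewrite derive1E; have := deriv_prim k ht => h; rewrite derive_val.
have := h0; rewrite /f RintegralB//; last exact: (integrableB _ (int_w _ _) (int_w _ _)).
rewrite RintegralB//.
rewrite !RintegralZl// => h1.
by rewrite !momentE; move: h1; set a := Rintegral _ _ _; set b := Rintegral _ _ _;
  set c := Rintegral _ _ _ => h1; rewrite -(mulr0 (2 * pi)^-1) -h1; ring.
Qed.

Definition moment_fun (p : {poly R}) : R := \sum_(i < size p) p`_i * m i.

Lemma moment_funE n (p : {poly R}) : (size p <= n)%N ->
  moment_fun p = \sum_(i < n) p`_i * m i.
Proof.
move=> hn; rewrite /moment_fun (big_ord_widen _ (fun i => p`_i * m i) hn) big_mkcond /=.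
apply: eq_bigr => i _; case: ltnP => // h.
by rewrite nth_default// mul0r.
Qed.

Lemma moment_fun_is_linear : linear (moment_fun : {poly R} -> R^o).
Proof.
move=> a p q; pose n := maxn (size (a *: p + q)) (maxn (size p) (size q)).
rewrite !(@moment_funE n) /n ?leq_max ?leqnn ?orbT//.
rewrite scaler_sumr -big_split /=; apply: eq_bigr => i _.
by rewrite coefD coefZ mulrDl -mulrA.
Qed.

HB.instance Definition _ := GRing.isLinear.Build R {poly R} R^o _ moment_fun
  moment_fun_is_linear.

Lemma moment_funXn k : moment_fun 'X^k = m k.
Proof.
rewrite /moment_fun size_polyXn big_ord_recr /= coefXn eqxx mul1r.
by rewrite big1 ?add0r// => i _; rewrite coefXn ltn_eqF// mul0r.
Qed.

Lemma moment_fun_ibp (p : {poly R}) :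
  moment_fun ((4%:P - 'X^2) * p^`() - 3 *: ('X * p)) = 0.
Proof.
rewrite -[p]coefK poly_def.
rewrite raddf_sum /= !mulr_sumr scaler_sumr -sumrB linear_sum big1 //= => i _.
rewrite derivZ derivXn.
have -> : (4%:P - 'X^2) * (p`_i *: ('X^(i.-1) *+ i)) - 3 *: ('X * (p`_i *: 'X^i)) =
    p`_i *: ((4 * i%:R) *: 'X^(i.-1) - i%:R *: 'X^(i.-1.+2) - 3 *: 'X^(i.+1)).
  by rewrite -!mul_polyC -mulr_natr !exprS !(polyCM, polyC_natr); ring.
rewrite linearZ /= !linearB /= !linearZ /= !moment_funXn.
have h := semicircle_moment_ibp i.
by rewrite /GRing.scale /= -[RHS](mulr0 p`_i) -h; ring.
Qed.

(** The Chebyshev polynomials of the second kind in t/2, orthogonal for the semicircle law. *)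
Fixpoint chebU (n : nat) : {poly R} :=
  if n is n'.+1 then
    if n' is n''.+1 then 'X * chebU n' - chebU n'' else 'X
  else 1.

Lemma chebUSS n : chebU n.+2 = 'X * chebU n.+1 - chebU n.
Proof. by []. Qed.

(** A first-order relation without derivatives on its right side: inserted into [moment_fun_ibp] it
    leaves a recursion for the integrals of the polynomials themselves. *)
Lemma chebU_deriv n :
  (4%:P - 'X^2) * (chebU n.+1)^`() =
  - n.+1%:R *: ('X * chebU n.+1) + (2 * n.+2%:R) *: chebU n /\
  (4%:P - 'X^2) * (chebU n.+2)^`() =
  - n.+2%:R *: ('X * chebU n.+2) + (2 * n.+3%:R) *: chebU n.+1.
Proof.
elim: n => [|n [IH1 IH2]].
  split; first by rewrite /= derivX -!mul_polyC !(polyCN, polyCM, polyC_natr, polyC1); ring.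
  rewrite /= derivB derivM derivX derivC.
  by rewrite -!mul_polyC !(polyCN, polyCM, polyC_natr, polyC1); ring.
split=> //; rewrite chebUSS derivB derivM derivX mul1r mulrBr mulrDr.
rewrite mulrCA IH2 IH1 -!mul_polyC !(polyCN, polyCM, polyC_natr).
rewrite [chebU n.+2]chebUSS -!natr1.
set u := chebU n.+1; set v := chebU n; set N : {poly R} := n%:R.
by ring.
Qed.

(** The relations combine to (k + 4) L(U_(k+2)) = k L(U_k), where L is [moment_fun]. This kills the
    even indices starting from k = 0 and the odd ones starting from L(U_1) = 0; no moment is
    evaluated. *)
Lemma moment_chebU n : moment_fun (chebU n.+1) = 0.
Proof.
have h k : - (k.+1%:R + 3) * moment_fun (chebU k.+2) + k%:R * moment_fun (chebU k) = 0.
  have := moment_fun_ibp (chebU k.+1); have [-> _] := chebU_deriv k.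
  have -> : 'X * chebU k.+1 = chebU k.+2 + chebU k by rewrite chebUSS subrK.
  rewrite linearB linearD /= !linearZ /= linearD /= /GRing.scale /= => e.
  by rewrite -[RHS]e -!natr1; ring.
have h1 : moment_fun (chebU 1) = 0.
  have := moment_fun_ibp 1; rewrite derivC mulr0 sub0r mulr1 linearN /= linearZ /=.
  by move=> /eqP; rewrite oppr_eq0 /GRing.scale /= mulf_eq0 pnatr_eq0 /= => /eqP.
suff : moment_fun (chebU n.+1) = 0 /\ moment_fun (chebU n.+2) = 0 by case.
have k0 k : - (k.+1%:R + 3) != 0 :> R.
  by rewrite oppr_eq0 gt_eqF// ltr_pwDr// ler0n.
have step k (u : R) : k%:R * u = 0 -> moment_fun (chebU k) = u -> moment_fun (chebU k.+2) = 0.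
  move=> e eu; have := h k; rewrite eu e addr0 => /eqP.
  by rewrite mulf_eq0 (negPf (k0 k)) /= => /eqP.
elim: n => [|n [IH1 IH2]].
  by split => //; apply: (step 0%N _ _ erefl); rewrite mul0r.
by split => //; apply: (step _ 0 _ IH1); rewrite mulr0.
Qed.

End semicircle.

(** * Freeness and Wick words *)

Section wick_words.
Variables (R : realType) (H : completeNormedModType R[i]).
Variable ip : {dot H for Num.conj}.
Variable M : set (H -> H).
Hypothesis hM : von_neumann_algebra ip M.
Variable tau : (H -> H) -> R[i].
Hypothesis ht : faithful_normal_tracial_state ip M tau.
Variable n : nat.
Hypothesis n0 : (0 < n)%N.
Variable iota : 'M[R[i]]_n -> (H -> H).
Hypothesis hi : trace_embedding ip M tau iota.
Variable S : H -> H.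
Hypothesis mS : M S.
Hypothesis hS : semicircular ip tau S.
Hypothesis hfree : free_pair tau (range iota) (bicommutant [set S]).
Local Notation A := (vnop hM).
Local Notation F := ('I_n -> R).
Local Notation one := (fun _ : 'I_n => 1 : R).

Lemma mean1 : mean one = 1.
Proof. exact: mean_cst. Qed.

Lemma mean_lin c (a b : F) : mean (fun i => c * a i + b i) = c * mean a + mean b.
Proof. by rewrite meanD meanZ. Qed.

Lemma embed_mem (X : 'M[R[i]]_n) : M (iota X).
Proof. by case: hi. Qed.

Definition dmx (a : F) : 'M[R]_n := diag_mx (\row_i a i).

Definition dg (a : F) : A := vn_mk hM (embed_mem (mxC (dmx a))).

Definition sc : A := vn_mk hM mS.

Lemma embed_lin (k : R[i]) X Y : iota (k *: X + Y) = k *: iota X + iota Y.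
Proof. by case: hi => _ []. Qed.

Lemma dg_lin c (a b : F) : dg (fun i => c * a i + b i) = c *: dg a + dg b.
Proof.
apply: ev_inj; rewrite [RHS]/= -[RHS]embed_lin; congr iota.
apply/matrixP => i j; rewrite !mxE; case: eqP => _; last by rewrite !mulr0n mulr0 addr0.
by rewrite !mulr1n rmorphD rmorphM.
Qed.

Lemma dg1 : dg one = 1.
Proof.
apply: ev_inj; case: hi => _ [_ h _ _ _]; rewrite -[RHS]h; congr iota.
by apply/matrixP => i j; rewrite !mxE; case: eqP.
Qed.

Lemma dgB (k : R) (a : F) : dg (fun i => k - a i) = k *: (1 : A) - dg a.
Proof.
have -> : k *: (1 : A) = dg (fun=> k).
  have -> : (fun=> k) = (fun i : 'I_n => (k - 1) * one i + one i).
    by apply/funext => i; rewrite mulr1 subrK.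
  by rewrite dg_lin dg1 -[X in _ = _ + X]scale1r -scalerDl subrK.
rewrite addrC -scaleN1r -dg_lin; congr dg; apply/funext => i.
by rewrite mulN1r addrC.
Qed.

Lemma dgM (a b : F) : dg (fun i => a i * b i) = dg a * dg b.
Proof.
apply: ev_inj; case: hi => _ [_ _ h _ _]; rewrite -[RHS]h; congr iota.
rewrite -map_mxM mulmx_diag; congr (map_mx _ (diag_mx _)).
by apply/rowP => i; rewrite !mxE.
Qed.

Lemma tau_dg a : tau (ev (dg a)) = (mean a)%:C.
Proof.
case: hi => _ [_ _ _ _ h]; rewrite [LHS]h /ntr trace_map_mx mxtrace_diag.
rewrite rmorphM fmorphV rmorph_nat; congr (_ * _); congr real_complex_def.
by apply: eq_bigr => i _; rewrite mxE.
Qed.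

Lemma sa_dg a : sa (dg a).
Proof.
apply: adjoint_sa; case: hi => _ [_ _ _ h _].
have := h (mxC (dmx a)); rewrite (_ : (map_mx _ _)^T = mxC (dmx a))//.
apply/matrixP => i j; rewrite !mxE eq_sym; case: eqP => [->|_].
  by rewrite !mulr1n conj_Creal// complex_real.
by rewrite !mulr0n rmorph0.
Qed.

Lemma sa_sc : sa sc.
Proof. by apply: adjoint_sa; case: hS. Qed.

Lemma dg_center (a : F) : dg a = mean a *: (1 : A) + dg (fun i => a i - mean a).
Proof.
rewrite -dg1 -dg_lin; congr dg; apply/funext => i.
by rewrite mulr1 addrC subrK.
Qed.

Lemma mean_center (a : F) : mean (fun i => a i - mean a) = 0.
Proof.
have -> : (fun i => a i - mean a) = (fun i => - mean a * one i + a i).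
  by apply/funext => i; rewrite mulr1 addrC.
by rewrite mean_lin mean1 mulr1 addNr.
Qed.

Fixpoint chebs (m : nat) : A :=
  if m is m'.+1 then
    if m' is m''.+1 then sc * chebs m' - chebs m'' else sc
  else 1.

Lemma chebsSS m : chebs m.+2 = sc * chebs m.+1 - chebs m.
Proof. by []. Qed.

Lemma tau_sc_exp j : tau (ev (sc ^+ j)) = (semicircle_moment R j)%:C.
Proof.
case: hS => _ <-; congr tau; elim: j => [|j IH]//.
by rewrite exprS /= -IH.
Qed.

Lemma tau_chebs m : tau (ev (chebs m)) = (moment_fun (chebU R m))%:C.
Proof.
suff h j : tau (ev (sc ^+ j * chebs m)) = (moment_fun ('X^j * chebU R m))%:C /\
    tau (ev (sc ^+ j * chebs m.+1)) = (moment_fun ('X^j * chebU R m.+1))%:C.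
  by have [+ _] := h 0%N; rewrite !expr0 !mul1r.
elim: m j => [|m IH] j.
  rewrite (_ : chebs 0 = 1)// (_ : chebU R 0 = 1)// (_ : chebs 1 = sc)//.
  rewrite (_ : chebU R 1 = 'X)// !mulr1 -(exprSr sc) -(exprSr 'X).
  by rewrite !tau_sc_exp !moment_funXn.
split; first by have [_] := IH j.
have tauB (X Y : A) : tau (ev (X - Y)) = tau (ev X) - tau (ev Y).
  by rewrite addrC -scaleN1r (tau_lin ht) rmorphN1 mulN1r addrC.
rewrite chebsSS chebUSS !mulrBr !mulrA -(exprSr sc) -(exprSr 'X) tauB.
rewrite (IH j.+1).2 (IH j).1 (raddfB (@moment_fun R)).
exact: (esym (rmorphB _ _ _)).
Qed.

Definition gen_sc (X : A) := bicommutant [set S] (ev X).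

Lemma gen_sc_chebs m : gen_sc (chebs m).
Proof.
have cB (X : A) : (forall U, commutant [set S] U -> ev X \o U = U \o ev X) -> gen_sc X.
  by move=> h; split=> //; have /(vnP hM)[] := ev_mem X.
apply: cB => U ZU.
have cS : S \o U = U \o S by case: ZU => _ h; rewrite h.
have [uD uZ u0 uN] : [/\ forall x y, U (x + y) = U x + U y,
   forall a x, U (a *: x) = a *: U x, U 0 = 0 & forall x, U (- x) = - U x].
  by apply: linear_op; case: ZU => -[].
suff : ev (chebs m) \o U = U \o ev (chebs m) /\ ev (chebs m.+1) \o U = U \o ev (chebs m.+1).
  by case.
elim: m => [|m [IH1 IH2]]; first by [].
split=> //; apply/funext => x.
have h1 : ev (chebs m) (U x) = U (ev (chebs m) x) := congr1 (@^~ x) IH1.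
have h2 : ev (chebs m.+1) (U x) = U (ev (chebs m.+1) x) := congr1 (@^~ x) IH2.
have h3 y : ev sc (U y) = U (ev sc y) := congr1 (@^~ y) cS.
rewrite chebsSS -[LHS]/(ev (sc * chebs m.+1 - chebs m) (U x)).
rewrite -[RHS]/(U (ev (sc * chebs m.+1 - chebs m) x)).
by rewrite !evB !evM uD uN h1 h2 h3.
Qed.

Definition letter (e : bool) (X : A) :=
  (if e then bicommutant [set S] else range iota) (ev X) /\ tau (ev X) = 0.

(* The lists are read from right to left: [alternating e (X :: l)] describes a
   product whose last factor X is a letter of type e. *)
Fixpoint alternating (e : bool) (l : seq A) : Prop :=
  if l is X :: l' then letter e X /\ alternating (~~ e) l' else True.

Fixpoint rprod (l : seq A) : A := if l is X :: l' then rprod l' * X else 1.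

Lemma alternating_nth e l j : alternating e l -> (j < size l)%N ->
  letter (e (+) odd j) (nth 0 l j).
Proof.
elim: l e j => [//|X l IH] e [|j] /= [hX hl] hj; first by rewrite addbF.
by rewrite addbN -addNb; exact: IH.
Qed.

Lemma rprodE l : \prod_(0 <= i < size l) nth 0 l (size l - i.+1) = rprod l.
Proof.
elim: l => [|X l IH]; first by rewrite big_nil.
rewrite /= big_nat_recr //= subnn /= -IH; congr (_ * _).
rewrite big_nat [RHS]big_nat; apply: eq_bigr => i /andP[_ hi'].
by rewrite subSS -[(size l - i)%N]prednK ?subn_gt0// -subnS.
Qed.

Lemma tau_alternating e l : l != [::] -> alternating e l -> tau (ev (rprod l)) = 0.
Proof.
case: l => [//|X l] _ al.
pose k := size l.
have sk i : (k.+1 - i.+1)%N = (k - i)%N by rewrite subSS.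
have := hfree (k := k) (e := fun i => e (+) odd (k - i)) (x := fun i => ev (nth 0 (X :: l) (k - i))).
move=> h; rewrite -rprodE.
rewrite (big_morph (@ev _ _ _ _ hM) (id1 := idfun) (op1 := fun T U : H -> H => T \o U))//.
under eq_bigr do rewrite /= sk.
apply: h => i ik.
  have := @alternating_nth e (X :: l) (k - i) al; rewrite /= ltnS leq_subr => /(_ isT).
  by case.
by rewrite -(subnSK ik) /= addbN; case: (e (+) _).
Qed.

(** The Wick-ordered form of a S b_1 S b_2 ... S b_m for s = [b_1; ...; b_m]: the contraction of two
    neighbouring factors S around a letter b, worth [mean b], is subtracted. Thus [size s] counts
    the factors S. *)
Fixpoint wick (a : F) (s : seq F) : A :=
  if s is b :: t then
    dg a * (sc * wick b t - (if t is c :: u then mean b *: wick c u else 0))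
  else dg a.

Lemma wickE a s : wick a s = dg a * wick one s.
Proof. by case: s => [|b t] /=; rewrite dg1 ?mulr1 ?mul1r. Qed.

Lemma sc_wick a s : sc * wick a s = wick one (a :: s) +
  (if s is b :: t then mean a *: wick b t else 0).
Proof. by rewrite /= dg1 mul1r subrK. Qed.

Lemma wick_cons2 b t : wick one (one :: b :: t) = sc * wick one (b :: t) - wick b t.
Proof. by rewrite sc_wick mean1 scale1r addrK. Qed.

Lemma wick_one m : wick one (nseq m one) = chebs m.
Proof.
suff : wick one (nseq m one) = chebs m /\ wick one (nseq m.+1 one) = chebs m.+1 by case.
elim: m => [|m [IH1 IH2]]; first by rewrite /= dg1 mulr1 subr0 mul1r.
by split=> //; rewrite chebsSS -IH2 -IH1 [nseq m.+1 _]/= [nseq m.+2 _]/= wick_cons2.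
Qed.

(** Along a run of letters [one] the Wick words are the Chebyshev polynomials of S. Splitting the
    next letter into its mean and its centred part either prolongs the run or closes it by
    [chebs m.+1] followed by a centred diagonal element. Two consecutive m are carried along for the
    three-term recursion. *)
Lemma wick_expand a s m :
  wick one (nseq m one ++ a :: s) = mean a *: wick one (nseq m.+1 one ++ s)
    + chebs m.+1 * (dg (fun i => a i - mean a) * wick one s).
Proof.
set o := fun i => a i - mean a.
have ea : wick a s = mean a *: wick one s + dg o * wick one s.
  by rewrite wickE dg_center mulrDl vnopZl mul1r.
suff : wick one (nseq m one ++ a :: s) = mean a *: wick one (nseq m.+1 one ++ s)
    + chebs m.+1 * (dg o * wick one s) /\
   wick one (nseq m.+1 one ++ a :: s) = mean a *: wick one (nseq m.+2 one ++ s)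
    + chebs m.+2 * (dg o * wick one s) by case.
elim: m => [|m [IH1 IH2]].
  have e0 : wick one (a :: s) = mean a *: wick one (one :: s) + sc * (dg o * wick one s).
    rewrite [LHS]/= dg1 mul1r ea mulrDr vnopZr addrAC; congr (_ + _).
    rewrite [wick one (one :: s)]/= dg1 mul1r scalerBr; congr (_ - _).
    by case: (s) => [|b t]; rewrite ?scaler0// mean1 scale1r.
  split; first exact: e0.
  rewrite [nseq _ _ ++ _]/= [nseq 2 _ ++ _]/=.
  rewrite !wick_cons2 e0 ea chebsSS mulrDr vnopZr scalerBr opprD addrACA; congr (_ + _).
  by rewrite mulrBl mul1r mulrA.
split=> //.
rewrite [nseq m.+2 _ ++ _]/= [nseq m.+3 _ ++ _]/= [LHS]wick_cons2 [in RHS]wick_cons2.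
rewrite -[one :: _ ++ a :: s]/(nseq m.+1 one ++ a :: s) IH1 IH2 (chebsSS m.+1).
rewrite -[one :: one :: _ ++ s]/(nseq m.+2 one ++ s) -[one :: _ ++ s]/(nseq m.+1 one ++ s).
rewrite mulrDr vnopZr scalerBr opprD addrACA; congr (_ + _).
by rewrite [RHS]mulrBl mulrA.
Qed.

Lemma letter_dg (a : F) : letter false (dg (fun i => a i - mean a)).
Proof.
split; last by rewrite tau_dg mean_center.
by exists (mxC (dmx (fun i => a i - mean a))).
Qed.

Lemma letter_chebs m : letter true (chebs m.+1).
Proof.
by split; [exact: gen_sc_chebs | rewrite tau_chebs moment_chebU].
Qed.

(** Freeness concerns alternating products of centred elements: [l] collects those already split off
    on the left and [m] is the length of the pending run. That l is empty or ends on a diagonal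
    element allows a Chebyshev letter to follow. *)
Lemma tau_rprod_wick s m l : alternating false l ->
  [|| l != [::], (0 < m)%N | s != [::]] ->
  tau (ev (rprod l * wick one (nseq m one ++ s))) = 0.
Proof.
elim: s m l => [|a s IH] m l al hne.
  rewrite cats0 wick_one; case: m hne => [|m] hne.
    by rewrite mulr1; apply: (tau_alternating (e := false)); move: hne; rewrite ?orbF.
  rewrite -[rprod l * _]/(rprod (chebs m.+1 :: l)).
  by apply: (tau_alternating (e := true)) => //; split => //; exact: letter_chebs.
rewrite wick_expand mulrDr vnopZr (tau_lin ht) IH ?orbT// mulr0 add0r.
rewrite !mulrA.
have := IH 0%N [:: dg (fun i => a i - mean a), chebs m.+1 & l]; apply => //.
by split; [exact: letter_dg | split; [exact: letter_chebs|]].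
Qed.

Lemma rho_wick a s : rho tau (wick a s) = if s is [::] then mean a else 0.
Proof.
case: s => [|b s]; first by rewrite /= /rho tau_dg.
rewrite wickE dg_center mulrDl vnopZl mul1r /rho (tau_lin ht).
have h0 : tau (ev (wick one (b :: s))) = 0.
  have := @tau_rprod_wick (b :: s) 0 [::] I isT.
  by rewrite [rprod _]/= [nseq 0 _ ++ _]/= mul1r.
have -> : tau (ev (dg (fun i => a i - mean a) * wick one (b :: s))) = 0.
  have := @tau_rprod_wick (b :: s) 0 [:: dg (fun i => a i - mean a)]
    (conj (letter_dg a) I) isT.
  by rewrite [rprod _]/= [nseq 0 _ ++ _]/= mul1r.
by rewrite h0 mulr0 addr0.
Qed.

Variables (sigma : R) (W : F).

Definition wop : A := dg W + sigma *: sc.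

(** Left multiplication of a Wick word by y = W + sigma S modifies its first letter, adds a factor S
    or contracts one; the recursion follows these three cases. From here on the moments of y are a
    matter of scalars and lists. *)
Fixpoint wmom (k : nat) (a : F) (s : seq F) : R :=
  if k is k'.+1 then
    wmom k' (fun i => W i * a i) s + sigma * wmom k' one (a :: s)
      + (if s is b :: t then sigma * mean a * wmom k' b t else 0)
  else if s is [::] then mean a else 0.

Lemma rho_wop_wick k a s : rho tau (wop ^+ k * wick a s) = wmom k a s.
Proof.
elim: k a s => [|k IH] a s; first by rewrite mul1r rho_wick.
have -> : wop ^+ k.+1 * wick a s = wop ^+ k * wick (fun i => W i * a i) s
    + sigma *: (wop ^+ k * wick one (a :: s))
    + sigma *: (wop ^+ k * (if s is b :: t then mean a *: wick b t else 0)).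
  rewrite exprSr -mulrA {2}/wop mulrDl vnopZl sc_wick scalerDr !mulrDr !vnopZr addrA.
  by rewrite (wickE a) [dg W * _]mulrA -dgM -wickE.
rewrite !(rhoD ht) !(rhoZ ht) !IH /=; congr (_ + _).
case: s => [|b t]; first by rewrite mulr0 (rho0 hM ht) mulr0.
by rewrite vnopZr (rhoZ ht) IH mulrA.
Qed.

Lemma rho_wop k : rho tau (wop ^+ k) = wmom k one [::].
Proof. by rewrite -rho_wop_wick /= dg1 mulr1. Qed.

End wick_words.

(** * The edge of the free sum *)

Section edge_transfer.
Variables (R : realType) (n : nat).
Hypothesis n0 : (0 < n)%N.
Local Notation F := ('I_n -> R).
Local Notation one := (fun _ : 'I_n => 1 : R).
Variables (d : F) (c sigma : R).
Hypothesis d0 : forall i, 0 < d i.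
Hypothesis dc : forall i, d i <= c.
Hypothesis s0 : 0 <= sigma.
Local Notation W := (fun i : 'I_n => c - d i).
Local Notation wmom := (wmom sigma W).

Lemma mean_lt (a b : F) : (forall i, a i < b i) -> mean a < mean b.
Proof.
move=> h; rewrite ltr_pM2l ?invr_gt0 ?ltr0n//.
by apply: ltr_sum => //; apply/hasP; exists (Ordinal n0); rewrite ?mem_index_enum.
Qed.

Definition cauchy_mean (w : R) (a : F) : R := mean (fun i => a i / (w + d i)).

(** The candidate for the trace of (z - y)^-1 times the Wick word of (a, s) at z = [edge w]: it
    factorises over the letters, and [green_eq] is its resolvent equation. *)
Definition green (w : R) (a : F) (s : seq F) : R :=
  sigma ^+ size s * cauchy_mean w a * \prod_(b <- s) cauchy_mean w b.

(** One step of the moment recursion as an operator on functions of words: [wmom k.+1] is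
    [transfer (wmom k)]. *)
Definition transfer (g : F -> seq F -> R) (a : F) (s : seq F) : R :=
  g (fun i => W i * a i) s + sigma * g one (a :: s)
    + (if s is b :: t then sigma * mean a * g b t else 0).

Definition edge (w : R) : R := c + w + sigma ^+ 2 * cauchy_mean w one.

Let F0 (a : F) (s : seq F) : R := if s is [::] then mean a else 0.

Let c0 : 0 < c. Proof. exact: lt_le_trans (d0 (Ordinal n0)) (dc _). Qed.

Lemma cauchy_mean_ge0 w a : 0 <= w -> (forall i, 0 <= a i) -> 0 <= cauchy_mean w a.
Proof.
by move=> w0 a0; apply: mean_ge0 => i; rewrite divr_ge0// addr_ge0// ltW.
Qed.

Lemma edge_gt0 w : 0 <= w -> 0 < edge w.
Proof.
move=> w0; rewrite /edge -addrA ltr_pwDl// addr_ge0// mulr_ge0 ?sqr_ge0//.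
exact: cauchy_mean_ge0.
Qed.

Lemma green_eq w a s : 0 <= w -> edge w * green w a s = F0 a s + transfer (green w) a s.
Proof.
move=> w0.
have wd i : w + d i != 0 by rewrite gt_eqF// ltr_wpDl.
have eW : cauchy_mean w (fun i => W i * a i) = (c + w) * cauchy_mean w a - mean a.
  rewrite /cauchy_mean -mulN1r -!meanZ -meanD; congr mean; apply/funext => i.
  by field.
rewrite /transfer /green eW /edge; case: s => [|b t]; rewrite /F0 /=.
  by rewrite big_seq1 big_nil; ring.
by rewrite !big_cons !exprS; ring.
Qed.

Lemma transferD g h a s : transfer (fun a s => g a s + h a s) a s =
  transfer g a s + transfer h a s.
Proof. by rewrite /transfer; case: s => [|b t]; ring. Qed.

Lemma transferZ k g a s : transfer (fun a s => k * g a s) a s = k * transfer g a s.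
Proof. by rewrite /transfer; case: s => [|b t]; ring. Qed.

Fixpoint nonneg_word (s : seq F) : Prop :=
  if s is b :: t then (forall i, 0 <= b i) /\ nonneg_word t else True.

Lemma transfer_le g h a s : (forall i, 0 <= a i) -> nonneg_word s ->
  (forall a s, (forall i, 0 <= a i) -> nonneg_word s -> g a s <= h a s) ->
  transfer g a s <= transfer h a s.
Proof.
move=> a0 ns gh; rewrite /transfer; apply: lerD; first apply: lerD.
- by apply: gh => // i; rewrite mulr_ge0// subr_ge0.
- by apply: ler_wpM2l => //; apply: gh => //= i; exact: ler01.
case: s ns => [//|b t] [b0 nt]; apply: ler_wpM2l.
  by rewrite mulr_ge0// mean_ge0.
exact: gh.
Qed.

Lemma transfer_ge0 g a s : (forall i, 0 <= a i) -> nonneg_word s ->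
  (forall a s, (forall i, 0 <= a i) -> nonneg_word s -> 0 <= g a s) ->
  0 <= transfer g a s.
Proof.
move=> a0 ns hg; have := @transfer_le (fun _ _ => 0) g a s a0 ns hg.
apply: le_trans; rewrite /transfer; case: (s) => [|b t];
by rewrite !mulr0 !addr0.
Qed.

Lemma word_prod_ge0 w s : 0 <= w -> nonneg_word s -> 0 <= \prod_(b <- s) cauchy_mean w b.
Proof.
move=> w0; elim: s => [|b t IH]; first by rewrite big_nil ler01.
by move=> [b0 nt]; rewrite big_cons mulr_ge0 ?IH//; exact: cauchy_mean_ge0.
Qed.

Lemma green_ge0 w a s : 0 <= w -> (forall i, 0 <= a i) -> nonneg_word s -> 0 <= green w a s.
Proof.
move=> w0 a0 ns; apply: mulr_ge0; last exact: word_prod_ge0.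
by apply: mulr_ge0; [exact: exprn_ge0 | exact: cauchy_mean_ge0].
Qed.

Lemma cauchy_mean_le w a : 0 <= w -> (forall i, 0 <= a i) -> cauchy_mean w a <= cauchy_mean 0 a.
Proof.
move=> w0 a0; apply: mean_le => i; apply: ler_wpM2l => //.
by rewrite add0r lef_pV2 ?posrE ?lerDr// ltr_wpDl.
Qed.

Lemma green_le w a s : 0 <= w -> (forall i, 0 <= a i) -> nonneg_word s ->
  green w a s <= green 0 a s.
Proof.
move=> w0 a0 ns; rewrite /green; apply: ler_pM.
- by apply: mulr_ge0; [exact: exprn_ge0 | exact: cauchy_mean_ge0].
- exact: word_prod_ge0.
- by apply: ler_wpM2l; rewrite ?exprn_ge0// cauchy_mean_le.
elim: s ns => [|b t IH]; first by rewrite !big_nil.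
move=> [b0 nt]; rewrite !big_cons; apply: ler_pM.
- exact: cauchy_mean_ge0.
- exact: word_prod_ge0.
- exact: cauchy_mean_le.
exact: IH.
Qed.

Lemma wmom_ge0 k a s : (forall i, 0 <= a i) -> nonneg_word s -> 0 <= wmom k a s.
Proof.
elim: k a s => [|k IH] a s a0 ns; last exact: (@transfer_ge0 (wmom k)).
by case: s ns => [|b t] _ //=; exact: mean_ge0.
Qed.

Fixpoint green_tail (w : R) (K : nat) : F -> seq F -> R :=
  if K is K'.+1 then fun a s => (edge w)^-1 * transfer (green_tail w K') a s
  else green w.

Lemma green_expand w K a s : 0 <= w ->
  green w a s = \sum_(k < K) (edge w)^-1 ^+ k.+1 * wmom k a s + green_tail w K a s.
Proof.
move=> w0; elim: K a s => [|K IH] a s; first by rewrite big_ord0 add0r.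
have zn : edge w != 0 by rewrite gt_eqF// edge_gt0.
have -> : green w a s = (edge w)^-1 * (F0 a s + transfer (green w) a s).
  by rewrite -green_eq// mulKf.
have -> : transfer (green w) a s = transfer (fun a s =>
    \sum_(k < K) (edge w)^-1 ^+ k.+1 * wmom k a s + green_tail w K a s) a s.
  by congr transfer; apply/funext => x; apply/funext => y; exact: IH.
rewrite transferD addrA mulrDr; congr (_ + _).
rewrite big_ord_recl expr1 mulrDr; congr (_ + _).
have -> : transfer (fun a s => \sum_(k < K) (edge w)^-1 ^+ k.+1 * wmom k a s) a s =
    \sum_(k < K) (edge w)^-1 ^+ k.+1 * wmom k.+1 a s.
  elim: (K) => [|N IHN].
    rewrite big_ord0 /transfer !big_ord0; case: (s) => [|b t];
    by rewrite ?big_ord0 !mulr0 !addr0.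
  transitivity (transfer (fun a s => \sum_(k < N) (edge w)^-1 ^+ k.+1 * wmom k a s) a s
      + (edge w)^-1 ^+ N.+1 * transfer (wmom N) a s).
    rewrite -transferZ -transferD.
    by congr transfer; apply/funext => x; apply/funext => y; rewrite big_ord_recr.
  by rewrite [RHS]big_ord_recr -IHN.
by rewrite mulr_sumr; apply: eq_bigr => i _; rewrite mulrA -exprS.
Qed.

(** As c - d_i >= 0, [transfer] preserves inequalities between functions on nonnegative words, and
    [green 0] is a nonnegative supersolution: its transfer is at most [edge 0] times itself. Each
    iteration therefore costs at most edge 0 / edge w. *)
Lemma green_tail_bound w K a s : 0 <= w -> (forall i, 0 <= a i) -> nonneg_word s ->
  0 <= green_tail w K a s <= (edge 0 / edge w) ^+ K * green 0 a s.
Proof.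
move=> w0; elim: K a s => [|K IH] a s a0 ns.
  by rewrite /= mul1r green_ge0//= green_le.
have z0 := edge_gt0 w0; have r0 := edge_gt0 (lexx 0).
have zi : 0 <= (edge w)^-1 by rewrite invr_ge0 ltW.
apply/andP; split=> /=.
  by apply: mulr_ge0 => //; apply: transfer_ge0 => // b t b0 nt; case/andP: (IH b t b0 nt).
have h : transfer (green_tail w K) a s <=
    transfer (fun a s => (edge 0 / edge w) ^+ K * green 0 a s) a s.
  by apply: transfer_le => // b t b0 nt; case/andP: (IH b t b0 nt).
apply: le_trans (ler_wpM2l zi h) _; rewrite transferZ.
have h2 : transfer (green 0) a s <= edge 0 * green 0 a s.
  rewrite green_eq// lerDr; case: (s) => [|b t] //=; exact: mean_ge0.
move: h2; set g := green 0 a s; set T := transfer _ _ _ => h2.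
have -> : (edge 0 / edge w) ^+ K.+1 * g =
    (edge w)^-1 * ((edge 0 / edge w) ^+ K * (edge 0 * g)).
  by rewrite exprS; ring.
apply: ler_wpM2l => //; apply: ler_wpM2l => //.
by rewrite exprn_ge0// divr_ge0// ltW.
Qed.

(** At w = 0 all terms of [green_expand] are nonnegative, so each of them is bounded by the total,
    without any convergence of the series. *)
Lemma wmom_le k : wmom k one [::] <= edge 0 * cauchy_mean 0 one * edge 0 ^+ k.
Proof.
have r0 := edge_gt0 (lexx 0).
have o0 (i : 'I_n) : 0 <= (1 : R) by exact: ler01.
have := @green_expand 0 k.+1 one [::] (lexx 0).
have /andP[t0 _] := @green_tail_bound 0 k.+1 one [::] (lexx 0) o0 I.
rewrite {1}/green /= mul1r big_nil mulr1 big_ord_recr /= => e.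
have h : (edge 0)^-1 ^+ k.+1 * wmom k one [::] <= cauchy_mean 0 one.
  rewrite e -addrA addrCA lerDl addr_ge0//; apply: sumr_ge0 => i _.
  by rewrite mulr_ge0 ?wmom_ge0// exprn_ge0// invr_ge0 ltW.
rewrite exprVn mulrC ler_pdivrMr ?exprn_gt0// in h.
by apply: le_trans h _; rewrite exprS mulrA (mulrC (edge 0)).
Qed.

Lemma cauchy_mean_sum w K : 0 <= w ->
  `|cauchy_mean w one - \sum_(k < K) (edge w)^-1 ^+ k.+1 * wmom k one [::]|
    <= (edge 0 / edge w) ^+ K * cauchy_mean 0 one.
Proof.
move=> w0; have o0 (i : 'I_n) : 0 <= (1 : R) by exact: ler01.
have := @green_expand w K one [::] w0.
have := @green_tail_bound w K one [::] w0 o0 I.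
rewrite /green /= !mul1r !big_nil !mulr1 => /andP[t0 t1] ->.
by rewrite addrAC subrr add0r ger0_norm.
Qed.

Hypothesis crit : sigma ^+ 2 * mean (fun i => (d i) ^- 2) = 1.

Lemma edge_sub w v : 0 <= w -> 0 <= v -> edge v - edge w =
  (v - w) * (1 - sigma ^+ 2 * mean (fun i => ((w + d i) * (v + d i))^-1)).
Proof.
move=> w0 v0; have -> : edge v - edge w = (v - w) -
    sigma ^+ 2 * (cauchy_mean w one - cauchy_mean v one) by rewrite /edge; ring.
have -> : cauchy_mean w one - cauchy_mean v one =
    (v - w) * mean (fun i => ((w + d i) * (v + d i))^-1).
  rewrite /cauchy_mean -[X in _ - X]mul1r -mulNr -!meanZ -meanD; congr mean.
  apply/funext => i; have a1 : w + d i != 0 by rewrite gt_eqF// ltr_wpDl.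
  have a2 : v + d i != 0 by rewrite gt_eqF// ltr_wpDl.
  by field; rewrite a1 a2.
by ring.
Qed.

Lemma cauchy_mean_sub w v : 0 <= w -> 0 <= v -> cauchy_mean w one - cauchy_mean v one =
    (v - w) * mean (fun i => ((w + d i) * (v + d i))^-1).
Proof.
move=> w0 v0; rewrite /cauchy_mean -[X in _ - X]mul1r -mulNr -!meanZ -meanD; congr mean.
apply/funext => i; have a1 : w + d i != 0 by rewrite gt_eqF// ltr_wpDl.
have a2 : v + d i != 0 by rewrite gt_eqF// ltr_wpDl.
by field; rewrite a1 a2.
Qed.

Lemma sigma2_gt0 : 0 < sigma ^+ 2.
Proof.
rewrite lt_neqAle sqr_ge0 andbT eq_sym; apply/eqP => e.
by move: crit; rewrite e mul0r => /esym/eqP; rewrite oner_eq0.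
Qed.

Lemma edge_lt w v : 0 <= w -> w < v -> edge w < edge v.
Proof.
move=> w0 wv; have v0 : 0 < v by exact: le_lt_trans wv.
rewrite -subr_gt0 edge_sub ?(ltW v0)// mulr_gt0 ?subr_gt0// -crit.
rewrite ltr_pM2l ?sigma2_gt0//; apply: mean_lt => i.
have dp := d0 i; have a1 : 0 < w + d i by rewrite ltr_wpDl.
have a2 : 0 < v + d i by rewrite addr_gt0.
rewrite ltf_pV2 ?posrE ?mulr_gt0 ?exprn_gt0// expr2.
apply: (@le_lt_trans _ _ ((w + d i) * d i)); first by rewrite ler_pM2r// lerDr.
by rewrite ltr_pM2l// ltrDr.
Qed.

(* The critical normalisation makes [edge] flat at 0, so the difference
   quotient of [cauchy_mean] with respect to [edge] blows up there. *)
Lemma edge_flat (B : R) : 0 <= B ->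
  exists2 w, 0 < w &
    B * (edge (2 * w) - edge w) < cauchy_mean w one - cauchy_mean (2 * w) one.
Proof.
(* With k the difference quotient of [cauchy_mean] between w and 2 w, that of [edge] is 1 - sigma^2
   k, and C is such that it is at most C w for w <= 1. *)
move=> B0; pose C := sigma ^+ 2 * mean (fun i => 3 * d i ^- 3 + 2 * d i ^- 4).
have C0 : 0 <= C.
  apply: mulr_ge0; first exact: sqr_ge0.
  by apply: mean_ge0 => i; rewrite addr_ge0// mulr_ge0// invr_ge0 exprn_ge0// ltW.
pose s2 := sigma ^+ 2; have s2p : 0 < s2 := sigma2_gt0.
(* The claim amounts to (1 + s2 B)(1 - s2 k) < 1, which w = 1/K guarantees. *)
pose K := (1 + s2 * B) * (C + 1).
have k1 : 1 <= 1 + s2 * B by rewrite lerDl mulr_ge0// ltW.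
have K1 : 1 <= K by apply: mulr_ege1 => //; rewrite lerDr.
have K0 : 0 < K by exact: lt_le_trans K1.
pose w := K^-1; have w0 : 0 < w by rewrite invr_gt0.
have w1 : w <= 1 by rewrite invf_le1.
exists w => //.
have ww : 0 <= 2 * w by rewrite mulr_ge0// ltW.
rewrite cauchy_mean_sub ?edge_sub ?(ltW w0)//.
have -> : 2 * w - w = w by ring.
rewrite mulrCA ltr_pM2l//.
set k := mean _.
have hk : 1 - s2 * k <= C * w.
  rewrite -{1}crit -/s2 -mulrBr /C -mulrA ler_pM2l//.
  rewrite mulrC -meanZ -[k]mul1r -mulNr -meanZ -meanD; apply: mean_le => i.
  have dp := d0 i; set x := d i in dp *.
  have -> : x ^- 2 + -1 * ((w + x) * (2 * w + x))^-1 =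
     w * ((3 * x + 2 * w) / (x ^+ 2 * ((w + x) * (2 * w + x)))).
    by field; rewrite !gt_eqF// ?ltr_wpDl// ltW.
  apply: ler_wpM2l; first exact: ltW.
  have -> : 3 * x ^- 3 + 2 * x ^- 4 = (3 * x + 2) / x ^+ 4 by field; rewrite gt_eqF.
  apply: ler_pM.
  - by rewrite addr_ge0// mulr_ge0// ltW.
  - by rewrite invr_ge0; apply: ltW; rewrite !mulr_gt0 ?exprn_gt0 ?addr_gt0 ?mulr_gt0.
  - by rewrite lerD2l -[leRHS]mulr1 ler_pM2l.
  rewrite lef_pV2 ?posrE ?mulr_gt0 ?exprn_gt0 ?addr_gt0 ?mulr_gt0//.
  rewrite (_ : x ^+ 4 = x ^+ 2 * (x * x)); last by ring.
  by rewrite ler_pM2l ?exprn_gt0// ler_pM ?(ltW dp)// lerDr ?(ltW w0).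
have Kw : K * w = 1 by rewrite divff// gt_eqF.
have : (1 + s2 * B) * (1 - s2 * k) < 1.
  apply: (@le_lt_trans _ _ ((1 + s2 * B) * (C * w))).
    by apply: ler_wpM2l => //; exact: le_trans k1.
  rewrite -[ltRHS]Kw -[K in ltRHS]/((1 + s2 * B) * (C + 1)) -mulrA.
  rewrite ltr_pM2l ?(lt_le_trans ltr01)//.
  by rewrite ltr_pM2r// ltrDl.
move=> h; rewrite -(ltr_pM2l s2p).
rewrite -/s2.
have -> : s2 * (B * (1 - s2 * k)) = (1 + s2 * B) * (1 - s2 * k) - (1 - s2 * k) by ring.
lra.
Qed.

End edge_transfer.

(** * Resolvents in the algebra *)

Section resolvents.
Variables (R : realType) (H : completeNormedModType R[i]).
Variable ip : {dot H for Num.conj}.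
Variable M : set (H -> H).
Hypothesis hM : von_neumann_algebra ip M.
Hypothesis hip : hilbert_norm ip.
Variable tau : (H -> H) -> R[i].
Hypothesis ht : faithful_normal_tracial_state ip M tau.
Local Notation A := (vnop hM).

Lemma scaled_inverse (k : R) (X G : A) : k != 0 -> X * G = 1 -> G * X = 1 ->
  (k *: X) * (k^-1 *: G) = 1 /\ (k^-1 *: G) * (k *: X) = 1.
Proof.
move=> k0 h1 h2; split; rewrite vnopZl vnopZr ?h1 ?h2 scalerA.
  by rewrite divff// scale1r.
by rewrite mulVf// scale1r.
Qed.

Lemma inverse_sa (X G : A) : sa X -> X * G = 1 -> sa G.
Proof.
move=> sX XG x y.
have e z : ev X (ev G z) = z by rewrite -evM XG.
by rewrite -{1}(e y) -{2}(e x) sX.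
Qed.

(** Neumann series for X^2 + b^2 = k (1 - Y) with k = c^2 + b^2: by [square_defect_nb] the norm of Y
    is at most c^2 / k < 1. This serves to exclude non-real spectrum. *)
Lemma square_shift_inverse (X : A) (b : R) : sa X -> b != 0 ->
  exists G : A, (X * X + b ^+ 2 *: (1 : A)) * G = 1 /\ G * (X * X + b ^+ 2 *: (1 : A)) = 1.
Proof.
move=> sX b0; have [c c0 hc] := nb_ex X.
have b2 : 0 < b ^+ 2 by rewrite exprn_even_gt0.
pose k := c ^+ 2 + b ^+ 2; have k0 : 0 < k by rewrite ltr_wpDl ?sqr_ge0.
pose Y : A := k^-1 *: (c ^+ 2 *: (1 : A) - X * X).
have nY : nb (k^-1 * c ^+ 2) Y.
  by apply: nbZ_ge0; [rewrite invr_ge0 ltW | exact: square_defect_nb].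
have [] := @neumann _ _ _ _ hM (k^-1 * c ^+ 2) Y.
- by rewrite mulr_ge0 ?sqr_ge0// invr_ge0 ltW.
- by rewrite mulrC ltr_pdivrMr// mul1r ltrDl.
- exact: nY.
move=> G [h1 h2].
have e : X * X + b ^+ 2 *: (1 : A) = k *: (1 - Y).
  rewrite scalerBr /Y scalerA divff ?gt_eqF// scale1r /k scalerDl opprB.
  by rewrite [RHS]addrC addrA subrK.
exists (k^-1 *: G); rewrite e.
by apply: scaled_inverse; rewrite ?gt_eqF.
Qed.

Variables (r : R) (y : A).
Hypotheses (r0 : 0 < r) (sy : sa y) (ny : nb r y).

Lemma resolvent_exists z : r < z -> exists G : A,
  (z *: (1 : A) - y) * G = 1 /\ G * (z *: (1 : A) - y) = 1.
Proof.
move=> rz; have z0 : 0 < z by exact: lt_trans rz.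
have nX : nb (z^-1 * r) (z^-1 *: y).
  by apply: nbZ_ge0; rewrite ?invr_ge0 ?(ltW z0).
have [] := @neumann _ _ _ _ hM (z^-1 * r) (z^-1 *: y).
- by rewrite mulr_ge0 ?invr_ge0// ltW.
- by rewrite mulrC ltr_pdivrMr// mul1r.
- exact: nX.
move=> G [h1 h2].
have e : z *: (1 : A) - y = z *: (1 - z^-1 *: y).
  by rewrite scalerBr scalerA divff ?gt_eqF// scale1r.
exists (z^-1 *: G); rewrite e.
by apply: scaled_inverse; rewrite ?gt_eqF.
Qed.

Lemma sa_shift z : sa (z *: (1 : A) - y).
Proof. by apply: saB => //; apply: saZ; exact: sa1. Qed.

(** A bound on the inverse of r - y is inherited by the resolvents at all z > r: for q = (r - y) u
    one has Re <q, u> >= 0, as r bounds y, and therefore |q + (z - r) u| >= |q|. *)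
Lemma resolvent_nb (G0 G : A) (B z : R) : nb B G0 -> G0 * (r *: (1 : A) - y) = 1 ->
  0 <= B -> r < z -> (z *: (1 : A) - y) * G = 1 -> nb B G.
Proof.
move=> nG0 G0Q B0 rz hG x.
set u := ev G x.
have eu : z%:C *: u - ev y u = x by rewrite -[RHS](ev1 hM) -hG evM evB evZ ev1.
pose q := r%:C *: u - ev y u.
have uq : u = ev G0 q by rewrite -[LHS](ev1 hM) -G0Q evM evB evZ ev1.
rewrite {1}uq; apply: le_trans (nG0 q) _; apply: ler_wpM2l => //.
have ex : x = q + (z - r)%:C *: u.
  by rewrite -eu /q rmorphB scalerBl [RHS]addrC subrKA.
have pos : 0 <= re ip q u.
  rewrite /q reDl reNl reZl -(nr_re hip) subr_ge0; apply: le_trans (re_opb u u hip ny) _.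
  by rewrite -mulrA -expr2.
clearbody q; clearbody u.
rewrite -(@ler_pXn2r _ 2) ?nnegrE ?nr_ge0// !(nr_re hip) ex !(reDl, reDr, reZl, reZr).
have := sqr_ge0 (nr u); rewrite (nr_re hip) (reC ip u q) => u0.
have zr : 0 <= z - r by rewrite subr_ge0 ltW.
rewrite -addrA lerDl; apply: addr_ge0; first exact: mulr_ge0.
by apply: mulr_ge0 => //; apply: addr_ge0 => //; exact: mulr_ge0.
Qed.

Lemma geometric_small (th C u : R) : 0 <= th -> th < 1 ->
  (forall K : nat, `|u| <= th ^+ K * C) -> u = 0.
Proof.
move=> t0 t1 h; apply/eqP; rewrite -normr_le0 leNgt; apply/negP => u0.
have : 1 <= th.
  by apply: (@exp_growth_le _ _ _ `|u| C) => // k; rewrite expr1n mul1r mulrC.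
by rewrite leNgt t1.
Qed.

Lemma resolvent_expand (G : A) z K : z != 0 -> (z *: (1 : A) - y) * G = 1 ->
  G = \sum_(k < K) z^-1 ^+ k.+1 *: y ^+ k + z^-1 ^+ K *: (y ^+ K * G).
Proof.
move=> z0 hG; elim: K => [|K IH]; first by rewrite big_ord0 add0r expr0 scale1r mul1r.
have e : G = z^-1 *: (1 : A) + z^-1 *: (y * G).
  have : z *: G = 1 + y * G.
    by rewrite -[in RHS]hG mulrBl vnopZl mul1r subrK.
  by move=> h; rewrite -scalerDr -h scalerA mulVf// scale1r.
rewrite {1}IH big_ord_recr /= -addrA; congr (_ + _).
rewrite {1}e mulrDr !vnopZr mulr1 scalerDr !scalerA -!exprSr; congr (_ + _ *: _).
by rewrite mulrA -exprSr.
Qed.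

(** The partial sums of the Neumann series approximate both numbers up to a multiple of (r / z)^K,
    which identifies them. *)
Lemma resolvent_trace (G : A) (B C z h : R) : r < z -> (z *: (1 : A) - y) * G = 1 ->
  0 <= B -> nb B G ->
  (forall K, `|h - \sum_(k < K) z^-1 ^+ k.+1 * rho tau (y ^+ k)| <= (r / z) ^+ K * C) ->
  rho tau G = h.
Proof.
move=> rz hG B0 nG hh; have z0 : 0 < z by exact: lt_trans rz.
have sG := inverse_sa (sa_shift z) hG.
apply/eqP; rewrite -subr_eq0; apply/eqP.
apply: (@geometric_small (r / z) (B + C)).
- by rewrite divr_ge0// ltW.
- by rewrite ltr_pdivrMr// mul1r.
move=> K; rewrite {1}(resolvent_expand K (lt0r_neq0 z0) hG) (rhoD ht) (rhoZ ht).
have -> : rho tau (\sum_(k < K) z^-1 ^+ k.+1 *: y ^+ k) =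
    \sum_(k < K) z^-1 ^+ k.+1 * rho tau (y ^+ k).
  elim: (K) => [|N IH]; first by rewrite !big_ord0 (rho0 hM ht).
  by rewrite !big_ord_recr /= (rhoD ht) (rhoZ ht) IH.
rewrite -addrAC; apply: le_trans (ler_normD _ _) _.
rewrite mulrDr [leRHS]addrC; apply: lerD; first by rewrite distrC.
rewrite normrM ger0_norm ?exprn_ge0 ?invr_ge0 ?(ltW z0)//.
rewrite exprMn mulrC [leRHS]mulrAC; apply: ler_wpM2r.
  by rewrite exprn_ge0// invr_ge0 ltW.
by apply: (rho_mul_le hip ht (saX _ sy) sG) => //; [rewrite exprn_ge0// ltW | apply: nbX => //; exact: ltW].
Qed.

Lemma resolvent_trace_sub (G1 G2 : A) (z1 z2 : R) :
  (z1 *: (1 : A) - y) * G1 = 1 -> G1 * (z1 *: (1 : A) - y) = 1 ->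
  (z2 *: (1 : A) - y) * G2 = 1 ->
  rho tau G1 - rho tau G2 = (z2 - z1) * rho tau (G1 * G2).
Proof.
move=> h1 h1' h2; rewrite -(rhoB ht) -(rhoZ ht); congr (rho _ _).
have -> : G1 - G2 = G1 * ((z2 *: (1 : A) - y) - (z1 *: (1 : A) - y)) * G2.
  by rewrite mulrBr mulrBl h1' mul1r -mulrA h2 mulr1.
by rewrite opprD opprK addrACA addNr addr0 -scalerBl vnopZr vnopZl mulr1.
Qed.

End resolvents.

(** * The maximum of the spectrum *)

Section free_edge.
Variables (R : realType) (n : nat).
Hypothesis n0 : (0 < n)%N.
Variables (beta : R) (D : 'M[R]_n).
Hypotheses (beta1 : 1 <= beta) (aD : admissible beta D).
Variables (H : completeNormedModType R[i]) (ip : {dot H for Num.conj}).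
Variables (M : set (H -> H)) (tau : (H -> H) -> R[i]).
Variables (iota : 'M[R[i]]_n -> (H -> H)) (S : H -> H).
Hypothesis hfp : semicircular_free_product ip M tau iota S.

Lemma max_spectrum_free_sum :
  max_of_spectrum M ((Num.sqrt 2 * beta)%:C *: S - iota (mxC D))
    (2 * beta ^+ 2 * ntr (invmx D)).
Proof.
have [[hip hM] ht hi [mS hS] [hfree _]] := hfp.
pose d i := D i i; have d0 i : 0 < d i by exact: adm_gt0 aD i.
(* Any upper bound of the d_i would do: it makes W nonnegative and merely translates the
   spectrum. *)
pose c : R := \sum_i d i.
have dc i : d i <= c.
  by rewrite /c (bigD1 i)//= lerDl; apply: sumr_ge0 => j _; exact: ltW.
pose sg := Num.sqrt 2 * beta.
have sg0 : 0 <= sg by rewrite mulr_ge0 ?sqrtr_ge0// (le_trans ler01).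
have sg2 : sg ^+ 2 = 2 * beta ^+ 2 by rewrite exprMn sqr_sqrtr.
have crit : sg ^+ 2 * mean (fun i => d i ^- 2) = 1.
  rewrite sg2 -[RHS](mean_inv2 aD); congr (_ * mean _).
  by apply/funext => i; rewrite exprVn.
pose W i := c - d i.
pose y := wop hM hi mS sg W.
pose r := edge d c sg 0.
set E := 2 * beta ^+ 2 * ntr (invmx D).
have rE : r = c + E.
  rewrite /r /edge addr0 sg2 /E -[invmx D]expr1 (ntr_inv aD) /cauchy_mean.
  by congr (_ + _ * mean _); apply/funext => i; rewrite add0r mul1r expr1.
have r0 : 0 < r by exact: edge_gt0.
have sy : sa y.
  by apply: saD; [exact: sa_dg | apply: saZ; exact: (sa_sc hM mS hS)].
have momE k : rho tau (y ^+ k) = wmom sg W k (fun=> 1) [::].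
  exact: (rho_wop hM ht n0 hi mS hS hfree).
have ny : nb r y.
  apply: (nb_of_moments hip ht (C := r * cauchy_mean d 0 (fun=> 1))) sy (ltW r0) _.
  by move=> k; rewrite momE; exact: wmom_le.
pose T : vnop hM := sg *: sc hM mS - dg hM hi d.
have TE : (Num.sqrt 2 * beta)%:C *: S - iota (mxC D) = ev T.
  by rewrite [in LHS](diag_mxE (X := D))//; case: aD.
have yE : y = c *: (1 : vnop hM) + T.
  by rewrite /y /wop dgB /T addrAC -addrA.
have shiftE z : T - z *: (1 : vnop hM) = - ((z + c) *: (1 : vnop hM) - y).
  by rewrite yE scalerDl opprB [c *: _ + T]addrC [z *: _ + _]addrC addrKA.
rewrite TE; split.
  move=> [U mU [h1 h2]].
  pose G0 : vnop hM := - vn_mk hM mU.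
  have G0Q : G0 * (r *: (1 : vnop hM) - y) = 1.
    have -> : r *: (1 : vnop hM) - y = - (T - E *: (1 : vnop hM)).
      by rewrite shiftE opprK rE (addrC c).
    by rewrite mulrNN; apply: (@ev_inj _ _ _ _ hM).
  have [B B0 nB] := nb_ex G0.
  (* If E were outside the spectrum, the trace of the resolvent would be Lipschitz with constant B^2
     on the right of r; [edge_flat] provides two points at which this fails. *)
  have [w w0 hw] := edge_flat c d0 crit (mulr_ge0 B0 B0).
  have w2 : w < 2 * w by rewrite mulr_natl mulr2n ltrDl.
  have w20 : 0 <= 2 * w by rewrite ltW// (lt_trans w0).
  pose z1 := edge d c sg w; pose z2 := edge d c sg (2 * w).
  have z12 : z1 < z2 by apply: (edge_lt n0 c d0 crit) => //; exact: ltW.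
  have rz1 : r < z1 by apply: (edge_lt n0 c d0 crit).
  have rz2 : r < z2 by exact: lt_trans z12.
  have [G1 [a1 b1]] := resolvent_exists r0 ny rz1.
  have [G2 [a2 b2]] := resolvent_exists r0 ny rz2.
  have n1 := resolvent_nb hip ny nB G0Q B0 rz1 a1.
  have n2 := resolvent_nb hip ny nB G0Q B0 rz2 a2.
  have t1 : rho tau G1 = cauchy_mean d w (fun=> 1).
    apply: (resolvent_trace hip ht r0 sy ny rz1 a1 B0 n1 (C := cauchy_mean d 0 (fun=> 1))) => K.
    have := @cauchy_mean_sum _ _ n0 d c sg d0 dc sg0 w K (ltW w0).
    by under eq_bigr do rewrite -momE.
  have t2 : rho tau G2 = cauchy_mean d (2 * w) (fun=> 1).
    apply: (resolvent_trace hip ht r0 sy ny rz2 a2 B0 n2 (C := cauchy_mean d 0 (fun=> 1))) => K.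
    have := @cauchy_mean_sum _ _ n0 d c sg d0 dc sg0 (2 * w) K w20.
    by under eq_bigr do rewrite -momE.
  have := resolvent_trace_sub ht a1 b1 a2; rewrite t1 t2 => e.
  have s1 : sa G1 := inverse_sa (sa_shift sy z1) a1.
  have s2 : sa G2 := inverse_sa (sa_shift sy z2) a2.
  have le12 := le_trans (ler_norm _) (rho_mul_le hip ht s1 s2 B0 B0 n1 n2).
  move: hw; rewrite e ltNge => /negP; apply.
  by rewrite [leRHS]mulrC; apply: ler_wpM2l le12; rewrite subr_ge0 ltW.
move=> [a b] hl; apply: contrapT => nle; apply: hl.
have [b0|b0] := eqVneq b 0.
  rewrite b0 in nle *.
  have Ea : E < a.
    by rewrite ltNge; apply/negP => h; apply: nle; rewrite lecE /= eqxx.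
  have rz : r < a + c by rewrite rE addrC ltrD2r.
  have [G [h1 h2]] := resolvent_exists r0 ny rz.
  exists (ev (- G)); first exact: ev_mem.
  split.
    rewrite -[LHS]/(ev ((T - a *: (1 : vnop hM)) * (- G))) shiftE mulrNN h1 //.
  rewrite -[LHS]/(ev ((- G) * (T - a *: (1 : vnop hM)))) shiftE mulrNN h2 //.
(* For b != 0 the inverse is (X + i b)(X^2 + b^2)^-1. Complex scalars do not act on [vnop], hence
   the computation on vectors. *)
pose X : vnop hM := T - a *: (1 : vnop hM).
have sX : sa X.
  apply: saB; last by apply: saZ; exact: sa1.
  by apply: saB; [apply: saZ; exact: (sa_sc hM mS hS) | exact: sa_dg].
have [G [h1 h2]] := square_shift_inverse hip sX b0.
pose ib : R[i] := 0 +i* b.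
have ibib : ib * ib = - (b ^+ 2)%:C.
  by apply/eqP; rewrite eq_complex /= !mulr0 !mul0r !addr0 sub0r expr2 oppr0 !eqxx.
have lE : a +i* b = a%:C + ib.
  by apply/eqP; rewrite eq_complex /= addr0 add0r !eqxx.
have TX x : (ev T - (a +i* b) *: idfun) x = ev X x - ib *: x.
  by rewrite lE -[LHS]/(ev T x - (a%:C + ib) *: x) scalerDl opprD addrA.
clearbody X.
pose V := (ev X + ib *: idfun : H -> H).
have VT x : V ((ev T - (a +i* b) *: idfun) x) = ev (X * X + b ^+ 2 *: (1 : vnop hM)) x.
  rewrite TX -[LHS]/(ev X (ev X x - ib *: x) + ib *: (ev X x - ib *: x)).
  by rewrite evBx evZx scalerBr scalerA ibib scaleNr opprK addrA subrK.
have TV x : (ev T - (a +i* b) *: idfun) (V x) = ev (X * X + b ^+ 2 *: (1 : vnop hM)) x.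
  rewrite TX -[V x]/(ev X x + ib *: x).
  by rewrite evDx evZx scalerDr scalerA ibib scaleNr opprD opprK addrA addrK.
have GR x : ev (X * X + b ^+ 2 *: (1 : vnop hM)) (ev G x) = x by rewrite -evM h1.
have GL x : ev G (ev (X * X + b ^+ 2 *: (1 : vnop hM)) x) = x by rewrite -evM h2.
have UV x : V (ev G x) = ev G (V x).
  by rewrite -[V (ev G x)]GL -VT TV GR.
exists (V \o ev G).
  apply: (vn_comp hM _ (ev_mem G)); apply: (vn_add hM (ev_mem X)).
  exact: (vn_scale hM ib (vn_id hM)).
split; apply/funext => x.
  by rewrite -[LHS]/((ev T - (a +i* b) *: idfun) (V (ev G x))) TV GR.
by rewrite -[LHS]/(V (ev G ((ev T - (a +i* b) *: idfun) x))) UV VT GL.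
Qed.

End free_edge.

Lemma expr_div_le (R : realFieldType) (c e : R) (m : nat) : 0 <= e ->
  forall p : R, 0 <= p -> p < c -> p ^+ m / e <= c ^+ m / e.
Proof.
move=> e0 p p0 pc; apply: ler_wpM2r; first by rewrite invr_ge0.
by apply: lerXn2r; rewrite ?nnegrE// ltW// (le_lt_trans p0).
Qed.

Theorem theorem4p1 (R : realType) :
  exists C1 C2 C3 C4 C5 : R,
  [/\ 0 < C1, 0 < C2, 0 < C3, 0 < C4 & 0 < C5] /\
  forall (beta delta : R) (n : nat),
  1 <= beta -> 0 < delta -> delta <= 17^-1 -> (0 < n)%N ->
  forall (d : measure_display) (Omega : measurableType d)
    (P : probability Omega R) (A : 'I_n -> 'I_n -> {RV P >-> R}),
  gaussian_iid A ->
  let b := bpar n beta delta in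
  [/\ forall D : 'M[R]_n, admissible beta D ->
        (forall (H : completeNormedModType R[i]) (ip : {dot H for Num.conj})
           (M : set (H -> H)) (tau : (H -> H) -> R[i])
           (iota : 'M[R[i]]_n -> (H -> H)) (S : H -> H),
           semicircular_free_product ip M tau iota S ->
           max_of_spectrum M ((Num.sqrt 2 * beta)%:C *: S - iota (mxC D))
             (2 * beta ^+ 2 * ntr (invmx D)))
        /\ `|2 * beta ^+ 2 * ntr (invmx D) - atilde beta b D|
             <= 2 * beta ^+ 4 * n%:R `^ (- (2 * delta)) * ntr (invmx D ^+ 3),
      forall (w : Omega) (D : 'M[R]_n), admissible beta D ->
        ntr (Pmx beta b (rmx A w) D ^+ 2 *m shifted beta b (rmx A w) D ^+ 2)
          <= 2 * beta ^+ 5 * n%:R `^ (- (3 * delta)) * ntr (invmx D ^+ 4)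
        /\ 2 * beta ^+ 5 * n%:R `^ (- (3 * delta)) * ntr (invmx D ^+ 4)
          <= 2 * beta ^+ 3 * n%:R `^ (- (3 * delta)) * opnorm (invmx D) ^+ 2,
      exists E : set Omega,
        [/\ measurable E, E `<=` good_event A beta delta C3
          & ((1 - C1 * expR (- (C2 * n%:R)))%:E <= P E)%E],
      forall D : 'M[R]_n, admissible beta D ->
        2^-1 * beta^-1 * n%:R `^ (- delta)
          - beta * opnorm (invmx D) ^+ 2 * n%:R `^ (- (3 * delta))
          <= ntr (diag_resolvent b D)
        /\ forall w : Omega, good_event A beta delta C3 w ->
          C4 * beta^-1 * n%:R `^ (- delta)
            - C3 * beta * n%:R `^ (- (2 * delta))
            - 2^-1 * beta * opnorm (invmx D) ^+ 2 * n%:R `^ (- (3 * delta))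
            <= ntr (Pmx beta b (rmx A w) D ^+ 2)
    & forall (w : Omega) (D : 'M[R]_n), admissible beta D ->
        opnorm (Pmx beta b (rmx A w) D ^+ 2)
          <= C5 * beta^-1 * n%:R `^ (3 * delta)].
Proof.
(* The number 12^17 / 1600 is hidden behind an existential so that it stays symbolic in C1. *)
have [K hK] : exists K : R, forall p : R, 0 <= p -> p < 12 -> p ^+ 17 / 1600 <= K.
  by exists (12 ^+ 17 / 1600); apply: (@expr_div_le R 12 1600 17); exact: ler0n.
exists (6 + expR K), 1600^-1, (5 * mean_const R), 2^-1, 3; split.
  split; rewrite ?invr_gt0 ?ltr0n//.
  by apply: mulr_gt0 (mean_const_gt0 R); rewrite ltr0n.
move=> beta delta n beta1 delta0 delta17 n0 d Omega P A iid b.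
have det w D (aD : admissible beta D) :=
  deterministic_parts (rmx A w) (5 * mean_const R) beta1 delta0 delta17 n0 aD.
split.
- move=> D aD; split; last first.
    by have [] := deterministic_parts 0 0 beta1 delta0 delta17 n0 aD.
  by move=> H ip M tau iota S; exact: max_spectrum_free_sum.
- by move=> w D aD; have [_ + _ _ _] := det w D aD.
- exact: good_event_prob hK beta1 delta0 delta17 n0 _ _ _ _ iid.
- move=> D aD; split.
    by have [_ _ + _ _] := deterministic_parts 0 0 beta1 delta0 delta17 n0 aD.
  by move=> w [_ /(_ D aD) hD]; have [_ _ _ /(_ hD)] := det w D aD.
- by move=> w D aD; have [_ _ _ _] := det w D aD.
Qed.
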